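(* For every $\eta>0$ there exist $\varepsilon_0>0$ and constants $\delta,c_0,c_1>0$ such that if $0<\varepsilon<\varepsilon_0$, then for every $\alpha=(\alpha_x,\alpha_\xi)\in\mathbb R^n\times\mathbb R^n$ with $\frac12\le|\alpha_\xi|\le2$ there exists a function $\varphi=\varphi(\theta,x,\alpha)$, $C^\infty$ on $\Omega_\delta$ (defined below in terms of $\delta,c_0,c_1,\alpha$), satisfying, with constants independent of $(\theta,x,\alpha)$: (i) whenever $(0,x)\in\Omega_\delta$, $\varphi(0,x,\alpha)=(x-\alpha_x)\cdot\alpha_\xi+\frac i2|x-\alpha_x|^2+\frac1{2i}|\alpha_\xi|^2+g(x,\alpha)$ with $|g(x,\alpha)|\le C_N|x-\alpha_x|^N$ for all $N\in\mathbb N$; (ii) for every $N$, $\big|\partial_\theta\varphi(\theta,x,\alpha)+p\big(x,\partial_x\varphi(\theta,x,\alpha)\big)\big|\le C_N\big(|x-x(\theta,\alpha)|/\langle\theta\rangle\big)^N$ on $\Omega_\delta$; (iii) $|\partial_x\varphi(\theta,x,\alpha)-\alpha_\xi|\le\eta$ on $\Omega_\delta$; (iv) $\big|\mathrm{Im}\,\varphi(\theta,x,\alpha)-\frac12\frac{|x-x(\theta,\alpha)|^2}{1+4\theta^2}+\frac12|\alpha_\xi|^2\big|\le\eta\,\frac{|x-x(\theta,\alpha)|^2}{\langle\theta\rangle^2}$ on $\Omega_\delta$; (v) $|\partial_x^A\varphi(\theta,x,\alpha)|\le C_A$ on $\Omega_\delta$ for all $A\in\mathbb N^n\setminus\{0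\}$.
   Context: Standing setting: $p(x,\xi)=|\xi|^2+\varepsilon\sum_{j,k}b_{jk}(x)\xi_j\xi_k$, $b_{jk}=b_{kj}$ real smooth, $\sigma_0>0$, $\sum_{|\beta|=\ell}\sum_{j,k}|\partial^\beta b_{jk}(x)|\le A_\ell\langle x\rangle^{-1-\ell-\sigma_0}$ for all $\ell$; $\langle x\rangle=(1+|x|^2)^{1/2}$; $(x(\theta,\alpha),\xi(\theta,\alpha))$ is the Hamiltonian flow of $p$ ($\dot x=\partial_\xi p$, $\dot\xi=-\partial_xp$) at time $\theta$ starting from $\alpha$. The set $\Omega_\delta\subset\mathbb R_\theta\times\mathbb R^n_x$ is: (a) if $|\alpha_x\cdot\alpha_\xi|\le c_0\langle\alpha_x\rangle|\alpha_\xi|$, $\Omega_\delta=\{(\theta,x):|x-x(\theta,\alpha)|<\delta\langle\theta\rangle\}$; (b) if $\alpha_x\cdot\alpha_\xi>c_0\langle\alpha_x\rangle|\alpha_\xi|$, $\Omega_\delta=\{(\theta,x):|x-x(\theta,\alpha)|\le\delta\langle\theta\rangle,\ x\cdot\alpha_\xi\ge-c_1\langle x\rangle|\alpha_\xi|\}$; (c) if $\alpha_x\cdot\alpha_\xi<-c_0\langle\alpha_x\rangle|\alpha_\xi|$, $\Omega_\delta=\{(\theta,x):|x-x(\theta,\alpha)|\le\delta\langle\theta\rangle,\ x\cdot\alpha_\xi\le c_1\langle x\rangle|\alpha_\xi|\}$. *)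

(* Defs.v *)
From Stdlib Require Import Reals.
From Coquelicot Require Import Coquelicot.
From mathcomp Require Import ssreflect ssrbool ssrfun eqtype ssrnat seq choice fintype finfun bigop.

Set Implicit Arguments.
Unset Strict Implicit.
Unset Printing Implicit Defensive.

Local Open Scope R_scope.

Definition vec (n : nat) := 'I_n -> R.

Definition vsum (n : nat) (F : 'I_n -> R) : R := \big[Rplus/0]_(j < n) F j.
Definition dot (n : nat) (u v : vec n) : R := vsum (fun j => u j * v j).
Definition vnorm (n : nat) (v : vec n) : R := sqrt (dot v v).
Definition vsub (n : nat) (u v : vec n) : vec n := fun j => u j - v j.
Definition jbr (n : nat) (v : vec n) : R := sqrt (1 + vnorm v ^ 2).
Definition jbrR (t : R) : R := sqrt (1 + t ^ 2).

Definition Csum (n : nat) (F : 'I_n -> C) : C := \big[Cplus/RtoC 0]_(j < n) F j.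
Definition vnormC (n : nat) (v : 'I_n -> C) : R := sqrt (vsum (fun j => Cmod (v j) ^ 2)).

Definition upd (n : nat) (x : vec n) (j : 'I_n) (s : R) : vec n :=
  fun i => if i == j then s else x i.

Definition dx (n : nat) (j : 'I_n) (g : vec n -> R) : vec n -> R :=
  fun x => Derive (fun s => g (upd x j s)) (x j).
Definition ex_dx (n : nat) (j : 'I_n) (g : vec n -> R) (x : vec n) : Prop :=
  ex_derive (fun s => g (upd x j s)) (x j).
Definition dxs (n : nat) (ds : seq 'I_n) (g : vec n -> R) : vec n -> R :=
  foldr (@dx n) g ds.
Definition cont_vec (n : nat) (g : vec n -> R) (x : vec n) : Prop :=
  forall e, 0 < e -> exists d, 0 < d /\
    forall y, vnorm (vsub y x) < d -> Rabs (g y - g x) < e.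
Definition smooth_Rn (n : nat) (g : vec n -> R) : Prop :=
  forall (ds : seq 'I_n) (x : vec n),
    (forall j, ex_dx j (dxs ds g) x) /\ cont_vec (dxs ds g) x.

Definition dmulti (n : nat) (beta : 'I_n -> nat) (g : vec n -> R) : vec n -> R :=
  foldr (fun j acc => iter (beta j) (dx j) acc) g (enum 'I_n).
Definition mabs (n : nat) (beta : 'I_n -> nat) : nat := \big[addn/0%N]_(j < n) beta j.

(** sum_{|beta| = l} sum_{j,k} |d^beta b_jk(x)|  (multi-indices of length l
    are exactly the beta : 'I_n -> 'I_(l+1) with |beta| = l) *)
Definition decay_sum (n : nat) (b : 'I_n -> 'I_n -> vec n -> R) (l : nat) (x : vec n) : R :=
  \big[Rplus/0]_(beta : {ffun 'I_n -> 'I_l.+1} | mabs (fun i => nat_of_ord (beta i)) == l)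
     \big[Rplus/0]_(j < n) \big[Rplus/0]_(k < n)
        Rabs (dmulti (fun i => nat_of_ord (beta i)) (b j k) x).

(** The symbol p(x,xi) = |xi|^2 + eps sum_{j,k} b_jk(x) xi_j xi_k, real and
    (as the same polynomial in xi) complex arguments *)
Definition pR (n : nat) (eps : R) (b : 'I_n -> 'I_n -> vec n -> R) (x xi : vec n) : R :=
  vnorm xi ^ 2 + eps * vsum (fun j => vsum (fun k => b j k x * xi j * xi k)).
Definition pC (n : nat) (eps : R) (b : 'I_n -> 'I_n -> vec n -> R) (x : vec n) (z : 'I_n -> C) : C :=
  (Csum (fun j => z j * z j) +
   RtoC eps * Csum (fun j => Csum (fun k => RtoC (b j k x) * z j * z k)))%C.

Definition ham_flow (n : nat) (eps : R) (b : 'I_n -> 'I_n -> vec n -> R)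
    (ax axi : vec n) (X Xi : R -> vec n) : Prop :=
  (forall j, X 0 j = ax j) /\ (forall j, Xi 0 j = axi j) /\
  forall (t : R) (j : 'I_n),
    is_derive (fun s => X s j) t
      (Derive (fun s => pR eps b (X t) (upd (Xi t) j s)) (Xi t j)) /\
    is_derive (fun s => Xi s j) t
      (- Derive (fun s => pR eps b (upd (X t) j s) (Xi t)) (X t j)).

(** The set Omega_delta (cases (a), (b), (c); these cases are exclusive and
    exhaustive), X = x(., alpha) *)
Definition Omega (n : nat) (delta c0 c1 : R) (ax axi : vec n) (X : R -> vec n)
    (t : R) (x : vec n) : Prop :=
  (Rabs (dot ax axi) <= c0 * jbr ax * vnorm axi /\
     vnorm (vsub x (X t)) < delta * jbrR t) \/
  (dot ax axi > c0 * jbr ax * vnorm axi /\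
     vnorm (vsub x (X t)) <= delta * jbrR t /\
     dot x axi >= - c1 * jbr x * vnorm axi) \/
  (dot ax axi < - c0 * jbr ax * vnorm axi /\
     vnorm (vsub x (X t)) <= delta * jbrR t /\
     dot x axi <= c1 * jbr x * vnorm axi).

Definition dtx (n : nat) (o : option 'I_n) (g : R -> vec n -> R) : R -> vec n -> R :=
  match o with
  | None => fun t x => Derive (fun s => g s x) t
  | Some j => fun t x => dx j (g t) x
  end.
Definition ex_dtx (n : nat) (o : option 'I_n) (g : R -> vec n -> R) (t : R) (x : vec n) : Prop :=
  match o with
  | None => ex_derive (fun s => g s x) t
  | Some j => ex_dx j (g t) x
  end.
Definition dtxs (n : nat) (ds : seq (option 'I_n)) (g : R -> vec n -> R) : R -> vec n -> R :=
  foldr (@dtx n) g ds.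
Definition cont_tx (n : nat) (g : R -> vec n -> R) (t : R) (x : vec n) : Prop :=
  forall e, 0 < e -> exists d, 0 < d /\
    forall s y, Rabs (s - t) < d -> vnorm (vsub y x) < d -> Rabs (g s y - g t x) < e.
Definition open_tx (n : nat) (U : R -> vec n -> Prop) : Prop :=
  forall t x, U t x -> exists d, 0 < d /\
    forall s y, Rabs (s - t) < d -> vnorm (vsub y x) < d -> U s y.
Definition smooth_on (n : nat) (U : R -> vec n -> Prop) (g : R -> vec n -> R) : Prop :=
  forall (ds : seq (option 'I_n)) t x, U t x ->
    (forall o, ex_dtx o (dtxs ds g) t x) /\ cont_tx (dtxs ds g) t x.

Definition smooth_onC (n : nat) (U : R -> vec n -> Prop) (f : R -> vec n -> C) : Prop :=
  smooth_on U (fun t x => Re (f t x)) /\ smooth_on U (fun t x => Im (f t x)).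
Definition dtxC (n : nat) (o : option 'I_n) (f : R -> vec n -> C) (t : R) (x : vec n) : C :=
  (dtx o (fun s y => Re (f s y)) t x, dtx o (fun s y => Im (f s y)) t x).
Definition gradC (n : nat) (f : R -> vec n -> C) (t : R) (x : vec n) : 'I_n -> C :=
  fun j => dtxC (Some j) f t x.
Definition dmultiC (n : nat) (A : 'I_n -> nat) (f : R -> vec n -> C) (t : R) (x : vec n) : C :=
  (dmulti A (fun y => Re (f t y)) x, dmulti A (fun y => Im (f t y)) x).

(* Main.v *)
(** The coefficients [b] are first extended almost analytically to complex arguments without
    losing their decay: applying to [u |-> b (p + u q)] a functional whose moments are the powers
    of [i] replaces [q] by [i q] to all orders. For given [theta] and [x] one then looks for the
    complex ray that starts on the Lagrangian of the Gaussian initial phase and reaches [x] at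
    time [theta]. With time rescaled to [0,1] and the ray written as the free one plus slowly
    varying amplitudes, this two-point boundary value problem is a contraction with integrable
    weights, smooth in all its data, because the distance from the ray to the origin at time [s]
    is at least of order [<s>] or at least of order [<theta - s>]. The phase is the action along
    the ray. As in Hamilton-Jacobi theory its gradient is the final momentum, up to the defect of
    the extension in the Cauchy-Riemann equations, which is flat in the imaginary part of the ray;
    comparing the complex ray with the real one shows that this imaginary part is bounded by
    [|x - x(theta)| / <theta>] times the weight of the ray, whence the remainders. *)
Require Import Defs.
From Stdlib Require Import Reals Lra Lia FunctionalExtensionality ClassicalEpsilon Classical.
From Coquelicot Require Import Coquelicot.
From HB Require Import structures.
From mathcomp Require Import ssreflect ssrbool ssrfun eqtype ssrnat seq choice fintype finfun bigop path.

Set Implicit Arguments.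
Unset Strict Implicit.
Unset Printing Implicit Defensive.
Local Open Scope R_scope.

Notation funext := functional_extensionality.
Notation ones := (fun _ _ => 1).
Notation I01 r := (0 <= r <= 1).
Notation cont_mult := (@continuous_mult _ R_AbsRing).
Notation cont_plus := (@continuous_plus _ R_AbsRing R_NormedModule).
Notation cont_minus := (@continuous_minus _ R_AbsRing R_NormedModule).
Notation der_plus := (@is_derive_plus R_AbsRing R_NormedModule).
Notation der_minus := (@is_derive_minus R_AbsRing R_NormedModule).

Create HintDb nonneg.
#[global] Hint Resolve Rabs_pos Cmod_ge_0 pos_INR sqrt_pos pow2_ge_0 Rle_0_1 Rlt_0_1 exp_pos : nonneg.

Ltac pos := intros; first
 [ assumption | solve [auto with nonneg nocore] | lra
 | lazymatch goal with
  | |- 0 <= _ * _ => apply Rmult_le_pos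
  | |- 0 <= _ / _ => apply Rmult_le_pos
  | |- 0 <= _ ^ _ => apply pow_le
  | |- 0 <= / _ => apply Rlt_le, Rinv_0_lt_compat
  | |- 0 <= _ + _ => apply Rplus_le_le_0_compat
  | |- 0 <= _ => apply Rlt_le; progress auto with nonneg nocore
  | |- 0 < _ * _ => apply Rmult_lt_0_compat
  | |- 0 < _ / _ => apply Rdiv_lt_0_compat
  | |- 0 < _ ^ _ => apply pow_lt
  | |- 0 < / _ => apply Rinv_0_lt_compat
  | |- 0 < Rmin _ _ => apply Rmin_pos
  | |- ?a * _ <= ?a * _ => apply Rmult_le_compat_l
  | |- _ * ?a <= _ * ?a => apply Rmult_le_compat_r
  | |- _ * _ <= _ * _ => apply Rmult_le_compat
  | |- _ / ?a <= _ / ?a => apply Rmult_le_compat_r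
  | |- / _ <= / _ => apply Rinv_le_contravar
  | |- _ ^ _ <= _ ^ _ => apply pow_incr; split
  | |- _ + _ <= _ + _ => apply Rplus_le_compat
  end; pos ].

Tactic Notation "bound" uconstr(t) := refine (Rle_trans _ _ _ t _).
Tactic Notation "via" uconstr(m) := refine (Rle_trans _ m _ _ _).

Ltac cont := intros; repeat first
 [ assumption | apply: continuous_const | apply: continuous_id
 | apply: (@continuous_plus _ R_AbsRing R_NormedModule)
 | apply: (@continuous_minus _ R_AbsRing R_NormedModule)
 | apply: (@continuous_opp _ R_AbsRing R_NormedModule)
 | apply: (@continuous_mult _ R_AbsRing) | solve [auto] ].

(** What shapes the proof is uniformity in [t] on a neighbourhood whose width grows like [<t>]. All
    sizes are expressed through two weights: the total time [TT] and a lower bound [Lm] for the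
    distance from the ray to the origin. The field decays like [Lm^(-1-sigma)], and
    [TT * Lm^(-1-sigma)] has an integral over rescaled time that is bounded in [t]; the estimates
    are arranged so as to end in this integral. The sign conditions in cases (b) and (c) of [Omega]
    serve to provide [Lm]. The problems are solved in charts, boxes of one fixed size about every
    [(t, x)], with constants common to all of them; uniqueness of the ray glues the phases.
    Constants in (ii) and (v) may depend on [eps], but (iii) and (iv) need bounds linear in [eps]
    with coefficients free of [eps]. For this reason the first derivatives of the rays in the
    parameters get a bound of their own, separate from the general smoothness theorem. *)

Fact Rplus_lawA : associative Rplus. Proof. by move=> x y z; ring. Qed.
Fact Rplus_lawC : commutative Rplus. Proof. by move=> x y; ring. Qed.
Fact Rplus_law0 : left_id 0 Rplus. Proof. by move=> x; ring. Qed.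
HB.instance Definition _ := Monoid.isComLaw.Build R 0 Rplus Rplus_lawA Rplus_lawC Rplus_law0.

(** * Finite sums of reals *)

Section FiniteSums.
Variable I : finType.
Implicit Types F G : I -> R.

Definition fsum F : R := \big[Rplus/0]_(i : I) F i.

Lemma fsum_ext F G : (forall i, F i = G i) -> fsum F = fsum G.
Proof. by move=> H; apply: eq_bigr => i _. Qed.

Lemma fsum_plus F G : fsum (fun i => F i + G i) = fsum F + fsum G.
Proof. exact: big_split. Qed.

Lemma fsum_scal k F : fsum (fun i => k * F i) = k * fsum F.
Proof.
apply: (big_ind2 (fun x y => x = k * y)) => //; first by ring.
by pos.
Qed.

Lemma fsum_opp F : fsum (fun i => - F i) = - fsum F.
Proof.
rewrite -[RHS](_ : -1 * fsum F = _); last by ring.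
by rewrite -fsum_scal; apply: fsum_ext => i; ring.
Qed.

Lemma fsum_minus F G : fsum (fun i => F i - G i) = fsum F - fsum G.
Proof. by rewrite /Rminus fsum_plus fsum_opp. Qed.

Lemma fsum_0 : fsum (fun _ => 0) = 0.
Proof. by rewrite /fsum big1. Qed.

Lemma fsum_le F G : (forall i, F i <= G i) -> fsum F <= fsum G.
Proof.
move=> H; apply: (big_ind2 (fun x y => x <= y)) => //; first by lra.
by pos.
Qed.

Lemma fsum_ge0 F : (forall i, 0 <= F i) -> 0 <= fsum F.
Proof. by move=> H; rewrite -fsum_0; apply: fsum_le. Qed.

Lemma fsum_Rabs F : Rabs (fsum F) <= fsum (fun i => Rabs (F i)).
Proof.
apply: (big_ind2 (fun x y => Rabs x <= y)) => //; first by rewrite Rabs_R0; lra.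
- by move=> x1 x2 y1 y2 H1 H2; bound (Rabs_triang _ _); lra.
- by pos.
Qed.

Lemma fsum_term F i : (forall j, 0 <= F j) -> F i <= fsum F.
Proof.
move=> H; rewrite /fsum (bigD1 i) //=.
suff: 0 <= \big[Rplus/0]_(j | j != i) F j by lra.
apply: (big_ind (fun x => 0 <= x)) => //; first by lra.
by pos.
Qed.

Lemma fsum_pick i (v : I -> R) : fsum (fun j => if j == i then v j else 0) = v i.
Proof. by rewrite /fsum -big_mkcond big_pred1_eq. Qed.

Lemma fsum_const (k : R) : fsum (fun _ => k) = INR #|I| * k.
Proof.
rewrite /fsum big_const; elim: #|I| => [|m IH]; first by rewrite /=; ring.
by rewrite iterS IH S_INR; ring.
Qed.

Lemma fsum_le_const F k : (forall i, F i <= k) -> fsum F <= INR #|I| * k.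
Proof. by rewrite -fsum_const; exact: fsum_le. Qed.

Lemma fsum_continuous (F : R -> I -> R) x :
 (forall i, continuous (fun r => F r i) x) -> continuous (fun r => fsum (F r)) x.
Proof.
move=> H; rewrite /fsum; elim: (index_enum I) => [|i s IH].
 apply: (continuous_ext (fun _ => 0)) => [r|]; first by rewrite big_nil.
 by cont.
apply: (continuous_ext (fun r => F r i + \big[Rplus/0]_(j <- s) F r j)).
 by move=> r; rewrite big_cons.
by cont.
Qed.

Lemma fsum_is_derive (F : R -> I -> R) (dF : I -> R) x :
 (forall i, is_derive (fun r => F r i) x (dF i)) ->
 is_derive (fun r => fsum (F r)) x (fsum dF).
Proof.
move=> H; rewrite /fsum; elim: (index_enum I) => [|i s IH].
 rewrite big_nil; apply: (is_derive_ext (fun _ => 0)) => [r|]; first by rewrite big_nil.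
 exact: is_derive_const.
rewrite big_cons; apply: (is_derive_ext (fun r => F r i + \big[Rplus/0]_(j <- s) F r j)).
 by move=> r; rewrite big_cons.
by apply: der_plus.
Qed.

End FiniteSums.

Lemma fsum_exchange (I J : finType) (F : I -> J -> R) :
 fsum (fun i => fsum (fun j => F i j)) = fsum (fun j => fsum (fun i => F i j)).
Proof. exact: exchange_big. Qed.

Lemma fsum_sum (I J : finType) (F : I + J -> R) :
 fsum F = fsum (fun i => F (inl i)) + fsum (fun j => F (inr j)).
Proof. by rewrite /fsum big_sumType. Qed.

(** Precomposition with this 1-Lipschitz retraction onto [0,1] turns continuity on the closed
    interval into continuity on the whole line, so that one-sided limits never appear. *)
Definition clamp (r : R) : R := Rmax 0 (Rmin r 1).

Lemma clamp_id r : I01 r -> clamp r = r.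
Proof. by move=> H; rewrite /clamp Rmin_left ?Rmax_right; lra. Qed.

Lemma clampP r : 0 <= clamp r <= 1.
Proof.
rewrite /clamp; split; first exact: Rmax_l.
by apply: Rmax_lub; [lra | apply: Rmin_r].
Qed.

Lemma clampK r : clamp (clamp r) = clamp r.
Proof. exact: clamp_id (clampP r). Qed.

Lemma clamp_lip r s : Rabs (clamp r - clamp s) <= Rabs (r - s).
Proof.
rewrite /clamp /Rmin; case: (Rle_dec r 1) => ?; case: (Rle_dec s 1) => ?;
rewrite /Rmax; repeat case: Rle_dec => ?; split_Rabs; lra.
Qed.

Lemma continuous_dom (F H : R -> R) x :
 continuous H x -> H x = 0 -> (forall r, Rabs (F r - F x) <= H r) -> continuous F x.
Proof.
move=> cH H0 HF; apply/filterlim_locally => eps.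
move/filterlim_locally: cH => /(_ eps); apply: filter_imp => r.
rewrite /ball /= /AbsRing_ball /= /abs /minus /plus /opp /= H0 => Hr.
apply: Rle_lt_trans (HF r) _; apply: Rle_lt_trans (Rle_abs _) _.
by move: Hr; rewrite Ropp_0 Rplus_0_r.
Qed.

Lemma clamp_continuous r : continuous clamp r.
Proof.
apply: (@continuous_dom _ (fun s => Rabs (s - r))).
- apply: (continuous_comp (fun s => s - r) Rabs); last exact: continuous_Rabs.
 by cont.
- by rewrite Rminus_diag_eq // Rabs_R0.
- by move=> s; exact: clamp_lip.
Qed.

(** ** Partial derivatives on rectangles *)

Section Coordinates.
Variable I : finType.
Implicit Types (y z : I -> R) (c : I).

Definition updI y c s : I -> R := fun i => if i == c then s else y i.

Lemma updI_same y c s : updI y c s c = s.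
Proof. by rewrite /updI eqxx. Qed.

Lemma updI_other y c s i : i != c -> updI y c s i = y i.
Proof. by rewrite /updI => /negbTE ->. Qed.

Lemma updI_id y c : updI y c (y c) = y.
Proof. by apply: funext => i; rewrite /updI; case: eqP => [->|]. Qed.

Lemma updI_updI y c s s' : updI (updI y c s) c s' = updI y c s'.
Proof. by apply: funext => i; rewrite /updI; case: eqP. Qed.

Definition pd (h : (I -> R) -> R) c y (l : R) := is_derive (fun s => h (updI y c s)) (y c) l.

Definition rect y y' z := forall c, Rmin (y c) (y' c) <= z c <= Rmax (y c) (y' c).

Lemma rect_trans y y' z z' : rect y y' z -> rect y z z' -> rect y y' z'.
Proof.
move=> H1 H2 c; move: (H1 c) (H2 c); rewrite /Rmin /Rmax.
by repeat case: Rle_dec => ?; lra.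
Qed.

Lemma rect_l y y' : rect y y' y.
Proof. by split; [apply: Rmin_l | apply: Rmax_l]. Qed.

Lemma rect_r y y' : rect y y' y'.
Proof. by split; [apply: Rmin_r | apply: Rmax_r]. Qed.

Definition l1 y : R := fsum (fun c => Rabs (y c)).

Lemma l1_ge0 y : 0 <= l1 y.
Proof. by apply: fsum_ge0 => c; pos. Qed.

Lemma l1_term y c : Rabs (y c) <= l1 y.
Proof. by apply: (@fsum_term _ (fun c => Rabs (y c))) => j; pos. Qed.

(** Pass from [y] to [y'] by changing one coordinate at a time and apply the mean value theorem on
    each edge; [mix s] is the vertex at which the coordinates in [s] have already been changed.
    Every edge lies in the box, so only partial derivatives at its points enter. *)
Lemma rect_lip h (dh : I -> (I -> R) -> R) (K : I -> R) y y' :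
 (forall z c, rect y y' z -> pd h c z (dh c z)) ->
 (forall z c, rect y y' z -> Rabs (dh c z) <= K c) ->
 Rabs (h y' - h y) <= fsum (fun c => K c * Rabs (y' c - y c)).
Proof.
move=> Hd HK.
pose mix (s : seq I) c := if c \in s then y' c else y c.
have mixR s : rect y y' (mix s).
 by move=> c; rewrite /mix; case: ifP => _; [apply: rect_r | apply: rect_l].
have main s : uniq s ->
  Rabs (h (mix s) - h y) <= \big[Rplus/0]_(c <- s) (K c * Rabs (y' c - y c)).
 elim: s => [_|c s IH /= /andP[cs us]].
  rewrite big_nil (_ : mix [::] = y); last exact: funext.
  by rewrite Rminus_diag_eq // Rabs_R0; lra.
 rewrite big_cons.
 have e1 : mix (c :: s) = updI (mix s) c (y' c).
  apply: funext => i; rewrite /mix /updI in_cons.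
  by case: eqP => [->|_].
 have e0 : mix s = updI (mix s) c (y c).
  apply: funext => i; rewrite /updI; case: eqP => // ->.
  by rewrite /mix (negbTE cs).
 have Rs x : Rmin (y c) (y' c) <= x <= Rmax (y c) (y' c) -> rect y y' (updI (mix s) c x).
  by move=> Hx i; rewrite /updI; case: eqP => [->|_] //; apply: mixR.
 have der x : Rmin (y c) (y' c) <= x <= Rmax (y c) (y' c) ->
   is_derive (fun x => h (updI (mix s) c x)) x (dh c (updI (mix s) c x)).
  move=> Hx; have := Hd _ c (Rs _ Hx); rewrite /pd updI_same.
  by apply: is_derive_ext => u; rewrite updI_updI.
 have [||x [Hx E]] := MVT_gen (fun x => h (updI (mix s) c x)) (y c) (y' c)
   (fun x => dh c (updI (mix s) c x)).
 - by move=> x Hx; apply: der; lra.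
 - move=> x Hx; apply/continuity_pt_filterlim; apply: ex_derive_continuous.
  by eexists; pos.
 have -> : h (mix (c :: s)) - h y = (h (mix (c :: s)) - h (mix s)) + (h (mix s) - h y) by ring.
 bound (Rabs_triang _ _); apply: Rplus_le_compat; last exact: IH.
 rewrite e1 {2}e0 E Rabs_mult.
 by pos.
have := main _ (enum_uniq I).
rewrite (_ : mix (enum I) = y'); last first.
 by apply: funext => c; rewrite /mix mem_enum.
by rewrite /fsum -big_enum.
Qed.

Lemma pd_linear (k : I -> R) c y : pd (fun z => fsum (fun i => k i * z i)) c y (k c).
Proof.
rewrite /pd -[X in is_derive _ _ X](fsum_pick c k).
apply: (@fsum_is_derive _ (fun s i => k i * updI y c s i)) => i.
rewrite /updI; case: eqP => _.
 have := is_derive_scal (fun s : R => s) (y c) (k i) 1 (is_derive_id _).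
 by rewrite /scal /= /mult /= Rmult_1_r.
exact: is_derive_const.
Qed.

(** The edge estimate is used twice: for the first derivatives [dh c], then for [h] minus its linear
    part at [y]. *)
Lemma rect_taylor h (dh : I -> (I -> R) -> R) (ddh : I -> I -> (I -> R) -> R) K y y' :
 (forall z c, rect y y' z -> pd h c z (dh c z)) ->
 (forall z c c', rect y y' z -> pd (dh c) c' z (ddh c c' z)) ->
 (forall z c c', rect y y' z -> Rabs (ddh c c' z) <= K) ->
 Rabs (h y' - h y - fsum (fun c => dh c y * (y' c - y c))) <= K * l1 (fun c => y' c - y c) ^ 2.
Proof.
move=> H1 H2 HK.
set L := l1 _.
pose h2 z := h z - fsum (fun c => dh c y * z c).
have d2 z c : rect y y' z -> pd h2 c z (dh c z - dh c y).
 by move=> Hz; apply: der_minus; [apply: H1|apply: pd_linear].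
have b2 z c : rect y y' z -> Rabs (dh c z - dh c y) <= K * L.
 move=> Hz.
 via (fsum (fun c' => K * Rabs (z c' - y c'))).
  apply: (@rect_lip (dh c) (ddh c) (fun _ => K)) => z' c' Hz'.
   by apply: H2; apply: rect_trans Hz'.
  by apply: HK; apply: rect_trans Hz'.
 rewrite fsum_scal; apply: Rmult_le_compat_l.
  by apply: Rle_trans (HK y c c (@rect_l _ _)); pos.
 apply: fsum_le => c'; move: (Hz c'); rewrite /Rmin /Rmax.
 by repeat case: Rle_dec => ?; split_Rabs; lra.
have := @rect_lip h2 (fun c z => dh c z - dh c y) (fun _ => K * L) y y' d2 b2.
rewrite fsum_scal -/(l1 (fun c => y' c - y c)) -/L.
have -> : h2 y' - h2 y = h y' - h y - fsum (fun c => dh c y * (y' c - y c)).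
 rewrite /h2 (_ : fsum (fun c => dh c y * (y' c - y c)) =
   fsum (fun c => dh c y * y' c) - fsum (fun c => dh c y * y c)); first by ring.
 by rewrite -fsum_minus; apply: fsum_ext => c; ring.
by lra.
Qed.

End Coordinates.

(** A chain rule whose only input is a quadratic remainder along the curve: after subtraction of the
    linear part the increment of [F] is at most [K] times the square of the increment of the curve,
    which is of first order in [s - x]. *)
Lemma curve_derive (I : finType) (F : R -> R) (L : I -> R) (gam : R -> I -> R) (dgam : I -> R) K x :
 (forall i, is_derive (fun s => gam s i) x (dgam i)) ->
 locally x (fun s => Rabs (F s - F x - fsum (fun i => L i * (gam s i - gam x i)))
   <= K * l1 (fun i => gam s i - gam x i) ^ 2) ->
 is_derive F x (fsum (fun i => L i * dgam i)).
Proof.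
move=> Hg HF.
pose G s := fsum (fun i => L i * gam s i).
have dG : is_derive G x (fsum (fun i => L i * dgam i)).
 apply: (@fsum_is_derive _ (fun s i => L i * gam s i)) => i.
 exact: is_derive_scal.
suff dR : is_derive (fun s => F s - G s) x 0.
 have := @is_derive_plus R_AbsRing R_NormedModule _ _ _ _ _ dR dG.
 rewrite {2}/plus /= Rplus_0_l; apply: is_derive_ext => s; rewrite /plus /=; ring.
split; first by apply: is_linear_scal_l.
move=> x' Hx'; have {x' Hx'}<- : x = x'.
 exact: (is_filter_lim_locally_unique _ _ Hx').
move=> eps.
have [B [B0 HB]] : exists B, 0 <= B /\
  locally x (fun s => l1 (fun i => gam s i - gam x i) <= B * Rabs (s - x)).
 have : forall i, locally x (fun s => Rabs (gam s i - gam x i) <= (Rabs (dgam i) + 1) * Rabs (s - x)).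
  move=> i; have [_ Hd] := Hg i.
  have {Hd} := Hd x (fun P H => H) (mkposreal 1 Rlt_0_1).
  apply: filter_imp => s /=.
  rewrite /norm /= /abs /minus /plus /opp /scal /= /mult /= => Hs.
  have -> : gam s i - gam x i = (gam s i + - gam x i + - ((s + - x) * dgam i)) + (s - x) * dgam i by ring.
  bound (Rabs_triang _ _); rewrite Rabs_mult.
  by rewrite /Rminus; lra.
 move=> Hl; exists (fsum (fun i => Rabs (dgam i) + 1)); split.
  by apply: fsum_ge0 => i; pos.
 have : locally x (fun s => forall i, Rabs (gam s i - gam x i) <= (Rabs (dgam i) + 1) * Rabs (s - x)).
  have : locally x (fun s => forall i, i \in enum I -> Rabs (gam s i - gam x i) <= (Rabs (dgam i) + 1) * Rabs (s - x)).
   elim: (enum I) => [|i s IH]; first by apply: filter_forall.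
   apply: filter_imp (filter_and _ _ (Hl i) IH) => s' [H1 H2] j.
   by rewrite in_cons => /orP[/eqP->|]; pos.
  by apply: filter_imp => s H i; apply: H; rewrite mem_enum.
 apply: filter_imp => s Hs.
 by rewrite Rmult_comm -fsum_scal; apply: fsum_le => i; rewrite Rmult_comm; pos.
have [d Hd] : exists d : posreal, K * (B ^ 2 * d) <= eps.
 have D0 : 0 < eps / (Rabs K * B ^ 2 + 1).
  apply: Rdiv_lt_0_compat; first exact: cond_pos.
  have := Rmult_le_pos _ _ (Rabs_pos K) (pow2_ge_0 B); lra.
 exists (mkposreal _ D0); rewrite [pos _]/=.
 have P := Rmult_le_pos _ _ (Rabs_pos K) (pow2_ge_0 B).
 via (Rabs K * (B ^ 2 * (eps / (Rabs K * B ^ 2 + 1)))).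
  apply: Rmult_le_compat_r; last exact: Rle_abs.
  apply: Rmult_le_pos; [apply: pow2_ge_0 | exact: (Rlt_le _ _ D0)].
 have E : Rabs K * (B ^ 2 * (eps / (Rabs K * B ^ 2 + 1))) = eps - eps / (Rabs K * B ^ 2 + 1).
  by field; lra.
 by lra.
have Hball : locally x (fun s => Rabs (s - x) < d) by exists d.
apply: filter_imp (filter_and _ _ HF (filter_and _ _ HB Hball)) => s [H1 [H2 H3]].
rewrite /norm /= /abs /minus /plus /opp /scal /= /mult /=.
have -> : F s + - G s + - (F x + - G x) + - ((s + - x) * 0) =
  F s - F x - fsum (fun i => L i * (gam s i - gam x i)).
 rewrite /G (_ : fsum (fun i => L i * (gam s i - gam x i)) =
   fsum (fun i => L i * gam s i) - fsum (fun i => L i * gam x i)); first by ring.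
 by rewrite -fsum_minus; apply: fsum_ext => i; ring.
bound H1.
have Q : l1 (fun i => gam s i - gam x i) ^ 2 <= (B * Rabs (s - x)) ^ 2.
 by apply: pow_incr; split => //; apply: l1_ge0.
have P := Rabs_pos (s - x); rewrite -/(s - x).
case: (Rle_lt_dec 0 K) => K0; last first.
 have := cond_pos eps; have := pow2_ge_0 (l1 (fun i => gam s i - gam x i)).
 by nra.
bound (Rmult_le_compat_l _ _ _ K0 Q).
have -> : K * (B * Rabs (s - x)) ^ 2 = (K * (B ^ 2 * Rabs (s - x))) * Rabs (s - x) by ring.
apply: Rmult_le_compat_r => //.
apply: Rle_trans Hd; apply: Rmult_le_compat_l => //.
by pos.
Qed.

Lemma derive_quadratic (F : R -> R) (l K d : R) x :
 0 < d -> (forall h, Rabs h < d -> Rabs (F (x + h) - F x - l * h) <= K * h ^ 2) ->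
 is_derive F x l.
Proof.
move=> d0 H.
have -> : l = fsum (fun _ : unit => l * 1) by rewrite /fsum big_const card_unit /=; ring.
apply: (@curve_derive unit F (fun _ => l) (fun s _ => s) (fun _ => 1) K x).
 by move=> _; apply: is_derive_id.
exists (mkposreal d d0) => s; rewrite /ball /= /AbsRing_ball /= /abs /minus /plus /opp /= => Hs.
have := H (s - x) Hs; rewrite /l1 /fsum !big_const card_unit /=.
have -> : x + (s - x) = s by ring.
have := pow2_abs (s - x); rewrite /= => E.
rewrite !Rplus_0_r !Rmult_1_r in E *. by rewrite E.
Qed.

(** Absorption, in the role of Gronwall's lemma: any a priori bound improves under iteration until
    only the fixed point [2 * h] of [B -> h + B / 2] is left. The index may run over coordinates
    times an interval, so systems of unknowns with different weights are treated at once. *)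
Lemma contraction_bound (T : Type) (F G : T -> R) h :
 0 <= h -> (forall x, 0 <= G x) ->
 (exists B, forall x, F x <= B * G x) ->
 (forall B, 0 <= B -> (forall x, F x <= B * G x) -> forall x, F x <= (h + B / 2) * G x) ->
 forall x, F x <= 2 * h * G x.
Proof.
move=> h0 G0 [B0 HB] step x.
have it n : forall x, F x <= (2 * h + Rabs B0 * (/ 2) ^ n) * G x.
 elim: n => [|n IH] u.
  bound (HB u); apply: Rmult_le_compat_r => //.
  by have := Rle_abs B0; lra.
 have P : 0 <= 2 * h + Rabs B0 * (/ 2) ^ n.
  by pos.
 have := step _ P IH u.
 by rewrite [(/ 2) ^ n.+1]/=; pos.
case: (Rle_lt_dec (F x) (2 * h * G x)) => // lt.
set e := F x - 2 * h * G x in lt.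
have e0 : 0 < e by rewrite /e; lra.
pose K := Rabs B0 * G x + 1.
have K1 : 1 <= K by rewrite /K; have := Rmult_le_pos _ _ (Rabs_pos B0) (G0 x); lra.
have [N HN] := pow_lt_1_zero (/ 2) ltac:(rewrite Rabs_pos_eq; lra) (e / K)
  ltac:(apply: Rdiv_lt_0_compat; lra).
have := HN N (le_n N); rewrite Rabs_pos_eq; last by pos.
move=> Hlt; have := it N x.
have : Rabs B0 * (/ 2) ^ N * G x <= K * (/ 2) ^ N.
 have := pow_le (/2) N ltac:(lra); rewrite /K => ?. nra.
have : K * (/2) ^ N < e.
 have -> : e = K * (e / K) by field; lra.
 by nra.
by rewrite /e; lra.
Qed.

#[global] Hint Resolve fsum_ge0 l1_ge0 : nonneg.
(** * Uniformly bounded smooth families *)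

(** [Sb D W k f]: uniformly in the index [a], the partial derivatives of order at most [k] of
  [f a r] exist on [D], are continuous in [r], and are bounded by a constant times [W a r].
  Outside [0,1] the parameter [r] is read through [clamp]. *)
Fixpoint Sb (A : Type) (I : finType) (D : (I -> R) -> Prop) (W : A -> R -> R) (k : nat)
  (f : A -> R -> (I -> R) -> R) : Prop :=
 (exists C, 0 <= C /\ forall a r y, I01 r -> D y -> Rabs (f a r y) <= C * W a r) /\
 (forall a y, D y -> forall r, continuous (fun r => f a (clamp r) y) r) /\
 (if k is k'.+1 then
   forall c, exists f', (forall a r y, I01 r -> D y -> pd (f a r) c y (f' a r y)) /\
    Sb D W k' f'
  else True).

Definition openI (I : finType) (D : (I -> R) -> Prop) :=
 forall y, D y -> exists d, 0 < d /\ forall y', (forall c, Rabs (y' c - y c) < d) -> D y'.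

Section Class.
Variables (A : Type) (I : finType) (D : (I -> R) -> Prop).
Hypothesis Dopen : openI D.
Implicit Types (W V : A -> R -> R) (f g : A -> R -> (I -> R) -> R).
Notation Sb := (@Sb A I D).

Lemma Sb_bound W k f : Sb W k f ->
 exists C, 0 <= C /\ forall a r y, I01 r -> D y -> Rabs (f a r y) <= C * W a r.
Proof. by case: k => [|k] []. Qed.

Lemma Sb_cont W k f : Sb W k f ->
 forall a y, D y -> forall r, continuous (fun r => f a (clamp r) y) r.
Proof. by case: k => [|k] [_ []]. Qed.

Lemma Sb_pd W k f : Sb W k.+1 f -> forall c, exists f',
 (forall a r y, I01 r -> D y -> pd (f a r) c y (f' a r y)) /\ Sb W k f'.
Proof. by move=> [_ [_]]. Qed.

Lemma Sb_le W k f : Sb W k.+1 f -> Sb W k f.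
Proof.
elim: k f => [|k IH] f H; first by case: H => ? [].
split; first exact: Sb_bound H.
split; first exact: Sb_cont H.
by move=> c; have [f' [H1 H2]] := Sb_pd H c; exists f'; cont.
Qed.

Lemma locally_updI y c (P : (I -> R) -> Prop) : openI P -> P y ->
 locally (y c) (fun s => P (updI y c s)).
Proof.
move=> oP Py; have [d [d0 Hd]] := oP y Py.
exists (mkposreal d d0) => s Hs; apply: Hd => i; rewrite /updI; case: eqP => [->|_].
 by [].
by rewrite Rminus_diag_eq // Rabs_R0.
Qed.

Lemma pd_ext (h1 h2 : (I -> R) -> R) c y l :
 (forall z, D z -> h1 z = h2 z) -> D y -> pd h1 c y l -> pd h2 c y l.
Proof.
move=> E Dy; apply: is_derive_ext_loc.
apply: filter_imp (locally_updI c Dopen Dy) => s; pos.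
Qed.

Lemma Sb_eq W k f g :
 (forall a r y, I01 r -> D y -> f a r y = g a r y) -> Sb W k f -> Sb W k g.
Proof.
move=> E H.
have B : exists C, 0 <= C /\ forall a r y, I01 r -> D y -> Rabs (g a r y) <= C * W a r.
 have [C [C0 HC]] := Sb_bound H; exists C; split => // a r y Hr Dy; rewrite -E //; pos.
have Cn : forall a y, D y -> forall r, continuous (fun r => g a (clamp r) y) r.
 move=> a y Dy r; apply: (continuous_ext (fun r => f a (clamp r) y)).
  by move=> s; apply: E => //; apply: clampP.
 exact: Sb_cont H a y Dy r.
case: k H => [|k] H; split => //; split => // c.
have [f' [H1 H2]] := Sb_pd H c; exists f'; split => // a r y Hr Dy.
apply: (pd_ext (h1 := f a r)) => //; pos.
Qed.

Lemma Sb_weak W V k f K : 0 <= K ->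
 (forall a r, I01 r -> W a r <= K * V a r) -> Sb W k f -> Sb V k f.
Proof.
move=> K0 HK; elim: k f => [|k IH] f H.
 split; last by split => //; apply: Sb_cont H.
 have [C [C0 HC]] := Sb_bound H; exists (C * K); split; first exact: Rmult_le_pos.
 move=> a r y Hr Dy; bound (HC a r y Hr Dy).
 rewrite Rmult_assoc; pos.
have Bd := Sb_bound (IH _ (Sb_le H)).
split => //; split; first exact: Sb_cont H.
by move=> c; have [f' [H1 H2]] := Sb_pd H c; exists f'; cont.
Qed.

Lemma Sb_cst W k (h : A -> R -> R) K : 0 <= K ->
 (forall a r, I01 r -> Rabs (h a r) <= K * W a r) ->
 (forall a r, continuous (fun r => h a (clamp r)) r) -> Sb W k (fun a r _ => h a r).
Proof.
have Z k' f : (forall a r y, f a r y = 0) -> (forall a r, I01 r -> 0 <= W a r) -> Sb W k' f.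
 elim: k' f => [|k' IH] f Ef W0.
 - split; last split => //.
   exists 0; split; [lra|] => a r y _ _; rewrite Ef Rabs_R0; lra.
  move=> a y _ r; apply: (continuous_ext (fun _ => 0)) => [s|]; first by [].
  by cont.
 - have H2 := Sb_cont (IH f Ef W0).
  have B := Sb_bound (IH f Ef W0).
  split => //; split => // c; exists (fun _ _ _ => 0); split; last exact: IH.
  move=> a r y _ _; apply: (is_derive_ext (fun _ => 0)) => [s|]; first by [].
  exact: is_derive_const.
move=> K0 HK Hc.
have B : exists C, 0 <= C /\ forall a r y, I01 r -> D y -> Rabs (h a r) <= C * W a r.
 by exists K; cont.
case: k => [|k]; split => //; split => //.
move=> c; exists (fun _ _ _ => 0); split; first by move=> *; apply: is_derive_const.
case: (Rle_lt_or_eq_dec _ _ K0) => [Kp|K00].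
 apply: Z => // a r Hr; apply: (Rmult_le_reg_l K) => //.
 rewrite Rmult_0_r; apply: Rle_trans (HK a r Hr); pos.
clear Z; elim: k => [|k IH].
 split; last by split => // *; cont.
 exists 0; split; [lra|] => *; rewrite Rabs_R0; lra.
have B' := Sb_bound IH; have C' := Sb_cont IH.
split => //; split => // c'; exists (fun _ _ _ => 0); split => //.
by move=> *; apply: is_derive_const.
Qed.

Lemma Sb_const k x : Sb ones k (fun _ _ _ => x).
Proof.
apply: (@Sb_cst _ _ _ (Rabs x)) => [|_ _ _|_ r]; [exact: Rabs_pos|lra|exact: continuous_const].
Qed.

Lemma Sb_coord k c K : (forall y, D y -> Rabs (y c) <= K) ->
 Sb ones k (fun _ _ y => y c).
Proof.
move=> HK.
have B : exists C, 0 <= C /\ forall (a : A) r y, I01 r -> D y -> Rabs (y c) <= C * 1.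
 exists (Rabs K); split; first exact: Rabs_pos.
 move=> a r y _ Dy; move: (HK y Dy) (Rle_abs K); lra.
have Cn : forall (a : A) y, D y -> forall r : R, continuous (fun r : R => y c) r.
 by cont.
case: k => [|k]; split => //; split => // c'.
exists (fun _ _ _ => if c == c' then 1 else 0); split; last exact: Sb_const.
move=> a r y _ _; rewrite /pd /updI; case: eqP => _; first exact: is_derive_id.
exact: is_derive_const.
Qed.

Lemma Sb_plus W k f g : Sb W k f -> Sb W k g -> Sb W k (fun a r y => f a r y + g a r y).
Proof.
elim: k f g => [|k IH] f g Hf Hg.
all: have [Cf [Cf0 Bf]] := Sb_bound Hf; have [Cg [Cg0 Bg]] := Sb_bound Hg.
all: have B : exists C, 0 <= C /\ forall a r y, I01 r -> D y ->
  Rabs (f a r y + g a r y) <= C * W a r by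
 [exists (Cf + Cg); split; [lra|] => a r y Hr Dy; bound (Rabs_triang _ _);
  rewrite Rmult_plus_distr_r; apply: Rplus_le_compat; [apply: Bf|apply: Bg]].
all: have Cn : forall a y, D y -> forall r, continuous (fun r => f a (clamp r) y + g a (clamp r) y) r by
 [move=> a y Dy r; apply: cont_plus;
  [exact: Sb_cont Hf a y Dy r | exact: Sb_cont Hg a y Dy r]].
 by [].
split => //; split => // c.
have [f' [Hf1 Hf2]] := Sb_pd Hf c; have [g' [Hg1 Hg2]] := Sb_pd Hg c.
exists (fun a r y => f' a r y + g' a r y); split; last exact: IH.
by move=> a r y Hr Dy; apply: der_plus; [apply: Hf1|apply: Hg1].
Qed.

Lemma Sb_mult W V k f g : Sb W k f -> Sb V k g ->
 Sb (fun a r => W a r * V a r) k (fun a r y => f a r y * g a r y).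
Proof.
elim: k f g => [|k IH] f g Hf Hg.
all: have [Cf [Cf0 Bf]] := Sb_bound Hf; have [Cg [Cg0 Bg]] := Sb_bound Hg.
all: have B : exists C, 0 <= C /\ forall a r y, I01 r -> D y ->
  Rabs (f a r y * g a r y) <= C * (W a r * V a r) by
 [exists (Cf * Cg); split; [exact: Rmult_le_pos|] => a r y Hr Dy; rewrite Rabs_mult;
  rewrite (_ : Cf * Cg * _ = (Cf * W a r) * (Cg * V a r)); [|ring];
  apply: Rmult_le_compat; [apply: Rabs_pos|apply: Rabs_pos|apply: Bf|apply: Bg]].
all: have Cn : forall a y, D y -> forall r, continuous (fun r => f a (clamp r) y * g a (clamp r) y) r by
 [move=> a y Dy r; apply: cont_mult;
  [exact: Sb_cont Hf a y Dy r | exact: Sb_cont Hg a y Dy r]].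
 by [].
split => //; split => // c.
have [f' [Hf1 Hf2]] := Sb_pd Hf c; have [g' [Hg1 Hg2]] := Sb_pd Hg c.
exists (fun a r y => f' a r y * g a r y + f a r y * g' a r y); split; last first.
 by apply: Sb_plus; apply: IH => //; apply: Sb_le.
move=> a r y Hr Dy.
have := @is_derive_mult R_AbsRing _ _ _ _ _ (Hf1 a r y Hr Dy) (Hg1 a r y Hr Dy) Rmult_comm.
by rewrite /= /plus /mult /= !updI_id.
Qed.

Lemma Sb_multW W1 W2 W k f g K : 0 <= K ->
 (forall a r, I01 r -> W1 a r * W2 a r <= K * W a r) ->
 Sb W1 k f -> Sb W2 k g -> Sb W k (fun a r y => f a r y * g a r y).
Proof. by move=> K0 HK Hf Hg; apply: (Sb_weak K0 HK); apply: Sb_mult. Qed.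

Lemma Sb_scal W k f x : Sb W k f -> Sb W k (fun a r y => x * f a r y).
Proof.
move=> H; apply: (@Sb_multW ones W _ _ _ _ 1) => //; [lra| |exact: Sb_const].
pos.
Qed.

Lemma Sb_opp W k f : Sb W k f -> Sb W k (fun a r y => - f a r y).
Proof.
move=> /(Sb_scal (-1)); apply: Sb_eq => a r y _ _; ring.
Qed.

Lemma Sb_minus W k f g : Sb W k f -> Sb W k g -> Sb W k (fun a r y => f a r y - g a r y).
Proof. by move=> Hf Hg; apply: Sb_plus => //; apply: Sb_opp. Qed.

Lemma Sb_zero W k : (forall a r, I01 r -> 0 <= W a r) -> Sb W k (fun _ _ _ => 0).
Proof.
move=> W0; apply: (@Sb_cst _ _ _ 0) => [|a r Hr|_ r]; [lra| |exact: continuous_const].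
rewrite Rabs_R0; lra.
Qed.

Lemma Sb_fsum (J : finType) W k (F : J -> A -> R -> (I -> R) -> R) :
 (forall a r, I01 r -> 0 <= W a r) ->
 (forall j, Sb W k (F j)) -> Sb W k (fun a r y => fsum (fun j => F j a r y)).
Proof.
move=> W0 H; rewrite /fsum; elim: (index_enum J) => [|j s IH].
 apply: Sb_eq (Sb_zero k W0) => a r y _ _; by rewrite big_nil.
by apply: Sb_eq (Sb_plus (H j) IH) => a r y _ _; rewrite big_cons.
Qed.

(** The derivative of [1/g] is [- g' * (1/g) * (1/g)], which reduces order [k+1] of [1/g] to order
    [k]; the inequality between the weights makes [V] reproduce itself under this formula. *)
Lemma Sb_inv W V k g K1 K2 : 0 <= K1 -> 0 <= K2 ->
 (forall a r y, I01 r -> D y -> g a r y <> 0 /\ Rabs (/ g a r y) <= K1 * V a r) ->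
 (forall a r, I01 r -> W a r * (V a r * V a r) <= K2 * V a r) ->
 Sb W k g -> Sb V k (fun a r y => / g a r y).
Proof.
move=> K10 K20 Hg HW; elim: k => [|k IH] Sg.
all: have B : exists C, 0 <= C /\ forall a r y, I01 r -> D y ->
  Rabs (/ g a r y) <= C * V a r by [exists K1; split => // a r y Hr Dy; apply: (proj2 (Hg a r y Hr Dy))].
all: have Cn : forall a y, D y -> forall r, continuous (fun r => / g a (clamp r) y) r by
 [move=> a y Dy r; apply: (continuous_comp (fun r => g a (clamp r) y) Rinv);
  [exact: Sb_cont Sg a y Dy r|];
  apply: continuous_Rinv; apply: (proj1 (Hg a (clamp r) y (clampP r) Dy))].
 by [].
split => //; split => // c.
have [g' [H1 H2]] := Sb_pd Sg c.
exists (fun a r y => - (g' a r y * (/ g a r y * / g a r y))); split.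
 move=> a r y Hr Dy.
 have G0 := proj1 (Hg a r y Hr Dy).
 have := @is_derive_inv (fun s => g a r (updI y c s)) (y c) _ (H1 a r y Hr Dy).
 rewrite updI_id => /(_ G0).
 have -> // : - (g' a r y * (/ g a r y * / g a r y)) = - g' a r y / g a r y ^ 2 by field.
apply: Sb_opp; apply: (Sb_multW K20 HW) => //.
by apply: Sb_mult; apply: IH; apply: Sb_le.
Qed.

Definition SbI W f := forall k, Sb W k f.

(** A priori each order supplies its own derivative. Uniqueness of derivatives lets the one found at
    order 1 serve for all orders. *)
Lemma SbI_pd W f : SbI W f -> forall c, exists f',
 (forall a r y, I01 r -> D y -> pd (f a r) c y (f' a r y)) /\ SbI W f'.
Proof.
move=> H c; have [f' [H1 _]] := Sb_pd (H 1%N) c; exists f'; split => // k.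
have [g [G1 G2]] := Sb_pd (H k.+1) c; apply: Sb_eq G2 => a r y Hr Dy.
have e1 := is_derive_unique _ _ _ (H1 a r y Hr Dy).
by rewrite -e1; apply/esym; apply: is_derive_unique; apply: G1.
Qed.

Lemma Sb_lip W f : Sb W 1 f -> exists K, 0 <= K /\ forall a r y y', I01 r ->
 (forall z, rect y y' z -> D z) ->
 Rabs (f a r y' - f a r y) <= K * W a r * l1 (fun c => y' c - y c).
Proof.
move=> H.
have [df Hdf] := choice _ (Sb_pd H).
have [C HC] := choice _ (fun c => Sb_bound (proj2 (Hdf c))).
exists (fsum C); split; first by apply: fsum_ge0 => c; case: (HC c).
move=> a r y y' Hr HD.
bound (@rect_lip _ (f a r) (fun c z => df c a r z) (fun c => fsum C * W a r) y y' _ _).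
- by move=> z c /HD Dz; apply: (proj1 (Hdf c)).
- move=> z c /HD Dz; bound (proj2 (HC c) a r z Hr Dz).
 case: (HC c) => C0 Hc; have Q := Hc a r z Hr Dz.
 have W0 : 0 <= C c * W a r by apply: Rle_trans Q; pos.
 case: (Rle_lt_or_eq_dec _ _ C0) => [Cp|<-].
  have Wp : 0 <= W a r by nra.
  by apply: Rmult_le_compat_r => //; apply: fsum_term => j; case: (HC j).
 rewrite Rmult_0_l.
 (* The sign of the weight is free: where [W] is negative all the constants [C j] must vanish,
    because [C j * W] bounds an absolute value. *)
 case: (Rle_lt_dec 0 (W a r)) => Wp.
  by apply: Rmult_le_pos => //; apply: fsum_ge0 => j; case: (HC j).
 suff -> : fsum C = 0 by lra.
 rewrite -(fsum_0 I); apply: fsum_ext => j; case: (HC j) => Cj /(_ a r z Hr Dz).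
 have := Rabs_pos (df j a r z); nra.
- by rewrite fsum_scal; apply: Rle_refl.
Qed.

(** Lipschitz dependence on [y], locally uniform in [r], combines with continuity in [r] for frozen
    [y]. *)
Lemma Sb_pathcont W f (P : R -> I -> R) a :
 (forall y y' z, D y -> D y' -> rect y y' z -> D z) ->
 (forall r, continuous (fun r => W a (clamp r)) r) ->
 Sb W 1 f -> (forall c r, continuous (fun r => P r c) r) -> (forall r, D (P r)) ->
 forall r, continuous (fun r => f a (clamp r) (P r)) r.
Proof.
move=> Dr cW H cP DP r.
have [K [K0 HK]] := Sb_lip H.
apply: (@continuous_dom _ (fun s => K * W a (clamp s) * l1 (fun c => P s c - P r c)
  + Rabs (f a (clamp s) (P r) - f a (clamp r) (P r)))).
- apply: cont_plus.
  apply: cont_mult.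
   by cont.
  apply: (@fsum_continuous _ (fun s c => Rabs (P s c - P r c))) => c.
  apply: (continuous_comp (fun s => P s c - P r c) Rabs); last exact: continuous_Rabs.
  by cont.
 apply: (continuous_comp (fun s => f a (clamp s) (P r) - f a (clamp r) (P r)) Rabs); last exact: continuous_Rabs.
 apply: cont_minus; last exact: continuous_const.
 exact: (Sb_cont H (DP r)).
- rewrite (_ : l1 _ = 0) ?Rminus_diag_eq // ?Rabs_R0; first ring.
 by rewrite /l1 -(fsum_0 I); apply: fsum_ext => c; rewrite Rminus_diag_eq // Rabs_R0.
- move=> s.
 have -> : f a (clamp s) (P s) - f a (clamp r) (P r) =
  (f a (clamp s) (P s) - f a (clamp s) (P r)) + (f a (clamp s) (P r) - f a (clamp r) (P r)) by ring.
 bound (Rabs_triang _ _); apply: Rplus_le_compat_r.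
 by apply: HK; [apply: clampP | move=> z; apply: Dr].
Qed.

End Class.

Definition emb (J K : finType) (th : J -> R) (s : K -> R) : J + K -> R :=
 fun i => match i with inl j => th j | inr k => s k end.

Lemma emb_updI (J K : finType) (th : J -> R) (s : K -> R) c v :
 emb (updI th c v) s = updI (emb th s) (inl c) v.
Proof. by apply: funext => -[j|k]; cont. Qed.

Lemma Sb_emb (A : Type) (J K : finType) (D : (J + K -> R) -> Prop) (D' : (J -> R) -> Prop)
  (s : K -> R) (W : A -> R -> R) k f :
 (forall th, D' th -> D (emb th s)) -> Sb D W k f ->
 Sb D' W k (fun a r th => f a r (emb th s)).
Proof.
move=> HD; elim: k f => [|k IH] f H.
all: have [C [C0 HC]] := Sb_bound H.
all: have B : exists C, 0 <= C /\ forall a r th, I01 r -> D' th ->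
  Rabs (f a r (emb th s)) <= C * W a r by [exists C; split => // a r th Hr Hth; apply: HC => //; apply: HD].
all: have Cn : forall a th, D' th -> forall r, continuous (fun r => f a (clamp r) (emb th s)) r by
 [move=> a th Hth r; exact: (Sb_cont H (HD _ Hth))].
 by [].
split => //; split => // c.
have [f' [H1 H2]] := Sb_pd H (inl c).
exists (fun a r th => f' a r (emb th s)); split; last exact: IH.
move=> a r th Hr Hth; have := H1 a r _ Hr (HD _ Hth).
by apply: is_derive_ext => v; rewrite emb_updI.
Qed.

Lemma Sb_restrict (A : Type) (J K : finType) (D' : (J + K -> R) -> Prop) (D : (J -> R) -> Prop)
  (W : A -> R -> R) k f :
 (forall th, D' th -> D (fun j => th (inl j))) -> (forall a r, I01 r -> 0 <= W a r) ->
 Sb D W k f -> Sb D' W k (fun a r th => f a r (fun j => th (inl j))).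
Proof.
move=> HD W0; elim: k f => [|k IH] f H.
all: have [C [C0 HC]] := Sb_bound H.
all: have B : exists C, 0 <= C /\ forall a r th, I01 r -> D' th ->
  Rabs (f a r (fun j => th (inl j))) <= C * W a r by
  [exists C; split => // a r th Hr Hth; apply: HC => //; apply: HD].
all: have Cn : forall a th, D' th -> forall r, continuous (fun r => f a (clamp r) (fun j => th (inl j))) r by
 [move=> a th Hth r; exact: (Sb_cont H (HD _ Hth))].
 by [].
split => //; split => // -[c|c].
 have [f' [H1 H2]] := Sb_pd H c.
 exists (fun a r th => f' a r (fun j => th (inl j))); split; last exact: IH.
 move=> a r th Hr Hth; have := H1 a r _ Hr (HD _ Hth).
 by [].
exists (fun _ _ _ => 0); split; last exact: Sb_zero.
move=> a r th Hr Hth; apply: (is_derive_ext (fun _ => f a r (fun j => th (inl j)))) => [v|].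
 by [].
exact: is_derive_const.
Qed.

(** * Two-point boundary value problems depending on parameters *)

Definition box (I : finType) (r : I -> R) (y : I -> R) := forall c, Rabs (y c) < r c.

Lemma box_open (I : finType) (r : I -> R) : openI (box r).
Proof.
move=> y Hy.
have main (s : seq I) : exists d, 0 < d /\ forall c, c \in s -> d <= r c - Rabs (y c).
 elim: s => [|c s [d [d0 Hd]]]; first by exists 1; split; [lra|].
 exists (Rmin d (r c - Rabs (y c))); split.
  apply: Rmin_pos => //; have := Hy c; lra.
 move=> c'; rewrite in_cons => /orP[/eqP->|H]; first exact: Rmin_r.
 bound (Rmin_l _ _); pos.
have [d [d0 Hd]] := main (enum I); exists d; split => // y' Hy' c.
have := Hy' c; have := Hd c ltac:(by rewrite mem_enum).
have := Rabs_triang (y' c - y c) (y c).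
rewrite (_ : y' c - y c + y c = y' c); lra.
Qed.

Lemma box_rect (I : finType) (r : I -> R) y y' z : box r y -> box r y' -> rect y y' z -> box r z.
Proof.
move=> H H' Hz c; move: (H c) (H' c) (Hz c); rewrite /Rmin /Rmax.
case: Rle_dec => ?; split_Rabs; lra.
Qed.

Lemma RInt_abs_le (f g : R -> R) a b : a <= b ->
 (forall r, continuous f r) -> (forall r, continuous g r) ->
 (forall r, a <= r <= b -> Rabs (f r) <= g r) -> Rabs (RInt f a b) <= RInt g a b.
Proof.
move=> ab cf cg H.
apply: (@norm_RInt_le R_NormedModule f g a b) => //.
- by apply: RInt_correct; apply: ex_RInt_continuous.
- by apply: RInt_correct; apply: ex_RInt_continuous.
Qed.

Lemma RInt_sub_le (g : R -> R) a b : 0 <= a -> a <= b -> b <= 1 ->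
 (forall r, continuous g r) -> (forall r, I01 r -> 0 <= g r) -> RInt g a b <= RInt g 0 1.
Proof.
move=> H1 H2 H3 cg g0.
have ex u v : ex_RInt g u v by apply: ex_RInt_continuous.
rewrite -(RInt_Chasles g 0 a 1) // -(RInt_Chasles g a b 1) // /plus /=.
have := RInt_ge_0 g 0 a H1 (ex _ _) ltac:(move=> x Hx; apply: g0; lra).
have := RInt_ge_0 g b 1 H3 (ex _ _) ltac:(move=> x Hx; apply: g0; lra).
lra.
Qed.

Definition endpt (b : bool) : R := if b then 1 else 0.

(** The boundary condition sits at [endpt e]; [m] rescales the unknown. *)
Definition Lop (e : bool) (m : R -> R) (f : R -> R) (s : R) : R :=
 m (clamp s) * RInt (fun r => f r / m (clamp r)) (endpt e) (clamp s).

Section Lop.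
Variables (e : bool) (m W : R -> R).
Hypotheses (m0 : forall r, I01 r -> 0 < m r) (mc : forall r, continuous (fun r => m (clamp r)) r).
Hypothesis mm : forall r s, I01 r -> I01 s ->
 (if e then s <= r else r <= s) -> m s <= m r.
Hypotheses (W0 : forall r, I01 r -> 0 <= W r) (Wc : forall r, continuous (fun r => W (clamp r)) r) (W1 : RInt (fun r => W (clamp r)) 0 1 <= 1).

Lemma Lop_int_cont f : (forall r, continuous f r) ->
 forall r, continuous (fun r => f r / m (clamp r)) r.
Proof.
move=> cf r; apply: cont_mult => //.
apply: (continuous_comp (fun r => m (clamp r)) Rinv) => //.
apply: continuous_Rinv; have := m0 (clampP r); lra.
Qed.

Lemma Lop_ex f u v : (forall r, continuous f r) -> ex_RInt (fun r => f r / m (clamp r)) u v.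
Proof. by move=> cf; apply: ex_RInt_continuous => z _; apply: Lop_int_cont. Qed.

Lemma Lop_derive f s : (forall r, continuous f r) ->
 is_derive (fun s => RInt (fun r => f r / m (clamp r)) (endpt e) s) s (f s / m (clamp s)).
Proof.
move=> cf.
apply: (is_derive_RInt (fun r => f r / m (clamp r)) _ (endpt e)); last exact: Lop_int_cont.
by apply: filter_forall => b; apply: RInt_correct; apply: Lop_ex.
Qed.

Lemma Lop_continuous f : (forall r, continuous f r) -> forall s, continuous (Lop e m f) s.
Proof.
move=> cf s; apply: cont_mult => //.
apply: (continuous_comp clamp (fun s => RInt (fun r => f r / m (clamp r)) (endpt e) s)).
 exact: clamp_continuous.
by apply: ex_derive_continuous; eexists; apply: Lop_derive.
Qed.

Lemma Lop_minus f g s : (forall r, continuous f r) -> (forall r, continuous g r) ->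
 Lop e m (fun r => f r - g r) s = Lop e m f s - Lop e m g s.
Proof.
move=> cf cg; rewrite /Lop.
rewrite (RInt_ext _ (fun r => minus (f r / m (clamp r)) (g r / m (clamp r)))).
 by rewrite RInt_minus; [rewrite /minus /plus /opp /=; ring|apply: Lop_ex|apply: Lop_ex].
move=> x _; rewrite /minus /plus /opp /= /Rdiv; ring.
Qed.

Lemma Lop_scal k f s : (forall r, continuous f r) ->
 Lop e m (fun r => k * f r) s = k * Lop e m f s.
Proof.
move=> cf; rewrite /Lop.
rewrite (RInt_ext _ (fun r => scal k (f r / m (clamp r)))).
 by rewrite RInt_scal; [rewrite /scal /= /mult /=; ring|apply: Lop_ex].
move=> x _; rewrite /scal /= /mult /= /Rdiv; ring.
Qed.

(** By the monotonicity [mm] the quotient [m s / m r] is at most one for [r] between the boundary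
    point and [s]. The rescaling therefore costs nothing and the integral of the weight is all that
    remains. *)
Lemma Lop_bound K f s : 0 <= K -> (forall r, continuous f r) ->
 (forall r, I01 r -> Rabs (f r) <= K * W r) -> Rabs (Lop e m f s) <= K.
Proof.
move=> K0 cf Hf; rewrite /Lop; set t := clamp s.
have Ht : 0 <= t <= 1 by apply: clampP.
have cK r : continuous (fun r => K * W (clamp r)) r.
 by cont.
have cF r : continuous (fun r => m t * (f r / m (clamp r))) r.
 by apply: cont_mult; [apply: continuous_const|apply: Lop_int_cont].
have EX u v : m t * RInt (fun r => f r / m (clamp r)) u v =
  RInt (fun r => m t * (f r / m (clamp r))) u v.
 apply/esym; apply: (RInt_scal (V := R_CompleteNormedModule) (fun r => f r / m (clamp r)) u v (m t)).
 exact: Lop_ex.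
have pt r : I01 r -> (if e then t <= r else r <= t) ->
  Rabs (m t * (f r / m (clamp r))) <= K * W (clamp r).
 move=> Hr He; rewrite clamp_id //.
 have mr := m0 Hr; have mt := m0 Ht; have le := mm Hr Ht He.
 have -> : m t * (f r / m r) = m t / m r * f r by lra.
 rewrite Rabs_mult Rabs_pos_eq; last pos.
 have : m t / m r <= 1 by apply/Rle_div_l; lra.
 have := Rabs_pos (f r); have := Hf r Hr => ? ? ?; nra.
have last u v : 0 <= u -> u <= v -> v <= 1 -> RInt (fun r => K * W (clamp r)) u v <= K.
 move=> H1 H2 H3.
 have ex a b : ex_RInt (fun r => W (clamp r)) a b by apply: ex_RInt_continuous.
 have -> : RInt (fun r => K * W (clamp r)) u v = K * RInt (fun r => W (clamp r)) u v.
  exact: (RInt_scal (V := R_CompleteNormedModule) (fun r => W (clamp r)) u v K).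
 have := @RInt_sub_le (fun r => W (clamp r)) u v H1 H2 H3 Wc ltac:(move=> r Hr /=; rewrite clamp_id //; exact: W0).
 nra.
rewrite EX /endpt; case: e pt => pt.
 rewrite -opp_RInt_swap; last by apply: ex_RInt_continuous.
 rewrite /opp /= Rabs_Ropp.
 bound (@RInt_abs_le _ (fun r => K * W (clamp r)) t 1 _ cF cK _); [lra| |apply: last; lra].
 move=> r Hr; apply: pt; lra.
bound (@RInt_abs_le _ (fun r => K * W (clamp r)) 0 t _ cF cK _); [lra| |apply: last; lra].
move=> r Hr; apply: pt; lra.
Qed.

End Lop.

(** [sr] gives the box in which paths live, [sw] the weights of the sup norm in which the integral
    operator contracts, and [sLw] is the corresponding row-sum condition. The half radius in [sgb]
    keeps a path in the box when its boundary data lie in the half box. The bound [skap < 1/2] is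
    what lets the linearised system satisfy [sgb] again, so that the construction can be
    repeated. *)
Record sys (A : Type) (I : finType) := Sys {
 sW : A -> R -> R; se : I -> bool; sm : A -> I -> R -> R;
 sg : I -> A -> R -> (I -> R) -> R; sdg : I -> I -> A -> R -> (I -> R) -> R;
 sr : I -> R; sw : I -> R; sL : I -> I -> R; skap : R;
 sW0 : forall a r, I01 r -> 0 <= sW a r;
 sWc : forall a r, continuous (fun r => sW a (clamp r)) r;
 sW1 : forall a, RInt (fun r => sW a (clamp r)) 0 1 <= 1;
 sm0 : forall a c r, I01 r -> 0 < sm a c r;
 smc : forall a c r, continuous (fun r => sm a c (clamp r)) r;
 smm : forall a c r s, I01 r -> I01 s ->
  (if se c then s <= r else r <= s) -> sm a c s <= sm a c r;
 sr0 : forall c, 0 < sr c;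
 sw0 : forall c, 0 < sw c;
 sL0 : forall c c', 0 <= sL c c';
 sgS : forall c, SbI (box sr) sW (sg c);
 sgd : forall c c' a r y, I01 r -> box sr y -> pd (sg c a r) c' y (sdg c c' a r y);
 sdS : forall c c', SbI (box sr) sW (sdg c c');
 sgb : forall c a r y, I01 r -> box sr y -> Rabs (sg c a r y) <= sr c / 2 * sW a r;
 sdb : forall c c' a r y, I01 r -> box sr y -> Rabs (sdg c c' a r y) <= sL c c' * sW a r;
 sLw : forall c, fsum (fun c' => sL c c' * sw c') <= skap * sw c;
 sk : 0 <= skap < / 2 }.

Lemma geometric_limit (u : nat -> R) K : 0 <= K ->
 (forall n, Rabs (u n.+1 - u n) <= K * (/ 2) ^ n) ->
 exists l, forall n, Rabs (l - u n) <= 2 * K * (/ 2) ^ n.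
Proof.
move=> K0 H.
have tail n j : Rabs (u (n + j)%N - u n) <= 2 * K * ((/ 2) ^ n - (/ 2) ^ (n + j)%N).
 elim: j => [|j IH]; first by rewrite addn0 !Rminus_diag_eq // Rabs_R0; lra.
 rewrite addnS.
 have -> : u (n + j).+1 - u n = (u (n + j).+1 - u (n + j)%N) + (u (n + j)%N - u n) by ring.
 bound (Rabs_triang _ _); have := H (n + j)%N.
 rewrite [(/ 2) ^ (n + j).+1]/=; lra.
have half n : 0 < (/ 2) ^ n by pos.
have tail' n j : Rabs (u (n + j)%N - u n) <= 2 * K * (/ 2) ^ n.
 bound (tail n j); apply: Rmult_le_compat_l; [lra|]; have := half (n + j)%N; lra.
have [l Hl] : {l | Un_cv u l}.
 refine (Stdlib.Reals.Rcomplete.R_complete u _); move=> e e0.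
 have [N HN] := pow_lt_1_zero (/ 2) ltac:(rewrite Rabs_pos_eq; lra) (e / (4 * K + 1))
   ltac:(apply: Rdiv_lt_0_compat; lra).
 exists N => n m /leP Hn /leP Hm; rewrite /Rdist.
 have := HN N (le_n N); rewrite Rabs_pos_eq; last exact: Rlt_le.
 move=> lt.
 have lt2 : 4 * K * (/ 2) ^ N < e.
  have : (4 * K + 1) * (/2)^N < e.
   rewrite -[X in _ < X](_ : (4 * K + 1) * (e / (4 * K + 1)) = e); last by field; lra.
   nra.
  nra.
 have -> : u n - u m = (u n - u N) - (u m - u N) by ring.
 apply: Rle_lt_trans (Rabs_triang _ _) _; rewrite Rabs_Ropp.
 have := tail' N (n - N)%N; have := tail' N (m - N)%N; rewrite !subnKC //.
 lra.
exists l => n.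
apply: Rnot_lt_le => lt.
have [N HN] := Hl (Rabs (l - u n) - 2 * K * (/ 2) ^ n) ltac:(lra).
have := HN (n + N)%N ltac:(apply/leP; exact: leq_addl); rewrite /Rdist.
have := tail' n N.
have := Rabs_triang (l - u (n + N)%N) (u (n + N)%N - u n).
have -> : l - u (n + N)%N + (u (n + N)%N - u n) = l - u n by ring.
rewrite (Rabs_minus_sym l (u (n + N)%N)); lra.
Qed.

Section Solve.
Variables (A : Type) (I : finType) (S : sys A I).
Local Notation r := (sr S).
Local Notation w := (sw S).

Definition rhs a (P : R -> I -> R) c s : R :=
 Lop (se S c) (sm S a c) (fun q => sg S c a (clamp q) (P q)) s.

Definition sol a (th : I -> R) (P : R -> I -> R) : Prop :=
 (forall c s, continuous (fun s => P s c) s) /\ (forall s, box r (P s)) /\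
 forall c s, P s c = th c + rhs a P c s.

Definition path (a : A) (P : R -> I -> R) :=
 (forall c s, continuous (fun s => P s c) s) /\ (forall s, box r (P s)).

Lemma path_cont a P (f : A -> R -> (I -> R) -> R) : path a P -> SbI (box r) (sW S) f ->
 forall q, continuous (fun q => f a (clamp q) (P q)) q.
Proof.
move=> [cP bP] Sf; apply: (Sb_pathcont (D := box r) (W := sW S)) => //.
- exact: box_rect.
- exact: sWc.
Qed.

Lemma rhs_cont a P c : path a P -> forall s, continuous (rhs a P c) s.
Proof.
move=> pP; apply: Lop_continuous; [exact: sm0|exact: smc|].
by apply: path_cont => //; apply: sgS.
Qed.

Lemma rhs_bound a P c s : path a P -> Rabs (rhs a P c s) <= r c / 2.
Proof.
move=> pP; apply: (Lop_bound (W := sW S a)).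
- exact: sm0. - exact: smc. - exact: smm. - exact: sW0. - exact: sWc. - exact: sW1.
- have := sr0 S c; lra.
- by apply: path_cont => //; apply: sgS.
- by move=> q Hq; rewrite clamp_id //; apply: sgb => //; apply: (proj2 pP).
Qed.

Lemma sg_lip B c a q y y' : I01 q -> box r y -> box r y' ->
 (forall c, Rabs (y' c - y c) <= B * w c) ->
 Rabs (sg S c a q y' - sg S c a q y) <= skap S * B * w c * sW S a q.
Proof.
move=> Hq Hy Hy' HB.
bound (@rect_lip _ (sg S c a q) (fun c' z => sdg S c c' a q z)
  (fun c' => sL S c c' * sW S a q) y y' _ _).
- by move=> z c' Hz; apply: sgd => //; apply: box_rect Hz.
- by move=> z c' Hz; apply: sdb => //; apply: box_rect Hz.
have W0 := sW0 S a Hq.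
have B0 : 0 <= B.
 have := HB c; have := Rabs_pos (y' c - y c); have := sw0 S c => ? ? ?.
 nra.
via (fsum (fun c' => (sW S a q * B) * (sL S c c' * w c'))).
 apply: fsum_le => c'.
 rewrite (_ : sW S a q * B * _ = sL S c c' * sW S a q * (B * w c')); last ring.
 by apply: Rmult_le_compat_l => //; apply: Rmult_le_pos => //; apply: sL0.
rewrite fsum_scal.
have -> : skap S * B * w c * sW S a q = sW S a q * B * (skap S * w c) by ring.
by apply: Rmult_le_compat_l; [apply: Rmult_le_pos|apply: sLw].
Qed.

Lemma rhs_lip B a P P' : path a P -> path a P' ->
 (forall c s, Rabs (P' s c - P s c) <= B * w c) ->
 forall c s, Rabs (rhs a P' c s - rhs a P c s) <= B / 2 * w c.
Proof.
move=> pP pP' HB c s.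
have c1 := path_cont pP (sgS S c); have c2 := path_cont pP' (sgS S c).
rewrite /rhs -Lop_minus //; [|exact: sm0|exact: smc].
have B0 : 0 <= B.
 have := HB c 0; have := Rabs_pos (P' 0 c - P 0 c); have := sw0 S c => ? ? ?.
 nra.
have K0 : 0 <= B / 2 * w c by apply: Rmult_le_pos; [lra|have := sw0 S c; lra].
apply: (Lop_bound (W := sW S a)) => //.
- exact: sm0. - exact: smc. - exact: smm. - exact: sW0. - exact: sWc. - exact: sW1.
- by cont.
- move=> q Hq; rewrite clamp_id //.
 bound (sg_lip c a Hq (proj2 pP q) (proj2 pP' q) (fun c => HB c q)).
 apply: Rmult_le_compat_r; first exact: sW0.
 apply: Rmult_le_compat_r; first by have := sw0 S c; lra.
 have := sk S => -[? ?]; nra.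
Qed.

Lemma sol_path a th P : sol a th P -> path a P.
Proof. by case=> ? []. Qed.

(** The difference of two solutions is bounded a priori by the size of the box, and the integral
    operator halves any bound; absorption leaves twice the difference of the data. *)
Lemma sol_lip a th th' P P' h : 0 <= h -> sol a th P -> sol a th' P' ->
 (forall c, Rabs (th' c - th c) <= h * w c) ->
 forall c s, Rabs (P' s c - P s c) <= 2 * h * w c.
Proof.
move=> h0 H H' Hh c s.
have pP := sol_path H; have pP' := sol_path H'.
apply: (@contraction_bound (I * R)%type (fun x => Rabs (P' x.2 x.1 - P x.2 x.1))
 (fun x => w x.1) h h0 _ _ _ (c, s)) => [x||B B0 HB x].
- have := sw0 S x.1; lra.
- exists (fsum (fun c => 2 * r c / w c)) => -[c' s'] /=.
 have := proj2 pP s' c'; have := proj2 pP' s' c' => H1 H2.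
 via (2 * r c' / w c' * w c').
  rewrite (_ : 2 * r c' / w c' * w c' = 2 * r c'); last by field; have := sw0 S c'; lra.
  split_Rabs; lra.
 apply: Rmult_le_compat_r; first by have := sw0 S c'; lra.
 apply: (@fsum_term _ (fun c => 2 * r c / w c)) => j.
 apply: Rlt_le; apply: Rdiv_lt_0_compat; last exact: sw0.
 have := sr0 S j; lra.
- have := rhs_lip pP pP' (fun c s => HB (c, s)) x.1 x.2.
 rewrite (proj2 (proj2 H)) (proj2 (proj2 H')).
 have := Hh x.1 => H1 H2.
 rewrite (_ : th' x.1 + rhs a P' x.1 x.2 - (th x.1 + rhs a P x.1 x.2) =
   (th' x.1 - th x.1) + (rhs a P' x.1 x.2 - rhs a P x.1 x.2)); last ring.
 bound (Rabs_triang _ _); lra.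
Qed.

Lemma sol_unique a th P P' : sol a th P -> sol a th P' -> P = P'.
Proof.
move=> H H'; apply: funext => s; apply: funext => c.
have : Rabs (P' s c - P s c) <= 2 * 0 * w c.
 apply: (sol_lip (Rle_refl 0) H H') => c'.
 rewrite Rminus_diag_eq // Rabs_R0; lra.
split_Rabs; lra.
Qed.

Fixpoint pic a (th : I -> R) (n : nat) : R -> I -> R :=
 if n is n'.+1 then fun s c => th c + rhs a (pic a th n') c s else fun _ => th.

(** Picard iteration. The limit stays in the open box because all iterates obey the bound
    [|th| + r/2], which is strictly below [r] for data in the half box and survives the limit. *)
Lemma sol_exists a th : box (fun c => r c / 2) th -> exists P, sol a th P.
Proof.
move=> Hth.
have pp n : path a (pic a th n) /\ forall s c, Rabs (pic a th n s c) <= Rabs (th c) + r c / 2.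
 elim: n => [|n [pP _]] /=.
  split; last by move=> s c; have := sr0 S c; lra.
  split; first by cont.
  move=> s c; move: (Hth c) (sr0 S c); lra.
 have b s c : Rabs (th c + rhs a (pic a th n) c s) <= Rabs (th c) + r c / 2.
  bound (Rabs_triang _ _); have := rhs_bound c s pP; lra.
 split => //; split.
  move=> c s; apply: cont_plus; first exact: continuous_const.
  exact: rhs_cont.
 move=> s c; move: (b s c) (Hth c); lra.
pose K := fsum (fun c => r c / w c).
have Kc c : r c <= K * w c.
 rewrite -[X in X <= _](_ : r c / w c * w c = r c); last by field; have := sw0 S c; lra.
 apply: Rmult_le_compat_r; first by have := sw0 S c; lra.
 apply: (@fsum_term _ (fun c => r c / w c)) => j.
 by apply: Rlt_le; apply: Rdiv_lt_0_compat; [apply: sr0|apply: sw0].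
have K0 : 0 <= K.
 by apply: fsum_ge0 => j; apply: Rlt_le; apply: Rdiv_lt_0_compat; [apply: sr0|apply: sw0].
have df n : forall c s, Rabs (pic a th n.+1 s c - pic a th n s c) <= K * (/ 2) ^ n * w c.
 elim: n => [|n IH] c s.
  rewrite /= Rmult_1_r (_ : th c + _ - th c = rhs a (fun _ => th) c s); last ring.
  bound (rhs_bound c s (proj1 (pp 0%N))).
  move: (Kc c) (sr0 S c); lra.
 have := rhs_lip (proj1 (pp n)) (proj1 (pp n.+1)) IH c s.
 rewrite (_ : pic a th n.+2 s c - pic a th n.+1 s c =
  rhs a (pic a th n.+1) c s - rhs a (pic a th n) c s); last by rewrite /=; ring.
 rewrite [(/ 2) ^ n.+1]/=; lra.
have lim s c : exists l, forall n, Rabs (l - pic a th n s c) <= 2 * (K * w c) * (/ 2) ^ n.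
 apply: geometric_limit; first by apply: Rmult_le_pos => //; have := sw0 S c; lra.
 move=> n; have := df n c s; lra.
have [P HP] : exists P : R -> I -> R, forall s c n,
  Rabs (P s c - pic a th n s c) <= 2 * (K * w c) * (/ 2) ^ n.
 have [P HP] := choice _ (fun x : R * I => lim x.1 x.2).
 exists (fun s c => P (s, c)) => s c n; pos.
have small e : 0 < e -> exists n, forall c, 2 * (K * w c) * (/ 2) ^ n < e.
 move=> e0.
 pose B := 2 * (K * fsum w) + 1.
 have B1 : 1 <= B.
  have := Rmult_le_pos _ _ K0 (@fsum_ge0 _ w (fun c => Rlt_le _ _ (sw0 S c))); rewrite /B; lra.
 have [N HN] := pow_lt_1_zero (/ 2) ltac:(rewrite Rabs_pos_eq; lra) (e / B)
   ltac:(apply: Rdiv_lt_0_compat; lra).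
 exists N => c; have := HN N (le_n N); rewrite Rabs_pos_eq; last pos.
 move=> lt; apply: (@Rle_lt_trans _ (B * (/ 2) ^ N)).
  apply: Rmult_le_compat_r; first pos.
  have : w c <= fsum w by apply: fsum_term => j; have := sw0 S j; lra.
  rewrite /B => ?; nra.
 have -> : e = B * (e / B) by field; lra.
 nra.
have bP s c : Rabs (P s c) <= Rabs (th c) + r c / 2.
 apply: Rnot_lt_le => lt.
 have [n Hn] := small (Rabs (P s c) - (Rabs (th c) + r c / 2)) ltac:(lra).
 have := Hn c; have := HP s c n; have := proj2 (pp n) s c.
 have := Rabs_triang (P s c - pic a th n s c) (pic a th n s c).
 rewrite (_ : P s c - pic a th n s c + pic a th n s c = P s c); pos.
have pP : path a P.
 split; last by move=> s c; move: (bP s c) (Hth c); lra.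
 move=> c s; apply/filterlim_locally => eps.
 have e3 : 0 < eps / 3 by have := cond_pos eps; lra.
 have [n Hn] := small (eps / 3) e3.
 have := proj1 (proj1 (pp n)) c s => /filterlim_locally /(_ (mkposreal _ e3)).
 apply: filter_imp => q; rewrite /ball /= /AbsRing_ball /= /abs /minus /plus /opp /= => Hq.
 have -> : P q c + - P s c = (P q c - pic a th n q c) +
  ((pic a th n q c + - pic a th n s c) - (P s c - pic a th n s c)) by ring.
 apply: Rle_lt_trans (Rabs_triang _ _) _.
 have T := Rabs_triang (pic a th n q c + - pic a th n s c) (- (P s c - pic a th n s c)).
 rewrite Rabs_Ropp in T.
 have := HP q c n; have := HP s c n; have := Hn c; rewrite /Rminus in T *; lra.
exists P; split; first exact: (proj1 pP); split; first exact: (proj2 pP).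
move=> c s; apply: cond_eq => e e0.
have [n Hn] := small (e / 2) ltac:(lra).
have L := rhs_lip (B := 2 * K * (/ 2) ^ n) (proj1 (pp n)) pP ltac:(move=> c' s'; have := HP s' c' n; lra) c s.
have H1 := HP s c n.+1; rewrite /= in H1.
have N0 := Hn c.
have -> : P s c - (th c + rhs a P c s) = (P s c - (th c + rhs a (pic a th n) c s)) -
 (rhs a P c s - rhs a (pic a th n) c s) by ring.
apply: Rle_lt_trans (Rabs_triang _ _) _; rewrite Rabs_Ropp.
lra.
Qed.

End Solve.

(** The system satisfied by a solution together with its derivative in the boundary data belongs
  to the same class, once the weights of the derivative are increased; differentiability of
  all orders follows by induction. *)
Section Extension.
Variables (A : Type) (I : finType) (S : sys A I).
Variables (ddg : I -> I -> I -> A -> R -> (I -> R) -> R) (K : R).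
Hypothesis K0 : 0 <= K.
Hypothesis ddP : forall c c' c'' a q y, I01 q -> box (sr S) y ->
 pd (sdg S c c' a q) c'' y (ddg c c' c'' a q y).
Hypothesis ddS : forall c c' c'', SbI (box (sr S)) (sW S) (ddg c c' c'').
Hypothesis ddb : forall c c' c'' a q y, I01 q -> box (sr S) y ->
 Rabs (ddg c c' c'' a q y) <= K * sW S a q.

Local Notation r := (sr S).
Local Notation w := (sw S).
Local Notation W := (sW S).

(** [kap'] lies midway between [skap] and 1/2. The derivative components feel the original ones with
    coefficients [K * fsum w]; giving them the larger weights [M * w] makes this coupling fit into
    the gap [kap' - skap]. *)
Let kap' := (skap S + / 2) / 2.
Let M := 1 + fsum (fun c => K * fsum w ^ 2 / (w c * (kap' - skap S))).

Definition xl (y : I + I -> R) : I -> R := fun i => y (inl i).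
(** The linearised equation is homogeneous, so its solutions may be scaled into a box of any size;
    for the radii [w] the row-sum condition is exactly what bounds the right-hand side. *)
Definition xr' : I + I -> R := emb r w.
Definition xw : I + I -> R := emb w (fun c => M * w c).
Definition xe (i : I + I) : bool := match i with inl c | inr c => se S c end.
Definition xm a (i : I + I) : R -> R := match i with inl c | inr c => sm S a c end.
Definition xg (i : I + I) a q (y : I + I -> R) : R :=
 match i with
 | inl c => sg S c a q (xl y)
 | inr c => fsum (fun c' => sdg S c c' a q (xl y) * y (inr c'))
 end.
Definition xdg (i j : I + I) a q (y : I + I -> R) : R :=
 match i, j with
 | inl c, inl c' => sdg S c c' a q (xl y)
 | inl c, inr c' => 0
 | inr c, inl c'' => fsum (fun c' => ddg c c' c'' a q (xl y) * y (inr c'))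
 | inr c, inr c' => sdg S c c' a q (xl y)
 end.
Definition xL (i j : I + I) : R :=
 match i, j with
 | inl c, inl c' => sL S c c'
 | inl c, inr c' => 0
 | inr c, inl c'' => K * fsum w
 | inr c, inr c' => sL S c c'
 end.

Lemma xl_box y : box xr' y -> box r (xl y).
Proof. by move=> H c; apply: (H (inl c)). Qed.

Lemma fsumw0 : 0 <= fsum w.
Proof. apply: fsum_ge0 => c; have := sw0 S c; lra. Qed.

Lemma restrS f : SbI (box r) W f -> SbI (box xr') W (fun a q y => f a q (xl y)).
Proof. by move=> H k; apply: (Sb_restrict (D := box r)) => //; [apply: xl_box | apply: sW0]. Qed.

Lemma coordS c : SbI (box xr') (fun (_ : A) _ => 1) (fun _ _ y => y (inr c)).
Proof. move=> k; apply: (@Sb_coord _ _ _ _ _ (w c)) => y /(_ (inr c)) /=; lra. Qed.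

Lemma linS (F : I -> A -> R -> (I -> R) -> R) : (forall c, SbI (box r) W (F c)) ->
 SbI (box xr') W (fun a q y => fsum (fun c => F c a q (xl y) * y (inr c))).
Proof.
move=> H k; apply: Sb_fsum; [exact: box_open|exact: sW0|move=> c].
apply: (@Sb_multW _ _ _ W ones W _ _ _ 1); [lra| |exact: restrS|exact: coordS].
pos.
Qed.

Lemma pd_xl (f : (I -> R) -> R) c y l : pd f c (xl y) l -> pd (fun y => f (xl y)) (inl c) y l.
Proof.
by [].
Qed.

Lemma pd_xl0 (f : (I -> R) -> R) c y : pd (fun y => f (xl y)) (inr c) y 0.
Proof.
apply: (is_derive_ext (fun _ => f (xl y))) => [v|]; last exact: is_derive_const.
by [].
Qed.

Lemma lin_bound (F : I -> R) (y : I + I -> R) (L : I -> R) : box xr' y ->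
 (forall c, Rabs (F c) <= L c) ->
 Rabs (fsum (fun c => F c * y (inr c))) <= fsum (fun c => L c * w c).
Proof.
move=> Hy H; bound (fsum_Rabs _); apply: fsum_le => c.
rewrite Rabs_mult; apply: Rmult_le_compat; [apply: Rabs_pos|apply: Rabs_pos|exact: H|].
have /= := Hy (inr c); lra.
Qed.

Lemma kap'_gt : 0 < kap' - skap S.
Proof. have := sk S; rewrite /kap'; lra. Qed.

Lemma M_term_ge0 c : 0 <= K * fsum w ^ 2 / (w c * (kap' - skap S)).
Proof.
apply: Rmult_le_pos; first pos.
apply: Rlt_le; apply: Rinv_0_lt_compat; apply: Rmult_lt_0_compat; first exact: sw0.
exact: kap'_gt.
Qed.

Lemma M_ge1 : 1 <= M.
Proof. rewrite /M; have := fsum_ge0 M_term_ge0; lra. Qed.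

Definition xsys : sys A (I + I)%type.
Proof.
refine (@Sys A (I + I)%type W xe xm xg xdg xr' xw xL kap' _ _ _ _ _ _ _ _ _ _ _ _ _ _ _ _).
- exact: sW0.
- exact: sWc.
- exact: sW1.
- by move=> a [c|c] q; apply: sm0.
- by move=> a [c|c] q; apply: smc.
- by move=> a [c|c] q s; apply: smm.
- by move=> [c|c]; [apply: sr0|apply: sw0].
- move=> [c|c] /=; first exact: sw0.
 by apply: Rmult_lt_0_compat; [have := M_ge1; lra|apply: sw0].
- move=> [c|c] [c'|c'] /=; [exact: sL0|lra|exact: (Rmult_le_pos _ _ K0 fsumw0)|exact: sL0].
- move=> [c|c]; first exact: (restrS (sgS S c)).
 by apply: linS => c'; apply: sdS.
- move=> [c|c] [c'|c'] a q y Hq Hy /=.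
 + by apply: pd_xl; apply: sgd => //; apply: xl_box.
 + exact: pd_xl0.
 + apply: (@fsum_is_derive _ (fun s c0 => sdg S c c0 a q (xl (updI y (inl c') s)) * updI y (inl c') s (inr c0))) => c0.
  have H := pd_xl (ddP c c0 c' a Hq (xl_box Hy)).
  apply: (is_derive_ext (fun s => y (inr c0) * sdg S c c0 a q (xl (updI y (inl c') s)))).
   move=> s; rewrite /updI /=; ring.
  by rewrite Rmult_comm; apply: is_derive_scal.
 + rewrite -(fsum_pick c' (fun c0 => sdg S c c0 a q (xl y))).
  apply: (@fsum_is_derive _ (fun s c0 => sdg S c c0 a q (xl (updI y (inr c') s)) * updI y (inr c') s (inr c0))) => c0.
  have E s : xl (updI y (inr c') s) = xl y.
   by [].
  rewrite /= ; case: eqP => [->|/eqP ne].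
   apply: (is_derive_ext (fun s => sdg S c c' a q (xl y) * s)).
    by move=> s; rewrite E /updI eqxx.
   have := is_derive_scal (fun s : R => s) (y (inr c')) (sdg S c c' a q (xl y)) 1 (is_derive_id _).
   by rewrite Rmult_1_r.
  apply: (is_derive_ext (fun s => sdg S c c0 a q (xl y) * y (inr c0))).
   by move=> s; rewrite E /updI (_ : (inr c0 == inr c' :> I + I) = false) //; apply: negbTE.
  exact: is_derive_const.
- move=> [c|c] [c'|c']; [exact: (restrS (sdS S c c'))| |exact: (linS (F := fun c0 => ddg c c0 c') (fun c0 => ddS c c0 c'))|exact: (restrS (sdS S c c'))].
 by move=> k; apply: Sb_zero; apply: sW0.
- move=> [c|c] a q y Hq Hy /=; first by apply: sgb => //; apply: xl_box.
 bound (@lin_bound (fun c' => sdg S c c' a q (xl y)) y (fun c' => sL S c c' * W a q) Hy (fun c' => sdb c c' a Hq (xl_box Hy))).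
 rewrite (_ : fsum _ = W a q * fsum (fun c' => sL S c c' * w c')); last first.
  rewrite -fsum_scal; apply: fsum_ext => c'; ring.
 rewrite Rmult_comm; apply: Rmult_le_compat_r; first exact: sW0.
 bound (sLw S c); have := sw0 S c; have := sk S => ? ?; nra.
- move=> [c|c] [c'|c'] a q y Hq Hy /=.
 + by apply: sdb => //; apply: xl_box.
 + rewrite Rabs_R0; lra.
 + bound (@lin_bound (fun c0 => ddg c c0 c' a q (xl y)) y (fun c0 => K * W a q) Hy (fun c0 => ddb c c0 c' a Hq (xl_box Hy))).
  rewrite fsum_scal; lra.
 + by apply: sdb => //; apply: xl_box.
- have kk := sk S; have kp := kap'_gt; have M1 := M_ge1.
 move=> [c|c]; rewrite fsum_sum /=.
  rewrite (fsum_ext (F := fun j => 0 * _) (G := fun _ => 0)); last pos.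
  rewrite fsum_0 Rplus_0_r; bound (sLw S c).
  by apply: Rmult_le_compat_r; [have := sw0 S c; lra | rewrite /kap'; lra].
 rewrite fsum_scal (fsum_ext (F := fun j => sL S c j * (M * w j)) (G := fun j => M * (sL S c j * w j))); last pos.
 rewrite fsum_scal.
 have wc := sw0 S c.
 have H1 : M * fsum (fun j => sL S c j * w j) <= M * (skap S * w c).
  by apply: Rmult_le_compat_l; [lra|apply: sLw].
 have H2 : K * fsum w ^ 2 <= M * (w c * (kap' - skap S)).
  rewrite -[X in X <= _](_ : K * fsum w ^ 2 / (w c * (kap' - skap S)) * (w c * (kap' - skap S)) = _); last by field; lra.
  apply: Rmult_le_compat_r; first pos.
  have := fsum_term c M_term_ge0; rewrite /M; lra.
 lra.
- have := sk S; rewrite /kap'; lra.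
Defined.

Lemma xsys_sol a th s Q : sol xsys a (emb th s) Q -> sol S a th (fun q c => Q q (inl c)).
Proof.
move=> [H1 [H2 H3]]; split; first by [].
split; first by move=> q; exact: (xl_box (H2 q)).
by [].
Qed.

Variables (P : A -> (I -> R) -> R -> I -> R).
Hypothesis PS : forall a th, box (fun c => r c / 2) th -> sol S a th (P a th).

(** The datum [w j / 4] in direction [j] lies in the half box of radius [w j], and the factor
    [4 / w j] undoes this scaling. The error [Del] of the linear approximation solves the linearised
    equation with a source quadratic in the step, so absorption makes it quadratic too. *)
Lemma sol_derive a th j Q : box (fun c => r c / 2) th ->
 sol xsys a (emb th (fun c => if c == j then w j / 4 else 0)) Q ->
 forall q c, pd (fun th => P a th q c) j th (4 / w j * Q q (inr c)).
Proof.
move=> Hth HQ q c.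
have wj := sw0 S j.
have H0 := PS a Hth.
have EQ : (fun q c => Q q (inl c)) = P a th by apply: sol_unique (xsys_sol HQ) H0.
have [d [d0 Hd]] := box_open Hth.
have Fw := fsumw0.
(* [C1 * h ^ 2] is the Taylor remainder of the right-hand side when the two solutions are
   [2 * rat * w] apart; the factor [fsum (/ w)] in [C2] expresses it in the weighted norm. *)
pose C1 := 4 * K * fsum w ^ 2 / w j ^ 2.
have C10 : 0 <= C1.
 apply: Rmult_le_pos; first pos.
 pos.
pose C2 := C1 * fsum (fun c => / w c).
have iw c' : / w c' <= fsum (fun c => / w c).
 by apply: (@fsum_term _ (fun c => / w c)) => i; apply: Rlt_le; apply: Rinv_0_lt_compat; apply: sw0.
have C20 : 0 <= C2.
 apply: Rmult_le_pos => //; apply: fsum_ge0 => i.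
 by apply: Rlt_le; apply: Rinv_0_lt_compat; apply: sw0.
apply: (@derive_quadratic _ _ (2 * C2 * w c) d) => // h hd.
set th' := updI th j (th j + h).
have Hth' : box (fun c => r c / 2) th'.
 apply: Hd => i; rewrite /th' /updI; case: eqP => [->|_].
  rewrite (_ : th j + h - th j = h) //; ring.
 by rewrite Rminus_diag_eq // Rabs_R0.
have H' := PS a Hth'.
rewrite updI_id.
set P0 := P a th; set P1 := P a th'.
have pP0 := sol_path H0; have pP1 := sol_path H'; have pQ := sol_path HQ.
pose rat := Rabs h / w j.
have rat0 : 0 <= rat by apply: Rmult_le_pos; pos.
have lip : forall c s, Rabs (P1 s c - P0 s c) <= 2 * rat * w c.
 apply: (sol_lip rat0 H0 H') => i; rewrite /th' /updI; case: eqP => [->|_].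
  have -> : th j + h - th j = h by ring.
  rewrite /rat; right; field; lra.
 rewrite Rminus_diag_eq // Rabs_R0; apply: Rmult_le_pos => //; have := sw0 S i; lra.
pose qq := 4 * h / w j.
pose Del s i := P1 s i - P0 s i - qq * Q s (inr i).
suff main : forall x : I * R, Rabs (Del x.2 x.1) <= 2 * (C2 * h ^ 2) * w x.1.
 have := main (c, q); rewrite /= /Del /qq => L.
 have -> : 4 / w j * Q q (inr c) * h = 4 * h / w j * Q q (inr c) by lra.
 lra.
apply: contraction_bound.
- pos.
- move=> x; have := sw0 S x.1; lra.
- have bQ i s : Rabs (Q s (inr i)) < w i := proj2 pQ s (inr i).
 exists (2 * rat + Rabs qq) => -[i s] /=; rewrite /Del.
 bound (Rabs_triang _ _); rewrite Rabs_Ropp Rabs_mult Rmult_plus_distr_r.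
 apply: Rplus_le_compat; first exact: lip.
 by apply: Rmult_le_compat_l; [apply: Rabs_pos|have := bQ i s; lra].
move=> B B0 HB [i s] /=.
have wi := sw0 S i.
pose G1 s := sg S i a (clamp s) (P1 s).
pose G0 s := sg S i a (clamp s) (P0 s).
pose GQ s := fsum (fun c' => sdg S i c' a (clamp s) (P0 s) * Q s (inr c')).
have cG1 : forall s, continuous G1 s by apply: path_cont pP1 (sgS S i).
have cG0 : forall s, continuous G0 s by apply: path_cont pP0 (sgS S i).
have cGQ : forall s, continuous GQ s.
 move=> s'; apply: (@fsum_continuous _ (fun s c' => sdg S i c' a (clamp s) (P0 s) * Q s (inr c'))) => c'.
 apply: cont_mult; first exact: (path_cont pP0 (sdS S i c')).
 exact: (proj1 pQ).
have ED : Del s i = Lop (se S i) (sm S a i) (fun s => G1 s - G0 s - qq * GQ s) s.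
 have cq s' : continuous (fun s => qq * GQ s) s'.
  by cont.
 have c10 s' : continuous (fun s => G1 s - G0 s) s'.
  by cont.
 rewrite Lop_minus //; [|exact: sm0|exact: smc].
 rewrite Lop_minus //; [|exact: sm0|exact: smc].
 rewrite Lop_scal //; [|exact: sm0|exact: smc].
 have E1 : P1 s i = th' i + Lop (se S i) (sm S a i) G1 s := proj2 (proj2 H') i s.
 have E0 : P0 s i = th i + Lop (se S i) (sm S a i) G0 s := proj2 (proj2 H0) i s.
 have EQi : Q s (inr i) = (if i == j then w j / 4 else 0) + Lop (se S i) (sm S a i) GQ s.
  rewrite (proj2 (proj2 HQ) (inr i) s) /rhs /= /GQ.
  have EP s' : xl (Q s') = P0 s' := f_equal (fun F => F s') EQ.
  congr (_ + Lop _ _ _ s); apply: funext => s'.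
  by rewrite EP.
 rewrite /Del E1 E0 EQi /th' /updI /qq.
 case: eqP => [->|_]; field; lra.
rewrite ED.
have W0 q' : 0 <= q' <= 1 -> 0 <= W a q' by apply: sW0.
have Kp : 0 <= (C2 * h ^ 2 + B / 2) * w i.
 apply: Rmult_le_pos; last lra.
 pos.
apply: (Lop_bound (W := W a)) => //.
- exact: sm0. - exact: smc. - exact: smm. - exact: sWc. - exact: sW1.
- move=> s'; apply: cont_minus.
  by cont.
 by cont.
move=> q' Hq'; rewrite /G1 /G0 /GQ clamp_id //.
have b0 := proj2 pP0 q'; have b1 := proj2 pP1 q'.
have TA := @rect_taylor _ (sg S i a q') (fun c' z => sdg S i c' a q' z)
 (fun c' c'' z => ddg i c' c'' a q' z) (K * W a q') (P0 q') (P1 q')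
 (fun z c' Hz => sgd i c' a Hq' (box_rect b0 b1 Hz))
 (fun z c' c'' Hz => ddP i c' c'' a Hq' (box_rect b0 b1 Hz))
 (fun z c' c'' Hz => ddb i c' c'' a Hq' (box_rect b0 b1 Hz)).
set X := fsum (fun c' => _ * (P1 q' c' - P0 q' c')) in TA.
have -> : sg S i a q' (P1 q') - sg S i a q' (P0 q') - qq * fsum (fun c' => sdg S i c' a q' (P0 q') * Q q' (inr c')) =
 (sg S i a q' (P1 q') - sg S i a q' (P0 q') - X) + fsum (fun c' => sdg S i c' a q' (P0 q') * Del q' c').
 rewrite /X -fsum_scal.
 rewrite (fsum_ext (F := fun c' => sdg S i c' a q' (P0 q') * Del q' c')
  (G := fun c' => sdg S i c' a q' (P0 q') * (P1 q' c' - P0 q' c') - qq * (sdg S i c' a q' (P0 q') * Q q' (inr c')))).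
  rewrite fsum_minus; ring.
 move=> c'; rewrite /Del; ring.
bound (Rabs_triang _ _).
have T1 : Rabs (sg S i a q' (P1 q') - sg S i a q' (P0 q') - X) <= C2 * h ^ 2 * w i * W a q'.
 bound TA.
 have l1b : l1 (fun c' => P1 q' c' - P0 q' c') <= 2 * rat * fsum w.
  rewrite -fsum_scal; apply: fsum_le => c'; pos.
 have sq : l1 (fun c' => P1 q' c' - P0 q' c') ^ 2 <= (2 * rat * fsum w) ^ 2.
  pos.
 via (K * W a q' * (2 * rat * fsum w) ^ 2).
  pos.
 have -> : K * W a q' * (2 * rat * fsum w) ^ 2 = C1 * h ^ 2 * W a q'.
  rewrite /rat /C1 -(pow2_abs h); field; lra.
 apply: Rmult_le_compat_r; first exact: W0.
 rewrite /C2 -[X in X <= _](_ : C1 * (/ w i) * (h ^ 2 * w i) = C1 * h ^ 2); last by field; lra.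
 rewrite (_ : C1 * _ * h ^ 2 * w i = C1 * fsum (fun c => / w c) * (h ^ 2 * w i)); last ring.
 apply: Rmult_le_compat_r; first pos.
 pos.
have T2 : Rabs (fsum (fun c' => sdg S i c' a q' (P0 q') * Del q' c')) <= B / 2 * w i * W a q'.
 bound (fsum_Rabs _).
 via (fsum (fun c' => (W a q' * B) * (sL S i c' * w c'))).
  apply: fsum_le => c'; rewrite Rabs_mult.
  have -> : W a q' * B * (sL S i c' * w c') = (sL S i c' * W a q') * (B * w c') by ring.
  apply: Rmult_le_compat; [apply: Rabs_pos|apply: Rabs_pos|exact: sdb|exact: (HB (c', q'))].
 rewrite fsum_scal (_ : B / 2 * w i * W a q' = W a q' * B * (/ 2 * w i)); last by field.
 apply: Rmult_le_compat_l; first pos.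
 bound (sLw S i); have := sk S => ?; nra.
lra.
Qed.

End Extension.

(** Order [k+1] for [S] is order [k] for the extended system, whose second half carries the
    derivative up to a factor. The index type doubles at each step, hence the quantification over
    all [I] and [S] inside the induction. *)
Theorem sol_smooth (A : Type) k : forall (I : finType) (S : sys A I) (P : A -> (I -> R) -> R -> I -> R),
 (forall a th, box (fun c => sr S c / 2) th -> sol S a th (P a th)) ->
 forall c, Sb (box (fun c => sr S c / 2)) ones k (fun a q th => P a th q c).
Proof.
elim: k => [|k IH] I S P PS c.
all: have B : exists C, 0 <= C /\ forall a q th, I01 q -> box (fun c => sr S c / 2) th ->
  Rabs (P a th q c) <= C * 1 by
 [exists (sr S c); split; [have := sr0 S c; lra|] => a q th _ Hth;
  have := proj2 (sol_path (PS a th Hth)) q c; lra].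
all: have Cn : forall a th, box (fun c => sr S c / 2) th ->
  forall q, continuous (fun q => P a th (clamp q) c) q by
 [move=> a th Hth q; apply: (continuous_comp clamp (fun q => P a th q c));
  [exact: clamp_continuous|exact: (proj1 (sol_path (PS a th Hth)))]].
 by [].
split => //; split => // j.
have [ddg' Hdd] := choice _ (fun x : I * I * I => SbI_pd (@box_open _ _) (@sdS _ _ S x.1.1 x.1.2) x.2).
pose ddg c c' c'' := ddg' (c, c', c'').
have [Kf HK] := choice _ (fun x : I * I * I => Sb_bound (proj2 (Hdd x) 0%N)).
pose K := fsum Kf.
have K0 : 0 <= K by apply: fsum_ge0 => x; case: (HK x).
have ddP c1 c2 c3 a q y : I01 q -> box (sr S) y -> pd (sdg S c1 c2 a q) c3 y (ddg c1 c2 c3 a q y).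
 by apply: (proj1 (Hdd (c1, c2, c3))).
have ddS c1 c2 c3 : SbI (box (sr S)) (sW S) (ddg c1 c2 c3) := proj2 (Hdd (c1, c2, c3)).
have ddb c1 c2 c3 a q y : I01 q -> box (sr S) y -> Rabs (ddg c1 c2 c3 a q y) <= K * sW S a q.
 move=> Hq Hy; bound (proj2 (HK (c1, c2, c3)) a q y Hq Hy).
 apply: Rmult_le_compat_r; first exact: sW0.
 by apply: fsum_term => x; case: (HK x).
pose X := xsys K0 ddP ddS ddb.
have [Q HQ] : exists Q : A -> (I + I -> R) -> R -> I + I -> R,
  forall a th, box (fun c => sr X c / 2) th -> sol X a th (Q a th).
 have ex (x : A * (I + I -> R)) : exists P', box (fun c => sr X c / 2) x.2 -> sol X x.1 x.2 P'.
  case: (classic (box (fun c => sr X c / 2) x.2)) => [H|H].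
   by have [P' HP'] := sol_exists x.1 H; exists P'.
  by exists (fun _ _ => 0).
 have [Q HQ] := choice _ ex.
 by exists (fun a th => Q (a, th)) => a th; apply: (HQ (a, th)).
pose sj := fun i => if i == j then sw S j / 4 else 0.
have Hbox th : box (fun c => sr S c / 2) th -> box (fun c => sr X c / 2) (emb th sj).
 move=> Hth [i|i] /=; first exact: Hth.
 rewrite /sj; case: eqP => [->|_]; last by rewrite Rabs_R0; have := sw0 S i; lra.
 have := sw0 S j => ?; rewrite Rabs_pos_eq; lra.
exists (fun a q th => 4 / sw S j * Q a (emb th sj) q (inr c)); split.
 move=> a q th Hq Hth; exact: (sol_derive PS Hth (HQ a _ (Hbox th Hth))).
apply: Sb_scal.
exact: (Sb_emb (s := sj) Hbox (IH _ X Q HQ (inr c))).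
Qed.

Lemma Cmod_Ci : Cmod Ci = 1.
Proof. rewrite /Cmod /Ci /= (_ : _ + _ = 1) ?sqrt_1 //; ring. Qed.

(** * A functional with moments i^l *)

(** This is [(-1)^k 4^(-k(k+1)/2)], the coefficients of a theta series. Continued to negative
    indices they are antisymmetric under [k -> -k-1], so the nodes [4^k] and [4^(-k-1)] together
    form one bilateral series. *)
Fixpoint mos (k : nat) : R := if k is k'.+1 then - mos k' * (/ 4) ^ k'.+1 else 1.

Definition node_up (k : nat) : R := 4 ^ k.
Definition node_dn (k : nat) : R := (/ 4) ^ k.+1.

Lemma node_up_pos k : 0 < node_up k. Proof. apply: pow_lt; lra. Qed.
Lemma node_dn_pos k : 0 < node_dn k. Proof. apply: pow_lt; lra. Qed.
Lemma node_dn_le k : node_dn k <= node_up k.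
Proof.
apply: (@Rle_trans _ 1); last by apply: pow_R1_Rle; lra.
by rewrite /node_dn pow_inv -Rinv_1; apply: Rinv_le_contravar; [lra|apply: pow_R1_Rle; lra].
Qed.

(** The ratio of consecutive terms of [a] is [q * (1/4)^(k+1)]: at most [q] up to index [j], and at
    most one beyond it. Hence [q ^ j] bounds them all. *)
Lemma mos_decay j : exists C, 0 <= C /\ forall k, Rabs (mos k) * node_up k ^ j <= C * (/ 2) ^ k.
Proof.
set q := 2 * 4 ^ j.
have q1 : 1 <= q by rewrite /q; have := pow_R1_Rle 4 j ltac:(lra); lra.
pose a k := Rabs (mos k) * node_up k ^ j * 2 ^ k.
have a0 k : 0 <= a k.
 apply: Rmult_le_pos; last pos.
 by apply: Rmult_le_pos; [apply: Rabs_pos|apply: pow_le; have := node_up_pos k; lra].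
have aS k : a k.+1 = a k * (q * (/ 4) ^ k.+1).
 rewrite /a [mos k.+1]/= Rabs_mult Rabs_Ropp.
 rewrite [Rabs (/4 * (/ 4) ^ k)]Rabs_pos_eq; last pos.
 have -> : node_up k.+1 ^ j = 4 ^ j * node_up k ^ j by rewrite /node_up [4 ^ k.+1]/= Rpow_mult_distr.
 rewrite /q /=; ring.
have le1 k : (/ 4) ^ k <= 1.
 by rewrite pow_inv -Rinv_1; apply: Rinv_le_contravar; [lra|apply: pow_R1_Rle; lra].
have small k : (k <= j)%N -> a k <= q ^ k.
 elim: k => [_|k IH Hk]; first by rewrite /a /= Rabs_R1 /node_up /= pow1; lra.
 rewrite aS [q ^ k.+1]/= Rmult_comm.
 apply: Rmult_le_compat => //.
 - pos.
 - have := le1 k.+1; nra.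
 - by cont.
have big i : a (j + i)%N <= a j.
 elim: i => [|i IH]; first by rewrite addn0; lra.
 rewrite addnS aS; apply: Rle_trans IH.
 have : q * (/ 4) ^ (j + i).+1 <= 1.
  rewrite /q -addSn pow_add.
  have -> : 2 * 4 ^ j * ((/ 4) ^ j.+1 * (/ 4) ^ i) = (4 * / 4) ^ j * (/ 2 * (/ 4) ^ i).
   by rewrite Rpow_mult_distr /=; field.
  have -> : 4 * / 4 = 1 by field.
  rewrite pow1; have := le1 i; lra.
 have := a0 (j + i)%N; nra.
exists (q ^ j); split; first pos.
move=> k.
have ak : a k <= q ^ j.
 case: (leqP k j) => H.
  by bound (small k H); apply: Rle_pow => //; apply/leP.
 by rewrite -(subnKC (ltnW H)); bound (big _); cont.
have p2 : 0 < 2 ^ k by pos.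
rewrite pow_inv; apply: (Rmult_le_reg_r (2 ^ k)) => //.
by rewrite (_ : q ^ j * / 2 ^ k * 2 ^ k = q ^ j); [|field; lra].
Qed.

(** The growth condition concerns [u > 0] only because all nodes of the functional are positive. *)
Definition pb (B : R) (J : nat) (h : R -> R) := forall u, 0 < u -> Rabs (h u) <= B * (1 + u) ^ J.

(** The theta series annihilates every power of [u]. Division by [1 + u^2] turns it into a
    functional with [nu (u^(l+2)) = - nu (u^l)], the recursion obeyed by the powers of [i] and of
    [-i]. *)
Definition nu_term (h : R -> R) (k : nat) : R :=
 mos k * (h (node_up k) / (1 + node_up k ^ 2) - h (node_dn k) / (1 + node_dn k ^ 2)).
Definition nu (h : R -> R) : R := Series (nu_term h).

Lemma nu_term_bound J : exists C, 0 <= C /\ forall B h, pb B J h ->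
 forall k, Rabs (nu_term h k) <= C * B * (/ 2) ^ k.
Proof.
have [C [C0 HC]] := mos_decay J.
exists (2 * 2 ^ J * C); split.
 pos.
move=> B h Hh k.
have up := node_up_pos k; have dn := node_dn_pos k; have le := node_dn_le k.
have u1 : 1 <= node_up k by apply: pow_R1_Rle; lra.
have B0 : 0 <= B.
 have := Hh 1 ltac:(lra); have := Rabs_pos (h 1); have := pow_lt (1 + 1) J ltac:(lra) => ? ? ?.
 nra.
have one u : 0 < u -> u <= node_up k -> Rabs (h u / (1 + u ^ 2)) <= B * (2 ^ J * node_up k ^ J).
 move=> u0 ule; have P := pow2_ge_0 u.
 rewrite /Rdiv Rabs_mult [Rabs (/ _)]Rabs_pos_eq; last pos.
 via (Rabs (h u)).
  rewrite -[X in _ <= X]Rmult_1_r; apply: Rmult_le_compat_l; first exact: Rabs_pos.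
  rewrite -Rinv_1; pos.
 bound (Hh u u0); apply: Rmult_le_compat_l => //.
 rewrite -Rpow_mult_distr; pos.
rewrite /nu_term Rabs_mult.
have T : Rabs (h (node_up k) / (1 + node_up k ^ 2) - h (node_dn k) / (1 + node_dn k ^ 2))
  <= 2 * (B * (2 ^ J * node_up k ^ J)).
 bound (Rabs_triang _ _); rewrite Rabs_Ropp.
 move: (one _ up (Rle_refl _)) (one _ dn le); lra.
bound (Rmult_le_compat_l _ _ _ (Rabs_pos _) T).
have Q := pow_le 2 J ltac:(lra).
have -> : Rabs (mos k) * (2 * (B * (2 ^ J * node_up k ^ J))) =
 2 * 2 ^ J * B * (Rabs (mos k) * node_up k ^ J) by ring.
have -> : 2 * 2 ^ J * C * B * (/ 2) ^ k = 2 * 2 ^ J * B * (C * (/ 2) ^ k) by ring.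
pos.
Qed.

Lemma ex_series_half K : ex_series (fun k => K * (/ 2) ^ k).
Proof.
apply: (@ex_series_scal R_AbsRing R_NormedModule K (fun k => (/ 2) ^ k)); apply: ex_series_geom.
rewrite Rabs_pos_eq; lra.
Qed.

Lemma nu_ex B J h : pb B J h -> ex_series (nu_term h).
Proof.
move=> Hh; have [C [C0 HC]] := nu_term_bound J.
apply: (@ex_series_le R_AbsRing R_CompleteNormedModule _ (fun k => C * B * (/ 2) ^ k)).
 pos.
exact: ex_series_half.
Qed.

Lemma nu_bound J : exists C, 0 <= C /\ forall B h, pb B J h -> Rabs (nu h) <= C * B.
Proof.
have [C [C0 HC]] := nu_term_bound J.
exists (2 * C); split; first lra.
move=> B h Hh.
have ex : ex_series (fun k => Rabs (nu_term h k)).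
 apply: (@ex_series_le R_AbsRing R_CompleteNormedModule _ (fun k => C * B * (/ 2) ^ k)).
  move=> k; rewrite /norm /= /abs /= Rabs_Rabsolu; pos.
 exact: ex_series_half.
bound (Series_Rabs _ ex).
bound (Series_le _ (fun k => C * B * (/ 2) ^ k) _ (ex_series_half _)).
 split; pos.
rewrite Series_scal_l Series_geom; last by rewrite Rabs_pos_eq; lra.
lra.
Qed.

Lemma nu_minus B1 J1 B2 J2 h1 h2 : pb B1 J1 h1 -> pb B2 J2 h2 ->
 nu (fun u => h1 u - h2 u) = nu h1 - nu h2.
Proof.
move=> H1 H2; rewrite /nu -Series_minus; [|exact: nu_ex H1|exact: nu_ex H2].
apply: Series_ext => k; rewrite /nu_term /Rdiv; ring.
Qed.

Lemma nu_scal c h : nu (fun u => c * h u) = c * nu h.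
Proof.
rewrite /nu -Series_scal_l; apply: Series_ext => k; rewrite /nu_term /Rdiv; ring.
Qed.

Lemma nu_ext h1 h2 : (forall u, 0 < u -> h1 u = h2 u) -> nu h1 = nu h2.
Proof.
move=> E; apply: Series_ext => k; rewrite /nu_term !E //; [exact: node_dn_pos|exact: node_up_pos].
Qed.

Lemma pb_pow l : pb 1 l (fun u => u ^ l).
Proof.
move=> u u0; rewrite Rabs_pos_eq; last pos.
rewrite Rmult_1_l; pos.
Qed.

Lemma pb_mult B1 J1 B2 J2 h1 h2 : pb B1 J1 h1 -> pb B2 J2 h2 ->
 pb (B1 * B2) (J1 + J2)%N (fun u => h1 u * h2 u).
Proof.
move=> H1 H2 u u0; rewrite Rabs_mult pow_add.
rewrite (_ : B1 * B2 * _ = (B1 * (1 + u) ^ J1) * (B2 * (1 + u) ^ J2)); last ring.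
pos.
Qed.

Lemma pb_mulu B J h : pb B J h -> pb B J.+1 (fun u => u * h u).
Proof.
move=> H; have := pb_mult (@pb_pow 1) H; rewrite Rmult_1_l add1n.
by move=> H' u u0; have := H' u u0; rewrite pow_1.
Qed.

Lemma pb_le B B' J J' h : 0 <= B -> B <= B' -> (J <= J')%N -> pb B J h -> pb B' J' h.
Proof.
move=> B0 BB /leP JJ H u u0; bound (H u u0).
apply: Rmult_le_compat => //; first pos.
apply: Rle_pow => //; lra.
Qed.

Lemma pb_plus B1 B2 J h1 h2 : pb B1 J h1 -> pb B2 J h2 -> pb (B1 + B2) J (fun u => h1 u + h2 u).
Proof.
move=> H1 H2 u u0; bound (Rabs_triang _ _).
rewrite Rmult_plus_distr_r; pos.
Qed.

Lemma pb_scal c B J h : pb B J h -> pb (Rabs c * B) J (fun u => c * h u).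
Proof.
move=> H u u0; rewrite Rabs_mult Rmult_assoc; pos.
Qed.

(** Shifting the index of the bilateral series by one multiplies it by a power of 4 and changes its
    sign, which is the recursion [rec]. The moment of order zero vanishes because the two halves of
    the series coincide. *)
Lemma nu_moments l : nu (fun u => (1 + u ^ 2) * u ^ l) = 0.
Proof.
pose Su (l : nat) k := mos k * node_up k ^ l.
pose Sd (l : nat) k := mos k * node_dn k ^ l.
have exu l' : ex_series (Su l').
 have [C [C0 HC]] := mos_decay l'.
 apply: (@ex_series_le R_AbsRing R_CompleteNormedModule _ (fun k => C * (/ 2) ^ k)).
  move=> k; rewrite /norm /= /abs /= /Su Rabs_mult [Rabs (_ ^ _)]Rabs_pos_eq; first exact: HC.
  apply: pow_le; have := node_up_pos k; lra.
 exact: ex_series_half.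
have exd l' : ex_series (Sd l').
 have [C [C0 HC]] := mos_decay l'.
 apply: (@ex_series_le R_AbsRing R_CompleteNormedModule _ (fun k => C * (/ 2) ^ k)).
  move=> k; rewrite /norm /= /abs /= /Sd Rabs_mult [Rabs (_ ^ _)]Rabs_pos_eq; last first.
   apply: pow_le; have := node_dn_pos k; lra.
  apply: Rle_trans (HC k); apply: Rmult_le_compat_l; first exact: Rabs_pos.
  by apply: pow_incr; split; [have := node_dn_pos k; lra|apply: node_dn_le].
 exact: ex_series_half.
have E l' : nu (fun u => (1 + u ^ 2) * u ^ l') = Series (Su l') - Series (Sd l').
 rewrite /nu -Series_minus //; apply: Series_ext => k; rewrite /nu_term /Su /Sd.
 have := pow2_ge_0 (node_up k); have := pow2_ge_0 (node_dn k) => ? ?.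
 field; lra.
rewrite E.
have rec l' : Series (Su l'.+1) - Series (Sd l'.+1) = - 4 ^ l' * (Series (Su l') - Series (Sd l')).
 have mS k : mos k.+1 = - mos k * (/ 4) ^ k.+1 by [].
 have inv4 k : 4 ^ k * (/ 4) ^ k = 1 by rewrite -Rpow_mult_distr (_ : 4 * / 4 = 1) ?pow1 //; field.
 have Eu k : Su l'.+1 k.+1 = - 4 ^ l' * Su l' k.
  rewrite /Su mS /node_up.
  have -> : (4 ^ k.+1) ^ l'.+1 = 4 ^ k.+1 * (4 ^ l' * (4 ^ k) ^ l').
   by rewrite [X in X = _]/= -Rpow_mult_distr.
  have := inv4 k.+1 => I4.
  transitivity (- mos k * (4 ^ k.+1 * (/ 4) ^ k.+1) * (4 ^ l' * (4 ^ k) ^ l')); first ring.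
  rewrite I4; ring.
 have Ed k : Sd l'.+1 k = - 4 ^ l' * Sd l' k.+1.
  rewrite /Sd mS /node_dn.
  have -> : ((/ 4) ^ k.+2) ^ l' = (/ 4) ^ l' * ((/ 4) ^ k.+1) ^ l'.
   by rewrite -Rpow_mult_distr.
  have := inv4 l' => I4.
  transitivity (mos k * (/ 4) ^ k.+1 * ((/ 4) ^ k.+1) ^ l'); first by rewrite -(tech_pow_Rmult ((/ 4) ^ k.+1) l'); ring.
  transitivity (mos k * (/ 4) ^ k.+1 * ((/ 4) ^ k.+1) ^ l' * (4 ^ l' * (/ 4) ^ l')); last ring.
  rewrite I4; ring.
 rewrite (Series_incr_1 (Su l'.+1)) // (Series_ext _ _ Eu) Series_scal_l.
 rewrite (Series_ext _ _ Ed) Series_scal_l.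
 rewrite (Series_incr_1 (Sd l')) //.
 have -> : Su l'.+1 0%N = 1 by rewrite /Su /node_up pow1 /=; ring.
 have -> : Sd l' 0%N = (/ 4) ^ l' by rewrite /Sd /node_dn [mos 0]/= [(/4)^1]/= Rmult_1_r Rmult_1_l.
 have I4 := inv4 l'.
 lra.
elim: l => [|l IH]; last by rewrite rec IH; ring.
rewrite (Series_ext (Su 0%N) (Sd 0%N)) //; ring.
Qed.

Lemma nu_pow_rec l : nu (fun u => u ^ l.+2) = - nu (fun u => u ^ l).
Proof.
have H := nu_moments l.
have E : nu (fun u => (1 + u ^ 2) * u ^ l) = nu (fun u => u ^ l.+2 - (-1) * u ^ l).
 apply: nu_ext => u _ /=; ring.
rewrite E (@nu_minus 1 l.+2 (Rabs (-1) * 1) l) in H; [|exact: pb_pow|exact: (pb_scal (-1) (@pb_pow l))].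
rewrite nu_scal in H; lra.
Qed.

(** This excludes the zero functional. The first two terms are computed, about -0.44 and 0.23, and
    the rest of the series is at most 1/48. *)
Lemma nu_one_neg : nu (fun _ => 1) < 0.
Proof.
have ex : ex_series (nu_term (fun _ => 1)).
 apply: (@nu_ex 1 0) => u _; rewrite Rabs_R1 /=; lra.
rewrite /nu (Series_incr_1 _ ex) (Series_incr_1 (fun k => nu_term (fun _ => 1) k.+1)); last first.
 exact: (proj1 (ex_series_incr_1 (nu_term (fun _ => 1))) ex).
have mb k : Rabs (mos k.+2) <= / 64 * (/ 4) ^ k.
 elim: k => [|k IH].
  rewrite (_ : mos 2 = / 64); first by rewrite /= Rabs_pos_eq; lra.
  by rewrite /=; field.
 rewrite (_ : mos k.+3 = - mos k.+2 * (/ 4) ^ k.+3) // Rabs_mult Rabs_Ropp.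
 rewrite [Rabs (_ ^ _)]Rabs_pos_eq; last pos.
 have le1 : (/ 4) ^ k.+3 <= / 4.
  have : (/ 4) ^ k.+2 <= 1.
   by rewrite pow_inv -Rinv_1; apply: Rinv_le_contravar; [lra|apply: pow_R1_Rle; lra].
  rewrite [(/ 4) ^ k.+3]/= [(/ 4) ^ k.+2]/=; lra.
 have P := pow_le (/ 4) k.+3 ltac:(lra).
 have -> : / 64 * (/ 4) ^ k.+1 = (/ 64 * (/ 4) ^ k) * / 4 by rewrite /=; ring.
 pos.
have tb k : Rabs (nu_term (fun _ => 1) k.+2) <= / 64 * (/ 4) ^ k.
 rewrite /nu_term Rabs_mult.
 via (Rabs (mos k.+2) * 1); last by rewrite Rmult_1_r; pos.
 apply: Rmult_le_compat_l; first exact: Rabs_pos.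
 have one u : 0 < u -> 0 <= 1 / (1 + u ^ 2) <= 1.
  move=> u0; have P := pow2_ge_0 u; rewrite /Rdiv Rmult_1_l; split.
   pos.
  rewrite -Rinv_1; pos.
 have := one _ (node_up_pos k.+2); have := one _ (node_dn_pos k.+2) => ? ?.
 apply/Rabs_le_between; lra.
have ex2 : ex_series (fun k => / 64 * (/ 4) ^ k).
 apply: (@ex_series_scal R_AbsRing R_NormedModule (/ 64) (fun k => (/ 4) ^ k)); apply: ex_series_geom.
 rewrite Rabs_pos_eq; lra.
have exa : ex_series (fun k => Rabs (nu_term (fun _ => 1) k.+2)).
 apply: (@ex_series_le R_AbsRing R_CompleteNormedModule _ (fun k => / 64 * (/ 4) ^ k)) => // k.
 rewrite /norm /= /abs /= Rabs_Rabsolu; pos.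
have TB : Rabs (Series (fun k => nu_term (fun _ => 1) k.+2)) <= / 64 * (/ (1 - / 4)).
 bound (Series_Rabs _ exa).
 bound (Series_le _ _ _ ex2); first by split; pos.
 rewrite Series_scal_l Series_geom; last by rewrite Rabs_pos_eq; lra.
 by right.
have E0 : nu_term (fun _ => 1) 0%N = / 2 - 16 / 17.
 by rewrite /nu_term /node_up /node_dn /=; field.
have E1 : nu_term (fun _ => 1) 1%N = / 4 * (256 / 257 - / 17).
 by rewrite /nu_term /node_up /node_dn /=; field.
rewrite E0 E1; move: TB; rewrite -/(Series _) => TB.
have := Rle_abs (Series (fun k => nu_term (fun=> 1) k.+2)).
lra.
Qed.

(** [nu] still mixes the evaluations at [i] and [-i]. The combination [nu h - i nu (u h)] projects
    onto the eigenvalue [i] of multiplication by [u], and [cM] normalises its value at 1; the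
    denominator has nonzero real part [nu 1]. *)
Definition cM : C := Cinv (nu (fun _ => 1), - nu (fun u => u ^ 1)).

Definition MM (h : R -> R) : C := Cmult cM (nu h, - nu (fun u => u * h u)).

Lemma cM_neq0 : (nu (fun _ => 1), - nu (fun u => u ^ 1)) <> RtoC 0.
Proof. move=> H; have := nu_one_neg; case: H => -> _; lra. Qed.

Lemma MM_ext h1 h2 : (forall u, 0 < u -> h1 u = h2 u) -> MM h1 = MM h2.
Proof.
move=> E; rewrite /MM (nu_ext E) (@nu_ext (fun u => u * h1 u) (fun u => u * h2 u)) //.
by move=> u u0; rewrite E.
Qed.

Lemma MM_minus B1 J1 B2 J2 h1 h2 : pb B1 J1 h1 -> pb B2 J2 h2 ->
 MM (fun u => h1 u - h2 u) = (MM h1 - MM h2)%C.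
Proof.
move=> H1 H2; rewrite /MM (nu_minus H1 H2).
rewrite (@nu_ext (fun u => u * (h1 u - h2 u)) (fun u => u * h1 u - u * h2 u)); last pos.
rewrite (nu_minus (pb_mulu H1) (pb_mulu H2)).
rewrite /Cminus /Cplus /Copp /Cmult /=; congr pair; ring.
Qed.

Lemma MM_scal c h : MM (fun u => c * h u) = (c * MM h)%C.
Proof.
rewrite /MM nu_scal (@nu_ext (fun u => u * (c * h u)) (fun u => c * (u * h u))); last pos.
rewrite nu_scal /Cmult /=; congr pair; ring.
Qed.

Lemma MM_one : MM (fun _ => 1) = RtoC 1.
Proof.
rewrite /MM (@nu_ext (fun u => u * 1) (fun u => u ^ 1)); last by [].
by apply: Cinv_l; apply: cM_neq0.
Qed.

Lemma MM_pow l : MM (fun u => u ^ l.+1) = Cmult Ci (MM (fun u => u ^ l)).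
Proof.
rewrite /MM (@nu_ext (fun u => u * u ^ l.+1) (fun u => u ^ l.+2)); last by [].
rewrite nu_pow_rec (@nu_ext (fun u => u * u ^ l) (fun u => u ^ l.+1)); last by [].
rewrite /Cmult /Ci /=; congr pair; ring.
Qed.

Lemma MM_bound J : exists C, 0 <= C /\ forall B h, pb B J h -> Cmod (MM h) <= C * B.
Proof.
have [C1 [C10 H1]] := nu_bound J; have [C2 [C20 H2]] := nu_bound J.+1.
exists (Cmod cM * (C1 + C2)); split; first pos.
move=> B h Hh; rewrite /MM Cmod_mult Rmult_assoc.
apply: Rmult_le_compat_l; first exact: Cmod_ge_0.
have -> : (nu h, - nu (fun u => u * h u)) = (nu h + Ci * (- nu (fun u => u * h u))%R)%C.
 rewrite /Cplus /Cmult /Ci /RtoC /=; congr pair; ring.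
bound (Cmod_triangle _ _); rewrite Cmod_mult !Cmod_R Rabs_Ropp.
rewrite Cmod_Ci.
move: (H1 B h Hh) (H2 B _ (pb_mulu Hh)); lra.
Qed.

Definition tpoly (N : nat) (a : nat -> R) (u : R) : R :=
 \big[Rplus/0]_(m < N) (a m / INR (Factorial.fact m) * u ^ m).

Lemma tpolyS N a u :
 tpoly N.+1 a u = a 0%N + u * \big[Rplus/0]_(m < N) (a m.+1 / INR (Factorial.fact m.+1) * u ^ m).
Proof.
rewrite /tpoly big_ord_recl [u ^ _]/= [INR _]/= Rdiv_1_r Rmult_1_r; congr (_ + _).
rewrite -(fsum_scal u); apply: eq_bigr => i _.
rewrite lift0 -tech_pow_Rmult; ring.
Qed.

Lemma tpoly_derive N a u : is_derive (tpoly N.+1 a) u (tpoly N (fun m => a m.+1) u).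
Proof.
have E v : a 0%N + fsum (fun m : 'I_N => a m.+1 / INR (Factorial.fact m.+1) * v ^ m.+1) = tpoly N.+1 a v.
 rewrite tpolyS -(fsum_scal v); congr (_ + _); apply: fsum_ext => m; rewrite -tech_pow_Rmult; ring.
apply: (is_derive_ext _ _ _ _ E).
rewrite -[tpoly N _ u]Rplus_0_l.
apply: der_plus; first exact: is_derive_const.
apply: (@fsum_is_derive _ (fun v (m : 'I_N) => a m.+1 / INR (Factorial.fact m.+1) * v ^ m.+1)) => m.
have F0 := INR_fact_neq_0 m.
have S0 : INR m.+1 <> 0 by apply: not_0_INR.
have -> : a m.+1 / INR (Factorial.fact m) * u ^ m =
  a m.+1 / INR (Factorial.fact m.+1) * (INR m.+1 * 1 * u ^ m).
 by rewrite fact_simpl mult_INR; field.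
apply: is_derive_scal.
exact: (is_derive_pow (fun v : R => v) m.+1 u 1 (is_derive_id u)).
Qed.

Lemma taylor_bound (N J : nat) : forall (H : nat -> R -> R) B,
 (forall m u, is_derive (H m) u (H m.+1 u)) ->
 (forall u, 0 <= u -> Rabs (H N u) <= B * (1 + u) ^ J) ->
 forall u, 0 <= u -> Rabs (H 0%N u - tpoly N (fun m => H m 0) u) <= B * (1 + u) ^ J * u ^ N.
Proof.
elim: N => [|N IH] H B Hd Hb u u0.
 rewrite /tpoly big_ord0 Rminus_0_r /= Rmult_1_r; pos.
have IH' := IH (fun m => H m.+1) B (fun m => Hd m.+1) Hb.
pose r v := H 0%N v - tpoly N.+1 (fun m => H m 0) v.
have dr v : is_derive r v (H 1%N v - tpoly N (fun m => H m.+1 0) v).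
 by apply: der_minus => //; apply: tpoly_derive.
have r0 : r 0 = 0 by rewrite /r tpolyS; ring.
have [||v [Hv E]] := MVT_gen r 0 u (fun v => H 1%N v - tpoly N (fun m => H m.+1 0) v).
- by [].
- move=> v _; apply/continuity_pt_filterlim; apply: ex_derive_continuous.
 eexists; pos.
rewrite Rmin_left // Rmax_right // in Hv.
have := E; rewrite r0 /r !Rminus_0_r => ->.
rewrite Rabs_mult [Rabs u]Rabs_pos_eq // (_ : B * _ * u ^ N.+1 = B * (1 + u) ^ J * u ^ N * u); last by rewrite /=; ring.
apply: Rmult_le_compat_r => //; bound (IH' v (proj1 Hv)).
have B0 : 0 <= B.
 have := Hb 0 (Rle_refl 0); rewrite Rplus_0_r pow1 Rmult_1_r.
 have := Rabs_pos (H N.+1 0); lra.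
apply: Rmult_le_compat.
- pos.
- pos.
- pos.
- pos.
Qed.

Lemma pb_tpoly N a : exists B J, 0 <= B /\ pb B J (tpoly N a).
Proof.
elim: N => [|N [B [J [B0 H]]]].
 exists 0, 0%N; split; [lra|] => u _; rewrite /tpoly big_ord0 Rabs_R0; lra.
set k := a N / INR (Factorial.fact N).
exists (B + Rabs k * 1), (J + N)%N; split.
 pos.
have E u : tpoly N a u + k * u ^ N = tpoly N.+1 a u by rewrite /tpoly big_ord_recr.
move=> u u0; rewrite -E; apply: (pb_plus (h1 := tpoly N a) (h2 := fun u => k * u ^ N)) => //.
- by apply: pb_le H => //; [lra|apply: leq_addr].
- apply: (pb_le (B := Rabs k * 1) (J := N)); [have := Rabs_pos k; lra|lra|exact: leq_addl|].
 exact: (pb_scal k (@pb_pow N)).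
Qed.

Lemma MM_tpoly_shift N a : MM (fun u => u * tpoly N a u) = (Ci * MM (tpoly N a))%C.
Proof.
elim: N => [|N IH].
 have E h : (forall u, h u = 0) -> MM h = RtoC 0.
  move=> Hh; rewrite (@MM_ext h (fun u => 0 * 1)); last by move=> u _; rewrite Hh; ring.
  rewrite (MM_scal 0 (fun _ => 1)) /Cmult /RtoC /=; congr pair; ring.
 rewrite !E ?Cmult_0_r // => u; rewrite /tpoly big_ord0; ring.
set k := a N / INR (Factorial.fact N).
have E u : tpoly N.+1 a u = tpoly N a u - (- k) * u ^ N by rewrite /tpoly big_ord_recr /= -/k; ring.
have [B [J [B0 H]]] := pb_tpoly N a.
have H2 := pb_scal (-k) (@pb_pow N).
rewrite (@MM_ext (tpoly N.+1 a) (fun u => tpoly N a u - (- k) * u ^ N)); last by [].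
rewrite (MM_minus H H2).
rewrite (@MM_ext _ (fun u => u * tpoly N a u - (- k) * u ^ N.+1)); last by move=> u _; rewrite E /=; ring.
rewrite (MM_minus (pb_mulu H) (pb_scal (-k) (@pb_pow N.+1))) IH !MM_scal MM_pow.
ring.
Qed.

Section MomentTaylor.
Variables (N J : nat).

(** On polynomials [MM] treats [u] as [i], so both differences see only the Taylor remainder, which
    is governed by the derivative of order [N]. The second difference will become the defect in the
    Cauchy-Riemann equations. *)
Lemma MM_taylor : exists C, 0 <= C /\ forall B (H : nat -> R -> R),
 (forall m u, is_derive (H m) u (H m.+1 u)) ->
 (forall u, 0 <= u -> Rabs (H N u) <= B * (1 + u) ^ J) ->
 Cmod (MM (H 0%N) - (MM (tpoly N (fun m => H m 0)))%R) <= C * B /\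
 Cmod ((MM (fun u => u * H 0%N u))%R - Ci * MM (H 0%N)) <= C * B.
Proof.
have [C1 [C10 H1]] := MM_bound (J + N)%N; have [C2 [C20 H2]] := MM_bound (J + N).+1.
exists (C1 + C2); split; first lra.
move=> B H Hd Hb.
have T := taylor_bound Hd Hb.
set p := tpoly N _ in T *.
have B0 : 0 <= B.
 have := Hb 0 (Rle_refl 0); rewrite Rplus_0_r pow1 Rmult_1_r.
 have := Rabs_pos (H N 0); lra.
have pr : pb B (J + N)%N (fun u => H 0%N u - p u).
 move=> u u0; bound (T u (Rlt_le _ _ u0)).
 rewrite pow_add Rmult_assoc; apply: Rmult_le_compat_l => //.
 pos.
have [B' [J' [B'0 pp]]] := pb_tpoly N (fun m => H m 0); rewrite -/p in pp.
have E : MM (H 0%N) = Cplus (MM (fun u => H 0%N u - p u)) (MM p).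
 have -> : MM p = Copp (MM (fun u => -1 * p u)).
  rewrite MM_scal; case: (MM p) => x y; rewrite /Cmult /Copp /RtoC /=; congr pair; lra.
 rewrite -[RHS](MM_minus pr (pb_scal (-1) pp)).
 apply: MM_ext => u _; ring.
have E' : MM (fun u => u * H 0%N u) = Cplus (MM (fun u => u * (H 0%N u - p u))) (MM (fun u => u * p u)).
 have -> : MM (fun u => u * p u) = Copp (MM (fun u => -1 * (u * p u))).
  rewrite MM_scal; case: (MM _) => x y; rewrite /Cmult /Copp /RtoC /=; congr pair; lra.
 rewrite -[RHS](MM_minus (pb_mulu pr) (pb_scal (-1) (pb_mulu pp))).
 apply: MM_ext => u _; ring.
have b1 := H1 B _ pr; have b2 := H2 B _ (pb_mulu pr).
split.
 rewrite E (_ : Cminus _ _ = MM (fun u => H 0%N u - p u)); last ring.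
 nra.
rewrite E' E MM_tpoly_shift -/p.
rewrite (_ : Cminus _ _ = ((MM (fun u => u * (H 0%N u - p u)))%R + (- (Ci * (MM (fun u => H 0%N u - p u))%R)))%C); last ring.
bound (Cmod_triangle _ _); rewrite Cmod_opp Cmod_mult.
rewrite Cmod_Ci.
lra.
Qed.

End MomentTaylor.

Lemma MM_tpoly1 a : MM (tpoly 1 a) = RtoC (a 0%N).
Proof.
rewrite (@MM_ext _ (fun u => a 0%N * 1)); last by move=> u _; rewrite tpolyS big_ord0; ring.
rewrite (MM_scal (a 0%N) (fun _ => 1)) MM_one; ring.
Qed.

Lemma MM_tpoly2 a : MM (tpoly 2 a) = (a 0%N, a 1%N).
Proof.
rewrite (@MM_ext _ (fun u => a 0%N * 1 - (- a 1%N) * u ^ 1)); last first.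
 by move=> u _; rewrite tpolyS big_ord_recl big_ord0 /=; field.
rewrite (@MM_minus (Rabs (a 0%N) * 1) 0 (Rabs (- a 1%N) * 1) 1).
- rewrite (MM_scal (a 0%N) (fun _ => 1)) (MM_scal (- a 1%N) (fun u => u ^ 1)) MM_pow.
 rewrite (@MM_ext (fun u => u ^ 0) (fun _ => 1)) // MM_one.
 rewrite /Cminus /Cplus /Copp /Cmult /Ci /RtoC /=; congr pair; ring.
- apply: (pb_scal (a 0%N) (B := 1) (J := 0)) => u _; rewrite Rabs_R1 /=; lra.
- exact: (pb_scal (- a 1%N) (@pb_pow 1)).
Qed.

Lemma Re_le_Cmod z : Rabs (Re z) <= Cmod z.
Proof. exact: Rle_trans (Rmax_l _ _) (Rmax_Cmod z). Qed.

Lemma Im_le_Cmod z : Rabs (Im z) <= Cmod z.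
Proof. exact: Rle_trans (Rmax_r _ _) (Rmax_Cmod z). Qed.

Lemma Cmod_le_sum z : Cmod z <= Rabs (Re z) + Rabs (Im z).
Proof.
have -> : z = (Re z + Ci * Im z)%C.
 case: z => x y; rewrite /Cplus /Cmult /Ci /RtoC /=; congr pair; ring.
bound (Cmod_triangle _ _); rewrite Cmod_mult !Cmod_R.
rewrite Cmod_Ci.
rewrite /Re /Im /Cplus /Cmult /Ci /RtoC /= !Rmult_0_l !Rmult_0_r !Rmult_1_l; right; f_equal; f_equal; ring.
Qed.

(** ** Euclidean vectors and the weight <x> *)

Section Vectors.
Variable n : nat.
Implicit Types x y p q : vec n.

Lemma dot_fsum x y : dot x y = fsum (fun i => x i * y i). Proof. by []. Qed.

Lemma dot_self_ge0 x : 0 <= dot x x.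
Proof. apply: fsum_ge0 => i; nra. Qed.

Lemma vnorm_ge0 x : 0 <= vnorm x. Proof. exact: sqrt_pos. Qed.

Lemma vnorm_sq x : vnorm x ^ 2 = dot x x.
Proof. by apply: pow2_sqrt; apply: dot_self_ge0. Qed.

Lemma vnorm_term x i : Rabs (x i) <= vnorm x.
Proof.
rewrite -sqrt_Rsqr_abs; apply: sqrt_le_1_alt; rewrite /Rsqr.
apply: (@fsum_term _ (fun i => x i * x i)) => j; nra.
Qed.

Lemma cauchy_schwarz x y : Rabs (dot x y) <= vnorm x * vnorm y.
Proof.
suff H : dot x y ^ 2 <= dot x x * dot y y.
 rewrite /vnorm -sqrt_mult; [|exact: dot_self_ge0|exact: dot_self_ge0].
 rewrite -sqrt_Rsqr_abs; apply: sqrt_le_1_alt; rewrite /Rsqr.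
 pos.
set a := dot y y; set b := dot x y.
have E : fsum (fun i => (a * x i - b * y i) ^ 2) = a * (a * dot x x - b ^ 2).
 transitivity (a ^ 2 * dot x x - 2 * a * b * dot x y + b ^ 2 * dot y y).
  rewrite !dot_fsum -(fsum_scal (a ^ 2)) -(fsum_scal (2 * a * b)) -(fsum_scal (b ^ 2)) -fsum_minus -fsum_plus.
  apply: fsum_ext => i; ring.
 rewrite -/a -/b; ring.
have P : 0 <= a * (a * dot x x - b ^ 2) by rewrite -E; pos.
have a0 : 0 <= a := dot_self_ge0 y.
case: (Rle_lt_or_eq_dec _ _ a0) => [ap|a00].
 nra.
suff -> : b = 0 by nra.
rewrite /b dot_fsum -(fsum_0 'I_n); apply: fsum_ext => i.
have : Rabs (y i) <= vnorm y by apply: vnorm_term.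
rewrite /vnorm -/a -a00 sqrt_0 => H; have := Rabs_pos (y i) => H'.
have -> : y i = 0 by split_Rabs; lra.
ring.
Qed.

Definition vadd x (u : R) q : vec n := fun i => x i + u * q i.

Lemma vnorm_vadd x u q : vnorm (vadd x u q) <= vnorm x + Rabs u * vnorm q.
Proof.
have P : 0 <= vnorm x + Rabs u * vnorm q.
 move: (vnorm_ge0 x) (Rmult_le_pos _ _ (Rabs_pos u) (vnorm_ge0 q)); lra.
apply: (Rsqr_incr_0_var _ _ _ P); rewrite /Rsqr.
have -> : vnorm (vadd x u q) * vnorm (vadd x u q) = dot x x + 2 * u * dot x q + u ^ 2 * dot q q.
 rewrite (_ : _ * _ = vnorm (vadd x u q) ^ 2); last ring.
 rewrite vnorm_sq !dot_fsum -(fsum_scal (2 * u)) -(fsum_scal (u ^ 2)) -!fsum_plus; apply: fsum_ext => i; rewrite /vadd; ring.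
rewrite -!vnorm_sq -(pow2_abs u).
have : 2 * u * dot x q <= 2 * (Rabs u * (vnorm x * vnorm q)).
 have := cauchy_schwarz x q => CS.
 via (Rabs (2 * u * dot x q)); first exact: Rle_abs.
 rewrite !Rabs_mult (Rabs_pos_eq 2); last lra.
 have := Rmult_le_compat_l _ _ _ (Rabs_pos u) CS; lra.
lra.
Qed.

Lemma vnorm_le_l1 x : vnorm x <= l1 x.
Proof.
have P := l1_ge0 x.
apply: (Rsqr_incr_0_var _ _ _ P); rewrite /Rsqr.
have -> : vnorm x * vnorm x = vnorm x ^ 2 by ring.
rewrite vnorm_sq dot_fsum.
via (fsum (fun i => l1 x * Rabs (x i))); last by rewrite fsum_scal; apply: Rle_refl.
apply: fsum_le => i; have := l1_term x i; have := Rabs_pos (x i) => ? ?.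
bound (Rle_abs _); rewrite Rabs_mult; pos.
Qed.

Lemma l1_le_vnorm x : l1 x <= INR n * vnorm x.
Proof.
have := @fsum_le_const _ (fun i => Rabs (x i)) (vnorm x) (vnorm_term x).
by rewrite card_ord.
Qed.

Lemma jbr_sq x : jbr x ^ 2 = 1 + vnorm x ^ 2.
Proof. apply: pow2_sqrt; pos. Qed.

Lemma jbr_ge1 x : 1 <= jbr x.
Proof. rewrite -{1}sqrt_1; apply: sqrt_le_1_alt; nra. Qed.

Lemma vnorm_le_jbr x : vnorm x <= jbr x.
Proof.
rewrite -{1}(sqrt_pow2 (vnorm x)); last exact: vnorm_ge0.
apply: sqrt_le_1_alt; lra.
Qed.

Lemma jbr_vadd x u q : jbr (vadd x u q) <= jbr x + Rabs u * vnorm q.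
Proof.
have P := Rmult_le_pos _ _ (Rabs_pos u) (vnorm_ge0 q); have J1 := jbr_ge1 x.
rewrite {1}/jbr -[X in _ <= X]sqrt_pow2; last lra.
apply: sqrt_le_1_alt.
have H := vnorm_vadd x u q; have V := vnorm_ge0 (vadd x u q); have V' := vnorm_ge0 x.
have := jbr_sq x; have := vnorm_le_jbr x => ? ?.
nra.
Qed.

Lemma jbr_sub x y : jbr y <= jbr x + vnorm (vsub y x).
Proof.
have := jbr_vadd x 1 (vsub y x); rewrite Rabs_R1 Rmult_1_l.
rewrite (_ : vadd x 1 (vsub y x) = y) //.
apply: funext => i; rewrite /vadd /vsub; ring.
Qed.

(** Peetre's inequality: evaluation at [p + u q] instead of [p] loses only powers of [1 + u], and
    these are absorbed by the functional [MM]. This is how the extension keeps the decay of the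
    coefficients. *)
Lemma peetre p u q : 0 <= u -> vnorm q <= 1 -> jbr p <= (1 + u) * jbr (vadd p u q).
Proof.
move=> u0 q1; have := jbr_vadd (vadd p u q) (- u) q.
rewrite (_ : vadd (vadd p u q) (- u) q = p); last first.
 apply: funext => i; rewrite /vadd; ring.
rewrite Rabs_Ropp Rabs_pos_eq //; have := jbr_ge1 (vadd p u q); have := vnorm_ge0 q => *.
nra.
Qed.

End Vectors.

Lemma Rpower_pos x s : 0 < Rpower x s. Proof. exact: exp_pos. Qed.

Lemma Rpower_neg_le1 x s : 1 <= x -> 0 <= s -> Rpower x (- s) <= 1.
Proof.
move=> x1 s0; rewrite -(Rpower_O x); last lra.
apply: Rle_Rpower => //; lra.
Qed.

Lemma Rpower_neg_anti x y s : 0 < x -> x <= y -> 0 <= s -> Rpower y (- s) <= Rpower x (- s).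
Proof.
move=> x0 xy s0; rewrite !Rpower_Ropp; apply: Rinv_le_contravar; first exact: Rpower_pos.
apply: Rle_Rpower_l; lra.
Qed.

#[global] Hint Resolve vnorm_ge0 Rpower_pos : nonneg.

(** * Symmetry of mixed partial derivatives and decay of all derivatives *)

Section MixedPartials.
Variables (n : nat) (g : vec n -> R).
Hypothesis sg : smooth_Rn g.

Lemma pd_dxs ds i x : pd (dxs ds g) i x (dxs (i :: ds) g x).
Proof. by apply: Derive_correct; apply: (proj1 (sg ds x)). Qed.

Lemma dx_updI (h : vec n -> R) i x s : dx i h (updI x i s) = Derive (fun v => h (updI x i v)) s.
Proof.
rewrite /dx updI_same; apply: Derive_ext => v.
by rewrite -[upd _ _ _]/(updI _ _ _) updI_updI.
Qed.

Lemma updI_comm (x : vec n) i j u v : i != j -> updI (updI x i u) j v = updI (updI x j v) i u.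
Proof.
move=> ij; apply: funext => k; rewrite /updI.
by case: eqP => [->|//]; case: eqP => // E; rewrite E eqxx in ij.
Qed.

(** The decay hypothesis concerns multi-indices, with the partial derivatives in one fixed order,
    whereas differentiating the extension produces them in any order. The identity is Schwarz's
    theorem in the plane of the two variables. *)
Lemma dx_comm ds i j : dx i (dxs (j :: ds) g) = dx j (dxs (i :: ds) g).
Proof.
case: (eqVneq i j) => [->//|ij].
apply: funext => x.
set h := dxs ds g.
pose f u v := h (updI (updI x i u) j v).
have Ej u v : Derive (fun t => f u t) v = dxs (j :: ds) g (updI (updI x i u) j v).
 by rewrite /= -/h dx_updI.
have Ei u v : Derive (fun t => f t v) u = dxs (i :: ds) g (updI (updI x i u) j v).
 rewrite /= -/h updI_comm // dx_updI; apply: Derive_ext => t; by rewrite /f updI_comm.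
have Eij u v : Derive (fun z => Derive (fun t => f z t) v) u =
  dxs (i :: j :: ds) g (updI (updI x i u) j v).
 rewrite [RHS]/= -/h updI_comm // dx_updI; apply: Derive_ext => t.
 by rewrite Ej /= updI_comm.
have Eji u v : Derive (fun z => Derive (fun t => f t z) u) v =
  dxs (j :: i :: ds) g (updI (updI x i u) j v).
 rewrite [RHS]/= -/h dx_updI; apply: Derive_ext => t.
 by [].
have H1 u v s : is_derive (fun z => dxs s g (updI (updI x i z) j v)) u
  (dxs (i :: s) g (updI (updI x i u) j v)).
 have := pd_dxs s i (updI (updI x i u) j v); rewrite /pd updI_other // updI_same.
 by apply: is_derive_ext => t; rewrite -(updI_comm _ t v ij) updI_updI.
have H2 u v s : is_derive (fun z => dxs s g (updI (updI x i u) j z)) v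
  (dxs (j :: s) g (updI (updI x i u) j v)).
 have := pd_dxs s j (updI (updI x i u) j v); rewrite /pd updI_same.
 by apply: is_derive_ext => t; rewrite updI_updI.
have ct s : continuity_2d_pt (fun u v => dxs s g (updI (updI x i u) j v)) (x i) (x j).
 move=> eps; have [d [d0 Hd]] := proj2 (sg s x) eps (cond_pos eps).
 have d2 : 0 < d / 2 by lra.
 exists (mkposreal _ d2) => u v /= Hu Hv.
 rewrite [X in _ - X](_ : _ = dxs s g x); last by rewrite updI_id updI_id.
 apply: Hd; apply: Rle_lt_trans (vnorm_le_l1 _) _.
 have -> : l1 (vsub (updI (updI x i u) j v) x) = Rabs (u - x i) + Rabs (v - x j).
  rewrite /l1 -(fsum_pick i (fun _ => Rabs (u - x i))) -(fsum_pick j (fun _ => Rabs (v - x j))) -fsum_plus.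
  apply: fsum_ext => k; rewrite /vsub /updI; case: (eqVneq k j) => [->|kj].
   rewrite eq_sym (negbTE ij); ring.
  case: (eqVneq k i) => [->|_]; first ring.
  rewrite (Rminus_diag_eq (x k)) // Rabs_R0; ring.
 lra.
have S := @Schwarz f (x i) (x j).
have -> : dx i (dxs (j :: ds) g) x = Derive (fun z => Derive (fun t => f z t) (x j)) (x i).
 by rewrite Eij /= updI_id updI_id.
rewrite S.
- by rewrite Eji /= updI_id updI_id.
- exists (mkposreal 1 Rlt_0_1) => u v _ _; repeat split.
 + by eexists; apply: (H1 u v ds).
 + by eexists; apply: (H2 u v ds).
 + eexists; apply: (is_derive_ext _ _ _ _ _ (H1 u v (j :: ds))) => t; by [].
 + eexists; apply: (is_derive_ext _ _ _ _ _ (H2 u v (i :: ds))) => t; by [].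
- apply: (continuity_2d_pt_ext _ _ _ _ _ (ct (i :: j :: ds))) => u v; by [].
- apply: (continuity_2d_pt_ext _ _ _ _ _ (ct (j :: i :: ds))) => u v; by [].
Qed.

Lemma dxs_move s1 i s2 : dxs (s1 ++ i :: s2) g = dxs (i :: s1 ++ s2) g.
Proof.
elim: s1 => // j s1 IH; rewrite cat_cons [LHS]/= IH; exact: (dx_comm (s1 ++ s2) j i).
Qed.

Lemma dxs_perm s1 s2 : perm_eq s1 s2 -> dxs s1 g = dxs s2 g.
Proof.
elim: s1 s2 => [|i s1 IH] s2 P.
 by move: P; rewrite perm_sym => /perm_nilP ->.
have : i \in s2 by rewrite -(perm_mem P) mem_head.
move=> /splitPr S; case: S P => p1 p2 P.
rewrite dxs_move /= (IH (p1 ++ p2)) //.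
by rewrite -(perm_cons i); apply: perm_trans P _; rewrite -cat1s perm_catCA.
Qed.

Lemma dmulti_dxs (beta : 'I_n -> nat) :
 dmulti beta g = dxs (flatten [seq nseq (beta j) j | j <- enum 'I_n]) g.
Proof.
rewrite /dmulti; elim: (enum 'I_n) => //= j s ->.
rewrite /dxs foldr_cat; elim: (beta j) => //= m ->.
by [].
Qed.

End MixedPartials.

Lemma count_flatten_nseq (T : eqType) (beta : T -> nat) s x : uniq s ->
 count_mem x (flatten [seq nseq (beta j) j | j <- s]) = (if x \in s then beta x else 0)%N.
Proof.
elim: s => //= j s IH /andP[js us]; rewrite count_cat IH // count_nseq in_cons /=.
case: (eqVneq x j) => [->|xj]; first by rewrite (negbTE js) mul1n addn0.
by [].
Qed.

Lemma perm_flatten_count (T : finType) (s : seq T) :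
 perm_eq s (flatten [seq nseq (count_mem j s) j | j <- enum T]).
Proof.
apply/allP => x _ /=.
by rewrite (count_flatten_nseq (fun j => count_mem j s)) ?enum_uniq // mem_enum.
Qed.

Lemma sum_count_mem (T : finType) (s : seq T) : (\sum_(j : T) count_mem j s)%N = size s.
Proof.
elim: s => [|i s IH] /=; first by rewrite big1.
rewrite big_split /= IH (bigD1 i) //= eqxx big1 // => j /negbTE.
by rewrite eq_sym => ->.
Qed.

Lemma big_nonneg_term (T : finType) (P : pred T) (F : T -> R) i : P i -> (forall j, 0 <= F j) ->
 F i <= \big[Rplus/0]_(j | P j) F j.
Proof.
move=> Pi F0; rewrite (bigD1 i) //=.
suff: 0 <= \big[Rplus/0]_(j | P j && (j != i)) F j by lra.
apply: (big_ind (fun x => 0 <= x)) => //; pos.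
Qed.

(** Sorting the list gives the order used by [dmulti]. Among the nonnegative terms of [decay_sum]
    the one kept belongs to the multi-index of multiplicities, which are at most the length of the
    list and so fit into the finite type. *)
Lemma dxs_decay (n : nat) (b : 'I_n -> 'I_n -> vec n -> R) (sgm : R) (A : nat -> R) :
 (forall j k, smooth_Rn (b j k)) ->
 (forall l x, decay_sum b l x <= A l * Rpower (jbr x) (- 1 - INR l - sgm)) ->
 forall j k ds x, Rabs (dxs ds (b j k) x) <= A (size ds) * Rpower (jbr x) (- (1 + INR (size ds) + sgm)).
Proof.
move=> sm dec j k ds x.
rewrite (_ : - (1 + _ + _) = - 1 - INR (size ds) - sgm); last ring.
apply: Rle_trans (dec (size ds) x).
set l := size ds.
pose beta : {ffun 'I_n -> 'I_l.+1} := [ffun i => inord (count_mem i ds)].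
have vb i : nat_of_ord (beta i) = count_mem i ds by rewrite ffunE inordK // ltnS count_size.
have mb : mabs (fun i => nat_of_ord (beta i)) == l.
 by rewrite /mabs (eq_bigr _ (fun i _ => vb i)) sum_count_mem.
rewrite /decay_sum.
apply: Rle_trans (@big_nonneg_term _ _ (fun beta : {ffun 'I_n -> 'I_l.+1} =>
 \big[Rplus/0]_(j < n) \big[Rplus/0]_(k < n)
  Rabs (dmulti (fun i => nat_of_ord (beta i)) (b j k) x)) beta mb _); last first.
 move=> be; apply: fsum_ge0 => j'; apply: fsum_ge0 => k'; pos.
apply: Rle_trans (@fsum_term _ (fun j => fsum (fun k => Rabs (dmulti (fun i => nat_of_ord (beta i)) (b j k) x))) j _); last first.
 pos.
apply: Rle_trans (@fsum_term _ (fun k => Rabs (dmulti (fun i => nat_of_ord (beta i)) (b j k) x)) k _); last first.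
 pos.
have -> : (fun i => nat_of_ord (beta i)) = (fun i => count_mem i ds) by exact: funext.
by rewrite (dmulti_dxs (b j k)) (dxs_perm (sm j k) (perm_flatten_count ds)); apply: Rle_refl.
Qed.

(** * Complex sums and derivatives, by real and imaginary parts *)

Definition csum (I : finType) (F : I -> C) : C := (fsum (fun i => Re (F i)), fsum (fun i => Im (F i))).

Lemma Csum_csum n (F : 'I_n -> C) : Csum F = csum F.
Proof.
rewrite /Csum /csum /fsum; elim: (index_enum _) => [|i s IH]; first by rewrite !big_nil.
by rewrite !big_cons IH.
Qed.

Lemma Re_RtoC_mult (r : R) z : Re (r * z) = r * Re z.
Proof. rewrite /Re /Cmult /RtoC /=; ring. Qed.

Lemma Im_RtoC_mult (r : R) z : Im (r * z) = r * Im z.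
Proof. rewrite /Im /Cmult /RtoC /=; ring. Qed.

Lemma Re_minus z w : Re (z - w) = Re z - Re w. Proof. by []. Qed.
Lemma Im_minus z w : Im (z - w) = Im z - Im w. Proof. by []. Qed.
Lemma Cmod_mul_le z w A B : Cmod z <= A -> Cmod w <= B -> Cmod z * Cmod w <= A * B.
Proof. pos. Qed.

Definition cpart (im : bool) (z : C) : R := if im then Im z else Re z.
Lemma cpart_scal im (x : R) z : cpart im (x * z)%C = x * cpart im z.
Proof. by case: im; [apply: Im_RtoC_mult|apply: Re_RtoC_mult]. Qed.
Lemma cpart_le_Cmod im z : Rabs (cpart im z) <= Cmod z.
Proof. by case: im; [apply: Im_le_Cmod|apply: Re_le_Cmod]. Qed.

Lemma Im_le_Cminus u (v : R) : Rabs (Im u) <= Cmod (u - v).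
Proof. apply: Rle_trans (Im_le_Cmod _); rewrite Im_minus /= Rminus_0_r; lra. Qed.

Lemma Cmod_csum (I : finType) (F : I -> C) : Cmod (csum F) <= 2 * fsum (fun i => Cmod (F i)).
Proof.
bound (Cmod_le_sum _); rewrite /csum /=.
have H1 : Rabs (fsum (fun i => Re (F i))) <= fsum (fun i => Cmod (F i)).
 by bound (fsum_Rabs _); apply: fsum_le => i; apply: Re_le_Cmod.
have H2 : Rabs (fsum (fun i => Im (F i))) <= fsum (fun i => Cmod (F i)).
 by bound (fsum_Rabs _); apply: fsum_le => i; apply: Im_le_Cmod.
lra.
Qed.

Definition derivC (f : R -> C) (x : R) (l : C) :=
 is_derive (fun s => Re (f s)) x (Re l) /\ is_derive (fun s => Im (f s)) x (Im l).

Lemma pb_fsum (I : finType) B J (h : I -> R -> R) : (forall i, pb (B i) J (h i)) ->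
 pb (fsum B) J (fun u => fsum (fun i => h i u)).
Proof.
move=> H u u0; bound (fsum_Rabs _); rewrite Rmult_comm -fsum_scal.
by apply: fsum_le => i; rewrite Rmult_comm; apply: H.
Qed.

Lemma MM_fsum (I : finType) B J (h : I -> R -> R) : (forall i, pb (B i) J (h i)) ->
 MM (fun u => fsum (fun i => h i u)) = csum (fun i => MM (h i)).
Proof.
move=> H.
have main (s : seq I) : (exists B', pb B' J (fun u => \big[Rplus/0]_(i <- s) h i u)) /\
  MM (fun u => \big[Rplus/0]_(i <- s) h i u) =
  (\big[Rplus/0]_(i <- s) Re (MM (h i)), \big[Rplus/0]_(i <- s) Im (MM (h i))).
 elim: s => [|i s [[B' HB] IH]].
  split; first by exists 0 => u _; rewrite big_nil Rabs_R0; lra.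
  rewrite (@MM_ext _ (fun u => 0 * 1)); last by move=> u _; rewrite big_nil; ring.
  rewrite (MM_scal 0 (fun _ => 1)) !big_nil /Cmult /RtoC /=; congr pair; ring.
 split.
  exists (B i + B') => u u0; rewrite big_cons.
  exact: (pb_plus (H i) HB u0).
 rewrite (@MM_ext _ (fun u => h i u - (-1) * \big[Rplus/0]_(i <- s) h i u)); last first.
  move=> u _; rewrite big_cons; ring.
 rewrite (MM_minus (H i) (pb_scal (-1) HB)) MM_scal IH !big_cons.
 case: (MM (h i)) => x y; rewrite /Cminus /Cplus /Copp /Cmult /RtoC /=; congr pair; ring.
exact: (proj2 (main (index_enum I))).
Qed.

(** * The almost analytic extension and its decay *)

Section AlmostAnalytic.
Variables (n : nat) (F : seq 'I_n -> vec n -> R) (Cd : nat -> R) (s0 : R).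
Hypotheses (s0p : 0 < s0) (FP : forall ds i x, pd (F ds) i x (F (i :: ds) x)).

Definition sz (ds : seq 'I_n) : R := 1 + INR (size ds) + s0.
Definition om (s : R) (x : vec n) : R := Rpower (jbr x) (- s).

Hypothesis Fb : forall ds x, Rabs (F ds x) <= Cd (size ds) * om (sz ds) x.

Lemma sz_pos ds : 0 < sz ds.
Proof. rewrite /sz; have := pos_INR (size ds); lra. Qed.

Lemma om_pos s x : 0 < om s x. Proof. exact: Rpower_pos. Qed.

Lemma om_le1 s x : 0 <= s -> om s x <= 1.
Proof. by apply: Rpower_neg_le1 => //; apply: jbr_ge1. Qed.

Lemma om_mono s s' x : s' <= s -> om s x <= om s' x.
Proof. by move=> H; apply: Rle_Rpower; [exact: jbr_ge1|lra]. Qed.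

Lemma F_bd ds x : Rabs (F ds x) <= Rabs (Cd (size ds)).
Proof.
bound (Fb ds x).
have := om_le1 x (Rlt_le _ _ (sz_pos ds)); have := om_pos (sz ds) x.
have := Rle_abs (Cd (size ds)); have := Rabs_pos (Cd (size ds)) => *; nra.
Qed.

Lemma F_taylor ds x y :
 Rabs (F ds y - F ds x - fsum (fun i => F (i :: ds) x * (y i - x i))) <=
 Rabs (Cd (size ds).+2) * l1 (fun i => y i - x i) ^ 2.
Proof.
apply: (@rect_taylor _ (F ds) (fun i => F (i :: ds)) (fun i j => F [:: j, i & ds])).
- by [].
- by [].
- by move=> z c c' _; apply: F_bd.
Qed.

Lemma F_lip ds x y : Rabs (F ds y - F ds x) <= Rabs (Cd (size ds).+1) * l1 (fun i => y i - x i).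
Proof.
rewrite -fsum_scal.
apply: (@rect_lip _ (F ds) (fun i => F (i :: ds)) (fun _ => Rabs (Cd (size ds).+1))).
- by [].
- by move=> z c _; apply: F_bd.
Qed.

Lemma F_curve ds (p : R -> vec n) (p' : 'I_n -> R) s :
 (forall i, is_derive (fun s => p s i) s (p' i)) ->
 is_derive (fun s => F ds (p s)) s (fsum (fun i => F (i :: ds) (p s) * p' i)).
Proof.
move=> Hp; apply: (curve_derive (gam := p) (K := Rabs (Cd (size ds).+2)) Hp).
by apply: filter_forall => v; apply: F_taylor.
Qed.

(** Formally [i^l] times the derivative [F ds] at [p + i q]. The exponent [l] counts
    differentiations in [q], each of which brings down a factor [u]. *)
Definition EE (ds : seq 'I_n) (l : nat) (p q : vec n) : C := MM (fun u => u ^ l * F ds (vadd p u q)).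

Lemma EE_pb0 ds l p q : pb (1 * Rabs (Cd (size ds))) (l + 0) (fun u => u ^ l * F ds (vadd p u q)).
Proof.
apply: (@pb_mult _ _ _ 0 (fun u => u ^ l) (fun u => F ds (vadd p u q))); first exact: pb_pow.
by move=> u _; rewrite /= Rmult_1_r; apply: F_bd.
Qed.

Lemma ceil_nat s : exists J : nat, s <= INR J.
Proof.
have [N HN] := nfloor_ex (Rabs s) (Rabs_pos s); exists N.+1.
rewrite S_INR; have := Rle_abs s; lra.
Qed.

Lemma peetre_om s : 0 <= s -> exists J : nat, forall p u q, 0 <= u -> vnorm q <= 1 ->
 om s (vadd p u q) <= om s p * (1 + u) ^ J.
Proof.
move=> s0'; have [J HJ] := ceil_nat s; exists J => p u q u0 q1.
have P := peetre p u0 q1; have j1 := jbr_ge1 p; have j2 := jbr_ge1 (vadd p u q).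
rewrite /om -Rpower_pow; last lra.
via (Rpower (jbr p) (- s) * Rpower (1 + u) s); last first.
 apply: Rmult_le_compat_l; first exact: Rlt_le (Rpower_pos _ _).
 apply: Rle_Rpower => //; lra.
rewrite !Rpower_Ropp.
apply: (Rmult_le_reg_l (Rpower (jbr (vadd p u q)) s)); first exact: Rpower_pos.
rewrite Rinv_r; last by have := Rpower_pos (jbr (vadd p u q)) s; lra.
apply: (Rmult_le_reg_l (Rpower (jbr p) s)); first exact: Rpower_pos.
have -> : Rpower (jbr p) s * (Rpower (jbr (vadd p u q)) s * (/ Rpower (jbr p) s * Rpower (1 + u) s)) =
 Rpower (jbr (vadd p u q)) s * Rpower (1 + u) s.
 field; have := Rpower_pos (jbr p) s; lra.
rewrite Rmult_1_r Rpower_mult_distr; [|lra|lra].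
apply: Rle_Rpower_l => //; pos.
Qed.

Lemma EE_bound ds l : exists C, 0 <= C /\ forall p q, vnorm q <= 1 ->
 Cmod (EE ds l p q) <= C * om (sz ds) p.
Proof.
have [J HJ] := peetre_om (Rlt_le _ _ (sz_pos ds)).
have [C [C0 HC]] := MM_bound (l + J)%N.
exists (C * Rabs (Cd (size ds))); split; first pos.
move=> p q q1; rewrite Rmult_assoc; apply: HC.
rewrite -[X in pb X]Rmult_1_l.
apply: (@pb_mult _ _ _ _ (fun u => u ^ l) (fun u => F ds (vadd p u q))); first exact: pb_pow.
move=> u u0; bound (Fb ds _).
have H1 := HJ p u q (Rlt_le _ _ u0) q1.
via (Rabs (Cd (size ds)) * om (sz ds) (vadd p u q)).
 by apply: Rmult_le_compat_r; [apply: Rlt_le; apply: om_pos|apply: Rle_abs].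
rewrite Rmult_assoc; pos.
Qed.

Definition EEd ds l p q (c : 'I_n + 'I_n) : C :=
 match c with inl i => EE (i :: ds) l p q | inr i => EE (i :: ds) l.+1 p q end.

(** [MM] is applied to the second-order Taylor remainder of [F] at [p + u q]. The increment of that
    point grows by a factor [1 + u] at most, so the functional bounds the result uniformly. *)
Lemma EE_taylor ds l : exists K, 0 <= K /\ forall p q p' q',
 Cmod (EE ds l p' q' - EE ds l p q - csum (fun c => ((emb p' q' c - emb p q c)%R * EEd ds l p q c)%C)) <=
 K * l1 (fun c => emb p' q' c - emb p q c) ^ 2.
Proof.
have [C [C0 HC]] := MM_bound (l + 2)%N.
set K2 := Rabs (Cd (size ds).+2).
exists (C * K2); split; first by apply: Rmult_le_pos => //; apply: Rabs_pos.
move=> p q p' q'.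
pose dl c := emb p' q' c - emb p q c.
pose t (c : 'I_n + 'I_n) u := match c with
 | inl i => dl (inl i) * (u ^ l * F (i :: ds) (vadd p u q))
 | inr i => dl (inr i) * (u ^ l.+1 * F (i :: ds) (vadd p u q)) end.
have pt c : pb (Rabs (dl c) * (1 * Rabs (Cd (size ds).+1))) l.+1 (t c).
 case: c => i; rewrite /t; last by have := pb_scal (dl (inr i)) (@EE_pb0 (i :: ds) l.+1 p q); rewrite addn0.
 have := pb_scal (dl (inl i)) (@EE_pb0 (i :: ds) l p q); rewrite addn0 => H.
 apply: pb_le H; [|exact: Rle_refl|exact: leqnSn].
 pos.
have E : csum (fun c => (dl c * EEd ds l p q c)%C) = MM (fun u => fsum (fun c => t c u)).
 rewrite (MM_fsum pt).
 have Et c : MM (t c) = (dl c * EEd ds l p q c)%C by case: c => i; rewrite /t /EEd /EE MM_scal.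
 by congr pair; apply: fsum_ext => c; rewrite Et.
rewrite E -(MM_minus (@EE_pb0 ds l p' q') (@EE_pb0 ds l p q)).
have p1 : pb (1 * Rabs (Cd (size ds)) + Rabs (-1) * (1 * Rabs (Cd (size ds)))) (l + 0)
  (fun u => u ^ l * F ds (vadd p' u q') - u ^ l * F ds (vadd p u q)).
 move=> u u0; have := pb_plus (@EE_pb0 ds l p' q') (pb_scal (-1) (@EE_pb0 ds l p q)) u0.
 rewrite (_ : _ - _ = u ^ l * F ds (vadd p' u q') + -1 * (u ^ l * F ds (vadd p u q))); pos.
rewrite -(MM_minus p1 (pb_fsum pt)) Rmult_assoc.
apply: HC => u u0.
have -> : u ^ l * F ds (vadd p' u q') - u ^ l * F ds (vadd p u q) - fsum (fun c => t c u) =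
 u ^ l * (F ds (vadd p' u q') - F ds (vadd p u q) -
  fsum (fun i => F (i :: ds) (vadd p u q) * (vadd p' u q' i - vadd p u q i))).
 rewrite !Rmult_minus_distr_l -fsum_scal fsum_sum; congr (_ - _).
 rewrite -fsum_plus; apply: fsum_ext => i; rewrite /t /dl /vadd /=; ring.
rewrite Rabs_mult Rabs_pos_eq; last pos.
have T := F_taylor ds (vadd p u q) (vadd p' u q').
have L : l1 (fun i => vadd p' u q' i - vadd p u q i) <= (1 + u) * l1 dl.
 rewrite /l1 fsum_sum Rmult_plus_distr_l -!fsum_scal -fsum_plus; apply: fsum_le => i.
 rewrite /vadd /dl /= (_ : _ - _ = (p' i - p i) + u * (q' i - q i)); last ring.
 bound (Rabs_triang _ _); rewrite Rabs_mult (Rabs_pos_eq u); last lra.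
 have := Rabs_pos (p' i - p i); have := Rabs_pos (q' i - q i) => *; nra.
have L2 : l1 (fun i => vadd p' u q' i - vadd p u q i) ^ 2 <= ((1 + u) * l1 dl) ^ 2.
 pos.
have ul : u ^ l <= (1 + u) ^ l by pos.
rewrite pow_add.
via ((1 + u) ^ l * (K2 * ((1 + u) * l1 dl) ^ 2)).
 apply: Rmult_le_compat => //; [pos|exact: Rabs_pos|].
 bound T; apply: Rmult_le_compat_l => //; pos.
rewrite Rpow_mult_distr -[l1 (fun c => _)]/(l1 dl); lra.
Qed.

Lemma EE_curve ds l (p q : R -> vec n) (p' q' : 'I_n -> R) s :
 (forall i, is_derive (fun s => p s i) s (p' i)) ->
 (forall i, is_derive (fun s => q s i) s (q' i)) ->
 derivC (fun s => EE ds l (p s) (q s)) s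
  (csum (fun c => (emb p' q' c * EEd ds l (p s) (q s) c)%C)).
Proof.
move=> Hp Hq; have [K [K0 HK]] := EE_taylor ds l.
have Hg c : is_derive (fun s => emb (p s) (q s) c) s (emb p' q' c) by case: c.
suff cp im : is_derive (fun s => cpart im (EE ds l (p s) (q s))) s (cpart im (csum (fun c => (emb p' q' c * EEd ds l (p s) (q s) c)%C))).
 by split; [apply: (cp false)|apply: (cp true)].
have sE (v : 'I_n + 'I_n -> R) : cpart im (csum (fun c => (v c * EEd ds l (p s) (q s) c)%C)) = fsum (fun c => cpart im (EEd ds l (p s) (q s) c) * v c).
 by case: im; apply: fsum_ext => c; rewrite Rmult_comm -?Re_RtoC_mult -?Im_RtoC_mult.
rewrite sE; apply: (curve_derive (gam := fun s => emb (p s) (q s)) (K := K) Hg).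
apply: filter_forall => v; apply: Rle_trans (HK (p s) (q s) (p v) (q v)); apply: Rle_trans (cpart_le_Cmod im _).
by rewrite -sE; right; case: im {sE}.
Qed.

Lemma EE_lip ds l : exists K, 0 <= K /\ forall p q p' q',
 Cmod (EE ds l p' q' - EE ds l p q) <= K * l1 (fun c => emb p' q' c - emb p q c).
Proof.
have [C [C0 HC]] := MM_bound (l + 1)%N.
exists (C * Rabs (Cd (size ds).+1)); split; first pos.
move=> p q p' q'; rewrite -(MM_minus (@EE_pb0 ds l p' q') (@EE_pb0 ds l p q)) Rmult_assoc.
apply: HC => u u0; rewrite -Rmult_minus_distr_l Rabs_mult Rabs_pos_eq; last pos.
have T := F_lip ds (vadd p u q) (vadd p' u q').
have L : l1 (fun i => vadd p' u q' i - vadd p u q i) <= (1 + u) * l1 (fun c => emb p' q' c - emb p q c).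
 rewrite /l1 fsum_sum Rmult_plus_distr_l -!fsum_scal -fsum_plus; apply: fsum_le => i.
 rewrite /vadd /= (_ : _ - _ = (p' i - p i) + u * (q' i - q i)); last ring.
 bound (Rabs_triang _ _); rewrite Rabs_mult (Rabs_pos_eq u); last lra.
 have := Rabs_pos (p' i - p i); have := Rabs_pos (q' i - q i) => *; nra.
rewrite pow_add pow_1.
via ((1 + u) ^ l * (Rabs (Cd (size ds).+1) * ((1 + u) * l1 (fun c => emb p' q' c - emb p q c)))).
 apply: Rmult_le_compat; [pos|exact: Rabs_pos|pos|].
 bound T; pos.
pos.
Qed.

(** The derivatives in [u] along [p + u q]. Each order yields one more factor [q] and one more power
    of decay. *)
Fixpoint Hm (m : nat) (ds : seq 'I_n) (p q : vec n) (u : R) : R :=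
 if m is m'.+1 then fsum (fun i => q i * Hm m' (i :: ds) p q u) else F ds (vadd p u q).

Lemma Hm_derive m ds p q u : is_derive (Hm m ds p q) u (Hm m.+1 ds p q u).
Proof.
elim: m ds => [|m IH] ds /=.
 have -> : fsum (fun i => q i * F (i :: ds) (vadd p u q)) = fsum (fun i => F (i :: ds) (vadd p u q) * q i).
  apply: fsum_ext => i; ring.
 apply: (@F_curve ds (fun u => vadd p u q) q u) => i; rewrite /vadd.
 rewrite -[X in is_derive _ _ X]Rplus_0_l.
 apply: der_plus; first exact: is_derive_const.
 have := is_derive_scal_l (fun u : R => u) u 1 (q i) (is_derive_id u).
 by rewrite /scal /= /mult /= Rmult_1_l.
apply: (@fsum_is_derive _ (fun u i => q i * Hm m (i :: ds) p q u)) => i.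
apply: is_derive_scal; pos.
Qed.

Lemma Hm_bound m ds p q u :
 Rabs (Hm m ds p q u) <= l1 q ^ m * (Rabs (Cd (size ds + m)) * om (sz ds + INR m) (vadd p u q)).
Proof.
elim: m ds => [|m IH] ds.
 rewrite [Hm _ _ _ _ _]/= [_ ^ 0]/= [INR 0]/= Rplus_0_r Rmult_1_l addn0.
 bound (Fb ds _); apply: Rmult_le_compat_r; first exact: Rlt_le (om_pos _ _).
 exact: Rle_abs.
rewrite [Hm _ _ _ _ _]/=; bound (fsum_Rabs _).
rewrite -tech_pow_Rmult Rmult_assoc Rmult_comm -fsum_scal.
apply: fsum_le => i; rewrite Rabs_mult Rmult_comm.
apply: Rmult_le_compat_r; first exact: Rabs_pos.
bound (IH (i :: ds)); rewrite addnS /= addSn.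
rewrite (_ : sz (i :: ds) + INR m = sz ds + INR m.+1); first exact: Rle_refl.
rewrite /sz [size _]/= !S_INR; ring.
Qed.

Lemma Hm_taylor N ds : exists C, 0 <= C /\ forall p q, vnorm q <= 1 ->
 let B := C * (l1 q ^ N * om (sz ds + INR N) p) in
 Cmod (EE ds 0 p q - MM (tpoly N (fun m => Hm m ds p q 0))) <= B /\
 Cmod (EE ds 1 p q - Ci * EE ds 0 p q) <= B.
Proof.
have szN : 0 <= sz ds + INR N by have := sz_pos ds; pos.
have [J HJ] := peetre_om szN.
have [C [C0 HC]] := MM_taylor N J.
exists (C * Rabs (Cd (size ds + N))); split; first pos.
move=> p q q1 B.
have := HC (Rabs (Cd (size ds + N)) * (l1 q ^ N * om (sz ds + INR N) p)) (fun m => Hm m ds p q)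
 (fun m u => Hm_derive m ds p q u).
rewrite -(Rmult_assoc C) -/B => H.
have [|H1 H2] := H.
 move=> u u0; bound (Hm_bound N ds p q u).
 have Q := pow_le (l1 q) N (l1_ge0 q).
 rewrite (_ : Rabs (Cd (size ds + N)) * _ * _ = l1 q ^ N * (Rabs (Cd (size ds + N)) * (om (sz ds + INR N) p * (1 + u) ^ J))); last ring.
 pos.
have E0 : MM (fun u => Hm 0 ds p q u) = EE ds 0 p q.
 apply: MM_ext => u _ /=; ring.
have E1 : MM (fun u => u * Hm 0 ds p q u) = EE ds 1 p q.
 apply: MM_ext => u _ /=; ring.
by rewrite -E1 -E0; split.
Qed.

Lemma EE_im1 ds : exists C, 0 <= C /\ forall p q, vnorm q <= 1 ->
 Rabs (Im (EE ds 0 p q)) <= C * (l1 q * om (sz ds + 1) p).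
Proof.
have [C [C0 HC]] := Hm_taylor 1 ds; exists C; split => // p q q1.
have [H _] := HC p q q1; rewrite MM_tpoly1 pow_1 in H; apply: Rle_trans H.
apply: Rle_trans (Im_le_Cmod _); rewrite /Cminus /Cplus /Copp /RtoC /=.
rewrite Ropp_0 Rplus_0_r; lra.
Qed.

(** At order two the Taylor polynomial gives [q] times the real gradient of [F]. Replacing this
    gradient by the real part of the extended one costs another factor [q]. *)
Lemma EE_im2 ds : exists C, 0 <= C /\ forall p q, vnorm q <= 1 ->
 Rabs (Im (EE ds 0 p q) - fsum (fun i => Re (EE (i :: ds) 0 p q) * q i)) <=
 C * (l1 q ^ 2 * om (sz ds + 2) p).
Proof.
have [C [C0 HC]] := Hm_taylor 2 ds.
have [D HD] := choice _ (fun i => Hm_taylor 1 (i :: ds)).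
exists (C + fsum D); split.
 by have : 0 <= fsum D; [apply: fsum_ge0 => i; case: (HD i)|lra].
move=> p q q1.
have [H _] := HC p q q1; rewrite MM_tpoly2 in H.
have X0 : 0 <= l1 q ^ 2 * om (sz ds + 2) p.
 by apply: Rmult_le_pos; [apply: pow2_ge_0|apply: Rlt_le; apply: om_pos].
have H1 : Rabs (Im (EE ds 0 p q) - Hm 1 ds p q 0) <= C * (l1 q ^ 2 * om (sz ds + 2) p).
 exact: Rle_trans (Im_le_Cmod _) H.
have H2 i : Rabs (Re (EE (i :: ds) 0 p q) - F (i :: ds) (vadd p 0 q)) <= D i * (l1 q * om (sz ds + 2) p).
 have [H2 _] := proj2 (HD i) p q q1; rewrite MM_tpoly1 pow_1 in H2.
 rewrite (_ : sz (i :: ds) + INR 1 = sz ds + 2) in H2; last by rewrite /sz [size _]/= S_INR /=; ring.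
 exact: Rle_trans (Re_le_Cmod _) H2.
have -> : Im (EE ds 0 p q) - fsum (fun i => Re (EE (i :: ds) 0 p q) * q i) =
 (Im (EE ds 0 p q) - Hm 1 ds p q 0) - fsum (fun i => (Re (EE (i :: ds) 0 p q) - F (i :: ds) (vadd p 0 q)) * q i).
 rewrite (fsum_ext (F := fun i => (_ - _) * q i)
   (G := fun i => Re (EE (i :: ds) 0 p q) * q i - q i * F (i :: ds) (vadd p 0 q))); last pos.
 rewrite fsum_minus /=; ring.
bound (Rabs_triang _ _); rewrite Rabs_Ropp Rmult_plus_distr_r.
apply: Rplus_le_compat => //; bound (fsum_Rabs _).
rewrite Rmult_comm -fsum_scal; apply: fsum_le => i; rewrite Rabs_mult.
via (D i * (l1 q * om (sz ds + 2) p) * l1 q); last pos.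
apply: Rmult_le_compat => //; [exact: Rabs_pos|exact: Rabs_pos|exact: l1_term].
Qed.

Lemma EE_real ds p : EE ds 0 p (fun _ => 0) = RtoC (F ds p).
Proof.
rewrite /EE (@MM_ext _ (fun u => F ds p * 1)).
 rewrite (MM_scal (F ds p) (fun _ => 1)) MM_one; ring.
move=> u _; rewrite /= (_ : vadd p u _ = p); first ring.
apply: funext => i; rewrite /vadd; ring.
Qed.

(** The segment from [x] to [y] may come close to the origin, but then [x] and [y] are far apart
  and the trivial bound is enough. *)
Lemma F_lip_weighted ds : exists C, 0 <= C /\ forall x y,
 Rabs (F ds y - F ds x) <= C * ((om (sz ds + 1) x + om (sz ds + 1) y) * vnorm (vsub y x)).
Proof.
set s := sz ds; have sp := sz_pos ds; rewrite -/s in sp.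
pose c1 := Rabs (Cd (size ds).+1) * Rpower 2 (s + 1) * INR n.
pose c2 := 3 * Rabs (Cd (size ds)).
have c10 : 0 <= c1.
 apply: Rmult_le_pos; last exact: pos_INR.
 pos.
have c20 : 0 <= c2 by rewrite /c2; pos.
exists (c1 + c2); split; first lra.
move=> x y; set d := vnorm (vsub y x).
have d0 : 0 <= d := vnorm_ge0 _.
have ox := om_pos (s + 1) x; have oy := om_pos (s + 1) y.
case: (Rle_lt_dec d (jbr x / 2)) => Hd.
 pose g t := F ds (vadd x t (vsub y x)).
 have dg t : is_derive g t (Hm 1 ds x (vsub y x) t) by exact: (Hm_derive 0 ds x (vsub y x) t).
 have [||t [Ht E]] := MVT_gen g 0 1 (Hm 1 ds x (vsub y x)).
 - by [].
 - move=> t _; apply/continuity_pt_filterlim; apply: ex_derive_continuous; eexists; pos.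
 rewrite Rmin_left ?Rmax_right in Ht; [|lra|lra].
 have g1 : g 1 = F ds y.
  congr (F ds _); apply: funext => i; rewrite /vadd /vsub; ring.
 have g0 : g 0 = F ds x.
  congr (F ds _); apply: funext => i; rewrite /vadd /vsub; ring.
 rewrite -g1 -g0 E Rminus_0_r Rmult_1_r.
 bound (Hm_bound 1 ds x (vsub y x) t); rewrite pow_1 addn1 -/s [INR 1]/=.
 have jx : jbr x / 2 <= jbr (vadd x t (vsub y x)).
  have := jbr_vadd (vadd x t (vsub y x)) (- t) (vsub y x).
  rewrite (_ : vadd (vadd x t (vsub y x)) (- t) _ = x); last first.
   apply: funext => i; rewrite /vadd; ring.
  rewrite Rabs_Ropp Rabs_pos_eq; last lra.
  rewrite -/d => H; nra.
 have o2 : om (s + 1) (vadd x t (vsub y x)) <= Rpower 2 (s + 1) * om (s + 1) x.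
  have j1 := jbr_ge1 x.
  via (Rpower (jbr x / 2) (- (s + 1))).
   apply: Rpower_neg_anti; lra.
  rewrite /om !Rpower_Ropp /Rdiv -Rpower_mult_distr; [|lra|lra].
  rewrite Rinv_mult -[Rpower (/ 2) _]Rinv_inv -Rpower_Ropp.
  right; rewrite Rmult_comm; congr (_ * _).
  rewrite -[X in Rpower X _](_ : Rpower 2 (-1) = / 2); last by rewrite Rpower_Ropp Rpower_1; lra.
  rewrite Rinv_inv Rpower_mult -Rpower_Ropp; congr Rpower; ring.
 via (c1 * (om (s + 1) x * d)); last first.
  pos.
 rewrite /c1 (_ : Rabs (Cd (size ds).+1) * Rpower 2 (s + 1) * INR n * (om (s + 1) x * d) =
   (INR n * d) * (Rabs (Cd (size ds).+1) * (Rpower 2 (s + 1) * om (s + 1) x))); last ring.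
 apply: Rmult_le_compat; [exact: l1_ge0| |exact: l1_le_vnorm|].
  by apply: Rmult_le_pos; [apply: Rabs_pos|apply: Rlt_le; apply: om_pos].
 pos.
have base z : jbr z <= 3 * d -> Rabs (F ds z) <= c2 * (om (s + 1) z * d).
 move=> Hz; bound (Fb ds z); rewrite -/s.
 have E : om s z = om (s + 1) z * jbr z.
  rewrite /om -{3}(Rpower_1 (jbr z)); last by have := jbr_ge1 z; lra.
  rewrite -Rpower_plus; congr Rpower; ring.
 rewrite E; have oz := om_pos (s + 1) z.
 via (Rabs (Cd (size ds)) * (om (s + 1) z * (3 * d))).
  apply: Rmult_le_compat; [| |exact: Rle_abs|].
  - have := Rabs_pos (F ds z); have := Fb ds z; rewrite -/s E => H1 H2.
   apply: (Rmult_le_reg_r (om (s + 1) z * jbr z)); last lra.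
   apply: Rmult_lt_0_compat => //; have := jbr_ge1 z; lra.
  - by apply: Rmult_le_pos; [lra|have := jbr_ge1 z; lra].
  - pos.
 rewrite /c2; lra.
have B1 := base x ltac:(have := jbr_ge1 x; lra).
have B2 := base y ltac:(have := jbr_sub x y; rewrite -/d; lra).
bound (Rabs_triang _ _); rewrite Rabs_Ropp.
have : 0 <= om (s + 1) x * d by pos.
have : 0 <= om (s + 1) y * d by pos.
nra.
Qed.

(** The real value is the extension at [q = 0], so the weighted Lipschitz bound for [F] applies for
    each [u], and Peetre's inequality moves the weight from [p + u q] back to [p]. *)
Lemma EE_lip_weighted ds : exists C, 0 <= C /\ forall p q x, vnorm q <= 1 ->
 Cmod (EE ds 0 p q - F ds x) <=
 C * ((om (sz ds + 1) p + om (sz ds + 1) x) * (vnorm (vsub p x) + vnorm q)).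
Proof.
have sp : 0 <= sz ds + 1 by have := sz_pos ds; lra.
have [J HJ] := peetre_om sp.
have [C [C0 HC]] := F_lip_weighted ds.
have [D [D0 HD]] := MM_bound J.+1.
exists (D * C); split; first exact: Rmult_le_pos.
move=> p q x q1.
rewrite -(EE_real ds x) /EE.
rewrite -(MM_minus (@EE_pb0 ds 0 p q) (@EE_pb0 ds 0 x (fun _ => 0))) Rmult_assoc.
apply: HD => u u0.
rewrite /= !Rmult_1_l (_ : vadd x u _ = x); last first.
 apply: funext => i; rewrite /vadd; ring.
bound (HC x (vadd p u q)).
rewrite Rmult_assoc; apply: Rmult_le_compat_l => //.
have N1 : vnorm (vsub (vadd p u q) x) <= (1 + u) * (vnorm (vsub p x) + vnorm q).
 rewrite (_ : vsub (vadd p u q) x = vadd (vsub p x) u q); last first.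
  apply: funext => i; rewrite /vadd /vsub; ring.
 bound (vnorm_vadd _ _ _); rewrite Rabs_pos_eq; last lra.
 have := vnorm_ge0 (vsub p x); have := vnorm_ge0 q => *; nra.
have O1 := HJ p u q (Rlt_le _ _ u0) q1.
have P1 : 1 <= (1 + u) ^ J by apply: pow_R1_Rle; lra.
have ox := om_pos (sz ds + 1) x; have op := om_pos (sz ds + 1) p; have oo := om_pos (sz ds + 1) (vadd p u q).
via (((om (sz ds + 1) p + om (sz ds + 1) x) * (1 + u) ^ J) *
  ((1 + u) * (vnorm (vsub p x) + vnorm q))); last pos.
apply: Rmult_le_compat => //; [lra|exact: vnorm_ge0|nra].
Qed.

End AlmostAnalytic.

#[global] Hint Resolve om_pos : nonneg.

(** * Complex-valued families of the class *)

Section ComplexClass.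
Variables (A : Type) (I : finType) (D : (I -> R) -> Prop).
Hypothesis Dopen : openI D.
Implicit Types (W V : A -> R -> R) (f g : A -> R -> (I -> R) -> C).

Definition SbC W f := SbI D W (fun a r y => Re (f a r y)) /\ SbI D W (fun a r y => Im (f a r y)).

Lemma SbC_eq W f g : (forall a r y, I01 r -> D y -> f a r y = g a r y) -> SbC W f -> SbC W g.
Proof.
move=> E [H1 H2]; split => k.
 by apply: Sb_eq (H1 k) => // a r y Hr Dy; rewrite E.
by apply: Sb_eq (H2 k) => // a r y Hr Dy; rewrite E.
Qed.

Lemma SbC_weak W V f K : 0 <= K -> (forall a r, I01 r -> W a r <= K * V a r) -> SbC W f -> SbC V f.
Proof. by move=> K0 HK [H1 H2]; split => k; apply: (Sb_weak K0 HK). Qed.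

Lemma SbC_plus W f g : SbC W f -> SbC W g -> SbC W (fun a r y => (f a r y + g a r y)%C).
Proof. by move=> [f1 f2] [g1 g2]; split => k; apply: Sb_plus. Qed.

Lemma SbC_opp W f : SbC W f -> SbC W (fun a r y => Copp (f a r y)).
Proof. by move=> [f1 f2]; split => k; apply: Sb_opp. Qed.

Lemma SbC_minus W f g : SbC W f -> SbC W g -> SbC W (fun a r y => (f a r y - g a r y)%C).
Proof. by move=> Hf Hg; apply: SbC_plus => //; apply: SbC_opp. Qed.

Lemma SbC_mult W V f g : SbC W f -> SbC V g ->
 SbC (fun a r => W a r * V a r) (fun a r y => (f a r y * g a r y)%C).
Proof.
move=> [f1 f2] [g1 g2]; split => k.
 by apply: Sb_minus => //; apply: Sb_mult.
by apply: Sb_plus => //; apply: Sb_mult.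
Qed.

Lemma SbC_multW W1 W2 W f g K : 0 <= K ->
 (forall a r, I01 r -> W1 a r * W2 a r <= K * W a r) ->
 SbC W1 f -> SbC W2 g -> SbC W (fun a r y => (f a r y * g a r y)%C).
Proof. by move=> K0 HK Hf Hg; apply: (SbC_weak K0 HK); apply: SbC_mult. Qed.

Lemma SbC_mult1 W f g : SbC ones f -> SbC W g ->
 SbC W (fun a r y => (f a r y * g a r y)%C).
Proof. apply: (SbC_multW (K := 1)); pos. Qed.

Lemma SbC_RtoC W (f : A -> R -> (I -> R) -> R) : (forall a r, I01 r -> 0 <= W a r) ->
 SbI D W f -> SbC W (fun a r y => RtoC (f a r y)).
Proof. by move=> W0 H; split => k; [apply: H|apply: Sb_zero]. Qed.

Lemma SbC_const (z : C) : SbC ones (fun _ _ _ => z).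
Proof. by split => k; apply: Sb_const. Qed.

Lemma SbC_scal W f (z : C) : SbC W f -> SbC W (fun a r y => (z * f a r y)%C).
Proof. by apply: SbC_mult1; apply: SbC_const. Qed.

Lemma SbC_csum (J : finType) W (f : J -> A -> R -> (I -> R) -> C) :
 (forall a r, I01 r -> 0 <= W a r) ->
 (forall j, SbC W (f j)) -> SbC W (fun a r y => csum (fun j => f j a r y)).
Proof.
by move=> W0 H; split => k; apply: Sb_fsum => // j; [apply: (proj1 (H j))|apply: (proj2 (H j))].
Qed.

Lemma SbC_bound W f : SbC W f -> exists C, 0 <= C /\ forall a r y, I01 r -> D y ->
 Cmod (f a r y) <= C * W a r.
Proof.
move=> [H1 H2]; have [C1 [C10 B1]] := Sb_bound (H1 0%N); have [C2 [C20 B2]] := Sb_bound (H2 0%N).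
exists (C1 + C2); split; first lra.
move=> a r y Hr Dy; bound (Cmod_le_sum _); rewrite Rmult_plus_distr_r.
pos.
Qed.

Definition pdC (f : (I -> R) -> C) c y (l : C) := derivC (fun s => f (updI y c s)) (y c) l.

Lemma SbC_pd W f : SbC W f -> forall c, exists f',
 (forall a r y, I01 r -> D y -> pdC (f a r) c y (f' a r y)) /\ SbC W f'.
Proof.
move=> [H1 H2] c; have [f1 [P1 S1]] := SbI_pd Dopen H1 c; have [f2 [P2 S2]] := SbI_pd Dopen H2 c.
exists (fun a r y => (f1 a r y, f2 a r y)); split; last by [].
by split; [apply: P1|apply: P2].
Qed.

End ComplexClass.

(** * The extension composed with a smooth family of complex points *)

Section Substitution.
Variables (A : Type) (I : finType) (D : (I -> R) -> Prop).
Hypothesis Dopen : openI D.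
Variables (n : nat) (F : seq 'I_n -> vec n -> R) (Cd : nat -> R) (s0 : R).
Hypotheses (s0p : 0 < s0) (FP : forall ds i x, pd (F ds) i x (F (i :: ds) x)) (Fb : forall ds x, Rabs (F ds x) <= Cd (size ds) * om (sz s0 ds) x).
Variables (base : A -> R -> vec n) (Pt Qt : 'I_n -> A -> R -> (I -> R) -> R) (Lam : A -> R -> R) (cL : R).
Hypotheses (basec : forall a i r, continuous (fun r => base a (clamp r) i) r) (PtS : forall i, SbI D ones (Pt i)) (QtS : forall i, SbI D ones (Qt i)) (cLp : 0 < cL) (Lam1 : forall a r, I01 r -> 1 <= Lam a r).

Definition ppos a r y : vec n := fun i => base a r i + Pt i a r y.
Definition qpos a r y : vec n := fun i => Qt i a r y.

Hypotheses (qsmall : forall a r y, I01 r -> D y -> vnorm (qpos a r y) <= 1) (pbig : forall a r y, I01 r -> D y -> cL * Lam a r <= jbr (ppos a r y)).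

Lemma om_Lam s a r y : 0 <= s -> I01 r -> D y ->
 om s (ppos a r y) <= Rpower cL (- s) * Rpower (Lam a r) (- s).
Proof.
move=> sp Hr Dy; have L1 := Lam1 a Hr.
rewrite Rpower_mult_distr //; last lra.
apply: Rpower_neg_anti => //; last exact: pbig.
pos.
Qed.

(** Induction on the order: a derivative of the composition involves derivatives of [F] with one
    more power of decay, and this surplus is discarded because [Lam >= 1]. *)
Lemma EE_compose ds l : SbC D (fun a r => Rpower (Lam a r) (- sz s0 ds))
 (fun a r y => EE F ds l (ppos a r y) (qpos a r y)).
Proof.
pose E ds l a r y := EE F ds l (ppos a r y) (qpos a r y); pose W (ds : seq (ordinal n)) a r := Rpower (Lam a r) (- sz s0 ds).
suff H k : forall ds l im, Sb D (W ds) k (fun a r y => cpart im (E ds l a r y)).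
 by split => k; [apply: (H k ds l false)|apply: (H k ds l true)].
clear ds l; have H0 ds l im : (exists C, 0 <= C /\ forall a r y, I01 r -> D y -> Rabs (cpart im (E ds l a r y)) <= C * W ds a r) /\
  forall a y, D y -> forall r, continuous (fun r => cpart im (E ds l a (clamp r) y)) r.
 have [C [C0 HC]] := EE_bound s0p Fb ds l; have szp := sz_pos s0p ds; have [K [K0 HK]] := EE_lip s0p FP Fb ds l; split.
  exists (C * Rpower cL (- sz s0 ds)); split => [|a r y Hr Dy]; first pos.
  bound (cpart_le_Cmod _ _); bound (HC _ _ (qsmall a Hr Dy)); rewrite Rmult_assoc; apply: Rmult_le_compat_l => //.
  apply: om_Lam => //; lra.
 move=> a y Dy r; pose u s c := emb (ppos a (clamp s) y) (qpos a (clamp s) y) c.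
 have cZ : continuous (fun s => K * l1 (fun c => u s c - u r c)) r.
  apply: cont_mult; [exact: continuous_const|].
  apply: (@fsum_continuous _ (fun s c => Rabs (u s c - u r c))) => c.
  apply: (continuous_comp (fun s => u s c - u r c) Rabs); [|exact: continuous_Rabs].
  apply: cont_minus; [|exact: continuous_const].
  case: c => i; [apply: cont_plus; [exact: basec|exact: (Sb_cont (PtS i 0%N) Dy)]|exact: (Sb_cont (QtS i 0%N) Dy)].
 apply: (continuous_dom cZ) => [|s].
  by rewrite (_ : l1 _ = 0) ?Rmult_0_r // /l1 -(fsum_0 ('I_n + 'I_n)%type); apply: fsum_ext => c; rewrite Rminus_diag_eq // Rabs_R0.
 rewrite (_ : _ - _ = cpart im (E ds l a (clamp s) y - E ds l a (clamp r) y)%C); last by case: im.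
 bound (cpart_le_Cmod _ _); exact: HK.
elim: k => [|k IH] ds l im; have [B1 B2] := H0 ds l im; first by [].
have W0 : forall a r, I01 r -> 0 <= W ds a r by rewrite /W; pos.
split => //; split => // c.
have [dP HdP] := choice _ (fun i => SbI_pd Dopen (PtS i) c).
have [dQ HdQ] := choice _ (fun i => SbI_pd Dopen (QtS i) c).
pose v a r y := emb (fun i => dP i a r y) (fun i => dQ i a r y).
exists (fun a r y => cpart im (csum (fun j => (v a r y j * EEd F ds l (ppos a r y) (qpos a r y) j)%C))); split.
 move=> a r y Hr Dy.
 have := @EE_curve _ _ _ _ s0p FP Fb ds l (fun s => ppos a r (updI y c s)) (fun s => qpos a r (updI y c s))
  (fun i => dP i a r y) (fun i => dQ i a r y) (y c).
 rewrite updI_id => h; suff : pdC (E ds l a r) c y (csum (fun j => (v a r y j * EEd F ds l (ppos a r y) (qpos a r y) j)%C)).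
  by case: im {B1 B2} => -[].
 apply: h => i; last exact: (proj1 (HdQ i)).
 rewrite -[X in is_derive _ _ X]Rplus_0_l; apply: der_plus; first exact: is_derive_const.
 exact: (proj1 (HdP i)).
have low i a r : I01 r -> 1 * Rpower (Lam a r) (- sz s0 (i :: ds)) <= 1 * Rpower (Lam a r) (- sz s0 ds).
 move=> Hr; rewrite !Rmult_1_l; apply: Rle_Rpower; first exact: Lam1.
 rewrite /sz [size _]/= S_INR; lra.
apply: (Sb_eq Dopen (f := fun a r y => fsum (fun j => v a r y j * cpart im (EEd F ds l (ppos a r y) (qpos a r y) j)))).
 by move=> a r y _ _; case: im {B1 B2}; apply: fsum_ext => j; rewrite -?Re_RtoC_mult -?Im_RtoC_mult.
apply: Sb_fsum => // -[i|i]; apply: (Sb_multW Rle_0_1 (low i)).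
- exact: (proj2 (HdP i)). - exact: (IH (i :: ds) l).
- exact: (proj2 (HdQ i)). - exact: (IH (i :: ds) l.+1).
Qed.

End Substitution.

(** ** Integration in the parameter *)

Section IntegralClass.
Variables (A : Type) (I : finType) (D : (I -> R) -> Prop).
Hypothesis Dopen : openI D.
Variables (W : A -> R -> R) (K : R).
Hypotheses (W0 : forall a r, I01 r -> 0 <= W a r) (Wc : forall a r, continuous (fun r => W a (clamp r)) r) (WK : forall a, RInt (fun r => W a (clamp r)) 0 1 <= K).

Definition primi (f : A -> R -> (I -> R) -> R) a s y : R := RInt (fun r => f a (clamp r) y) 0 s.

Lemma primi_bound f k : Sb D W k f -> exists C, 0 <= C /\
 forall a s y, I01 s -> D y -> Rabs (primi f a s y) <= C.
Proof.
move=> H; have [C [C0 HC]] := Sb_bound H; exists (C * Rabs K); split.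
 pos.
move=> a s y Hs Dy.
have cC r : continuous (fun r => C * W a (clamp r)) r.
 by cont.
have ex u v : ex_RInt (fun r => W a (clamp r)) u v by apply: ex_RInt_continuous.
via (RInt (fun r => C * W a (clamp r)) 0 s).
 apply: (@norm_RInt_le R_NormedModule (fun r => f a (clamp r) y) (fun r => C * W a (clamp r)) 0 s).
 - lra.
 - by move=> r Hr; apply: HC => //; apply: clampP.
 - by apply: RInt_correct; apply: ex_RInt_continuous => z _; apply: (Sb_cont H Dy).
 - by apply: RInt_correct; apply: ex_RInt_continuous.
have -> : RInt (fun r => C * W a (clamp r)) 0 s = C * RInt (fun r => W a (clamp r)) 0 s.
 exact: (RInt_scal (V := R_CompleteNormedModule) (fun r => W a (clamp r)) 0 s C).
apply: Rmult_le_compat_l => //.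
via (RInt (fun r => W a (clamp r)) 0 1); last first.
 by bound (WK a); apply: Rle_abs.
rewrite -(RInt_Chasles (fun r => W a (clamp r)) 0 s 1) // /plus /=.
have := RInt_ge_0 (fun r => W a (clamp r)) s 1 ltac:(lra) (ex _ _)
 ltac:(by move=> r Hr; apply: W0; apply: clampP).
lra.
Qed.

(** Differentiation under the integral: two applications of the mean value theorem bound the
    increment minus its linear part by [C * W * h^2], and the integral of [W] is bounded uniformly
    in the index. *)
Lemma primi_pd f f' c : SbI D W f -> (forall a r y, I01 r -> D y -> pd (f a r) c y (f' a r y)) ->
 SbI D W f' -> forall a s y, I01 s -> D y -> pd (primi f a s) c y (primi f' a s y).
Proof.
move=> Sf Hd Sf' a s y Hs Dy.
have [f2 [Hd2 Sf2]] := SbI_pd Dopen Sf' c.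
have [C [C0 HC]] := Sb_bound (Sf2 0%N).
have [d [d0 Hdy]] := Dopen Dy.
have seg v : Rabs (v - y c) < d -> D (updI y c v).
 move=> Hv; apply: Hdy => i; rewrite /updI; case: eqP => [->//|_].
 by rewrite Rminus_diag_eq // Rabs_R0.
apply: (@derive_quadratic _ _ (C * Rabs K) d) => // h hd.
rewrite updI_id.
have Dh : D (updI y c (y c + h)) by apply: seg; rewrite (_ : y c + h - y c = h) //; ring.
have c0 : forall r, continuous (fun r => f a (clamp r) y) r := Sb_cont (Sf 0%N) Dy.
have c1 : forall r, continuous (fun r => f a (clamp r) (updI y c (y c + h))) r := Sb_cont (Sf 0%N) Dh.
have c2 : forall r, continuous (fun r => f' a (clamp r) y) r := Sb_cont (Sf' 0%N) Dy.
have E : primi f a s (updI y c (y c + h)) - primi f a s y - primi f' a s y * h =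
  RInt (fun r => f a (clamp r) (updI y c (y c + h)) - f a (clamp r) y - h * f' a (clamp r) y) 0 s.
 apply/esym; apply: is_RInt_unique; have -> : primi f' a s y * h = h * primi f' a s y by ring.
 apply: (@is_RInt_minus R_NormedModule).
  apply: (@is_RInt_minus R_NormedModule); by apply: RInt_correct; apply: ex_RInt_continuous.
 by apply: (@is_RInt_scal R_NormedModule); apply: RInt_correct; apply: ex_RInt_continuous.
have pt r : I01 r -> Rabs (f a r (updI y c (y c + h)) - f a r y - h * f' a r y) <= C * W a r * h ^ 2.
 move=> Hr.
 pose g v := f a r (updI y c v) - f' a r y * v.
 have seg2 v : Rmin (y c) (y c + h) <= v <= Rmax (y c) (y c + h) -> Rabs (v - y c) <= Rabs h.
  rewrite /Rmin /Rmax; case: Rle_dec => ?; split_Rabs; lra.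
 have dg v : Rmin (y c) (y c + h) <= v <= Rmax (y c) (y c + h) ->
   is_derive g v (f' a r (updI y c v) - f' a r y).
  move=> /seg2 Hv; apply: der_minus.
   have := Hd a r (updI y c v) Hr ltac:(apply: seg; lra); rewrite /pd updI_same.
   by apply: is_derive_ext => t; rewrite updI_updI.
  have := is_derive_scal (fun v : R => v) v (f' a r y) 1 (is_derive_id v).
  by rewrite Rmult_1_r.
 have [||v [Hv Ev]] := MVT_gen g (y c) (y c + h) (fun v => f' a r (updI y c v) - f' a r y).
 - move=> v Hv; apply: dg; lra.
 - move=> v Hv; apply/continuity_pt_filterlim; apply: ex_derive_continuous; eexists; pos.
 have -> : f a r (updI y c (y c + h)) - f a r y - h * f' a r y = (f' a r (updI y c v) - f' a r y) * h.
  move: Ev; rewrite /g updI_id => Ev; lra.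
 have vb := seg2 v Hv.
 have d2 u : Rmin (y c) v <= u <= Rmax (y c) v ->
   is_derive (fun u => f' a r (updI y c u)) u (f2 a r (updI y c u)) /\ D (updI y c u).
  move=> Hu; have Du : D (updI y c u).
   apply: seg; move: Hu; rewrite /Rmin /Rmax; case: Rle_dec => ?; split_Rabs; lra.
  split => //; have := Hd2 a r _ Hr Du; rewrite /pd updI_same.
  by apply: is_derive_ext => t; rewrite updI_updI.
 have [||u [Hu Eu]] := MVT_gen (fun u => f' a r (updI y c u)) (y c) v (fun u => f2 a r (updI y c u)).
 - move=> u Hu; apply: (proj1 (d2 u _)); lra.
 - by move=> u Hu; apply/continuity_pt_filterlim; apply: ex_derive_continuous; eexists; apply: (proj1 (d2 u Hu)).
 rewrite updI_id in Eu; rewrite Eu !Rabs_mult.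
 have B := HC a r _ Hr (proj2 (d2 u Hu)).
 rewrite (_ : C * W a r * h ^ 2 = C * W a r * (Rabs h * Rabs h)); last by rewrite -(pow2_abs h); ring.
 rewrite Rmult_assoc; apply: Rmult_le_compat => //; first exact: Rabs_pos.
  pos.
 pos.
have cC r : continuous (fun r => (C * h ^ 2) * W a (clamp r)) r.
 by cont.
have ex u v : ex_RInt (fun r => W a (clamp r)) u v by apply: ex_RInt_continuous.
rewrite E; via (RInt (fun r => (C * h ^ 2) * W a (clamp r)) 0 s).
 apply: (@norm_RInt_le R_NormedModule (fun r => f a (clamp r) (updI y c (y c + h)) - f a (clamp r) y - h * f' a (clamp r) y)
  (fun r => (C * h ^ 2) * W a (clamp r)) 0 s).
 - lra.
 - move=> r _; bound (pt _ (clampP r)); lra.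
 - apply: RInt_correct; apply: ex_RInt_continuous => z _.
  by cont.
 - by apply: RInt_correct; apply: ex_RInt_continuous.
have -> : RInt (fun r => (C * h ^ 2) * W a (clamp r)) 0 s = (C * h ^ 2) * RInt (fun r => W a (clamp r)) 0 s.
 exact: (RInt_scal (V := R_CompleteNormedModule) (fun r => W a (clamp r)) 0 s (C * h ^ 2)).
have -> : C * Rabs K * h ^ 2 = C * h ^ 2 * Rabs K by ring.
apply: Rmult_le_compat_l; first pos.
via (RInt (fun r => W a (clamp r)) 0 1); last first.
 by bound (WK a); apply: Rle_abs.
rewrite -(RInt_Chasles (fun r => W a (clamp r)) 0 s 1) // /plus /=.
have := RInt_ge_0 (fun r => W a (clamp r)) s 1 ltac:(lra) (ex _ _)
 ltac:(by move=> r Hr; apply: W0; apply: clampP).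
lra.
Qed.

Lemma primi_Sb f : SbI D W f -> SbI D ones (primi f).
Proof.
suff H k : forall f, SbI D W f -> Sb D ones k (primi f) by move=> Sf k; pos.
elim: k => [|k IH] {}f Sf.
all: have B : exists C, 0 <= C /\ forall a s y, I01 s -> D y -> Rabs (primi f a s y) <= C * 1 by
 [have [C [C0 HC]] := primi_bound (Sf 0%N); exists C; split => // a s y Hs Dy; rewrite Rmult_1_r; apply: HC].
all: have Cn : forall a y, D y -> forall s, continuous (fun s => primi f a (clamp s) y) s by
 [move=> a y Dy s; apply: (continuous_comp clamp (fun s => primi f a s y)); [exact: clamp_continuous|];
  apply: ex_derive_continuous; exists (f a (clamp (clamp s)) y);
  apply: (is_derive_RInt (fun r => f a (clamp r) y) _ 0); [|exact: (Sb_cont (Sf 0%N) Dy)];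
  apply: filter_forall => b; apply: RInt_correct; apply: ex_RInt_continuous => z _; exact: (Sb_cont (Sf 0%N) Dy)].
 by [].
split => //; split => // c.
have [f' [H1 H2]] := SbI_pd Dopen Sf c.
by exists (primi f'); split; [apply: primi_pd|apply: IH].
Qed.

End IntegralClass.

Definition decays n (b : 'I_n -> 'I_n -> vec n -> R) (s : R) (Ad : nat -> R) :=
 forall j k ds x, Rabs (dxs ds (b j k) x) <= Ad (size ds) * om (sz s ds) x.

(** * The complexified boundary value problem *)

Ltac ctac := repeat first [apply: clamp_continuous | progress cont].

Lemma Rpower_continuous s x : 0 < x -> continuous (fun x => Rpower x s) x.
Proof.
move=> x0; apply: ex_derive_continuous; exists (s * Rpower x (s - 1)).
by apply/is_derive_Reals; apply: derivable_pt_lim_power.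
Qed.

(** * Weights in rescaled time *)

Section Weights.
Variable sgm : R.
Hypothesis s0p : 0 < sgm.

(** At rescaled time [r] the physical time is [t r]: [mC] measures the time elapsed since the start,
    [mD] the time left before the end. [Lm] is the one that bounds the distance of the ray to the
    origin. *)
Definition mC (t r : R) : R := 1 + Rabs t * r.
Definition mD (t r : R) : R := 1 + Rabs t * (1 - r).
Definition Lm (ty : bool) (t r : R) : R := if ty then mD t r else mC t r.
Definition TT (t : R) : R := 1 + Rabs t.

Lemma TT_ge1 t : 1 <= TT t. Proof. rewrite /TT; have := Rabs_pos t; lra. Qed.
Lemma mC_ge1 t r : I01 r -> 1 <= mC t r.
Proof. rewrite /mC => ?; have := Rabs_pos t => ?; nra. Qed.
Lemma mD_ge1 t r : I01 r -> 1 <= mD t r.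
Proof. rewrite /mD => ?; have := Rabs_pos t => ?; nra. Qed.
Lemma mC_le t r : I01 r -> mC t r <= TT t.
Proof. rewrite /mC /TT => ?; have := Rabs_pos t => ?; nra. Qed.
Lemma mD_le t r : I01 r -> mD t r <= TT t.
Proof. rewrite /mD /TT => ?; have := Rabs_pos t => ?; nra. Qed.
Lemma Lm_ge1 ty t r : I01 r -> 1 <= Lm ty t r.
Proof. by case: ty; [apply: mD_ge1|apply: mC_ge1]. Qed.
(** One of the two factors is [Lm] itself and the other is at most [TT]. The surplus factor [Lm]
    will be paid for by the stronger decay of the force. *)
Lemma mCmD_le ty t r : I01 r -> mC t r * mD t r <= TT t * Lm ty t r.
Proof.
move=> Hr; have := mC_ge1 t Hr; have := mD_ge1 t Hr; have := mC_le t Hr; have := mD_le t Hr.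
case: ty => /= *; nra.
Qed.

Lemma mC_cont t r : continuous (fun r => mC t (clamp r)) r. Proof. by ctac. Qed.
Lemma mD_cont t r : continuous (fun r => mD t (clamp r)) r. Proof. by ctac. Qed.
Lemma Lm_cont ty t r : continuous (fun r => Lm ty t (clamp r)) r.
Proof. by case: ty; [apply: mD_cont|apply: mC_cont]. Qed.

Definition W0 ty t r : R := TT t * Rpower (Lm ty t r) (- (1 + sgm)).

Lemma W0_pos ty t r : 0 < W0 ty t r.
Proof. by apply: Rmult_lt_0_compat; [have := TT_ge1 t; lra|apply: Rpower_pos]. Qed.

Lemma W0_cont ty t r : continuous (fun r => W0 ty t (clamp r)) r.
Proof.
rewrite /W0; apply: cont_mult; first exact: continuous_const.
apply: (continuous_comp (fun r => Lm ty t (clamp r)) (fun x => Rpower x (- (1 + sgm)))).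
 exact: Lm_cont.
apply: Rpower_continuous; have := Lm_ge1 ty t (clampP r); lra.
Qed.

(** The weight is at most [1 + |t| * Lm^(-1-sgm)], of which [G] is an explicit primitive whose
    increment over [0,1] does not see [t]. *)
Lemma W0_int ty t : RInt (fun r => W0 ty t (clamp r)) 0 1 <= 1 + / sgm.
Proof.
set a := Rabs t; have a0 : 0 <= a := Rabs_pos t.
pose G r := if ty then r + / sgm * Rpower (1 + a * (1 - r)) (- sgm)
 else r - / sgm * Rpower (1 + a * r) (- sgm).
pose dG r := 1 + a * Rpower (Lm ty t r) (- (1 + sgm)).
have dGP r : I01 r -> is_derive G r (dG r).
 move=> Hr; rewrite /G /dG /Lm /mC /mD -/a.
 have p x : 0 < x -> is_derive (fun x => Rpower x (- sgm)) x (- sgm * Rpower x (- sgm - 1)).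
  by move=> x0; apply/is_derive_Reals; apply: derivable_pt_lim_power.
 have -> : - (1 + sgm) = - sgm - 1 by ring.
 destruct ty.
 - have i : is_derive (fun r => 1 + a * (1 - r)) r (- a) by auto_derive => //; ring.
  have := is_derive_comp _ _ _ _ _ (p (1 + a * (1 - r)) ltac:(nra)) i.
  move=> /(is_derive_scal _ _ (/ sgm)) H.
  have := @is_derive_plus R_AbsRing R_NormedModule _ _ _ _ _ (is_derive_id r) H.
  rewrite /plus /scal /= /mult /= /one /=.
  rewrite (_ : 1 + / sgm * _ = 1 + a * Rpower (1 + a * (1 - r)) (- sgm - 1)) //; field; lra.
 - have i : is_derive (fun r => 1 + a * r) r a by auto_derive => //; ring.
  have := is_derive_comp _ _ _ _ _ (p (1 + a * r) ltac:(nra)) i.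
  move=> /(is_derive_scal _ _ (/ sgm)) H.
  have := @is_derive_minus R_AbsRing R_NormedModule _ _ _ _ _ (is_derive_id r) H.
  rewrite /minus /plus /opp /scal /= /mult /= /one /=.
  rewrite (_ : 1 + - (/ sgm * _) = 1 + a * Rpower (1 + a * r) (- sgm - 1)) //; field; lra.
have cd r : I01 r -> continuous dG r.
 move=> Hr; rewrite /dG; apply: cont_plus; first exact: continuous_const.
 apply: cont_mult; first exact: continuous_const.
 apply: (continuous_comp (fun r => Lm ty t r) (fun x => Rpower x (- (1 + sgm)))).
  by destruct ty; cont.
 apply: Rpower_continuous; have := Lm_ge1 ty t Hr; lra.
have I : is_RInt dG 0 1 (minus (G 1) (G 0)).
 apply: is_RInt_derive => r; rewrite Rmin_left ?Rmax_right; pos.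
via (RInt dG 0 1).
 apply: RInt_le; [lra|by apply: ex_RInt_continuous => z _; apply: W0_cont|by eexists; apply: I|].
 move=> r Hr; rewrite clamp_id ?/W0; last lra.
 have Hr' : I01 r by lra.
 have := Rpower_neg_le1 (Lm_ge1 ty t Hr') (s := 1 + sgm) ltac:(lra).
 rewrite /dG /TT -/a => *; nra.
rewrite (is_RInt_unique _ _ _ _ I) /minus /plus /opp /=.
have is0 : 0 < / sgm by pos.
have le x : 1 <= x -> 0 <= / sgm * Rpower x (- sgm) <= / sgm.
 move=> x1; have := Rpower_neg_le1 x1 (s := sgm) ltac:(lra); have := Rpower_pos x (- sgm) => *; nra.
rewrite /G; destruct ty.
 have := le (1 + a * (1 - 0)) ltac:(nra); have := le (1 + a * (1 - 1)) ltac:(nra) => *; lra.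
have := le (1 + a * 0) ltac:(nra); have := le (1 + a * 1) ltac:(nra) => *; lra.
Qed.

End Weights.

(** This is [1/(1 + 2it)]. A free ray from [z0] with momentum [e + i (z0 - ax)] reaches [x] at time
    [t] exactly when [(1 + 2it)(z0 - ax) = x - ax - 2te], so it starts at [ax + kap t * yf]. *)
Definition kap (t : R) : C := (/ (1 + 4 * t ^ 2), - (2 * t) * / (1 + 4 * t ^ 2)).

Lemma kap_inv t : Cmult (kap t) (1, 2 * t) = RtoC 1.
Proof. rewrite /kap /Cmult /RtoC /=; congr pair; field; nra. Qed.

(** * The data of a problem and the class of its right-hand side *)

Section Data.
Variable n : nat.

(** A margin small against the dimension: the errors per coordinate are at most [41 * cst] and must
    add up to less than one. *)
Definition cst : R := / (100 * (INR n + 1)).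

Lemma cst_pos : 0 < cst.
Proof. apply: Rinv_0_lt_compat; have := pos_INR n; lra. Qed.

Lemma cst_n : INR n * cst <= / 100.
Proof.
have := pos_INR n => H; rewrite /cst Rinv_mult; set x := INR n in H *.
have : x * / (x + 1) <= 1 by apply/Rle_div_l; lra.
lra.
Qed.

Lemma cst_le : cst <= / 100.
Proof. apply: Rinv_le_contravar; have := pos_INR n; lra. Qed.

Definition yf (ax e : vec n) (t : R) (x : vec n) (i : 'I_n) : R := x i - ax i - 2 * t * e i.

(** The real part of the free complex ray from [ax + kap t * yf] to [x]. *)
Definition Rezf (ax e : vec n) (t : R) (x : vec n) (r : R) : vec n :=
 fun i => (1 - r) * ax i + r * x i + (1 - r) * (yf ax e t x i * Re (kap t)).

Definition cG : R := / 4.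

(** The data of one boundary value problem: [ity = false] when the path stays at distance at least
  of order [|s|] from the origin, [ity = true] when it is of order [|t - s|]. *)
Record idx := Idx {
 iax : vec n; iaxi : vec n; it : R; ix : vec n; ity : bool;
 ie : / 2 <= vnorm iaxi <= 2;
 iy : forall i, Rabs (yf iax iaxi it ix i) <= cst * TT it;
 iL : forall r, I01 r -> cG * Lm ity it r <= jbr (Rezf iax iaxi it ix r) }.

Variables (I : finType) (D : (I -> R) -> Prop).
Hypothesis Dopen : openI D.
Local Notation fnR := (idx -> R -> (I -> R) -> R).
Local Notation fnC := (idx -> R -> (I -> R) -> C).

(** These functions are kept abstract because the estimates serve twice: with the amplitudes as
    unknowns of the boundary value problem, and with the solved amplitudes as functions of time and
    position. *)
Variables (tauf : fnR) (xif : 'I_n -> fnR) (Ch Dh : 'I_n -> fnC).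
Hypotheses (tauS : SbI D ones tauf) (xiS : forall i, SbI D ones (xif i)) (ChS : forall i, SbC D ones (Ch i)) (DhS : forall i, SbC D ones (Dh i)) (taub : forall a r y, I01 r -> D y -> Rabs (tauf a r y) <= cst) (xib : forall i a r y, I01 r -> D y -> Rabs (xif i a r y) <= cst).
Hypothesis Chb : forall i a r y, I01 r -> D y ->
 Rabs (Re (Ch i a r y)) <= 1 /\ Rabs (Im (Ch i a r y)) <= 1.
Hypothesis Dhb : forall i a r y, I01 r -> D y ->
 Rabs (Re (Dh i a r y)) <= 1 /\ Rabs (Im (Dh i a r y)) <= 1.

Definition tf : fnR := fun a r y => it a + tauf a r y.
Definition xf : 'I_n -> fnR := fun i a r y => ix a i + xif i a r y.
(** The scales [1/mC] and [1/mD] are those at which the two contributions [(1 + 2itr) c] and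
    [t(1 - r) d] to the ray stay bounded. *)
Definition Cf : 'I_n -> fnC := fun i a r y => ((cst / mC (it a) r)%R * Ch i a r y)%C.
Definition Df : 'I_n -> fnC := fun i a r y => ((cst / mD (it a) r)%R * Dh i a r y)%C.

(** The free complex ray corrected by the slowly varying amplitudes [c] and [d]. *)
Definition zC (ax e : vec n) (t : R) (x : vec n) (c d : 'I_n -> C) (r : R) (i : 'I_n) : C :=
 (((1 - r) * ax i + r * x i)%R + (((1 - r) * yf ax e t x i)%R * kap t + ((1, 2 * t * r)%R * c i + (t * (1 - r))%R * d i)))%C.
(** The free fundamental system, position first and momentum second, is [(1 + 2itr, i)], compatible
    with the initial Lagrangian, and [(t(1 - r), -1/2)], which vanishes at the end. Hence the
    boundary conditions decouple into [c = 0] at [r = 1] and [d = 0] at [r = 0]. *)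
Definition zetaC (ax e : vec n) (t : R) (x : vec n) (c d : 'I_n -> C) (i : 'I_n) : C :=
 (e i + ((0, yf ax e t x i) * kap t + (Ci * c i + (- / 2)%R * d i)))%C.

Definition zf i : fnC := fun a r y =>
 zC (iax a) (iaxi a) (tf a r y) (fun i => xf i a r y) (fun i => Cf i a r y) (fun i => Df i a r y) r i.
Definition zetaf i : fnC := fun a r y =>
 zetaC (iax a) (iaxi a) (tf a r y) (fun i => xf i a r y) (fun i => Cf i a r y) (fun i => Df i a r y) i.

Lemma T0w a r : I01 r -> 0 <= TT (it a).
Proof. have := TT_ge1 (it a); lra. Qed.

Lemma cstS (W : idx -> R -> R) (h : idx -> R -> R) K : 0 <= K ->
 (forall a r, I01 r -> Rabs (h a r) <= K * W a r) ->
 (forall a r, continuous (fun r => h a (clamp r)) r) -> SbI D W (fun a r _ => h a r).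
Proof. by move=> *; move=> k; apply: (@Sb_cst _ _ _ _ _ _ K). Qed.

Lemma tS : SbI D (fun a _ => TT (it a)) tf.
Proof.
move=> k; apply: Sb_plus.
 apply: (@cstS _ (fun a _ => it a) 1); [lra| |by cont].
 move=> a r _; rewrite /TT; lra.
apply: (Sb_weak (K := 1)) (tauS k); first lra.
move=> a r _; have := TT_ge1 (it a); lra.
Qed.

Lemma t_abs a r y : I01 r -> D y -> Rabs (tf a r y - it a) <= cst.
Proof. rewrite /tf (_ : _ - _ = tauf a r y); pos. Qed.

Lemma kap_den a r y : I01 r -> D y -> TT (it a) ^ 2 <= 9 * (1 + 4 * tf a r y ^ 2).
Proof.
move=> Hr Dy; have := t_abs a Hr Dy; have := cst_le; rewrite /TT.
set t := tf a r y => H1 H2.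
have : Rabs (it a) <= Rabs t + 1 by split_Rabs; lra.
have := Rabs_pos t; have := Rabs_pos (it a); rewrite -(pow2_abs t).
move: (Rabs t) (Rabs (it a)) => u v v0 u0 uv.
have : (1 + v) ^ 2 <= (2 + u) ^ 2 by pos.
nra.
Qed.

Lemma kapre : SbI D (fun a _ => / TT (it a) ^ 2) (fun a r y => / (1 + 4 * tf a r y ^ 2)).
Proof.
move=> k.
apply: (@Sb_inv _ _ _ Dopen (fun a _ => TT (it a) ^ 2) _ _ _ 9 1); [lra|lra| | |].
- move=> a r y Hr Dy; have H := kap_den a Hr Dy; have P := pow2_ge_0 (tf a r y).
 have T1 := TT_ge1 (it a).
 split; first lra.
 rewrite Rabs_pos_eq; last pos.
 have T2 : 0 < TT (it a) ^ 2 by pos.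
 apply: (Rmult_le_reg_l (TT (it a) ^ 2)) => //.
 have -> : TT (it a) ^ 2 * (9 * / TT (it a) ^ 2) = 9 by field; lra.
 apply: (Rmult_le_reg_r (1 + 4 * tf a r y ^ 2)); first lra.
 rewrite Rmult_assoc Rinv_l; lra.
- move=> a r _; have := TT_ge1 (it a) => ?; right; field; lra.
- apply: (Sb_eq Dopen (f := fun a r y => 1 + 4 * (tf a r y * tf a r y))).
  pos.
 apply: Sb_plus.
  apply: (Sb_weak (W := ones) (K := 1)); [lra| |exact: Sb_const].
  move=> a r _; have := TT_ge1 (it a) => ?; nra.
 apply: Sb_scal; apply: (Sb_multW (W1 := fun a _ => TT (it a)) (W2 := fun a _ => TT (it a)) (K := 1)); [lra| |exact: tS|exact: tS].
 pos.
Qed.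

Lemma kapS : SbC D (fun a _ => / TT (it a)) (fun a r y => kap (tf a r y)).
Proof.
split => k.
- apply: (Sb_weak (K := 1)) (kapre k); first lra.
 move=> a r _; have T1 := TT_ge1 (it a).
 rewrite Rmult_1_l; apply: Rinv_le_contravar; nra.
- apply: (Sb_multW (W1 := fun a _ => TT (it a)) (K := 1)) (kapre k); first lra.
  move=> a r _; have := TT_ge1 (it a) => ?; right; field; lra.
 apply: Sb_opp => //; apply: Sb_scal; exact: tS.
Qed.

Lemma tkapS : SbC D ones (fun a r y => (tf a r y * kap (tf a r y))%C).
Proof.
apply: (SbC_multW Dopen (W1 := fun a _ => TT (it a)) (K := 1)) kapS; first lra.
 move=> a r _; have := TT_ge1 (it a) => ?; right; field; lra.
by apply: SbC_RtoC; [exact: T0w|exact: tS].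
Qed.

Lemma yS i : SbI D (fun a _ => TT (it a)) (fun a r y => yf (iax a) (iaxi a) (tf a r y) (fun i => xf i a r y) i).
Proof.
move=> k.
apply: (Sb_eq Dopen (f := fun a r y => yf (iax a) (iaxi a) (it a) (ix a) i +
  (xif i a r y - (2 * iaxi a i) * tauf a r y))).
 move=> a r y _ _; rewrite /yf /tf /xf; ring.
apply: Sb_plus.
 apply: (@cstS _ (fun a _ => yf (iax a) (iaxi a) (it a) (ix a) i) cst).
 - have := cst_pos; lra.
 - by move=> a r _; apply: iy.
 - by cont.
apply: (Sb_weak (W := ones) (K := 1)); first lra.
 move=> a r _; have := TT_ge1 (it a); lra.
apply: Sb_minus => //; first exact: xiS.
apply: (Sb_multW (W1 := ones) (W2 := ones) (K := 1)); [lra| | |exact: tauS].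
 pos.
apply: (@cstS _ (fun a _ => 2 * iaxi a i) 4); [lra| |by cont].
move=> a r _; rewrite Rabs_mult Rabs_pos_eq; last lra.
move: (vnorm_term (iaxi a) i) (ie a); lra.
Qed.

Lemma e_abs a i : Rabs (iaxi a i) <= 2.
Proof. move: (vnorm_term (iaxi a) i) (ie a); lra. Qed.

Lemma ampS (m : R -> R -> R) (F : fnC) : (forall t r, I01 r -> 1 <= m t r) ->
 (forall t r, continuous (fun r => m t (clamp r)) r) -> SbC D ones F ->
 SbC D (fun a r => / m (it a) r) (fun a r y => ((cst / m (it a) r)%R * F a r y)%C).
Proof.
move=> m1 mc; apply: (SbC_multW Dopen (W1 := fun a r => / m (it a) r) (K := 1)); [lra|pos|].
have c0 := cst_pos; have ip a r : I01 r -> 0 < / m (it a) r by move=> Hr; have := m1 (it a) r Hr; pos.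
apply: SbC_RtoC; first by move=> a r Hr; apply: Rlt_le; pos.
apply: (@cstS _ (fun a r => cst / m (it a) r) cst); first lra.
- move=> a r Hr; rewrite Rabs_pos_eq; first exact: Rle_refl.
 have := ip a r Hr; pos.
- move=> a r; apply: cont_mult; first exact: continuous_const.
 apply: (continuous_comp (fun r => m (it a) (clamp r)) Rinv); first exact: mc.
 apply: continuous_Rinv; have := m1 (it a) _ (clampP r); lra.
Qed.

Lemma CfS i : SbC D (fun a r => / mC (it a) r) (Cf i).
Proof. exact: (ampS mC_ge1 mC_cont (ChS i)). Qed.

Lemma DfS i : SbC D (fun a r => / mD (it a) r) (Df i).
Proof. exact: (ampS mD_ge1 mD_cont (DhS i)). Qed.

Lemma trS : SbC D (fun a r => mC (it a) r) (fun a r y => (1, 2 * tf a r y * r)).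
Proof.
split => k /=.
- apply: (Sb_weak (W := ones) (K := 1)); [lra| |exact: Sb_const].
 move=> a r Hr; have := mC_ge1 (it a) Hr; lra.
- apply: (Sb_eq Dopen (f := fun a r y => 2 * it a * r + (2 * r) * tauf a r y)).
  move=> a r y _ _; rewrite /tf; ring.
 apply: Sb_plus.
  apply: (@cstS _ (fun a r => 2 * it a * r) 2); [lra| |by move=> a r; ctac].
  move=> a r Hr; rewrite !Rabs_mult (Rabs_pos_eq 2); last lra.
  rewrite (Rabs_pos_eq r) /mC; lra.
 apply: (Sb_multW (W1 := ones) (W2 := ones) (K := 1)); [lra| | |exact: tauS].
  move=> a r Hr; have := mC_ge1 (it a) Hr; lra.
 apply: (@cstS _ (fun a r => 2 * r) 2); [lra| |by move=> a r; ctac].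
 move=> a r Hr; rewrite Rabs_pos_eq; lra.
Qed.

Lemma t1rS : SbI D (fun a r => mD (it a) r) (fun a r y => tf a r y * (1 - r)).
Proof.
move=> k; apply: (Sb_eq Dopen (f := fun a r y => it a * (1 - r) + (1 - r) * tauf a r y)).
 move=> a r y _ _; rewrite /tf; ring.
apply: Sb_plus.
 apply: (@cstS _ (fun a r => it a * (1 - r)) 1); [lra| |by move=> a r; ctac].
 move=> a r Hr; rewrite !Rabs_mult (Rabs_pos_eq (1 - r)) /mD; lra.
apply: (Sb_multW (W1 := ones) (W2 := ones) (K := 1)); [lra| | |exact: tauS].
 move=> a r Hr; have := mD_ge1 (it a) Hr; lra.
apply: (@cstS _ (fun a r => 1 - r) 1); [lra| |by move=> a r; ctac].
move=> a r Hr; rewrite Rabs_pos_eq; lra.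
Qed.

Lemma mD0 a r : I01 r -> 0 <= mD (it a) r.
Proof. move=> Hr; have := mD_ge1 (it a) Hr; lra. Qed.

Lemma mC0 a r : I01 r -> 0 <= mC (it a) r.
Proof. move=> Hr; have := mC_ge1 (it a) Hr; lra. Qed.

Definition zbase a r : vec n := fun i => (1 - r) * iax a i + r * ix a i.
Definition zt i : fnC := fun a r y =>
 ((r * xif i a r y)%R + (((1 - r) * yf (iax a) (iaxi a) (tf a r y) (fun i => xf i a r y) i)%R * kap (tf a r y) + ((1, 2 * tf a r y * r)%R * Cf i a r y + (tf a r y * (1 - r))%R * Df i a r y)))%C.

Lemma zf_zt i a r y : zf i a r y = (zbase a r i + zt i a r y)%C.
Proof.
rewrite /zf /zC /zt /zbase [RHS]Cplus_assoc -RtoC_plus; congr ((RtoC _) + _)%C.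
rewrite /xf; ring.
Qed.

Lemma one0 (a : idx) r : I01 r -> 0 <= 1. Proof. lra. Qed.

Lemma rS (h : R -> R) : (forall r, I01 r -> Rabs (h r) <= 1) -> (forall r, continuous h r) ->
 SbI D (fun (_ : idx) _ => 1) (fun _ r _ => h r).
Proof.
move=> H c; apply: (@cstS _ (fun _ r => h r) 1); [lra|rewrite Rmult_1_r; pos|].
by move=> a r; apply: (continuous_comp clamp h); [exact: clamp_continuous|exact: c].
Qed.

Lemma y1S i : SbI D (fun a _ => TT (it a))
 (fun a r y => (1 - r) * yf (iax a) (iaxi a) (tf a r y) (fun i => xf i a r y) i).
Proof.
move=> k; apply: (Sb_multW (W1 := ones) (K := 1)) (yS i k); [lra|pos|].
by apply: (@rS (fun r => 1 - r)); [move=> r Hr; rewrite Rabs_pos_eq; lra|move=> r; ctac].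
Qed.

Lemma ztS i : SbC D ones (zt i).
Proof.
apply: SbC_plus.
 apply: SbC_RtoC; first exact: one0.
 move=> k; apply: (Sb_multW (W1 := ones) (K := 1)) (xiS i k); [lra|pos|].
 by apply: (@rS (fun r => r)); [move=> r Hr; rewrite Rabs_pos_eq; lra|move=> r; ctac].
apply: SbC_plus.
 apply: (SbC_multW Dopen (W1 := fun a _ => TT (it a)) (K := 1)) kapS; first lra.
  move=> a r _; have := TT_ge1 (it a) => ?; right; field; lra.
 by apply: SbC_RtoC; [exact: T0w|exact: y1S].
apply: SbC_plus.
 apply: (SbC_multW Dopen (K := 1)) trS (CfS i); first lra.
 move=> a r Hr; have := mC_ge1 (it a) Hr => ?; right; field; lra.
apply: (SbC_multW Dopen (W1 := fun a r => mD (it a) r) (K := 1)) (DfS i); first lra.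
 move=> a r Hr; have := mD_ge1 (it a) Hr => ?; right; field; lra.
by apply: SbC_RtoC; [exact: mD0|exact: t1rS].
Qed.

Lemma zetaS i : SbC D ones (zetaf i).
Proof.
apply: SbC_plus.
 apply: SbC_RtoC; first exact: one0.
 apply: (@cstS _ (fun a _ => iaxi a i) 2); [lra| |by cont].
 by move=> a r _; rewrite Rmult_1_r; apply: e_abs.
apply: SbC_plus.
 apply: (SbC_multW Dopen (W1 := fun a _ => TT (it a)) (K := 1)) kapS; first lra.
  move=> a r _; have := TT_ge1 (it a) => ?; right; field; lra.
 split; [move=> k; apply: Sb_zero; exact: T0w|exact: yS].
apply: SbC_plus.
 apply: SbC_scal => //; apply: (SbC_weak (K := 1)) (CfS i); first lra.
 move=> a r Hr; have m1 := mC_ge1 (it a) Hr.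
 rewrite Rmult_1_r -Rinv_1; pos.
apply: SbC_scal => //; apply: (SbC_weak (K := 1)) (DfS i); first lra.
move=> a r Hr; have m1 := mD_ge1 (it a) Hr.
rewrite Rmult_1_r -Rinv_1; pos.
Qed.

Lemma kap_abs a r y : I01 r -> D y ->
 Rabs (Re (kap (tf a r y))) <= 3 / TT (it a) /\ Rabs (Im (kap (tf a r y))) <= 3 / TT (it a).
Proof.
move=> Hr Dy; have H := kap_den a Hr Dy; set t := tf a r y in H *.
have T1 := TT_ge1 (it a); set T := TT (it a) in H T1 *.
have P : 0 < 1 + 4 * t ^ 2 by nra.
have iP : 0 < / (1 + 4 * t ^ 2) by pos.
suff G x : Rabs x ^ 2 <= 1 + 4 * t ^ 2 -> Rabs (x * / (1 + 4 * t ^ 2)) <= 3 / T.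
 rewrite /kap /=; split; last by apply: G; rewrite Rabs_Ropp Rabs_mult (Rabs_pos_eq 2); [rewrite -(pow2_abs t); nra|lra].
 rewrite -[X in Rabs X](Rmult_1_l); apply: G; rewrite Rabs_R1; nra.
move=> Hx; rewrite Rabs_mult (Rabs_pos_eq (/ _)); last lra.
apply: (Rmult_le_reg_r (T * (1 + 4 * t ^ 2))); first pos.
rewrite (_ : Rabs x * _ * _ = Rabs x * T); last by field; lra.
rewrite (_ : 3 / T * _ = 3 * (1 + 4 * t ^ 2)); last by field; lra.
nra.
Qed.

Lemma yb i a r y : I01 r -> D y ->
 Rabs (yf (iax a) (iaxi a) (tf a r y) (fun i => xf i a r y) i) <= 6 * cst * TT (it a).
Proof.
move=> Hr Dy.
have -> : yf (iax a) (iaxi a) (tf a r y) (fun i => xf i a r y) i = yf (iax a) (iaxi a) (it a) (ix a) i +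
  (xif i a r y - 2 * (iaxi a i * tauf a r y)) by rewrite /yf /tf /xf; ring.
have H1 := iy a i; have H2 := xib i a Hr Dy; have H3 := taub a Hr Dy; have H4 := e_abs a i.
have H5 : Rabs (iaxi a i * tauf a r y) <= 2 * cst.
 rewrite Rabs_mult; pos.
have T1 := TT_ge1 (it a); have c0 := cst_pos.
have c1 : cst <= cst * TT (it a) by nra.
split_Rabs; lra.
Qed.

(** Every amplitude of size [cst / m] meets a coefficient of order [m]. The counts are
    [22 = 18 + 1 + 2 + 1] for the imaginary part, and [41 = 1 + 18 + 1 + 2 + 1 + 18] for the real
    part, the last 18 being the subtracted free term. *)
Lemma zt_parts i a r y : I01 r -> D y ->
 Rabs (Im (zt i a r y)) <= 22 * cst /\
 Rabs (Re (zt i a r y) - (1 - r) * (yf (iax a) (iaxi a) (it a) (ix a) i * Re (kap (it a)))) <= 41 * cst.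
Proof.
move=> Hr Dy.
have c0 := cst_pos; have T1 := TT_ge1 (it a).
have [k1 k2] := kap_abs a Hr Dy; have Y := yb i a Hr Dy.
set yy := yf _ _ _ _ _ in Y.
have yk x : Rabs x <= 3 / TT (it a) -> Rabs ((1 - r) * yy * x) <= 18 * cst.
 move=> Hx; rewrite !Rabs_mult (Rabs_pos_eq (1 - r)); last lra.
 have E : Rabs yy * Rabs x <= 6 * cst * TT (it a) * (3 / TT (it a)).
  pos.
 have E2 : 6 * cst * TT (it a) * (3 / TT (it a)) = 18 * cst by field; lra.
 nra.
have [C1 C2] := Chb i a Hr Dy; have [D1 D2] := Dhb i a Hr Dy.
have mc := mC_ge1 (it a) Hr; have md := mD_ge1 (it a) Hr.
have tt := t_abs a Hr Dy; have cle := cst_le.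
have tr : Rabs (2 * tf a r y * r) <= 2 * mC (it a) r.
 rewrite !Rabs_mult (Rabs_pos_eq 2) ?(Rabs_pos_eq r); try lra.
 have : Rabs (tf a r y) <= Rabs (it a) + 1 by split_Rabs; lra.
 rewrite /mC => ?; nra.
have t1 : Rabs (tf a r y * (1 - r)) <= mD (it a) r.
 rewrite !Rabs_mult (Rabs_pos_eq (1 - r)); try lra.
 have : Rabs (tf a r y) <= Rabs (it a) + 1 by split_Rabs; lra.
 rewrite /mD => ?; nra.
have sc m u v : 1 <= m -> Rabs u <= 1 -> Rabs v <= m -> Rabs (v * (cst / m * u)) <= cst.
 move=> m1 Hu Hv; rewrite (Rabs_mult v) (Rabs_mult (cst / m)) (Rabs_pos_eq (cst / m)); last pos.
 have P : 0 < cst / m by pos.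
 via (m * (cst / m * 1)); last by right; field; lra.
 pos.
have sc2 u v : Rabs u <= 1 -> Rabs v <= 2 * mC (it a) r -> Rabs (v * (cst / mC (it a) r * u)) <= 2 * cst.
 move=> Hu Hv; have Hv2 : Rabs (v / 2) <= mC (it a) r by move/Rabs_le_between: Hv => Hv; apply/Rabs_le_between; lra.
 have := sc _ u (v / 2) mc Hu Hv2.
 rewrite (_ : v / 2 * _ = v * (cst / mC (it a) r * u) / 2); last pos.
 move: (v * _) => x /Rabs_le_between Hx; apply/Rabs_le_between; lra.
have onem : Rabs 1 <= mC (it a) r by rewrite Rabs_R1.
have X := xib i a Hr Dy.
have xi : Rabs (r * xif i a r y) <= cst.
 rewrite Rabs_mult (Rabs_pos_eq r); nra.
have yk0 : Rabs ((1 - r) * (yf (iax a) (iaxi a) (it a) (ix a) i * Re (kap (it a)))) <= 18 * cst.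
 have Hk : Rabs (Re (kap (it a))) <= 3 / TT (it a).
  rewrite /kap /= Rabs_pos_eq; last by apply: Rlt_le; apply: Rinv_0_lt_compat; nra.
  apply: (Rmult_le_reg_r (TT (it a) * (1 + 4 * it a ^ 2))).
   nra.
  have P := pow2_ge_0 (it a).
  rewrite (_ : / _ * _ = TT (it a)); last by field; lra.
  rewrite (_ : 3 / TT (it a) * _ = 3 * (1 + 4 * it a ^ 2)); last by field; lra.
  rewrite /TT -(pow2_abs (it a)); nra.
 have Y0 := iy a i.
 rewrite Rabs_mult (Rabs_pos_eq (1 - r)) ?Rabs_mult; last lra.
 have E : Rabs (yf (iax a) (iaxi a) (it a) (ix a) i) * Rabs (Re (kap (it a))) <= cst * TT (it a) * (3 / TT (it a)).
  pos.
 have E2 : cst * TT (it a) * (3 / TT (it a)) = 3 * cst by field; lra.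
 nra.
have ER : Re (zt i a r y) = r * xif i a r y + ((1 - r) * yy * Re (kap (tf a r y)) +
 ((1 * (cst / mC (it a) r * Re (Ch i a r y)) - (2 * tf a r y * r) * (cst / mC (it a) r * Im (Ch i a r y)))
  + (tf a r y * (1 - r)) * (cst / mD (it a) r * Re (Dh i a r y)))).
 rewrite /zt /Cf /Df /Cplus /Cmult /RtoC /Re /Im -/yy /=; ring.
have EI : Im (zt i a r y) = (1 - r) * yy * Im (kap (tf a r y)) +
 ((1 * (cst / mC (it a) r * Im (Ch i a r y)) + (2 * tf a r y * r) * (cst / mC (it a) r * Re (Ch i a r y)))
  + (tf a r y * (1 - r)) * (cst / mD (it a) r * Im (Dh i a r y))).
 rewrite /zt /Cf /Df /Cplus /Cmult /RtoC /Re /Im -/yy /=; ring.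
have h1 := yk _ k1; have h2 := yk _ k2.
have h3 := sc _ _ _ mc C1 onem; have h4 := sc _ _ _ mc C2 onem.
have h5 := sc2 _ _ C1 tr; have h6 := sc2 _ _ C2 tr.
have h7 := sc _ _ _ md D1 t1; have h8 := sc _ _ _ md D2 t1.
move: h1 h2 h3 h4 h5 h6 h7 h8 xi yk0; rewrite ER EI.
set u1 := _ * Re (kap (tf _ _ _)); set u2 := _ * Im (kap (tf _ _ _)).
move: (1 * _) (1 * _) (2 * _ * _ * _) (2 * _ * _ * _) (tf a r y * (1 - r) * _) (tf a r y * (1 - r) * _) (r * _) ((1 - r) * _).
move=> v1 v2 v3 v4 v5 v6 v7 v8 /Rabs_le_between ? /Rabs_le_between ? /Rabs_le_between ? /Rabs_le_between ? /Rabs_le_between ? /Rabs_le_between ? /Rabs_le_between ? /Rabs_le_between ? /Rabs_le_between ? /Rabs_le_between ?; split; apply/Rabs_le_between; lra.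
Qed.

Definition zq a r y : vec n := fun i => Im (zt i a r y).
Definition zp a r y : vec n := fun i => zbase a r i + Re (zt i a r y).

Lemma zq_small a r y : I01 r -> D y -> vnorm (zq a r y) <= 1.
Proof.
move=> Hr Dy; bound (vnorm_le_l1 _).
via (INR #|'I_n| * (22 * cst)).
 by apply: fsum_le_const => i; apply: (proj1 (zt_parts i a Hr Dy)).
rewrite card_ord; have := cst_n; lra.
Qed.

(** The point is within distance one of the free ray, so its weight is at least [cG * Lm - 1]; it is
    also at least one, and adding the two bounds gives half of [cG * Lm]. *)
Lemma zp_big a r y : I01 r -> D y -> cG / 2 * Lm (ity a) (it a) r <= jbr (zp a r y).
Proof.
move=> Hr Dy; have L := iL a Hr.
have S := jbr_sub (zp a r y) (Rezf (iax a) (iaxi a) (it a) (ix a) r).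
have V : vnorm (vsub (Rezf (iax a) (iaxi a) (it a) (ix a) r) (zp a r y)) <= 1.
 bound (vnorm_le_l1 _).
 via (INR #|'I_n| * (41 * cst)); last by rewrite card_ord; have := cst_n; lra.
 apply: fsum_le_const => i; rewrite Rabs_minus_sym.
 have := proj2 (zt_parts i a Hr Dy); congr (Rabs _ <= _); rewrite /vsub /Rezf /zp /zbase; ring.
have := jbr_ge1 (zp a r y); lra.
Qed.

Variables (b : 'I_n -> 'I_n -> vec n -> R) (sgm : R) (Ad : nat -> R).
Hypotheses (s0p : 0 < sgm) (bsm : forall j k, smooth_Rn (b j k)) (bdec : decays b sgm Ad).

Definition EB j k ds l (p q : vec n) : C := EE (fun ds => dxs ds (b j k)) ds l p q.

Lemma EBS j k ds l : SbC D (fun a r => Rpower (Lm (ity a) (it a) r) (- sz sgm ds))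
 (fun a r y => EB j k ds l (zp a r y) (zq a r y)).
Proof.
apply: (@EE_compose _ _ _ Dopen _ _ Ad sgm s0p _ _ zbase (fun i a r y => Re (zt i a r y))
 (fun i a r y => Im (zt i a r y)) (fun a r => Lm (ity a) (it a) r) (cG / 2)).
- by apply: pd_dxs.
- by [].
- by move=> a i r; ctac.
- by move=> i; apply: (proj1 (ztS i)).
- by move=> i; apply: (proj2 (ztS i)).
- rewrite /cG; lra.
- by move=> a r; apply: Lm_ge1.
- exact: zq_small.
- exact: zp_big.
Qed.

(** [gg], [ff] are the velocity and momentum perturbations without the factor [eps]. *)
Definition gg (p q : vec n) (zeta : 'I_n -> C) (j : 'I_n) : C :=
 (2 * csum (fun k => (EB j k [::] 0 p q * zeta k)))%C.
Definition ff (p q : vec n) (zeta : 'I_n -> C) (i : 'I_n) : C :=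
 Copp (csum (fun j => csum (fun k => (EB j k [:: i] 0 p q * (zeta j * zeta k))%C))).

Definition L1 a r : R := Rpower (Lm (ity a) (it a) r) (- (1 + sgm)).
Definition L2 a r : R := Rpower (Lm (ity a) (it a) r) (- (2 + sgm)).

Lemma sz0 : @sz n sgm [::] = 1 + sgm.
Proof. rewrite /sz /=; ring. Qed.
Lemma sz1 (i : 'I_n) : sz sgm [:: i] = 2 + sgm.
Proof. by []. Qed.

Lemma L10 a r : I01 r -> 0 <= L1 a r. Proof. by move=> _; apply: Rlt_le; apply: Rpower_pos. Qed.
Lemma L20 a r : I01 r -> 0 <= L2 a r. Proof. by move=> _; apply: Rlt_le; apply: Rpower_pos. Qed.

Lemma ggS j : SbC D L1 (fun a r y => gg (zp a r y) (zq a r y) (fun i => zetaf i a r y) j).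
Proof.
apply: SbC_scal => //; apply: (SbC_csum Dopen L10) => k.
apply: (SbC_multW Dopen (W1 := L1) (W2 := ones) (K := 1)); [lra|pos| |exact: zetaS].
by have := EBS j k [::] 0; rewrite sz0.
Qed.

Lemma ffS i : SbC D L2 (fun a r y => ff (zp a r y) (zq a r y) (fun i => zetaf i a r y) i).
Proof.
apply: SbC_opp => //; apply: (SbC_csum Dopen L20) => j; apply: (SbC_csum Dopen L20) => k.
apply: (SbC_multW Dopen (W1 := L2) (W2 := ones) (K := 1)); [lra|pos| |].
 have := EBS j k [:: i] 0; pos.
by apply: (SbC_mult1 Dopen); apply: zetaS.
Qed.

Local Notation at_z F a r y := (F (zp a r y) (zq a r y) (fun i => zetaf i a r y)).

(** Variation of constants, without the factor [eps]. The Wronskian of the free fundamental system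
    is [-(1 + 2it)/2], whence [kap t]; the factor [t] comes from the rescaled time. *)
Definition dCf i : fnC := fun a r y => let t := tf a r y in
 (t * kap t * (at_z gg a r y i + 2 * ((t * (1 - r))%R * at_z ff a r y i)))%C.
Definition dDf i : fnC := fun a r y => let t := tf a r y in
 (t * kap t * ((0, 2) * at_z gg a r y i - 2 * ((1, 2 * t * r)%R * at_z ff a r y i)))%C.

Lemma L2_L1 a r m : I01 r -> m * L2 a r = m / Lm (ity a) (it a) r * L1 a r.
Proof.
move=> Hr; have L := Lm_ge1 (ity a) (it a) Hr; rewrite /L2 /L1.
have -> : - (2 + sgm) = - (1 + sgm) + - 1 by ring.
rewrite Rpower_plus (Rpower_Ropp _ 1) Rpower_1; pos.
Qed.

Lemma mratio a r m m' : I01 r -> 0 <= m -> m * m' <= TT (it a) * Lm (ity a) (it a) r ->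
 m * (m' * L2 a r) <= 1 * W0 sgm (ity a) (it a) r.
Proof.
move=> Hr m0 H; have L := Lm_ge1 (ity a) (it a) Hr.
rewrite -Rmult_assoc (L2_L1 _ _ Hr) Rmult_1_l /W0 -/(L1 a r).
apply: Rmult_le_compat_r; first exact: L10.
apply/Rle_div_l; lra.
Qed.

Lemma W00 a r : I01 r -> 0 <= W0 sgm (ity a) (it a) r.
Proof. by move=> _; apply: Rlt_le; apply: W0_pos. Qed.

Lemma mcst (m : R -> R -> R) : (forall t r, I01 r -> 1 <= m t r) -> (forall t r, continuous (fun r => m t (clamp r)) r) ->
 SbC D (fun a r => m (it a) r) (fun a r _ => RtoC (m (it a) r)).
Proof.
move=> m1 mc; apply: SbC_RtoC; first by move=> a r Hr; have := m1 (it a) r Hr; lra.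
apply: (@cstS _ (fun a r => m (it a) r) 1); [lra| |by []].
move=> a r Hr; have h := m1 (it a) r Hr; rewrite Rabs_pos_eq; lra.
Qed.

(** In the velocity term [mC <= TT]. In the force term [t(1 - r)] is of order [mD], the product
    [mC * mD] is at most [TT * Lm], and the force has one more power of decay than the velocity to
    compensate [Lm]. *)
Lemma dCS i : SbC D (fun a r => W0 sgm (ity a) (it a) r)
 (fun a r y => (mC (it a) r * dCf i a r y)%C).
Proof.
apply: (SbC_eq Dopen (f := fun a r y => let t := tf a r y in (t * kap t * (mC (it a) r * at_z gg a r y i + mC (it a) r * (2 * ((t * (1 - r))%R * at_z ff a r y i))))%C)).
 move=> a r y _ _; rewrite /dCf /=; ring.
apply: (SbC_mult1 Dopen); first exact: tkapS.
apply: SbC_plus.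
 apply: (SbC_multW Dopen (K := 1)) (mcst mC_ge1 mC_cont) (ggS i); first lra.
 move=> a r Hr; rewrite Rmult_1_l /W0; apply: Rmult_le_compat_r; [exact: (L10 a Hr)|exact: mC_le].
apply: (SbC_multW Dopen (W2 := fun a r => mD (it a) r * L2 a r) (K := 1)) (mcst mC_ge1 mC_cont) _; first lra.
 by move=> a r Hr; apply: mratio => //; [exact: mC0|exact: mCmD_le].
apply: (SbC_scal Dopen); apply: (SbC_mult Dopen); last exact: ffS.
by apply: SbC_RtoC; [exact: mD0|exact: t1rS].
Qed.

Lemma dDS i : SbC D (fun a r => W0 sgm (ity a) (it a) r)
 (fun a r y => (mD (it a) r * dDf i a r y)%C).
Proof.
apply: (SbC_eq Dopen (f := fun a r y => let t := tf a r y in (t * kap t * ((0, 2) * (mD (it a) r * at_z gg a r y i) - mD (it a) r * (2 * ((1, 2 * t * r)%R * at_z ff a r y i))))%C)).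
 move=> a r y _ _; rewrite /dDf /=; ring.
apply: (SbC_mult1 Dopen); first exact: tkapS.
apply: (SbC_minus Dopen).
 apply: (SbC_scal Dopen); apply: (SbC_multW Dopen (K := 1)) (mcst mD_ge1 mD_cont) (ggS i); first lra.
 move=> a r Hr; rewrite Rmult_1_l /W0; apply: Rmult_le_compat_r; [exact: (L10 a Hr)|exact: mD_le].
apply: (SbC_multW Dopen (W2 := fun a r => mC (it a) r * L2 a r) (K := 1)) (mcst mD_ge1 mD_cont) _; first lra.
 move=> a r Hr; apply: mratio => //; [exact: mD0|rewrite Rmult_comm; exact: mCmD_le].
by apply: (SbC_scal Dopen); apply: (SbC_mult Dopen); [exact: trS|exact: ffS].
Qed.

End Data.

#[global] Hint Resolve W0_pos cst_pos : nonneg.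
#[global] Hint Extern 1 (_ < TT ?t) => (pose proof (TT_ge1 t); lra) : nonneg.
#[global] Hint Extern 1 (_ <= TT ?t) => (pose proof (TT_ge1 t); lra) : nonneg.
(** ** Functions of class C^1 on [0,1] *)

(** The witness [v] extends [u] beyond the interval, so that the derivatives at 0 and 1 are ordinary
    two-sided ones. *)
Definition AC (u U : R -> R) : Prop :=
 (forall r, continuous (fun r => U (clamp r)) r) /\
 exists v, forall r, I01 r -> v r = u r /\ is_derive v r (U r).

Lemma AC_FTC u U s : AC u U -> I01 s -> u s - u 0 = RInt (fun r => U (clamp r)) 0 s.
Proof.
move=> [cU [v Hv]] Hs; apply/esym; apply: is_RInt_unique.
rewrite -(proj1 (Hv s Hs)) -(proj1 (Hv 0 ltac:(lra))).
apply: (is_RInt_derive v (fun r => U (clamp r))) => r; rewrite Rmin_left ?Rmax_right; try lra; move=> Hr.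
- rewrite clamp_id; [apply: (proj2 (Hv r _))|]; lra.
- by [].
Qed.

Lemma AC_int U u0 u : (forall r, continuous (fun r => U (clamp r)) r) ->
 (forall r, I01 r -> u r = u0 + RInt (fun r => U (clamp r)) 0 r) -> AC u U.
Proof.
move=> cU Hu; split => //; exists (fun r => u0 + RInt (fun r => U (clamp r)) 0 r) => r Hr.
split; first by rewrite Hu.
rewrite -[X in is_derive _ _ X]Rplus_0_l.
apply: der_plus; first exact: is_derive_const.
rewrite -{2}(clamp_id Hr).
apply: (is_derive_RInt (fun r => U (clamp r)) _ 0); last exact: cU.
by apply: filter_forall => b; apply: RInt_correct; apply: ex_RInt_continuous.
Qed.

Lemma AC_cont u U r : AC u U -> continuous (fun r => u (clamp r)) r.
Proof.
move=> [cU [v Hv]]; apply: (continuous_ext (fun r => v (clamp r))).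
 by move=> s; rewrite (proj1 (Hv _ (clampP s))).
apply: (continuous_comp clamp v); first exact: clamp_continuous.
by apply: ex_derive_continuous; eexists; apply: (proj2 (Hv _ (clampP r))).
Qed.

Lemma AC_ext u1 u2 U1 U2 : (forall r, I01 r -> u1 r = u2 r) -> (forall r, I01 r -> U1 r = U2 r) ->
 AC u1 U1 -> AC u2 U2.
Proof.
move=> E1 E2 [cU [v Hv]]; split.
 by move=> r; apply: (continuous_ext (fun r => U1 (clamp r))) => [s|//]; apply: E2; apply: clampP.
exists v => r Hr; rewrite -E1 // -E2 //; pos.
Qed.

Lemma AC_plus u1 U1 u2 U2 : AC u1 U1 -> AC u2 U2 -> AC (fun r => u1 r + u2 r) (fun r => U1 r + U2 r).
Proof.
move=> [c1 [v1 H1]] [c2 [v2 H2]]; split.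
 by cont.
exists (fun r => v1 r + v2 r) => r Hr; have [e1 d1] := H1 r Hr; have [e2 d2] := H2 r Hr.
by split; [rewrite e1 e2|apply: der_plus].
Qed.

Lemma AC_mult u1 U1 u2 U2 : AC u1 U1 -> AC u2 U2 ->
 AC (fun r => u1 r * u2 r) (fun r => U1 r * u2 r + u1 r * U2 r).
Proof.
move=> A1 A2; have k1 := fun r => @AC_cont _ _ r A1; have k2 := fun r => @AC_cont _ _ r A2.
case: A1 A2 => [c1 [v1 H1]] [c2 [v2 H2]]; split.
 by cont.
exists (fun r => v1 r * v2 r) => r Hr; have [e1 d1] := H1 r Hr; have [e2 d2] := H2 r Hr.
split; first nra.
have := @is_derive_mult R_AbsRing _ _ _ _ _ d1 d2 Rmult_comm.
by rewrite /= /plus /mult /= e1 e2.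
Qed.

Lemma AC_const k : AC (fun _ => k) (fun _ => 0).
Proof.
split; first by cont.
by exists (fun _ => k) => r _; split => //; apply: is_derive_const.
Qed.

Lemma AC_id : AC (fun r => r) (fun _ => 1).
Proof.
split; first by cont.
by exists (fun r => r) => r _; split => //; apply: is_derive_id.
Qed.

Lemma AC_scal k u U : AC u U -> AC (fun r => k * u r) (fun r => k * U r).
Proof.
move=> H; apply: AC_ext (AC_mult (AC_const k) H) => r _ //; ring.
Qed.

Lemma AC_fsum (I : finType) (u U : I -> R -> R) : (forall i, AC (u i) (U i)) ->
 AC (fun r => fsum (fun i => u i r)) (fun r => fsum (fun i => U i r)).
Proof.
move=> H; rewrite /fsum; elim: (index_enum I) => [|i s IH].
 by apply: AC_ext (AC_const 0) => r _; rewrite big_nil.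
by apply: AC_ext (AC_plus (H i) IH) => r _; rewrite big_cons.
Qed.

Definition ACC (u U : R -> C) := AC (fun r => Re (u r)) (fun r => Re (U r)) /\
 AC (fun r => Im (u r)) (fun r => Im (U r)).

Lemma ACC_ext u1 u2 U1 U2 : (forall r, I01 r -> u1 r = u2 r) -> (forall r, I01 r -> U1 r = U2 r) ->
 ACC u1 U1 -> ACC u2 U2.
Proof.
move=> E1 E2 [H1 H2]; split; [apply: AC_ext H1|apply: AC_ext H2] => r Hr; by rewrite ?E1 ?E2.
Qed.

Lemma ACC_plus u1 U1 u2 U2 : ACC u1 U1 -> ACC u2 U2 ->
 ACC (fun r => (u1 r + u2 r)%C) (fun r => (U1 r + U2 r)%C).
Proof. by move=> [a1 b1] [a2 b2]; split; apply: AC_plus. Qed.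

Lemma ACC_mult u1 U1 u2 U2 : ACC u1 U1 -> ACC u2 U2 ->
 ACC (fun r => (u1 r * u2 r)%C) (fun r => (U1 r * u2 r + u1 r * U2 r)%C).
Proof.
move=> [a1 b1] [a2 b2]; split.
- apply: AC_ext (AC_plus (AC_mult a1 a2) (AC_scal (-1) (AC_mult b1 b2))) => r _;
 rewrite /Re /Im /Cmult /Cplus /=; ring.
- apply: AC_ext (AC_plus (AC_mult a1 b2) (AC_mult b1 a2)) => r _;
 rewrite /Re /Im /Cmult /Cplus /=; ring.
Qed.

Lemma ACC_const k : ACC (fun _ => k) (fun _ => RtoC 0).
Proof. by split; apply: AC_const. Qed.

Lemma ACC_scal k u U : ACC u U -> ACC (fun r => (k * u r)%C) (fun r => (k * U r)%C).
Proof.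
move=> H; apply: ACC_ext (ACC_mult (ACC_const k) H) => r _ //; ring.
Qed.

Lemma ACC_RtoC u U : AC u U -> ACC (fun r => RtoC (u r)) (fun r => RtoC (U r)).
Proof. by split => //; apply: AC_const. Qed.

Lemma ACC_csum (I : finType) (u U : I -> R -> C) : (forall i, ACC (u i) (U i)) ->
 ACC (fun r => csum (fun i => u i r)) (fun r => csum (fun i => U i r)).
Proof.
by split; apply: (AC_fsum (u := fun i r => _ (u i r)) (U := fun i r => _ (U i r))) => i; case: (H i).
Qed.

(** * The system for the amplitudes *)

Section System.
Variables (n : nat) (b : 'I_n -> 'I_n -> vec n -> R) (sgm : R) (Ad : nat -> R).
Hypotheses (s0p : 0 < sgm) (bsm : forall j k, smooth_Rn (b j k)) (bdec : decays b sgm Ad).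

Notation J := (option 'I_n).
Notation K := (bool * bool * 'I_n)%type.
Notation I := (J + K)%type.

(** The shifts of time and position are components with right-hand side zero, so that smoothness in
    the boundary data yields smoothness in time and position. In the other components the first
    Boolean separates the amplitudes [c] and [d], the second real and imaginary parts. *)
Definition st_tau (a : idx n) (r : R) (y : I -> R) : R := y (inl None).
Definition st_xi (i : 'I_n) (a : idx n) (r : R) (y : I -> R) : R := y (inl (Some i)).
Definition st_C (i : 'I_n) (a : idx n) (r : R) (y : I -> R) : C := (y (inr (false, false, i)), y (inr (false, true, i))).
Definition st_D (i : 'I_n) (a : idx n) (r : R) (y : I -> R) : C := (y (inr (true, false, i)), y (inr (true, true, i))).

Definition rad (c : I) : R := match c with inl _ => cst n | inr _ => 1 end.

Lemma rad_coord c : SbI (box rad) (fun (_ : idx n) _ => 1) (fun _ _ y => y c).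
Proof. move=> k; apply: (@Sb_coord _ _ _ _ _ (rad c)) => y /(_ c); lra. Qed.

Lemma rad_cst y o : box rad y -> Rabs (y (inl o)) <= cst n.
Proof. move=> /(_ (inl o)) /=; lra. Qed.

Lemma rad_one y o : box rad y -> Rabs (y (inr o)) <= 1.
Proof. move=> /(_ (inr o)) /=; lra. Qed.

Definition sdC i : idx n -> R -> (I -> R) -> C := dCf st_tau st_xi st_C st_D b i.
Definition sdD i : idx n -> R -> (I -> R) -> C := dDf st_tau st_xi st_C st_D b i.

(** Multiplication by [m / cst] passes from the physical amplitudes to the rescaled unknowns; [eps]
    is left out so that the constants found for [g0] serve all small [eps]. *)
Definition g0 (c : I) (a : idx n) (r : R) (y : I -> R) : R :=
 match c with
 | inl _ => 0
 | inr (false, im, i) => cpart im ((/ cst n)%R * (mC (it a) r * sdC i a r y))%C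
 | inr (true, im, i) => cpart im ((/ cst n)%R * (mD (it a) r * sdD i a r y))%C
 end.

Definition Wn (a : idx n) (r : R) : R := W0 sgm (ity a) (it a) r / (1 + / sgm).

Lemma is0 : 0 < / sgm. Proof. pos. Qed.

Lemma Wn_pos a r : 0 < Wn a r.
Proof. by apply: Rdiv_lt_0_compat; [apply: W0_pos|have := is0; lra]. Qed.

Lemma Wn_cont a r : continuous (fun r => Wn a (clamp r)) r.
Proof. by apply: cont_mult; [apply: W0_cont|apply: continuous_const]. Qed.

Lemma Wn_int a : RInt (fun r => Wn a (clamp r)) 0 1 <= 1.
Proof.
have H := W0_int s0p (ity a) (it a); have := is0 => i0.
have -> : RInt (fun r => Wn a (clamp r)) 0 1 = / (1 + / sgm) * RInt (fun r => W0 sgm (ity a) (it a) (clamp r)) 0 1.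
 rewrite -[RHS](RInt_scal (V := R_CompleteNormedModule) (fun r => W0 sgm (ity a) (it a) (clamp r)) 0 1 (/ (1 + / sgm))).
  by apply: RInt_ext => r _; rewrite /Wn /scal /= /mult /= /Rdiv Rmult_comm.
 by apply: ex_RInt_continuous => z _; apply: W0_cont.
apply: (Rmult_le_reg_l (1 + / sgm)); first lra.
rewrite -Rmult_assoc Rinv_r; lra.
Qed.

Lemma g0S c : SbI (box rad) Wn (g0 c).
Proof.
have Wk k f : Sb (box rad) (fun a r => W0 sgm (ity a) (it a) r) k f -> Sb (box rad) Wn k f.
 apply: (Sb_weak (K := 1 + / sgm)); first pos.
 rewrite /Wn; right; field; pos.
have bo := @box_open _ rad.
have xs : forall i, SbI (box rad) (fun (_ : idx n) _ => 1) (st_xi i) by move=> i; apply: rad_coord.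
have cs : forall i, SbC (box rad) ones (st_C i) by split; apply: rad_coord.
have ds : forall i, SbC (box rad) ones (st_D i) by split; apply: rad_coord.
have tb : forall (a : idx n) r y, I01 r -> box rad y -> Rabs (st_tau a r y) <= cst n.
 by move=> a r y _ Hy; apply: rad_cst.
have xb : forall i (a : idx n) r y, I01 r -> box rad y -> Rabs (st_xi i a r y) <= cst n.
 by move=> i a r y _ Hy; apply: rad_cst.
have cb : forall i (a : idx n) r y, I01 r -> box rad y -> Rabs (Re (st_C i a r y)) <= 1 /\ Rabs (Im (st_C i a r y)) <= 1.
 by split; apply: rad_one.
have db : forall i (a : idx n) r y, I01 r -> box rad y -> Rabs (Re (st_D i a r y)) <= 1 /\ Rabs (Im (st_D i a r y)) <= 1.
 by split; apply: rad_one.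
move=> k; apply: Wk; case: c => [o|[[d im] i]]; first by apply: Sb_zero => a r _; pos.
case: d => /=.
 have [H1 H2] := SbC_scal bo (RtoC (/ cst n)) (dDS bo (rad_coord (inl None)) xs cs ds tb xb cb db s0p bsm bdec i).
 case: im => /=; pos.
have [H1 H2] := SbC_scal bo (RtoC (/ cst n)) (dCS bo (rad_coord (inl None)) xs cs ds tb xb cb db s0p bsm bdec i).
case: im => /=; pos.
Qed.

Definition ge (c : I) : bool := match c with inr (false, _, _) => true | _ => false end.
Definition gm (a : idx n) (c : I) (r : R) : R :=
 match c with inl _ => 1 | inr (false, _, _) => mC (it a) r | inr (true, _, _) => mD (it a) r end.

Lemma gm_ge1 a c r : I01 r -> 1 <= gm a c r.
Proof. by case: c => [o|[[[] im] i]] Hr /=; [lra|apply: mD_ge1|apply: mC_ge1]. Qed.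

Lemma gm_cont a c r : continuous (fun r => gm a c (clamp r)) r.
Proof. by case: c => [o|[[[] im] i]] /=; [apply: continuous_const|apply: mD_cont|apply: mC_cont]. Qed.

Variables (dg0 : I -> I -> idx n -> R -> (I -> R) -> R) (C0 : R).
Hypotheses (C00 : 0 <= C0) (dg0P : forall c c' a r y, I01 r -> box rad y -> pd (g0 c a r) c' y (dg0 c c' a r y)) (dg0S : forall c c', SbI (box rad) Wn (dg0 c c')) (g0b : forall c a r y, I01 r -> box rad y -> Rabs (g0 c a r y) <= C0 * Wn a r) (dg0b : forall c c' a r y, I01 r -> box rad y -> Rabs (dg0 c c' a r y) <= C0 * Wn a r).

Variable eps : R.
Hypotheses (ep : 0 < eps) (esm : 4 * eps * C0 * (1 + INR #|{: I}|) <= cst n).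

Lemma esm1 : 4 * eps * C0 <= cst n.
Proof.
apply: Rle_trans esm; have := pos_INR #|{: I}|; have := Rmult_le_pos _ _ (Rlt_le _ _ ep) C00 => *; nra.
Qed.

(** All norm weights are one, hence the row sums are [eps * C0] times the number of components, and
    [esm] brings them below 1/4. *)
Definition Seps : sys (idx n) I.
Proof.
refine (@Sys _ I Wn ge gm (fun c a r y => eps * g0 c a r y) (fun c c' a r y => eps * dg0 c c' a r y)
 rad (fun _ => 1) (fun _ _ => eps * C0) (/ 4) _ _ _ _ _ _ _ _ _ _ _ _ _ _ _ _).
- by move=> a r _; apply: Rlt_le; apply: Wn_pos.
- exact: Wn_cont.
- exact: Wn_int.
- move=> a c r Hr; have := gm_ge1 a c Hr; lra.
- exact: gm_cont.
- move=> a [o|[[[] im] i]] r s Hr Hs /=; first lra.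
 + rewrite /mD; pos.
 + rewrite /mC; pos.
- move=> [o|o] /=; pos.
- pos.
- pos.
- by move=> c k; apply: Sb_scal; apply: g0S.
- by move=> c c' a r y Hr Hy; apply: is_derive_scal; apply: dg0P.
- by move=> c c' k; apply: Sb_scal; apply: dg0S.
- move=> c a r y Hr Hy; rewrite Rabs_mult Rabs_pos_eq; last lra.
 have W := Wn_pos a r; have := g0b c a Hr Hy; have := esm1; have := cst_le n; have c0 := cst_pos n => H1 H2 H3.
 via (eps * (C0 * Wn a r)); first pos.
 rewrite -Rmult_assoc; apply: Rmult_le_compat_r; first lra.
 case: c H3 => o _ /=; lra.
- move=> c c' a r y Hr Hy; rewrite Rabs_mult Rabs_pos_eq; last lra.
 rewrite Rmult_assoc; pos.
- move=> c; rewrite fsum_const; have H1 := esm; have := cst_le n; have := Rmult_le_pos _ _ (Rlt_le _ _ ep) C00.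
 set N := INR _ in H1 *; have : 0 <= N by apply: pos_INR.
 pos.
- lra.
Defined.

Definition hb (th : J -> R) := box (fun _ : J => cst n / 2) th.

Lemma hb_open : openI hb. Proof. exact: box_open. Qed.

Lemma hb_emb th : hb th -> box (fun c : I => rad c / 2) (emb th (fun _ => 0)).
Proof. by move=> H [o|o] /=; [apply: H|rewrite Rabs_R0; lra]. Qed.

(** The box only says that the amplitudes are below one. Inserting this in the integral equation,
    whose boundary data for the amplitudes are zero, improves it to order [eps], as the gradient
    estimate requires. *)
Lemma sol_small a th P c s : sol Seps a (emb th (fun _ => 0)) P -> Rabs (P s (inr c)) <= eps * C0.
Proof.
move=> HS; have pP := sol_path HS.
rewrite (proj2 (proj2 HS)) /= Rplus_0_l.
apply: (Lop_bound (W := Wn a)).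
- exact: sm0 Seps a (inr c). - exact: gm_cont. - exact: smm Seps a (inr c).
- by move=> r _; apply: Rlt_le; apply: Wn_pos. - exact: Wn_cont. - exact: Wn_int.
- pos.
- exact: (path_cont pP (sgS Seps (inr c))).
- move=> r Hr; rewrite clamp_id // -[sg _ _ _ _ _]/(eps * g0 (inr c) a r (P r)) Rabs_mult Rabs_pos_eq; last lra.
 by rewrite Rmult_assoc; apply: Rmult_le_compat_l; [lra|apply: g0b => //; apply: (proj2 pP)].
Qed.

Lemma sol_const a th P o s : sol Seps a (emb th (fun _ => 0)) P -> P s (inl o) = th o.
Proof.
move=> HS; rewrite (proj2 (proj2 HS)) /= /rhs /Lop /= Rmult_1_l.
rewrite (RInt_ext _ (fun _ => 0)); last pos.
rewrite RInt_const /scal /= /mult /=; ring.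
Qed.

End System.

(** * Amplitudes in physical scale and independence of the chart *)

Section Physical.
Variables (n : nat) (b : 'I_n -> 'I_n -> vec n -> R).

(** The right-hand sides of the amplitude equations as functions of time, position and amplitudes
  only: they do not depend on the chart in which the problem is solved. *)
Definition phC (ax e : vec n) (t : R) (x : vec n) (c d : 'I_n -> C) (r : R) (i : 'I_n) : C :=
 let p := (fun i => Re (zC ax e t x c d r i)) : vec n in
 let q := (fun i => Im (zC ax e t x c d r i)) : vec n in
 let zt := zetaC ax e t x c d in
 (t * kap t * (gg b p q zt i + 2 * ((t * (1 - r))%R * ff b p q zt i)))%C.
Definition phD (ax e : vec n) (t : R) (x : vec n) (c d : 'I_n -> C) (r : R) (i : 'I_n) : C :=
 let p := (fun i => Re (zC ax e t x c d r i)) : vec n in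
 let q := (fun i => Im (zC ax e t x c d r i)) : vec n in
 let zt := zetaC ax e t x c d in
 (t * kap t * ((0, 2) * gg b p q zt i - 2 * ((1, 2 * t * r)%R * ff b p q zt i)))%C.

Section Chart.
Variables (I : finType) (tauf : idx n -> R -> (I -> R) -> R) (xif : 'I_n -> idx n -> R -> (I -> R) -> R)
 (Ch Dh : 'I_n -> idx n -> R -> (I -> R) -> C).

Lemma zp_phys a r y : zp tauf xif Ch Dh a r y = (fun i => Re (zf tauf xif Ch Dh i a r y)).
Proof. by apply: funext => i; rewrite zf_zt. Qed.

Lemma zq_phys a r y : zq tauf xif Ch Dh a r y = (fun i => Im (zf tauf xif Ch Dh i a r y)).
Proof. by []. Qed.

Lemma dCf_phys i a r y : dCf tauf xif Ch Dh b i a r y =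
 phC (iax a) (iaxi a) (tf tauf a r y) (fun i => xf xif i a r y) (fun i => Cf Ch i a r y) (fun i => Df Dh i a r y) r i.
Proof. by rewrite /dCf zp_phys zq_phys. Qed.

Lemma dDf_phys i a r y : dDf tauf xif Ch Dh b i a r y =
 phD (iax a) (iaxi a) (tf tauf a r y) (fun i => xf xif i a r y) (fun i => Cf Ch i a r y) (fun i => Df Dh i a r y) r i.
Proof. by rewrite /dDf zp_phys zq_phys. Qed.
End Chart.

Notation J := (option 'I_n).
Notation I := (J + (bool * bool * 'I_n))%type.

Definition th_tau (a : idx n) (r : R) (th : J -> R) : R := th None.
Definition th_xi (i : 'I_n) (a : idx n) (r : R) (th : J -> R) : R := th (Some i).
Definition tt (a : idx n) (th : J -> R) : R := it a + th None.
Definition xx (a : idx n) (th : J -> R) : vec n := fun i => ix a i + th (Some i).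

Variables (sgm : R) (Ad : nat -> R).
Hypotheses (s0p : 0 < sgm) (bsm : forall j k, smooth_Rn (b j k)) (bdec : decays b sgm Ad).

(** The constants hidden in [amC] and [amD] may depend on [eps]; the Lipschitz constant 2 in [amCl]
    and [amDl] does not, and it will give a bound on first derivatives uniform in [eps]. [amU]
    expresses that only time and position matter, not the chart in which they are written. *)
Record amplitudes (eps C0 : R) (Ch Dh : 'I_n -> idx n -> R -> (J -> R) -> C) : Prop := Amplitudes {
 amC : forall i, SbC (@hb n) ones (Ch i);
 amD : forall i, SbC (@hb n) ones (Dh i);
 amCb : forall i a r th, hb th -> Rabs (Re (Ch i a r th)) <= eps * C0 /\ Rabs (Im (Ch i a r th)) <= eps * C0;
 amDb : forall i a r th, hb th -> Rabs (Re (Dh i a r th)) <= eps * C0 /\ Rabs (Im (Dh i a r th)) <= eps * C0;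
 amsm : 4 * eps * C0 <= cst n;
 amCl : forall i a r th c s, hb th -> hb (updI th c s) ->
  Rabs (Re (Ch i a r (updI th c s)) - Re (Ch i a r th)) <= 2 * Rabs (s - th c) /\
  Rabs (Im (Ch i a r (updI th c s)) - Im (Ch i a r th)) <= 2 * Rabs (s - th c);
 amDl : forall i a r th c s, hb th -> hb (updI th c s) ->
  Rabs (Re (Dh i a r (updI th c s)) - Re (Dh i a r th)) <= 2 * Rabs (s - th c) /\
  Rabs (Im (Dh i a r (updI th c s)) - Im (Dh i a r th)) <= 2 * Rabs (s - th c);
 amCI : forall i a th, hb th -> ACC (fun r => Cf Ch i a r th)
   (fun r => (eps * dCf th_tau th_xi Ch Dh b i a r th)%C);
 amDI : forall i a th, hb th -> ACC (fun r => Df Dh i a r th)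
   (fun r => (eps * dDf th_tau th_xi Ch Dh b i a r th)%C);
 amC1 : forall i a th, hb th -> Cf Ch i a 1 th = RtoC 0;
 amD0 : forall i a th, hb th -> Df Dh i a 0 th = RtoC 0;
 amU : forall a a' th th', hb th -> hb th' -> iax a = iax a' -> iaxi a = iaxi a' ->
  tt a th = tt a' th' -> xx a th = xx a' th' -> forall i r, I01 r ->
  Cf Ch i a r th = Cf Ch i a' r th' /\ Df Dh i a r th = Df Dh i a' r th' }.

Lemma amplitudes_exist : exists eps1 C0, 0 < eps1 /\ 0 <= C0 /\ forall eps, 0 < eps < eps1 ->
 exists Ch Dh, amplitudes eps C0 Ch Dh.
Proof.
have bo := @box_open _ (@rad n).
have S0 := g0S s0p bsm bdec.
have [dg Hdg] := choice _ (fun x : I * I => SbI_pd bo (S0 x.1) x.2).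
have [K1 HK1] := choice _ (fun c : I => Sb_bound (S0 c 0%N)).
have [K2 HK2] := choice _ (fun x : I * I => Sb_bound (proj2 (Hdg x) 0%N)).
pose C0 := fsum K1 + fsum K2.
have F1 : 0 <= fsum K1 by apply: fsum_ge0 => x; case: (HK1 x).
have F2 : 0 <= fsum K2 by apply: fsum_ge0 => x; case: (HK2 x).
have C00 : 0 <= C0 by rewrite /C0; lra.
have Wp a r : 0 < Wn sgm a r := Wn_pos s0p a r.
pose dg0 c c' := dg (c, c').
have dg0P c c' a r y : I01 r -> box (@rad n) y -> pd (g0 b c a r) c' y (dg0 c c' a r y).
 by apply: (proj1 (Hdg (c, c'))).
have dg0S c c' : SbI (box (@rad n)) (Wn sgm) (dg0 c c') := proj2 (Hdg (c, c')).
have g0b c a r y : I01 r -> box (@rad n) y -> Rabs (g0 b c a r y) <= C0 * Wn sgm a r.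
 move=> Hr Hy; bound (proj2 (HK1 c) a r y Hr Hy).
 apply: Rmult_le_compat_r; first pos.
 have : K1 c <= fsum K1 by [apply: fsum_term => x; case: (HK1 x)]; rewrite /C0; lra.
have dg0b c c' a r y : I01 r -> box (@rad n) y -> Rabs (dg0 c c' a r y) <= C0 * Wn sgm a r.
 move=> Hr Hy; bound (proj2 (HK2 (c, c')) a r y Hr Hy).
 apply: Rmult_le_compat_r; first pos.
 have : K2 (c, c') <= fsum K2 by [apply: fsum_term => x; case: (HK2 x)]; rewrite /C0; lra.
set N := 1 + INR #|{: I}|.
have N1 : 1 <= N by rewrite /N; have := pos_INR #|{: I}|; lra.
(* The summand 1 keeps the denominator positive when [C0] vanishes. *)
exists (cst n / (4 * C0 * N + 1)), C0; split; last split => //.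
 by apply: Rdiv_lt_0_compat; [apply: cst_pos|have := Rmult_le_pos _ _ C00 (Rle_trans _ _ _ Rle_0_1 N1); lra].
move=> eps [ep esm'].
have esm : 4 * eps * C0 * N <= cst n.
 have P := Rmult_le_pos _ _ C00 (Rle_trans _ _ _ Rle_0_1 N1).
 have : eps * (4 * C0 * N + 1) <= cst n.
  apply: Rlt_le; apply: (Rmult_lt_reg_r (/ (4 * C0 * N + 1))); first pos.
  rewrite Rmult_assoc Rinv_r; lra.
 nra.
pose S := Seps s0p bsm bdec C00 dg0P dg0S g0b dg0b ep esm.
have [P HP] : exists P, forall a th, box (fun c => sr S c / 2) th -> sol S a th (P a th).
 have ex (x : idx n * (I -> R)) : exists P', box (fun c => sr S c / 2) x.2 -> sol S x.1 x.2 P'.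
  case: (classic (box (fun c => sr S c / 2) x.2)) => [H|H].
   by have [P' HP'] := sol_exists x.1 H; exists P'.
  by exists (fun _ _ => 0).
 have [Q HQ] := choice _ ex.
 by exists (fun a th => Q (a, th)) => a th; apply: (HQ (a, th)).
pose z0 := (fun _ => 0) : bool * bool * 'I_n -> R.
have HPe a th : hb th -> sol S a (emb th z0) (P a (emb th z0)) by move=> H; apply: HP; apply: hb_emb.
pose PP a r th c := P a (emb th z0) r (inr c).
pose Ch i a r th : C := (PP a r th (false, false, i), PP a r th (false, true, i)).
pose Dh i a r th : C := (PP a r th (true, false, i), PP a r th (true, true, i)).
have PS c : SbI (@hb n) ones (fun a r th => PP a r th c).
 move=> k; apply: (Sb_emb (D := box (fun c => sr S c / 2)) (s := z0) (f := fun a r th => P a th r (inr c))).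
  by apply: hb_emb.
 exact: sol_smooth.
have Pb a r th c : hb th -> Rabs (PP a r th c) <= eps * C0.
 move=> H; exact: (sol_small _ r (HPe a th H)).
have Pc a r th o : hb th -> P a (emb th z0) r (inl o) = th o.
 move=> H; exact: (sol_const _ r (HPe a th H)).
have c0 := cst_pos n.
have e1 : 4 * eps * C0 <= cst n.
 nra.
pose rh (s : bool) := if s then dDf th_tau th_xi Ch Dh b else dCf th_tau th_xi Ch Dh b.
pose am (s : bool) := if s then Df Dh else Cf Ch.
have EC (s : bool) i a r th : hb th -> (if s then sdD b else sdC b) i a r (P a (emb th z0) r) = rh s i a r th.
 move=> H; case: s; [rewrite [LHS]dDf_phys [RHS]dDf_phys; congr phD|rewrite [LHS]dCf_phys [RHS]dCf_phys; congr phC]; try by []; first [by rewrite /tf /st_tau /th_tau Pc|by apply: funext => j; rewrite /xf /st_xi /th_xi Pc].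
have Pcl a th q : hb th -> P a (emb th z0) q = P a (emb th z0) (clamp q).
 move=> H; apply: funext => c; have E := proj2 (proj2 (HPe a th H)) c.
 by rewrite E (E (clamp q)) /rhs /Lop clampK.
have aE s im i a r th : cpart im (am s i a r th) = cst n / gm a (inr (s, im, i)) r * PP a r th (s, im, i).
 by case: s; case: im; rewrite /am /Df /Cf cpart_scal.
have IC s im i a th : hb th ->
  (forall r, continuous (fun r => eps * cpart im (rh s i a (clamp r) th)) r) /\
  forall r, I01 r -> cpart im (am s i a r th) = RInt (fun r => eps * cpart im (rh s i a (clamp r) th)) (endpt (~~ s)) r.
 move=> H; set k := (s, im, i).
 pose g r := eps * g0 b (inr k) a (clamp r) (P a (emb th z0) r) / gm a (inr k) (clamp r).
 have g1 r := gm_ge1 a (inr k) (clampP r).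
 have pt r : cst n * g r = eps * cpart im (rh s i a (clamp r) th).
  rewrite /g (Pcl _ _ r H) -(EC s) //; have := g1 r; rewrite /k; case: s {k g g1} => /= ?; rewrite !cpart_scal; field; lra.
 have gc r : continuous g r.
  apply: cont_mult; first exact: (path_cont (sol_path (HPe a th H)) (sgS S (inr k))).
  apply: (continuous_comp (fun r => gm a (inr k) (clamp r)) Rinv); first exact: gm_cont.
  apply: continuous_Rinv; have := g1 r; lra.
 split => [r|r Hr].
  by apply: (continuous_ext (fun r => cst n * g r)) => [q|]; [exact: pt|apply: cont_mult; [cont|exact: gc]].
 rewrite aE /PP (proj2 (proj2 (HPe a th H))) /rhs /Lop (clamp_id Hr).
 rewrite (_ : _ * _ = cst n * RInt g (endpt (~~ s)) r); last first.
  have := gm_ge1 a (inr k) Hr => ?; rewrite -/k -[emb _ _ _]/0 -[RInt _ _ _]/(RInt g (endpt (~~ s)) r) -[sm _ _ _ _]/(gm a (inr k) r); field; lra.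
 rewrite -[LHS](RInt_scal (V := R_CompleteNormedModule)); last exact: ex_RInt_continuous.
 exact: RInt_ext.
have Pl a r th c s k : hb th -> hb (updI th c s) -> Rabs (PP a r (updI th c s) k - PP a r th k) <= 2 * Rabs (s - th c).
 move=> H H'; rewrite -[2 * _]Rmult_1_r.
 apply: (sol_lip (Rabs_pos _) (HPe a th H) (HPe a _ H')) => -[o|o] /=; last by rewrite Rminus_diag Rabs_R0 Rmult_1_r; pos.
 rewrite /updI; case: eqP => [->|_]; first lra.
 rewrite Rminus_diag Rabs_R0 Rmult_1_r; pos.
have AI s i a th : hb th -> ACC (fun r => am s i a r th) (fun r => (eps * rh s i a r th)%C).
 move=> H; have gen im : AC (fun r => cpart im (am s i a r th)) (fun r => eps * cpart im (rh s i a r th)).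
  have [cc ii] := IC s im i a th H.
  apply: (AC_int (u0 := cpart im (am s i a 0 th))) => // r Hr; rewrite !ii //; last lra.
  by rewrite -[X in X = _](RInt_Chasles _ (endpt (~~ s)) 0 r) //; apply: ex_RInt_continuous.
 split; [apply: AC_ext (gen false)|apply: AC_ext (gen true)] => r _ //; by rewrite ?Re_RtoC_mult ?Im_RtoC_mult.
have A0 s i a th : hb th -> am s i a (endpt (~~ s)) th = RtoC 0.
 move=> H; have h im := proj2 (IC s im i a th H) (endpt (~~ s)) ltac:(rewrite /endpt; case: (s) => /=; lra).
 move: (h false) (h true); rewrite !RInt_point /cpart /zero; clear.
 by case: (am s i a (endpt (~~ s)) th) => u v /= -> ->.
exists Ch, Dh; split => //.
- by split; apply: PS.
- by split; apply: PS.
- by split; apply: Pb.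
- by split; apply: Pb.
- by split; apply: Pl.
- by split; apply: Pl.
- by move=> i a th; apply: (AI false).
- by move=> i a th; apply: (AI true).
- by move=> i a th; apply: (A0 false).
- by move=> i a th; apply: (A0 true).
- move=> a a' th th' H H' Eax Ee Et Ex.
 (* The solution of the second chart rescaled to the first. The times of the two charts differ by
    less than one, so the scales differ by a factor of at most 2; the amplitudes being of order
    [eps], [Q] stays in the box. It solves the system of the first chart, and uniqueness identifies
    it with the solution there. *)
 pose Q r (c : I) := match c with inl o => th o
  | inr k => gm a (inr k) (clamp r) / gm a' (inr k) (clamp r) * P a' (emb th' z0) r (inr k) end.
 have ratio c r : 0 < gm a c (clamp r) / gm a' c (clamp r) <= 2.
  have g1 := gm_ge1 a c (clampP r); have g2 := gm_ge1 a' c (clampP r).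
  split; first pos.
  apply/Rle_div_l; first lra.
  have tdiff : Rabs (it a) <= Rabs (it a') + 1.
   move: (H None) (H' None) (cst_le n) Et; rewrite /tt /=; clear.
   split_Rabs; lra.
  have := clampP r; case: c g1 g2 => [o|[[[] im] i]] /=; rewrite /mC /mD => *; try lra.
   nra.
  nra.
 have AE s i r : (if s then Df (@st_D n) else Cf (@st_C n)) i a (clamp r) (Q r) = am s i a' (clamp r) th'.
  move: (mC_ge1 (it a) (clampP r)) (mC_ge1 (it a') (clampP r)) (mD_ge1 (it a) (clampP r)) (mD_ge1 (it a') (clampP r)) => *.
  rewrite /am; case: s; rewrite /Df /Cf /st_C /st_D /Ch /Dh /PP /Q (Pcl _ _ r H') /Cmult /RtoC /=; congr pair; field; lra.
 have xE r : (fun i => xf (@st_xi n) i a (clamp r) (Q r)) = (fun i => xf th_xi i a' (clamp r) th').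
  by [].
 have sE (s : bool) i r : (if s then sdD b else sdC b) i a (clamp r) (Q r) = rh s i a' (clamp r) th'.
  have HC : (fun i => Cf (@st_C n) i a (clamp r) (Q r)) = (fun i => Cf Ch i a' (clamp r) th') by apply: funext => k; apply: (AE false).
  have HD : (fun i => Df (@st_D n) i a (clamp r) (Q r)) = (fun i => Df Dh i a' (clamp r) th') by apply: funext => k; apply: (AE true).
  have HT : tf (@st_tau n) a (clamp r) (Q r) = tf th_tau a' (clamp r) th' by [].
  by case: s; [rewrite [LHS]dDf_phys [RHS]dDf_phys|rewrite [LHS]dCf_phys [RHS]dCf_phys]; rewrite Eax Ee xE HC HD HT.
 have solQ : sol S a (emb th z0) Q.
  have g1 k r := gm_ge1 a k (clampP r); have g2 k r := gm_ge1 a' k (clampP r).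
  split; last split.
  + move=> [o|k] s; first exact: continuous_const.
   rewrite /Q.
   apply: cont_mult; last exact: (proj1 (HPe a' th' H')).
   apply: cont_mult; first exact: gm_cont.
   apply: (continuous_comp (fun r => gm a' (inr k) (clamp r)) Rinv); first exact: gm_cont.
   apply: continuous_Rinv; have := g2 (inr k) s; lra.
  + move=> s [o|k]; first by move: (H o) => /=; lra.
   suff : Rabs (Q s (inr k)) < 1 by [].
   rewrite /Q.
   rewrite Rabs_mult Rabs_pos_eq; last by case: (ratio (inr k) s) => h _; apply: Rlt_le.
   case: (ratio (inr k) s) => h1 h2; apply: (@Rle_lt_trans _ (2 * (eps * C0))); last by have := cst_le n; lra.
   by apply: Rmult_le_compat; [apply: Rlt_le|apply: Rabs_pos| |apply: (Pb a' s th' k H')].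
  + move=> [o|k] s.
    rewrite /= /rhs /Lop /= Rmult_1_l (RInt_ext _ (fun _ => 0)); last pos.
    rewrite RInt_const /scal /= /mult /=; ring.
   rewrite /Q {1}(proj2 (proj2 (HPe a' th' H')) (inr k) s) /= !Rplus_0_l /rhs /Lop /=.
   rewrite -Rmult_assoc (_ : gm a (inr k) (clamp s) / gm a' (inr k) (clamp s) * gm a' (inr k) (clamp s) = gm a (inr k) (clamp s)); last by field; have := g2 (inr k) s; lra.
   congr (_ * _); apply: RInt_ext => r _.
   have := g1 (inr k) r; have := g2 (inr k) r.
   case: k => [[s' im] i].
   case: s' => /= *; rewrite !cpart_scal; [rewrite (sE true i r) (Pcl _ _ r H') (EC true)|rewrite (sE false i r) (Pcl _ _ r H') (EC false)] => //; field; lra.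
 have EQ : Q = P a (emb th z0) := sol_unique solQ (HPe a th H).
 move=> i r Hr; have := AE false i r; have := AE true i r; rewrite /= (clamp_id Hr) EQ => <- <-.
 by [].
Qed.

End Physical.

(** * The phase and its first derivatives *)

Section ComplexSums.
Variable I : finType.
Implicit Types F G : I -> C.

Lemma csum_ext F G : (forall i, F i = G i) -> csum F = csum G.
Proof. by move=> E; congr csum; apply: funext. Qed.

Lemma csum_plus F G : csum (fun i => (F i + G i)%C) = (csum F + csum G)%C.
Proof. by congr pair; rewrite -fsum_plus. Qed.

Lemma csum_scal k F : csum (fun i => (k * F i)%C) = (k * csum F)%C.
Proof.
rewrite /csum /Cmult /=; congr pair.
 by rewrite -(fsum_scal k.1) -(fsum_scal k.2) -fsum_minus; cont.
by rewrite -(fsum_scal k.1) -(fsum_scal k.2) -fsum_plus; cont.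
Qed.

Lemma csum_scalr k F : csum (fun i => (F i * k)%C) = (csum F * k)%C.
Proof. by rewrite Cmult_comm -csum_scal; apply: csum_ext => i; rewrite Cmult_comm. Qed.

Lemma csum_0 : csum (fun _ : I => RtoC 0) = RtoC 0.
Proof. by rewrite /csum /= !fsum_0. Qed.

Lemma csum_pick i (v : I -> C) : csum (fun j => if j == i then v j else RtoC 0) = v i.
Proof.
apply: injective_projections.
 by rewrite -[RHS](fsum_pick i (fun j => Re (v j))); apply: fsum_ext => j; case: (j == i).
by rewrite -[RHS](fsum_pick i (fun j => Im (v j))); apply: fsum_ext => j; case: (j == i).
Qed.

End ComplexSums.

Lemma csum_exchange (I J : finType) (F : I -> J -> C) :
 csum (fun i => csum (fun j => F i j)) = csum (fun j => csum (fun i => F i j)).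
Proof. by congr pair; rewrite fsum_exchange. Qed.

Lemma csum_sum (I J : finType) (F : I + J -> C) :
 csum F = Cplus (csum (fun i => F (inl i))) (csum (fun j => F (inr j))).
Proof. by congr pair; rewrite fsum_sum. Qed.

Section ComplexDerivative.
Implicit Types (f g : R -> C) (l m : C) (x : R).

Lemma derivC_unique f x l m : derivC f x l -> derivC f x m -> l = m.
Proof.
move=> [a1 b1] [a2 b2]; apply: injective_projections.
 by rewrite -[LHS](is_derive_unique _ _ _ a1) -[RHS](is_derive_unique _ _ _ a2).
by rewrite -[LHS](is_derive_unique _ _ _ b1) -[RHS](is_derive_unique _ _ _ b2).
Qed.

Lemma derivC_ext f g x l : (forall s, f s = g s) -> derivC f x l -> derivC g x l.
Proof. by move=> E; rewrite (funext f g E). Qed.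

Lemma derivC_const k x : derivC (fun _ => k) x (RtoC 0).
Proof. by split; apply: is_derive_const. Qed.

Lemma derivC_RtoC (f : R -> R) x (l : R) : is_derive f x l -> derivC (fun s => RtoC (f s)) x (RtoC l).
Proof. by split => //; apply: is_derive_const. Qed.

Lemma derivC_plus f g x l m : derivC f x l -> derivC g x m ->
 derivC (fun s => (f s + g s)%C) x (l + m)%C.
Proof. by move=> [a1 b1] [a2 b2]; split; apply: der_plus. Qed.

Lemma derivC_mult f g x l m : derivC f x l -> derivC g x m ->
 derivC (fun s => (f s * g s)%C) x (l * g x + f x * m)%C.
Proof.
have pm (u v : R -> R) u' v' : is_derive u x u' -> is_derive v x v' ->
  is_derive (fun s => u s * v s) x (u' * v x + u x * v').
 by move=> h1 h2; have := @is_derive_mult R_AbsRing _ _ _ _ _ h1 h2 Rmult_comm.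
move=> [a1 b1] [a2 b2]; split.
- have := @is_derive_minus R_AbsRing R_NormedModule _ _ _ _ _ (pm _ _ _ _ a1 a2) (pm _ _ _ _ b1 b2).
 congr (is_derive _ _ _); rewrite /minus /plus /opp /Re /Im /Cmult /Cplus /=; ring.
- have := @is_derive_plus R_AbsRing R_NormedModule _ _ _ _ _ (pm _ _ _ _ a1 b2) (pm _ _ _ _ b1 a2).
 congr (is_derive _ _ _); rewrite /plus /Re /Im /Cmult /Cplus /=; ring.
Qed.

Lemma derivC_scal k f x l : derivC f x l -> derivC (fun s => (k * f s)%C) x (k * l)%C.
Proof. by move=> H; have := derivC_mult (derivC_const k x) H; rewrite Cmult_0_l Cplus_0_l. Qed.

Lemma derivC_csum (I : finType) (f : I -> R -> C) (l : I -> C) x : (forall i, derivC (f i) x (l i)) ->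
 derivC (fun s => csum (fun i => f i s)) x (csum l).
Proof.
by split; apply: (@fsum_is_derive _ (fun s i => _ (f i s)) (fun i => _ (l i))) => i; case: (H i).
Qed.

End ComplexDerivative.

Section ClassExtras.
Variables (A : Type) (I : finType) (D : (I -> R) -> Prop).
Hypothesis Dopen : openI D.

Lemma Sb_at W k (f : A -> R -> (I -> R) -> R) r0 : 0 <= r0 <= 1 -> Sb D W k f ->
 Sb D (fun a _ => W a r0) k (fun a _ y => f a r0 y).
Proof.
move=> H0; elim: k f => [|k IH] f H; (split; [|split]).
- by have [C [C0 HC]] := Sb_bound H; exists C; cont.
- by cont.
- by [].
- by have [C [C0 HC]] := Sb_bound H; exists C; cont.
- by cont.
- move=> c; have [f' [H1 H2]] := Sb_pd H c; exists (fun a _ y => f' a r0 y); split; last exact: IH.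
 pos.
Qed.

Lemma SbC_at W (f : A -> R -> (I -> R) -> C) r0 : 0 <= r0 <= 1 -> SbC D W f ->
 SbC D (fun a _ => W a r0) (fun a _ y => f a r0 y).
Proof.
move=> H0 [H1 H2]; split => k.
 exact: (Sb_at (f := fun a r y => Re (f a r y)) H0 (H1 k)).
exact: (Sb_at (f := fun a r y => Im (f a r y)) H0 (H2 k)).
Qed.

Definition primiC (f : A -> R -> (I -> R) -> C) a s y : C :=
 (primi (fun a r y => Re (f a r y)) a s y, primi (fun a r y => Im (f a r y)) a s y).

Variables (W : A -> R -> R) (K : R).
Hypotheses (W0 : forall a r, I01 r -> 0 <= W a r) (Wc : forall a r, continuous (fun r => W a (clamp r)) r) (WK : forall a, RInt (fun r => W a (clamp r)) 0 1 <= K).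

Lemma primiC_SbC f : SbC D W f -> SbC D ones (primiC f).
Proof. by move=> [H1 H2]; split; apply: (primi_Sb Dopen W0 Wc WK). Qed.

Lemma primiC_pd f f' c : SbC D W f -> (forall a r y, I01 r -> D y -> pdC (f a r) c y (f' a r y)) ->
 SbC D W f' -> forall a s y, I01 s -> D y -> pdC (primiC f a s) c y (primiC f' a s y).
Proof.
move=> [S1 S2] H [S1' S2'] a s y Hs Dy; split.
 apply: (primi_pd Dopen W0 Wc WK (f := fun a r y => Re (f a r y)) (f' := fun a r y => Re (f' a r y)) S1 _ S1' a Hs Dy).
 by move=> *; apply: (proj1 (H _ _ _ _ _)).
apply: (primi_pd Dopen W0 Wc WK (f := fun a r y => Im (f a r y)) (f' := fun a r y => Im (f' a r y)) S2 _ S2' a Hs Dy).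
by move=> *; apply: (proj2 (H _ _ _ _ _)).
Qed.

Lemma SbC_cont V (f : A -> R -> (I -> R) -> C) a y : SbC D V f -> D y ->
 (forall r, continuous (fun r => Re (f a (clamp r) y)) r) /\ (forall r, continuous (fun r => Im (f a (clamp r) y)) r).
Proof.
move=> [H1 H2] Dy; split; first exact: (Sb_cont (H1 0%N)).
exact: (Sb_cont (H2 0%N)).
Qed.

Lemma primiC_ACC V (f : A -> R -> (I -> R) -> C) u u0 a y : SbC D V f -> D y ->
 (forall r, I01 r -> u r = (u0 + primiC f a r y)%C) -> ACC u (fun r => f a r y).
Proof.
move=> Sf Dy Hu; have [c1 c2] := SbC_cont a Sf Dy; split.
 by apply: (AC_int (u0 := Re u0)) => // r Hr; rewrite Hu.
by apply: (AC_int (u0 := Im u0)) => // r Hr; rewrite Hu.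
Qed.

Lemma ACC_primiC V (f : A -> R -> (I -> R) -> C) u a y : SbC D V f -> D y -> ACC u (fun r => f a r y) ->
 forall r, I01 r -> u r = (u 0 + primiC f a r y)%C.
Proof.
move=> Sf Dy [h1 h2] r Hr; have e1 := AC_FTC h1 Hr; have e2 := AC_FTC h2 Hr.
apply: injective_projections; rewrite /primiC /primi /=.
 move: e1; rewrite /Re; lra.
move: e2; rewrite /Im; lra.
Qed.

End ClassExtras.

(** * The extended Hamiltonian *)

Section Phase.
Variables (n : nat) (b : 'I_n -> 'I_n -> vec n -> R) (sgm : R) (Ad : nat -> R).
Hypotheses (s0p : 0 < sgm) (bsm : forall j k, smooth_Rn (b j k)) (bdec : decays b sgm Ad) (bsym : forall j k x, b j k x = b k j x).
Variable eps : R.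

Lemma EB_sym j k ds l p q : EB b j k ds l p q = EB b k j ds l p q.
Proof. by rewrite /EB (funext _ _ (bsym j k)). Qed.

Definition Ht (p q : vec n) (zeta : 'I_n -> C) : C :=
 (csum (fun j => (zeta j * zeta j)) + eps * csum (fun j => csum (fun k => (EB b j k [::] 0 p q * (zeta j * zeta k)))))%C.

(** The failure of the Cauchy-Riemann equations for the extended coefficients. *)
Definition cr (p q : vec n) (zeta : 'I_n -> C) (i : 'I_n) : C :=
 csum (fun j => csum (fun k => ((EB b j k [:: i] 1 p q - Ci * EB b j k [:: i] 0 p q) * (zeta j * zeta k))%C)).

Definition vel (p q : vec n) (zeta : 'I_n -> C) (j : 'I_n) : C :=
 (2 * zeta j + eps * gg b p q zeta j)%C.

(** Euler's relation for a quadratic form. It turns the action, the integral of [zeta dz - H dt],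
    into the integral of [H dt]. *)
Lemma Ht_homog p q zeta : csum (fun j => (zeta j * vel p q zeta j)%C) = (2 * Ht p q zeta)%C.
Proof.
rewrite /Ht /vel Cmult_plus_distr_l -!csum_scal -csum_plus; apply: csum_ext => j.
rewrite Cmult_plus_distr_l; congr Cplus; first ring.
rewrite /gg -!csum_scal; apply: csum_ext => k; ring.
Qed.

Definition dHt (p q : vec n) (zeta : 'I_n -> C) (dz dzeta : 'I_n -> C) : C :=
 (csum (fun j => (vel p q zeta j * dzeta j)) + eps * csum (fun i => (Im (dz i) * cr p q zeta i - ff b p q zeta i * dz i)))%C.

(** The extension is differentiated in the real variables [p] and [q]. Its [q]-derivative is [i]
    times its [p]-derivative up to the defect, which therefore enters with the factor
    [Im (dz i)]. *)
Lemma Ht_derive (p q : R -> vec n) (zeta : R -> 'I_n -> C) (dz dzeta : 'I_n -> C) s :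
 (forall i, is_derive (fun s => p s i) s (Re (dz i))) ->
 (forall i, is_derive (fun s => q s i) s (Im (dz i))) ->
 (forall i, derivC (fun s => zeta s i) s (dzeta i)) ->
 derivC (fun s => Ht (p s) (q s) (zeta s)) s (dHt (p s) (q s) (zeta s) dz dzeta).
Proof.
move=> Hp Hq Hz.
pose E' j k := csum (fun c => (emb (fun i => Re (dz i)) (fun i => Im (dz i)) c * EEd (fun ds => dxs ds (b j k)) [::] 0 (p s) (q s) c)%C).
have HE j k : derivC (fun s => EB b j k [::] 0 (p s) (q s)) s (E' j k).
 apply: (@EE_curve _ (fun ds => dxs ds (b j k)) Ad sgm s0p) => //.
 by apply: pd_dxs.
set z := zeta s.
have raw : derivC (fun s => Ht (p s) (q s) (zeta s)) s
  (csum (fun j => (dzeta j * z j + z j * dzeta j)) + eps * csum (fun j => csum (fun k => (E' j k * (z j * z k) + EB b j k [::] 0 (p s) (q s) * (dzeta j * z k + z j * dzeta k)))))%C.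
 apply: derivC_plus.
  by apply: (derivC_csum (f := fun j s => (zeta s j * zeta s j)%C)) => j; apply: derivC_mult.
 apply: derivC_scal.
 apply: (derivC_csum (f := fun j s => csum (fun k => (EB b j k [::] 0 (p s) (q s) * (zeta s j * zeta s k))%C))) => j.
 apply: (derivC_csum (f := fun k s => (EB b j k [::] 0 (p s) (q s) * (zeta s j * zeta s k))%C)) => k.
 by apply: derivC_mult => //; apply: derivC_mult.
move: raw; congr derivC; rewrite /dHt.
have -> : csum (fun j => csum (fun k => (E' j k * (z j * z k) + EB b j k [::] 0 (p s) (q s) * (dzeta j * z k + z j * dzeta k))%C)) =
 (csum (fun j => csum (fun k => (E' j k * (z j * z k)))) + csum (fun j => csum (fun k => (EB b j k [::] 0 (p s) (q s) * (dzeta j * z k + z j * dzeta k)))))%C.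
 by rewrite -csum_plus; apply: csum_ext => j; rewrite -csum_plus.
have -> : csum (fun j => csum (fun k => (EB b j k [::] 0 (p s) (q s) * (dzeta j * z k + z j * dzeta k))%C)) =
  csum (fun j => (gg b (p s) (q s) z j * dzeta j)%C).
 have -> : csum (fun j => csum (fun k => (EB b j k [::] 0 (p s) (q s) * (dzeta j * z k + z j * dzeta k))%C)) =
  (csum (fun j => csum (fun k => (EB b j k [::] 0 (p s) (q s) * (dzeta j * z k)))) + csum (fun j => csum (fun k => (EB b j k [::] 0 (p s) (q s) * (z j * dzeta k)))))%C.
  rewrite -csum_plus; apply: csum_ext => j; rewrite -csum_plus; apply: csum_ext => k; ring.
 rewrite [X in Cplus _ X]csum_exchange -csum_plus; apply: csum_ext => j.
 rewrite /gg -csum_plus -csum_scal -csum_scalr; apply: csum_ext => k.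
 rewrite (EB_sym k j); ring.
have -> : csum (fun j => csum (fun k => (E' j k * (z j * z k))%C)) =
 csum (fun i => (Im (dz i) * cr (p s) (q s) z i - ff b (p s) (q s) z i * dz i)%C).
 have -> : csum (fun j => csum (fun k => (E' j k * (z j * z k))%C)) =
  csum (fun j => csum (fun k => csum (fun i => ((Re (dz i) * EB b j k [:: i] 0 (p s) (q s) + Im (dz i) * EB b j k [:: i] 1 (p s) (q s)) * (z j * z k))%C))).
  apply: csum_ext => j; apply: csum_ext => k; rewrite csum_scalr; congr Cmult.
  by rewrite /E' csum_sum -csum_plus; cont.
 have -> : csum (fun j => csum (fun k => csum (fun i => ((Re (dz i) * EB b j k [:: i] 0 (p s) (q s) + Im (dz i) * EB b j k [:: i] 1 (p s) (q s)) * (z j * z k))%C))) =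
  csum (fun i => csum (fun j => csum (fun k => ((Re (dz i) * EB b j k [:: i] 0 (p s) (q s) + Im (dz i) * EB b j k [:: i] 1 (p s) (q s)) * (z j * z k))%C))).
  by rewrite [RHS]csum_exchange; apply: csum_ext => j; rewrite csum_exchange.
 apply: csum_ext => i; rewrite /cr /ff.
 have -> : forall u v w, (u - (- v) * w)%C = (u + w * v)%C by move=> *; ring.
 rewrite -!csum_scal -csum_plus; apply: csum_ext => j; rewrite -!csum_scal -csum_plus; apply: csum_ext => k.
 have E : dz i = (Re (dz i) + Ci * Im (dz i))%C.
  case: (dz i) => u v; rewrite /Cplus /Cmult /Ci /RtoC /=; congr pair; ring.
 rewrite [X in (X * (EB _ _ _ _ _ _ _ * _))%C]E.
 move: (EB _ _ _ _ 0 _ _) (EB _ _ _ _ 1 _ _) (RtoC (Re _)) (RtoC (Im _)) (z j) (z k) => e0 e1 u v z1 z2.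
 ring.
have -> : csum (fun j => (vel (p s) (q s) z j * dzeta j)%C) =
  (csum (fun j => (dzeta j * z j + z j * dzeta j)) + eps * csum (fun j => (gg b (p s) (q s) z j * dzeta j)))%C.
 rewrite -csum_scal -csum_plus; apply: csum_ext => j; rewrite /vel; ring.
ring.
Qed.

End Phase.

Lemma pair_C (x y : R) : (x, y) = (x + Ci * y)%C :> C.
Proof. rewrite /Cplus /Cmult /Ci /RtoC /=; congr pair; ring. Qed.

Lemma RInt_clamp_scal k (f : R -> R) s : (forall r, continuous (fun r => f (clamp r)) r) ->
 RInt (fun r => k * f (clamp r)) 0 s = k * RInt (fun r => f (clamp r)) 0 s.
Proof.
move=> c; apply: (RInt_scal (V := R_CompleteNormedModule) (fun r => f (clamp r)) 0 s k).
by apply: ex_RInt_continuous.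
Qed.

Section PrimitiveAlgebra.
Variables (A : Type) (I : finType) (D : (I -> R) -> Prop).
Hypothesis Dopen : openI D.
Implicit Types f g : A -> R -> (I -> R) -> C.

Lemma primiC_ext f g a s y : I01 s -> (forall r, I01 r -> f a r y = g a r y) ->
 primiC f a s y = primiC g a s y.
Proof. by move=> Hs E; congr pair; apply: RInt_ext => r _; rewrite E //; apply: clampP. Qed.

Lemma primiC_plus V1 V2 f g a s y : SbC D V1 f -> SbC D V2 g -> D y ->
 primiC (fun a r y => (f a r y + g a r y)%C) a s y = (primiC f a s y + primiC g a s y)%C.
Proof.
move=> Sf Sg Dy; have [f1 f2] := SbC_cont a Sf Dy; have [g1 g2] := SbC_cont a Sg Dy.
by rewrite /primiC /primi /Cplus /=; congr pair; rewrite -[RHS](RInt_plus (V := R_CompleteNormedModule)) //;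
 apply: ex_RInt_continuous => z _; pos.
Qed.

Lemma primiC_scal V f (k : A -> (I -> R) -> R) a s y : SbC D V f -> D y ->
 primiC (fun a r y => (k a y * f a r y)%C) a s y = (k a y * primiC f a s y)%C.
Proof.
move=> Sf Dy; have [f1 f2] := SbC_cont a Sf Dy.
apply: injective_projections.
 have -> : fst (k a y * primiC f a s y)%C = k a y * primi (fun a r y => Re (f a r y)) a s y by exact: Re_RtoC_mult.
 rewrite /primi -(@RInt_clamp_scal _ (fun r => Re (f a r y))) //.
 by apply: RInt_ext => r _; rewrite Re_RtoC_mult.
have -> : snd (k a y * primiC f a s y)%C = k a y * primi (fun a r y => Im (f a r y)) a s y by exact: Im_RtoC_mult.
rewrite /primi -(@RInt_clamp_scal _ (fun r => Im (f a r y))) //.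
by apply: RInt_ext => r _; rewrite Im_RtoC_mult.
Qed.

Lemma pdC_ext (h1 h2 : (I -> R) -> C) c y l : (forall z, D z -> h1 z = h2 z) -> D y ->
 pdC h1 c y l -> pdC h2 c y l.
Proof.
move=> E Dy [H1 H2]; split.
 by apply: (pd_ext Dopen (h1 := fun z => Re (h1 z)) (h2 := fun z => Re (h2 z))) => // z Dz; rewrite E.
by apply: (pd_ext Dopen (h1 := fun z => Im (h1 z)) (h2 := fun z => Im (h2 z))) => // z Dz; rewrite E.
Qed.

End PrimitiveAlgebra.

(** Variation of constants reproduces Hamilton's equation because the two sides differ by a multiple
    of [kap t * (1 + 2it) - 1]; the multiple is displayed in the proof. *)
Lemma momentum_alg (t r eps : R) (g f : C) :
 (0 + (Ci * (eps * (t * kap t * (g + 2 * ((t * (1 - r))%R * f)))) + (- / 2)%R * (eps * (t * kap t * ((0, 2) * g - 2 * ((1, 2 * t * r)%R * f))))))%C =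
 (t * (eps * f))%C.
Proof.
have := kap_inv t; move: (kap t) => k.
rewrite !pair_C !RtoC_mult !RtoC_minus RtoC_opp RtoC_inv; last lra.
move: (RtoC t) (RtoC eps) (RtoC r) => T e s K.
set L := LHS; set M := RHS.
have -> : L = (M + M * (k * (1 + Ci * (2 * T)) - 1))%C.
 rewrite /L /M; field; lra.
rewrite K; ring.
Qed.

Lemma velocity_alg (t r eps dxa y e : R) (g f c d : C) : dxa = y + 2 * t * e ->
 (dxa + ((- y)%R * kap t + ((1 - r) * y)%R * 0 + ((0, 2 * t)%R * c + (1, 2 * t * r)%R * (eps * (t * kap t * (g + 2 * ((t * (1 - r))%R * f)))) + ((- t)%R * d + (t * (1 - r))%R * (eps * (t * kap t * ((0, 2) * g - 2 * ((1, 2 * t * r)%R * f))))))))%C =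
 (t * (2 * (e + ((0, y) * kap t + (Ci * c + (- / 2)%R * d))) + eps * g))%C.
Proof.
move=> ->; have := kap_inv t; move: (kap t) => k.
rewrite !pair_C !RtoC_plus !RtoC_mult !RtoC_minus !RtoC_opp RtoC_inv; last lra.
move: (RtoC t) (RtoC eps) (RtoC r) (RtoC y) (RtoC e) => T p s Y E K.
set L := LHS; set M := RHS.
have -> : L = (M + (Y - p * (T * g)) * (1 - k * (1 + Ci * (2 * T))))%C.
 rewrite /L /M; field; lra.
rewrite K; ring.
Qed.

Definition dtc n (c : option 'I_n) : R := if c is None then 1 else 0.

Lemma tt_derive n (a : idx n) th c : is_derive (fun s => tt a (updI th c s)) (th c) (dtc c).
Proof.
rewrite /tt; case: c => [j|] /=.
 by apply: (is_derive_ext (fun _ => it a + th None)) => [s|]; [|exact: is_derive_const].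
apply: (is_derive_ext (fun s => it a + s)) => [s|]; first by [].
by auto_derive.
Qed.

(** * The phase in a chart and its differential *)

Section ThetaPhase.
Variables (n : nat) (b : 'I_n -> 'I_n -> vec n -> R) (sgm : R) (Ad : nat -> R).
Hypotheses (s0p : 0 < sgm) (bsm : forall j k, smooth_Rn (b j k)) (bdec : decays b sgm Ad) (bsym : forall j k x, b j k x = b k j x).
Notation J := (option 'I_n).
Variables (eps C0 : R) (Ch Dh : 'I_n -> idx n -> R -> (J -> R) -> C).
Hypothesis am : amplitudes b eps C0 Ch Dh.

Notation HB := (@hb n).
Notation fnC := (idx n -> R -> (J -> R) -> C).
Let Dop : openI HB := @hb_open n.

Lemma thtauS : SbI HB ones (@th_tau n).
Proof. move=> k; apply: (@Sb_coord _ _ _ _ None (cst n)) => y /(_ None) /=; have := cst_pos n; lra. Qed.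
Lemma thxiS i : SbI HB ones (@th_xi n i).
Proof. move=> k; apply: (@Sb_coord _ _ _ _ (Some i) (cst n)) => y /(_ (Some i)) /=; have := cst_pos n; lra. Qed.
Lemma thtaub (a : idx n) r th : I01 r -> HB th -> Rabs (th_tau a r th) <= cst n.
Proof. move=> _ /(_ None) /=; have := cst_pos n; rewrite /th_tau; lra. Qed.
Lemma thxib i (a : idx n) r th : I01 r -> HB th -> Rabs (th_xi i a r th) <= cst n.
Proof. move=> _ /(_ (Some i)) /=; have := cst_pos n; rewrite /th_xi; lra. Qed.
Lemma Ch1 i (a : idx n) r th : I01 r -> HB th -> Rabs (Re (Ch i a r th)) <= 1 /\ Rabs (Im (Ch i a r th)) <= 1.
Proof. move=> _ H; have := amCb am i a r H; have := amsm am; have := cst_le n; pos. Qed.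
Lemma Dh1 i (a : idx n) r th : I01 r -> HB th -> Rabs (Re (Dh i a r th)) <= 1 /\ Rabs (Im (Dh i a r th)) <= 1.
Proof. move=> _ H; have := amDb am i a r H; have := amsm am; have := cst_le n; pos. Qed.

Definition tZ i : fnC := zf (@th_tau n) (@th_xi n) Ch Dh i.
Definition tT i : fnC := zt (@th_tau n) (@th_xi n) Ch Dh i.
Definition tE i : fnC := zetaf (@th_tau n) (@th_xi n) Ch Dh i.
Definition tP a r th : vec n := zp (@th_tau n) (@th_xi n) Ch Dh a r th.
Definition tQ a r th : vec n := zq (@th_tau n) (@th_xi n) Ch Dh a r th.

Lemma tTS i : SbC HB ones (tT i).
Proof. exact: (ztS Dop thtauS thxiS (amC am) (amD am) thtaub thxib Ch1 Dh1). Qed.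
Lemma tES i : SbC HB ones (tE i).
Proof. exact: (zetaS Dop thtauS thxiS (amC am) (amD am) thtaub thxib Ch1 Dh1). Qed.
Lemma tgS i : SbC HB (L1 sgm) (fun a r th => gg b (tP a r th) (tQ a r th) (fun i => tE i a r th) i).
Proof. exact: (ggS Dop thtauS thxiS (amC am) (amD am) thtaub thxib Ch1 Dh1 s0p bsm bdec). Qed.
Lemma tfS i : SbC HB (L2 sgm) (fun a r th => ff b (tP a r th) (tQ a r th) (fun i => tE i a r th) i).
Proof. exact: (ffS Dop thtauS thxiS (amC am) (amD am) thtaub thxib Ch1 Dh1 s0p bsm bdec). Qed.
Lemma tBS j k ds l : SbC HB (fun a r => Rpower (Lm (ity a) (it a) r) (- sz sgm ds))
 (fun a r th => EB b j k ds l (tP a r th) (tQ a r th)).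
Proof. exact: (EBS Dop thtauS thxiS (amC am) (amD am) thtaub thxib Ch1 Dh1 s0p bsm bdec). Qed.
Lemma tQ_small a r th : I01 r -> HB th -> vnorm (tQ a r th) <= 1.
Proof. exact: (zq_small thtaub thxib Ch1 Dh1). Qed.
Lemma tP_big a r th : I01 r -> HB th -> cG / 2 * Lm (ity a) (it a) r <= jbr (tP a r th).
Proof. exact: (zp_big thtaub thxib Ch1 Dh1). Qed.

Lemma one_ge0 (a : idx n) (r : R) : I01 r -> 0 <= 1. Proof. lra. Qed.

Lemma L1_le1 (a : idx n) r : I01 r -> L1 sgm a r <= 1 * 1.
Proof. by move=> Hr; rewrite Rmult_1_r; apply: Rpower_neg_le1; [apply: Lm_ge1|lra]. Qed.
Lemma L2_le1 (a : idx n) r : I01 r -> L2 sgm a r <= 1 * 1.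
Proof. by move=> Hr; rewrite Rmult_1_r; apply: Rpower_neg_le1; [apply: Lm_ge1|lra]. Qed.

Definition tV j : fnC := fun a r th => vel b eps (tP a r th) (tQ a r th) (fun i => tE i a r th) j.
Definition tF i : fnC := fun a r th => ff b (tP a r th) (tQ a r th) (fun i => tE i a r th) i.
Definition tR i : fnC := fun a r th => cr b (tP a r th) (tQ a r th) (fun i => tE i a r th) i.
Definition tH : fnC := fun a r th => Ht b eps (tP a r th) (tQ a r th) (fun i => tE i a r th).

Lemma tVS j : SbC HB ones (tV j).
Proof.
apply: SbC_plus; first by apply: (SbC_scal Dop); apply: tES.
by apply: (SbC_scal Dop); apply: (SbC_weak (K := 1)) (tgS j); [lra|exact: L1_le1].
Qed.

Lemma tRS i : SbC HB (L2 sgm) (tR i).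
Proof.
apply: (SbC_csum Dop (@L20 n sgm)) => j; apply: (SbC_csum Dop (@L20 n sgm)) => k.
apply: (SbC_multW Dop (W1 := L2 sgm) (W2 := ones) (K := 1)); [lra|pos| |].
 have B l : SbC HB (L2 sgm) (fun a r th => EB b j k [:: i] l (tP a r th) (tQ a r th)).
  have := tBS j k [:: i] l; pos.
 apply: (SbC_minus Dop); [exact: B|apply: (SbC_scal Dop); exact: B].
by apply: (SbC_mult1 Dop); apply: tES.
Qed.

Lemma tHS : SbC HB ones tH.
Proof.
apply: SbC_plus.
 by apply: (SbC_csum Dop one_ge0) => j; apply: (SbC_mult1 Dop); apply: tES.
apply: (SbC_scal Dop); apply: (SbC_csum Dop one_ge0) => j; apply: (SbC_csum Dop one_ge0) => k.
apply: (SbC_multW Dop (W1 := L1 sgm) (W2 := ones) (K := 1)); [lra| | |].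
- move=> a r Hr; have := L1_le1 a Hr; lra.
- by have := tBS j k [::] 0; rewrite sz0.
- by apply: (SbC_mult1 Dop); apply: tES.
Qed.

Lemma ttS : SbI HB (fun a _ => TT (it a)) (fun a r th => tt a th).
Proof. exact: (tS thtauS). Qed.

Lemma TT0 (a : idx n) (r : R) : I01 r -> 0 <= TT (it a).
Proof. pos. Qed.

Lemma ttCS : SbC HB (fun a _ => TT (it a)) (fun a r th => RtoC (tt a th)).
Proof. by apply: SbC_RtoC; [exact: TT0|exact: ttS]. Qed.

Lemma tE_ACC i a th : HB th -> ACC (fun r => tE i a r th) (fun r => (tt a th * (eps * tF i a r th))%C).
Proof.
move=> Hth; have HC := amCI am i a Hth; have HD := amDI am i a Hth.
have base := ACC_plus (ACC_const (iaxi a i + (0, yf (iax a) (iaxi a) (tt a th) (xx a th) i) * kap (tt a th))%C)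
 (ACC_plus (ACC_scal Ci HC) (ACC_scal (RtoC (- / 2)) HD)).
apply: ACC_ext base => r Hr.
 by rewrite /tE /zetaf /zetaC [RHS]Cplus_assoc.
exact: momentum_alg.
Qed.

Lemma tZ_ACC i a th : HB th -> ACC (fun r => tZ i a r th) (fun r => (tt a th * tV i a r th)%C).
Proof.
move=> Hth; have HC := amCI am i a Hth; have HD := amDI am i a Hth.
set t := tt a th; set x := xx a th; set y := yf (iax a) (iaxi a) t x i.
have A1 : AC (fun r => (1 - r) * iax a i + r * x i) (fun r => x i - iax a i).
 apply: AC_ext (AC_plus (AC_const (iax a i)) (AC_scal (x i - iax a i) AC_id)) => r _; ring.
have A2 : AC (fun r => (1 - r) * y) (fun r => - y).
 apply: AC_ext (AC_plus (AC_const y) (AC_scal (- y) AC_id)) => r _; ring.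
have A3 : ACC (fun r => (1, 2 * t * r)) (fun r => (0, 2 * t)).
 by split; [exact: AC_const|apply: AC_ext (AC_scal (2 * t) AC_id) => r _ /=; ring].
have A4 : AC (fun r => t * (1 - r)) (fun r => - t).
 apply: AC_ext (AC_plus (AC_const t) (AC_scal (- t) AC_id)) => r _; ring.
have base := ACC_plus (ACC_RtoC A1) (ACC_plus (ACC_mult (ACC_RtoC A2) (ACC_const (kap t)))
 (ACC_plus (ACC_mult A3 HC) (ACC_mult (ACC_RtoC A4) HD))).
apply: ACC_ext base => r Hr //.
apply: velocity_alg; rewrite /y /yf; ring.
Qed.

Lemma tP_parts a r th i : tP a r th i = Re (tZ i a r th).
Proof. by rewrite /tP zp_phys. Qed.
Lemma tQ_parts a r th i : tQ a r th i = Im (tZ i a r th).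
Proof. by []. Qed.

Lemma tZ1 i a th : HB th -> tZ i a 1 th = RtoC (xx a th i).
Proof.
move=> Hth; rewrite /tZ /zf /zC (amC1 am i a Hth).
rewrite -[xf _ _ _ _ _]/(xx a th i) !Rminus_diag !Rmult_0_l !Rmult_0_r Rmult_1_l Rplus_0_l.
ring.
Qed.

Lemma tT1 i a th : HB th -> tT i a 1 th = RtoC (th (Some i)).
Proof.
move=> Hth; have := tZ1 i a Hth; rewrite /tZ zf_zt /zbase -/(tT i a 1 th) /xx => H.
have -> : tT i a 1 th = (((1 - 1) * iax a i + 1 * ix a i)%R + tT i a 1 th - ix a i)%C.
 by rewrite (_ : (1 - 1) * iax a i + 1 * ix a i = ix a i); [ring|ring].
rewrite H RtoC_plus; ring.
Qed.

Lemma tE0 i a th : HB th -> tE i a 0 th = (iaxi a i + Ci * tT i a 0 th)%C.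
Proof.
move=> Hth; rewrite /tE /tT /zetaf /zetaC /zt (amD0 am i a Hth).
rewrite -[xf _]/(fun j a r th => xf (@th_xi n) j a r th).
set y := yf _ _ _ _ _; rewrite !pair_C !RtoC_mult RtoC_minus; ring.
Qed.

Lemma tZ_tT i a r th : tZ i a r th = (zbase a r i + tT i a r th)%C.
Proof. exact: zf_zt. Qed.

(** Hamilton's equations cancel the velocity and force terms of the derivative, so the energy varies
    along the ray only through the Cauchy-Riemann defect. *)
Lemma tH_ACC a th : HB th -> ACC (fun r => tH a r th) (fun r =>
 (eps * csum (fun i => (Im (tt a th * tV i a r th) * tR i a r th)))%C).
Proof.
move=> Hth.
(* The chain rule for [Ht] wants two-sided derivatives, so the ray is replaced by its continuation
   past the ends of [0,1]. *)
have [u Hu] := choice _ (fun i => proj2 (proj1 (tZ_ACC i a Hth))).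
have [v Hv] := choice _ (fun i => proj2 (proj2 (tZ_ACC i a Hth))).
have [f Hf] := choice _ (fun i => proj2 (proj1 (tE_ACC i a Hth))).
have [g Hg] := choice _ (fun i => proj2 (proj2 (tE_ACC i a Hth))).
have US : SbC HB (fun a _ => TT (it a)) (fun a r th =>
  (eps * csum (fun i => (Im (tt a th * tV i a r th) * tR i a r th)))%C).
 apply: (SbC_scal Dop); apply: (SbC_csum Dop TT0) => i.
 apply: (SbC_multW Dop (W1 := fun a _ => TT (it a)) (W2 := ones) (K := 1)); [lra|pos| |].
  apply: SbC_RtoC; first exact: TT0.
  apply: (proj2 (SbC_multW Dop (W1 := fun a _ => TT (it a)) (W2 := ones) (K := 1) _ _ ttCS (tVS i))); first lra.
  pos.
 by apply: (SbC_weak (K := 1)) (tRS i); [lra|exact: L2_le1].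
have [c1 c2] := SbC_cont a US Hth.
have eqP r : I01 r -> (fun i => u i r) = tP a r th /\ (fun i => v i r) = tQ a r th /\ (fun i => (f i r, g i r)) = (fun i => tE i a r th).
 move=> Hr; split; [|split]; apply: funext => i.
 - by rewrite tP_parts (proj1 (Hu i r Hr)).
 - by rewrite tQ_parts (proj1 (Hv i r Hr)).
 - by rewrite (proj1 (Hf i r Hr)) (proj1 (Hg i r Hr)) -surjective_pairing.
pose w r := Ht b eps (fun i => u i r) (fun i => v i r) (fun i => (f i r, g i r)).
have W r : I01 r -> w r = tH a r th /\ derivC w r
  (eps * csum (fun i => (Im (tt a th * tV i a r th) * tR i a r th)))%C.
 move=> Hr; have [E1 [E2 E3]] := eqP r Hr; split; first by rewrite /w E1 E2 E3.
 have := @Ht_derive n b sgm Ad s0p bsm bdec bsym eps (fun r i => u i r) (fun r i => v i r) (fun r i => (f i r, g i r))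
  (fun i => (tt a th * tV i a r th)%C) (fun i => (tt a th * (eps * tF i a r th))%C) r
  (fun i => proj2 (Hu i r Hr)) (fun i => proj2 (Hv i r Hr)) (fun i => conj (proj2 (Hf i r Hr)) (proj2 (Hg i r Hr))).
 congr derivC; rewrite /dHt E1 E2 E3 -!csum_scal -csum_plus; apply: csum_ext => i.
 rewrite -/(tV i a r th) -/(tR i a r th) -/(tF i a r th); ring.
split.
 split => //; exists (fun r => Re (w r)) => r Hr; have [E [d1 d2]] := W r Hr; by rewrite E.
split => //; exists (fun r => Im (w r)) => r Hr; have [E [d1 d2]] := W r Hr; by rewrite E.
Qed.

(** The integrand is divided by [TT (it a)] to have weight one. *)
Definition tHN : fnC := fun a r th => ((/ TT (it a))%R * (tt a th * tH a r th))%C.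

(** The Gaussian phase at the complex starting point, [tT] at [r = 0] being its displacement from
    [ax], plus the action, which by homogeneity is [t] times the mean of the energy. The term with
    [- i/2] is [|axi|^2 / (2i)]. *)
Definition phi (a : idx n) (th : J -> R) : C :=
 (csum (fun i => (iaxi a i * tT i a 0 th)) + (Ci * (/ 2)%R * csum (fun i => (tT i a 0 th * tT i a 0 th)) - Ci * (/ 2)%R * (vnorm (iaxi a) ^ 2)%R) + TT (it a) * primiC tHN a 1 th)%C.

Lemma invTTS (f : fnC) W : SbC HB (fun a r => TT (it a) * W a r) f ->
 SbC HB W (fun a r th => ((/ TT (it a))%R * f a r th)%C).
Proof.
move=> Sf; apply: (SbC_multW Dop (W1 := fun a _ => / TT (it a)) (K := 1)) Sf; first lra.
 move=> a r _; have := TT_ge1 (it a) => ?; right; field; lra.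
have P (a : idx n) : 0 < / TT (it a) by pos.
apply: SbC_RtoC; first pos.
move=> k; apply: (@Sb_cst _ _ _ _ _ (fun a _ => / TT (it a)) 1); [lra| |by cont].
move=> a r _; rewrite Rabs_pos_eq; pos.
Qed.

Lemma one_cont (a : idx n) (r : R) : continuous (fun r : R => 1) r. Proof. by cont. Qed.
Lemma one_int (a : idx n) : RInt (fun r : R => 1) 0 1 <= 1.
Proof. rewrite RInt_const /scal /= /mult /=; lra. Qed.

Lemma ttmS (f : fnC) : SbC HB ones f ->
 SbC HB (fun a _ => TT (it a) * 1) (fun a r th => (tt a th * f a r th)%C).
Proof. apply: (SbC_mult Dop) => //; exact: ttCS. Qed.

Lemma tHNS : SbC HB ones tHN.
Proof. apply: invTTS; apply: ttmS; exact: tHS. Qed.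

Lemma phiS : SbC HB (fun a _ => TT (it a)) (fun a _ th => phi a th).
Proof.
have w i := SbC_at (r0 := 0) ltac:(lra) (tTS i).
have up (f : fnC) : SbC HB ones f -> SbC HB (fun a _ => TT (it a)) f.
 by apply: (SbC_weak (K := 1)); [lra|move=> a r _; have := TT_ge1 (it a); lra].
apply: SbC_plus.
 apply: up; apply: SbC_plus.
  apply: (SbC_csum Dop one_ge0) => i; apply: (SbC_mult1 Dop) (w i).
  apply: SbC_RtoC; first exact: one_ge0.
  move=> k; apply: (@Sb_cst _ _ _ _ _ (fun a _ => iaxi a i) 2); [lra| |by cont].
  by move=> a r _; rewrite Rmult_1_r; apply: e_abs.
 apply: (SbC_minus Dop).
  apply: (SbC_scal Dop); apply: (SbC_csum Dop one_ge0) => i; apply: (SbC_mult1 Dop); pos.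
 apply: (SbC_scal Dop); apply: SbC_RtoC; first exact: one_ge0.
 move=> k; apply: (@Sb_cst _ _ _ _ _ (fun a _ => vnorm (iaxi a) ^ 2) 4); [lra| |by cont].
 move=> a r _; have := ie a => ?; rewrite Rabs_pos_eq; nra.
apply: (SbC_multW Dop (W1 := fun a _ => TT (it a)) (W2 := ones) (K := 1)); [lra|pos| |].
 apply: SbC_RtoC; first exact: TT0.
 move=> k; apply: (@Sb_cst _ _ _ _ _ (fun a _ => TT (it a)) 1); [lra| |by cont].
 move=> a r Hr; rewrite Rabs_pos_eq; pos.
have P := primiC_SbC Dop one_ge0 one_cont one_int tHNS.
exact: (SbC_at (r0 := 1) ltac:(lra) P).
Qed.

Definition dxc (c : J) (i : 'I_n) : R := if c == Some i then 1 else 0.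

Definition Gam (dZ : 'I_n -> fnC) : fnC := fun a r th =>
 (eps * csum (fun i => (Im (dZ i a r th) * tR i a r th)))%C.

(** The classical differential [zeta dx - H dt] of the action, with the integrated defect [Gam] as
    correction. *)
Definition dphi (dZ : 'I_n -> fnC) (c : J) (a : idx n) (th : J -> R) : C :=
 (csum (fun i => (dxc c i * tE i a 1 th)) - dtc c * primiC tH a 1 th - tt a th * primiC (Gam dZ) a 1 th)%C.

Lemma GamS (dZ : 'I_n -> fnC) : (forall i, SbC HB ones (dZ i)) -> SbC HB (L2 sgm) (Gam dZ).
Proof.
move=> S; apply: (SbC_scal Dop); apply: (SbC_csum Dop (@L20 n sgm)) => i.
apply: (SbC_mult1 Dop) (tRS i); apply: SbC_RtoC; first exact: one_ge0.
exact: (proj2 (S i)).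
Qed.

Lemma is_derive_updI_Re i c a r th (l : C) : pdC (tT i a r) c th l ->
 is_derive (fun s => tP a r (updI th c s) i) (th c) (Re l) /\
 is_derive (fun s => tQ a r (updI th c s) i) (th c) (Im l).
Proof.
move=> [h1 h2]; split => //.
have := @is_derive_plus R_AbsRing R_NormedModule _ _ _ _ _ (is_derive_const (zbase a r i) (th c)) h1.
by rewrite /plus /= /zero /= Rplus_0_l.
Qed.

(** First variation: the derivative in [r] of the sum of [zeta * dZ] is the parameter derivative of
    [t H], plus [dtc c * H], plus [t] times the defect. After integration over [0,1] the boundary
    term at 0 equals the variation of the initial phase, because the ray starts on its Lagrangian;
    the one at 1 is the final momentum, since [z] ends at [x]. *)
Lemma phi_pd : exists dZ : J -> 'I_n -> fnC, (forall c i, SbC HB ones (dZ c i)) /\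
 (forall c i a r th, I01 r -> HB th -> pdC (tT i a r) c th (dZ c i a r th)) /\
 (forall c i a th, HB th -> dZ c i a 1 th = RtoC (dxc c i)) /\
 forall c a th, HB th -> pdC (phi a) c th (dphi (dZ c) c a th).
Proof.
have fam (T : 'I_n -> fnC) : (forall i, SbC HB ones (T i)) -> exists dT : J -> 'I_n -> fnC,
  (forall c i a r th, I01 r -> HB th -> pdC (T i a r) c th (dT c i a r th)) /\ forall c i, SbC HB ones (dT c i).
 move=> HT; have [d Hd] := choice _ (fun x : J * 'I_n => SbC_pd Dop (HT x.2) x.1).
 by exists (fun c i => d (c, i)); split => c i; [exact: (proj1 (Hd (c, i)))|exact: (proj2 (Hd (c, i)))].
have [dZ [dZP dZS]] := fam _ tTS; have [dE [dEP dES]] := fam _ tES; have [dV [dVP dVS]] := fam _ tVS.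
pose dH c : fnC := fun a r th => dHt b eps (tP a r th) (tQ a r th) (fun i => tE i a r th)
 (fun i => dZ c i a r th) (fun i => dE c i a r th).
have dHP c a r th : I01 r -> HB th -> pdC (tH a r) c th (dH c a r th).
 move=> Hr Hth.
 have D i := is_derive_updI_Re (dZP c i a r th Hr Hth).
 have := @Ht_derive n b sgm Ad s0p bsm bdec bsym eps (fun s => tP a r (updI th c s)) (fun s => tQ a r (updI th c s))
  (fun s i => tE i a r (updI th c s)) (fun i => dZ c i a r th) (fun i => dE c i a r th) (th c)
  (fun i => proj1 (D i)) (fun i => proj2 (D i)) (fun i => dEP c i a r th Hr Hth).
 by rewrite updI_id.
have FS i : SbC HB ones (tF i) by apply: (SbC_weak (K := 1)) (tfS i); [lra|exact: L2_le1].
have RS i : SbC HB ones (tR i) by apply: (SbC_weak (K := 1)) (tRS i); [lra|exact: L2_le1].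
have dHS c : SbC HB ones (dH c).
 apply: SbC_plus.
  by apply: (SbC_csum Dop one_ge0) => j; apply: (SbC_mult1 Dop); [exact: tVS|exact: dES].
 apply: (SbC_scal Dop); apply: (SbC_csum Dop one_ge0) => i; apply: (SbC_minus Dop).
  by apply: (SbC_mult1 Dop) (RS i); apply: SbC_RtoC; [exact: one_ge0|exact: (proj2 (dZS c i))].
 by apply: (SbC_mult1 Dop); [exact: FS|exact: dZS].
have dtP c (a : idx n) th : pdC (fun th => RtoC (tt a th)) c th (RtoC (dtc c)) by apply: derivC_RtoC; apply: tt_derive.
have pdm c a r (f : fnC) f' th : pdC (f a r) c th f' ->
  pdC (fun th => (tt a th * f a r th)%C) c th
   (dtc c * f a r th + tt a th * f')%C.
 by move=> H; have := derivC_mult (dtP c a th) H; rewrite updI_id.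
have dtS (c : J) (f : fnC) : SbC HB ones f -> SbC HB (fun a _ => TT (it a) * 1) (fun a r th => (dtc c * f a r th)%C).
 move=> Sf; apply: (SbC_scal Dop); apply: (SbC_weak (K := 1)) Sf; first lra.
 move=> a r _; have := TT_ge1 (it a); lra.
(* Division by [TT (it a)] brings the velocity to weight one, for which differentiation under the
   integral is available. *)
pose VN j : fnC := fun a r th => ((/ TT (it a))%R * (tt a th * tV j a r th))%C.
pose W2 c j : fnC := fun a r th => (dtc c * tV j a r th + tt a th * dV c j a r th)%C.
have W2S c j : SbC HB (fun a _ => TT (it a) * 1) (W2 c j) by apply: SbC_plus; [apply: dtS; exact: tVS|apply: ttmS].
pose dVN c j : fnC := fun a r th => ((/ TT (it a))%R * W2 c j a r th)%C.
have VNS j : SbC HB ones (VN j) by apply: invTTS; apply: ttmS; exact: tVS.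
have dVNS c j : SbC HB ones (dVN c j).
 exact: invTTS.
have dVNP c j a r th : I01 r -> HB th -> pdC (VN j a r) c th (dVN c j a r th).
 move=> Hr Hth; apply: derivC_scal; apply: (pdm c a r (tV j)); pos.
have Tinv (a : idx n) z : (TT (it a) * ((/ TT (it a))%R * z))%C = z.
 rewrite Cmult_assoc -RtoC_mult Rinv_r; first ring.
 have := TT_ge1 (it a); lra.
have VNint j a r th : I01 r -> HB th ->
  tT j a r th = ((zbase a 0 j - zbase a r j)%R + (tT j a 0 th + TT (it a) * primiC (VN j) a r th))%C.
 move=> Hr Hth.
 have := ACC_primiC (ttmS (tVS j)) Hth (tZ_ACC j a Hth) Hr.
 have -> : primiC (fun a r th => (tt a th * tV j a r th)%C) a r th = (TT (it a) * primiC (VN j) a r th)%C.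
  rewrite -(primiC_scal (fun a _ => TT (it a)) _ _ (VNS j) Hth); apply: primiC_ext => // s Hs.
  by rewrite Tinv.
 rewrite !tZ_tT => E.
 have -> : tT j a r th = (zbase a r j + tT j a r th - zbase a r j)%C by ring.
 rewrite E RtoC_minus; ring.
(* Differentiating the integral form of the equation of motion shows that the parameter derivative
   of the ray is itself differentiable in [r] and satisfies the linearised equation. *)
have dZint c j a r th : I01 r -> HB th ->
  dZ c j a r th = (dZ c j a 0 th + primiC (W2 c j) a r th)%C.
 move=> Hr Hth; apply: (derivC_unique (dZP c j a r th Hr Hth)).
 apply: (pdC_ext Dop (h1 := fun th => ((zbase a 0 j - zbase a r j)%R + (tT j a 0 th + TT (it a) * primiC (VN j) a r th))%C)) => //.
  by move=> th' Hth'; rewrite -VNint.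
 rewrite -[X in pdC _ _ _ X]Cplus_0_l; apply: derivC_plus; first exact: derivC_const.
 apply: derivC_plus; first by apply: dZP => //; lra.
 have -> : primiC (W2 c j) a r th = (TT (it a) * primiC (dVN c j) a r th)%C.
  rewrite -(primiC_scal (fun a _ => TT (it a)) _ _ (dVNS c j) Hth); apply: primiC_ext => // s Hs.
  by rewrite Tinv.
 apply: derivC_scal.
 exact: (primiC_pd Dop one_ge0 one_cont one_int (VNS j) (dVNP c j) (dVNS c j)).
have dZACC c j a th : HB th -> ACC (fun r => dZ c j a r th) (fun r => W2 c j a r th).
 move=> Hth.
 by apply: (primiC_ACC (u0 := dZ c j a 0 th) (W2S c j) Hth) => r Hr; pos.
have dZ1 c i a th : HB th -> dZ c i a 1 th = RtoC (dxc c i).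
 move=> Hth; apply: (derivC_unique (dZP c i a 1 th ltac:(lra) Hth)).
 apply: (pdC_ext Dop (h1 := fun th => RtoC (th (Some i)))) => //; first by move=> th' Hth'; rewrite tT1.
 apply: derivC_RtoC; rewrite /dxc /updI eq_sym; case: eqP => _; [exact: is_derive_id|exact: is_derive_const].
exists dZ; do 3!split => //.
move=> c a th Hth.
(* Euler's relation, differentiated in the parameter. *)
have euler r : I01 r -> (csum (fun j => (dE c j a r th * tV j a r th)) + csum (fun j => (tE j a r th * dV c j a r th)))%C =
  (2 * dH c a r th)%C.
 move=> Hr; rewrite -csum_plus.
 apply: (derivC_unique (f := fun s => csum (fun j => (tE j a r (updI th c s) * tV j a r (updI th c s))%C)) (x := th c)).
  apply: (derivC_csum (f := fun j s => (tE j a r (updI th c s) * tV j a r (updI th c s))%C)) => j.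
  by have := derivC_mult (dEP c j a r th Hr Hth) (dVP c j a r th Hr Hth); rewrite updI_id.
 apply: (derivC_ext (f := fun s => (2 * tH a r (updI th c s))%C)).
  by move=> s; rewrite -Ht_homog.
 by apply: derivC_scal; apply: dHP.
pose H2 : fnC := fun a r th => (dtc c * tH a r th + tt a th * dH c a r th)%C.
pose U : fnC := fun a r th => (H2 a r th + (dtc c * tH a r th + tt a th * Gam (dZ c) a r th))%C.
have GS : SbC HB ones (Gam (dZ c)) by apply: (SbC_weak (K := 1)) (GamS (dZS c)); [lra|exact: L2_le1].
have S1 : SbC HB (fun a _ => TT (it a) * 1) H2 by apply: SbC_plus; [apply: dtS; exact: tHS|apply: ttmS].
have S2 := dtS c tH tHS.
have S3 := ttmS GS.
have SU : SbC HB (fun a _ => TT (it a) * 1) U by apply: SbC_plus => //; apply: SbC_plus.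
have SA : ACC (fun r => csum (fun j => (tE j a r th * dZ c j a r th)%C)) (fun r => U a r th).
 have := ACC_csum (u := fun j r => (tE j a r th * dZ c j a r th)%C) (fun j => ACC_mult (tE_ACC j a Hth) (dZACC c j a th Hth)).
 apply: ACC_ext => // r Hr.
 have -> : csum (fun i => (tt a th * (eps * tF i a r th) * dZ c i a r th + tE i a r th * (dtc c * tV i a r th + tt a th * dV c i a r th))%C) =
   (tt a th * (eps * csum (fun i => (tF i a r th * dZ c i a r th))) + (dtc c * csum (fun i => (tE i a r th * tV i a r th)) + tt a th * csum (fun j => (tE j a r th * dV c j a r th))))%C.
  rewrite -!csum_scal -!csum_plus; apply: csum_ext => i; ring.
 have -> : csum (fun i => (tE i a r th * tV i a r th)%C) = (2 * tH a r th)%C by rewrite -Ht_homog.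
 have E1 := euler r Hr.
 have E2 : dH c a r th = (csum (fun j => (dE c j a r th * tV j a r th)) + (Gam (dZ c) a r th - eps * csum (fun i => (tF i a r th * dZ c i a r th))))%C.
  rewrite /dH /dHt /Gam.
  have -> : forall u v, (eps * u - eps * v)%C = (eps * (u + (Copp (RtoC 1)) * v))%C.
   move=> u v; ring.
  rewrite -[Cmult (Copp (RtoC 1)) _]csum_scal -csum_plus; congr (_ + _ * _)%C.
   by apply: csum_ext => j; rewrite Cmult_comm.
  apply: csum_ext => i; rewrite -/(tR i a r th) -/(tF i a r th); ring.
 rewrite /U /H2; move: E1 E2.
 set X := csum (fun j => (dE c j a r th * _)%C); set Y := csum (fun j => (tE j a r th * _)%C).
 set F := csum (fun i => (tF i a r th * _)%C); set G := Gam _ _ _ _.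
 move: (dH c a r th) (tH a r th) (RtoC (dtc c)) (RtoC (tt a th)) => h H d t E1 E2.
 have -> : (eps * F)%C = (X + (G - h))%C by rewrite E2; ring.
 have -> : Y = (2 * h - X)%C by rewrite -E1; ring.
 ring.
have FT := ACC_primiC SU Hth SA (r := 1) ltac:(lra).
have PU : primiC U a 1 th = (primiC H2 a 1 th + (dtc c * primiC tH a 1 th + tt a th * primiC (Gam (dZ c)) a 1 th))%C.
 rewrite /U (primiC_plus a 1 S1 (SbC_plus S2 S3) Hth) (primiC_plus a 1 S2 S3 Hth).
 by rewrite (primiC_scal (fun a _ => dtc c) _ _ tHS Hth) (primiC_scal (@tt n) _ _ GS Hth).
pose dHN : fnC := fun a r th => ((/ TT (it a))%R * H2 a r th)%C.
have dHNS : SbC HB ones dHN by apply: invTTS.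
have dHNP a' r th' : I01 r -> HB th' -> pdC (tHN a' r) c th' (dHN a' r th').
 move=> Hr Hth'; apply: derivC_scal; apply: (pdm c a' r tH); pos.
have PN : primiC H2 a 1 th = (TT (it a) * primiC dHN a 1 th)%C.
 rewrite -(primiC_scal (fun a _ => TT (it a)) _ _ dHNS Hth); apply: primiC_ext => [|s Hs]; first lra.
 by rewrite Tinv.
have D0 : pdC (phi a) c th (csum (fun i => (iaxi a i * dZ c i a 0 th)) + (Ci * (/ 2)%R * csum (fun i => (dZ c i a 0 th * tT i a 0 th + tT i a 0 th * dZ c i a 0 th)) + 0) + TT (it a) * primiC dHN a 1 th)%C.
 apply: derivC_plus; last first.
  apply: derivC_scal.
  exact: (primiC_pd Dop one_ge0 one_cont one_int tHNS dHNP dHNS a (s := 1) ltac:(lra) Hth).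
 have dw i : pdC (tT i a 0) c th (dZ c i a 0 th) by apply: dZP => //; lra.
 apply: derivC_plus.
  apply: (derivC_csum (f := fun i s => (iaxi a i * tT i a 0 (updI th c s))%C)) => i.
  by apply: derivC_scal; apply: dw.
 apply: derivC_plus; last exact: derivC_const.
 apply: derivC_scal; apply: (derivC_csum (f := fun i s => (tT i a 0 (updI th c s) * tT i a 0 (updI th c s))%C)) => i.
 by have := derivC_mult (dw i) (dw i); rewrite updI_id.
move: D0; congr pdC; rewrite /dphi.
have <- : csum (fun j => (tE j a 1 th * dZ c j a 1 th)%C) = csum (fun i => (dxc c i * tE i a 1 th)%C).
 by apply: csum_ext => i; rewrite dZ1 // Cmult_comm.
rewrite FT PU PN.
have -> : csum (fun j => (tE j a 0 th * dZ c j a 0 th)%C) =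
  (csum (fun i => (iaxi a i * dZ c i a 0 th)) + Ci * (/ 2)%R * csum (fun i => (dZ c i a 0 th * tT i a 0 th + tT i a 0 th * dZ c i a 0 th)))%C.
 rewrite -csum_scal -csum_plus; apply: csum_ext => i; rewrite tE0 // RtoC_inv; last lra.
 field; pos.
ring.
Qed.

End ThetaPhase.

Lemma derive_le_lip (f : R -> R) x l K : is_derive f x l ->
 locally x (fun s => Rabs (f s - f x) <= K * Rabs (s - x)) -> Rabs l <= K.
Proof.
move=> Hd Hl; apply: Rnot_lt_le => lt.
have e0 : 0 < (Rabs l - K) / 2 by lra.
move/is_derive_Reals: Hd => /(_ _ e0) [d Hd].
case: Hl => d' Hd'.
pose h := Rmin d d' / 2.
have m0 : 0 < Rmin d d' by apply: Rmin_case; apply: cond_pos.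
have h0 : 0 < h by rewrite /h; lra.
have hd : h < d by rewrite /h; have := Rmin_l d d'; lra.
have hd' : h < d' by rewrite /h; have := Rmin_r d d'; lra.
have B1 := Hd h ltac:(lra) ltac:(rewrite Rabs_pos_eq; lra).
have B2 : Rabs (f (x + h) - f x) <= K * h.
 have := Hd' (x + h); have -> : x + h - x = h by ring.
 rewrite (Rabs_pos_eq h); last lra.
 apply; rewrite /ball /= /AbsRing_ball /abs /minus /plus /opp /=; rewrite (_ : x + h + - x = h) ?Rabs_pos_eq; lra.
have B3 : Rabs ((f (x + h) - f x) / h) <= K.
 rewrite /Rdiv Rabs_mult Rabs_inv (Rabs_pos_eq h); last lra.
 by apply/Rle_div_l.
have := Rabs_triang_inv l ((f (x + h) - f x) / h).
rewrite (Rabs_minus_sym l); lra.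
Qed.

(** * First derivatives of the rays, uniformly in [eps] *)

Section FirstDerivativeBound.
Variable n : nat.
Notation J := (option 'I_n).
Notation HB := (@hb n).
Notation fnC := (idx n -> R -> (J -> R) -> C).
Let Dop : openI HB := @hb_open n.
Let zero : 'I_n -> fnC := fun _ _ _ _ => RtoC 0.

(** With zero amplitudes neither the coefficients nor [eps] enter, so the class supplies a constant
    depending on the dimension alone. *)
Lemma free_bound : exists K, 0 <= K /\ forall i c a r th l, I01 r -> HB th ->
 pdC (zt (@th_tau n) (@th_xi n) zero zero i a r) c th l -> Cmod l <= K.
Proof.
have zS i : SbC HB (fun (_ : idx n) _ => 1) (zero i) by apply: SbC_const.
have zb i (a : idx n) r th : I01 r -> HB th -> Rabs (Re (zero i a r th)) <= 1 /\ Rabs (Im (zero i a r th)) <= 1.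
 rewrite Rabs_R0; lra.
have S i := ztS Dop (@thtauS n) (@thxiS n) zS zS (@thtaub n) (@thxib n) zb zb i.
have [d Hd] := choice _ (fun x : 'I_n * J => SbC_pd Dop (S x.1) x.2).
have [K HK] := choice _ (fun x => SbC_bound (proj2 (Hd x))).
exists (fsum K); split; first by apply: fsum_ge0 => x; case: (HK x).
move=> i c a r th l Hr Hth Hl.
have -> : l = d (i, c) a r th by apply: (derivC_unique Hl); apply: (proj1 (Hd (i, c))).
bound (proj2 (HK (i, c)) a r th Hr Hth); rewrite Rmult_1_r.
by apply: fsum_term => x; case: (HK x).
Qed.

(** The smallness of [eps] will be chosen in terms of this constant, so the bounds of the class,
    which may depend on [eps], cannot be used for the amplitudes. Their derivatives are read off the
    Lipschitz constant 2 instead, and what remains is the free ray. *)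
Lemma tT_pd_bound : exists K, 0 <= K /\ forall b eps C0 Ch Dh, amplitudes b eps C0 Ch Dh ->
 forall i c a r th l, I01 r -> HB th -> pdC (tT Ch Dh i a r) c th l -> Cmod l <= K.
Proof.
have [K [K0 HK]] := free_bound.
exists (K + 20); split; first lra.
move=> b eps C0 Ch Dh am i c a r th l Hr Hth Hl.
have [dC [dCP dCS]] := SbC_pd Dop (amC am i) c.
have [dD [dDP dDS]] := SbC_pd Dop (amD am i) c.
have lip (f : fnC) f' : (forall s, hb (updI th c s) ->
   Rabs (Re (f a r (updI th c s)) - Re (f a r th)) <= 2 * Rabs (s - th c) /\
   Rabs (Im (f a r (updI th c s)) - Im (f a r th)) <= 2 * Rabs (s - th c)) ->
  pdC (f a r) c th f' -> Cmod f' <= 4.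
 move=> Hf [h1 h2]; bound (Cmod_le_sum _).
 have L1 : Rabs (Re f') <= 2.
  apply: (derive_le_lip h1); rewrite updI_id.
  by apply: filter_imp (locally_updI c Dop Hth) => s /Hf [].
 have L2 : Rabs (Im f') <= 2.
  apply: (derive_le_lip h2); rewrite updI_id.
  by apply: filter_imp (locally_updI c Dop Hth) => s /Hf [].
 lra.
have bC : Cmod (dC a r th) <= 4.
 by apply: lip (dCP a r th Hr Hth) => s Hs; apply: (amCl am).
have bD : Cmod (dD a r th) <= 4.
 by apply: lip (dDP a r th Hr Hth) => s Hs; apply: (amDl am).
(* Subtracting the contribution of the amplitudes leaves a derivative of the free ray. *)
have zf0 : pdC (zt (@th_tau n) (@th_xi n) zero zero i a r) c th
  (l - ((0, 2 * r * dtc c)%R * Cf Ch i a r th + (1, 2 * tt a th * r)%R * ((cst n / mC (it a) r)%R * dC a r th) + ((dtc c * (1 - r))%R * Df Dh i a r th + (tt a th * (1 - r))%R * ((cst n / mD (it a) r)%R * dD a r th))))%C.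
 have dt := tt_derive a th c.
 have eq1 u : 2 * r * u = 2 * u * r by ring.
 have d1 : derivC (fun s => (1, 2 * tt a (updI th c s) * r)) (th c) (0, 2 * r * dtc c).
  split; first exact: is_derive_const.
  apply: (is_derive_ext (fun s => (2 * r) * tt a (updI th c s))) => [s|]; first exact: (eq1 (tt a (updI th c s))).
  exact: is_derive_scal.
 have d2 : derivC (fun s => RtoC (tt a (updI th c s) * (1 - r))) (th c) (RtoC (dtc c * (1 - r))).
  apply: derivC_RtoC; apply: (is_derive_ext (fun s => (1 - r) * tt a (updI th c s))) => [s|]; first exact: Rmult_comm.
  rewrite Rmult_comm; exact: is_derive_scal.
 have dd : pdC (fun th => ((1, 2 * tt a th * r)%R * Cf Ch i a r th + (tt a th * (1 - r))%R * Df Dh i a r th)%C) c th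
  ((0, 2 * r * dtc c)%R * Cf Ch i a r th + (1, 2 * tt a th * r)%R * ((cst n / mC (it a) r)%R * dC a r th) + ((dtc c * (1 - r))%R * Df Dh i a r th + (tt a th * (1 - r))%R * ((cst n / mD (it a) r)%R * dD a r th)))%C.
  apply: derivC_plus.
   have := derivC_mult d1 (derivC_scal (RtoC (cst n / mC (it a) r)) (dCP a r th Hr Hth)).
   by rewrite updI_id.
  have := derivC_mult d2 (derivC_scal (RtoC (cst n / mD (it a) r)) (dDP a r th Hr Hth)).
  by rewrite updI_id.
 have := derivC_plus Hl (derivC_scal (Copp (RtoC 1)) dd).
 have E u v : (u + (Copp (RtoC 1)) * v)%C = (u - v)%C by ring.
 rewrite E; apply: derivC_ext => s; rewrite E /tT /zt /zero.
 rewrite -[tf _ _ _ _]/(tt a (updI th c s)) !/(Cf (fun _ => _)) /Df /Cf.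
 ring.
have Hz := HK i c a r th _ Hr Hth zf0.
set E := Cplus _ _ in Hz.
have -> : l = (l - E + E)%C by ring.
bound (Cmod_triangle _ _).
suff : Cmod E <= 20 by lra.
have c0 := cst_pos n; have cl := cst_le n; have mc := mC_ge1 (it a) Hr; have md := mD_ge1 (it a) Hr.
have ta : Rabs (tt a th) <= Rabs (it a) + 1.
 have := Hth None; rewrite /tt /= => /Rabs_lt_between H; move: H cl; clear; split_Rabs; lra.
have sm (f : fnC) : (Rabs (Re (f a r th)) <= eps * C0 /\ Rabs (Im (f a r th)) <= eps * C0) -> Cmod (f a r th) <= 1.
 move=> [h1 h2]; bound (Cmod_le_sum _); have := amsm am; lra.
have bCh := sm (Ch i) (amCb am i a r Hth); have bDh := sm (Dh i) (amDb am i a r Hth).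
have pr x y : Cmod (x, y) <= Rabs x + Rabs y by exact: Cmod_le_sum.
have sc m z k : 1 <= m -> Cmod z <= k -> Cmod ((cst n / m)%R * z) <= k / m.
 move=> m1 Hz'; rewrite Cmod_mult Cmod_R Rabs_pos_eq; last pos.
 rewrite /Rdiv (Rmult_comm k) Rmult_comm -Rmult_assoc Rmult_comm; apply: Rmult_le_compat_l; first pos.
 have := Cmod_ge_0 z => ?; nra.
have dt1 : Rabs (dtc c) <= 1 by case: c {lip dCP dCS dDP dDS Hl zf0 Hz E} => [j|] /=; rewrite ?Rabs_R0 ?Rabs_R1; lra.
have inv1 m : 1 <= m -> 0 < / m <= 1.
 by split; [apply: Rinv_0_lt_compat; lra|rewrite -Rinv_1; apply: Rinv_le_contravar; lra].
have iC := inv1 _ mc; have iD := inv1 _ md.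
have t1 : Cmod ((0, 2 * r * dtc c)%R * Cf Ch i a r th) <= 2.
 have h := sc _ _ _ mc bCh; rewrite -/(Cf Ch i a r th) in h.
 rewrite Cmod_mult; bound (Rmult_le_compat _ 2 _ 1 (Cmod_ge_0 _) (Cmod_ge_0 _) _ _); [|lra|lra].
 bound (pr _ _); rewrite Rabs_R0 !Rabs_mult (Rabs_pos_eq 2) ?(Rabs_pos_eq r); try lra.
 nra.
have t2 : Cmod ((1, 2 * tt a th * r)%R * ((cst n / mC (it a) r)%R * dC a r th)) <= 12.
 have h := sc _ _ _ mc bC.
 rewrite Cmod_mult; bound (Rmult_le_compat _ (3 * mC (it a) r) _ _ (Cmod_ge_0 _) (Cmod_ge_0 _) _ h); last by right; field; lra.
 bound (pr _ _); rewrite Rabs_R1 !Rabs_mult (Rabs_pos_eq 2) ?(Rabs_pos_eq r); try lra.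
 move: mc; rewrite /mC; nra.
have t3 : Cmod ((dtc c * (1 - r))%R * Df Dh i a r th) <= 1.
 have h := sc _ _ _ md bDh; rewrite -/(Df Dh i a r th) in h.
 rewrite Cmod_mult; bound (Rmult_le_compat _ 1 _ 1 (Cmod_ge_0 _) (Cmod_ge_0 _) _ _); [|lra|lra].
 rewrite Cmod_R Rabs_mult (Rabs_pos_eq (1 - r)); nra.
have t4 : Cmod ((tt a th * (1 - r))%R * ((cst n / mD (it a) r)%R * dD a r th)) <= 4.
 have h := sc _ _ _ md bD.
 rewrite Cmod_mult; bound (Rmult_le_compat _ (mD (it a) r) _ _ (Cmod_ge_0 _) (Cmod_ge_0 _) _ h); last by right; field; lra.
 rewrite Cmod_R Rabs_mult (Rabs_pos_eq (1 - r)); last lra.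
 move: md; rewrite /mD; nra.
rewrite /E; bound (Cmod_triangle _ _).
bound (Rplus_le_compat _ _ _ _ (Cmod_triangle _ _) (Cmod_triangle _ _)); lra.
Qed.

End FirstDerivativeBound.

(** ** The phase as a function of time and position *)

Section Charts.
Variables (n : nat) (b : 'I_n -> 'I_n -> vec n -> R) (sgm : R) (Ad : nat -> R).
Hypotheses (s0p : 0 < sgm) (bsm : forall j k, smooth_Rn (b j k)) (bdec : decays b sgm Ad) (bsym : forall j k x, b j k x = b k j x).
Notation J := (option 'I_n).
Variables (eps C0 : R) (Ch Dh : 'I_n -> idx n -> R -> (J -> R) -> C).
Hypothesis am : amplitudes b eps C0 Ch Dh.
Notation HB := (@hb n).
Notation fnC := (idx n -> R -> (J -> R) -> C).
Notation fnR := (idx n -> R -> (J -> R) -> R).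
Let Dop : openI HB := @hb_open n.

(** The phase grows like [TT], but its gradient does not: [t] times the defect is dominated by the
    integrable weight [W0]. *)
Lemma dphiS (dZ : 'I_n -> fnC) j : (forall i, SbC HB ones (dZ i)) ->
 SbC HB ones (fun a _ th => dphi b eps Ch Dh dZ (Some j) a th).
Proof.
move=> dZS; have GS := GamS s0p bsm bdec am dZS.
have S1 : SbC HB (fun a r => W0 sgm (ity a) (it a) r) (fun a r th => (tt a th * Gam b eps Ch Dh dZ a r th)%C).
 apply: (SbC_multW Dop (W1 := fun a _ => TT (it a)) (K := 1) _ _ (@ttCS n) GS); first lra.
 move=> a r Hr; rewrite Rmult_1_l /W0; apply: Rmult_le_compat_l; first exact: (TT0 a Hr).
 by apply: Rle_Rpower; [apply: Lm_ge1|lra].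
have P := primiC_SbC Dop (@W00 n sgm) (fun a => @W0_cont sgm (ity a) (it a)) (fun a => W0_int s0p (ity a) (it a)) S1.
have P1 := SbC_at (r0 := 1) ltac:(lra) P.
apply: (SbC_minus Dop); first apply: (SbC_minus Dop).
- apply: (SbC_csum Dop (@one_ge0 n)) => i; apply: (SbC_scal Dop).
 exact: (SbC_at (r0 := 1) ltac:(lra) (tES am i)).
- apply: (SbC_scal Dop).
 exact: (SbC_at (r0 := 1) ltac:(lra) (primiC_SbC Dop (@one_ge0 n) (@one_cont n) (@one_int n) (tHS s0p bsm bdec am))).
- by apply: (SbC_eq Dop) P1 => a r th _ Hth; rewrite (primiC_scal (@tt n) _ _ GS Hth).
Qed.

Lemma phiE a th : HB th -> (TT (it a) * primiC (tHN b eps Ch Dh) a 1 th)%C =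
 (tt a th * primiC (tH b eps Ch Dh) a 1 th)%C.
Proof.
move=> Hth; have T1 := TT_ge1 (it a).
rewrite -(primiC_scal (fun a _ => TT (it a)) _ _ (tHNS s0p bsm bdec am) Hth).
rewrite -(primiC_scal (@tt n) _ _ (tHS s0p bsm bdec am) Hth); apply: primiC_ext => [|r Hr]; first lra.
by rewrite /tHN Cmult_assoc -RtoC_mult Rinv_r; [ring|lra].
Qed.

Lemma phi_chart a a' th th' : HB th -> HB th' -> iax a = iax a' -> iaxi a = iaxi a' ->
 tt a th = tt a' th' -> xx a th = xx a' th' -> phi b eps Ch Dh a th = phi b eps Ch Dh a' th'.
Proof.
move=> H H' Eax Ee Et Ex; have E := amU am H H' Eax Ee Et Ex.
have fE (f g : 'I_n -> C) : (forall i, f i = g i) -> f = g := @funext _ _ f g.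
have CE r : I01 r -> (fun i => Cf Ch i a r th) = (fun i => Cf Ch i a' r th') by move=> Hr; apply: fE => i; case: (E i r Hr).
have DE r : I01 r -> (fun i => Df Dh i a r th) = (fun i => Df Dh i a' r th') by move=> Hr; apply: fE => i; case: (E i r Hr).
have ZE r i : I01 r -> tZ Ch Dh i a r th = tZ Ch Dh i a' r th'.
 move=> Hr; rewrite /tZ /zf -[tf _ a _ _]/(tt a th) -[tf _ a' _ _]/(tt a' th') Eax Ee Et CE // DE //.
 by rewrite -[fun i => xf _ _ a _ _]/(xx a th) -[fun i => xf _ _ a' _ _]/(xx a' th') Ex.
have EE r i : I01 r -> tE Ch Dh i a r th = tE Ch Dh i a' r th'.
 move=> Hr; rewrite /tE /zetaf -[tf _ a _ _]/(tt a th) -[tf _ a' _ _]/(tt a' th') Eax Ee Et CE // DE //.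
 by rewrite -[fun i => xf _ _ a _ _]/(xx a th) -[fun i => xf _ _ a' _ _]/(xx a' th') Ex.
have HE r : I01 r -> tH b eps Ch Dh a r th = tH b eps Ch Dh a' r th'.
 move=> Hr; rewrite /tH; congr Ht; last pos.
  by apply: funext => i; rewrite !tP_parts ZE.
 by apply: funext => i; rewrite !tQ_parts ZE.
have TE i : tT Ch Dh i a 0 th = tT Ch Dh i a' 0 th'.
 have := ZE 0 i ltac:(lra); rewrite !tZ_tT /zbase Eax.
 rewrite !Rmult_0_l => /(f_equal (fun z => (z - ((1 - 0) * iax a' i + 0)%R)%C)).
 by have Q u v : (u + v - u)%C = v by [ring]; rewrite !Q.
rewrite /phi !phiE // Ee Et; congr (_ + (_ * _ - _) + _ * _)%C.
- by apply: csum_ext => i; rewrite TE.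
- by apply: csum_ext => i; rewrite TE.
- by congr pair; apply: RInt_ext => r _; rewrite HE //; apply: clampP.
Qed.

Definition thof (a : idx n) (t : R) (x : vec n) : J -> R :=
 fun o => match o with None => t - it a | Some i => x i - ix a i end.

Lemma tt_thof a t x : tt a (thof a t x) = t. Proof. rewrite /tt /thof; ring. Qed.
Lemma xx_thof a t x : xx a (thof a t x) = x.
Proof. apply: funext => i; rewrite /xx /thof; ring. Qed.

(** The union of the charts. An open set is wanted because cases (b) and (c) of [Omega] contain
    boundary points. *)
Definition dom (ax e : vec n) (t : R) (x : vec n) : Prop :=
 exists a, [/\ iax a = ax, iaxi a = e & HB (thof a t x)].

(** Any chart containing the point may be selected, by [phi_chart]; zero is a default value off the
    domain. *)
Definition Phi (ax e : vec n) (t : R) (x : vec n) : C :=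
 match excluded_middle_informative (dom ax e t x) with
 | left H => let a := proj1_sig (constructive_indefinite_description _ H) in phi b eps Ch Dh a (thof a t x)
 | right _ => RtoC 0
 end.

Lemma Phi_chart a t x : HB (thof a t x) -> Phi (iax a) (iaxi a) t x = phi b eps Ch Dh a (thof a t x).
Proof.
move=> H; rewrite /Phi; case: excluded_middle_informative => [D|[]]; last by exists a.
case: constructive_indefinite_description => a' [E1 E2 H'] /=.
by apply: phi_chart; rewrite ?tt_thof ?xx_thof.
Qed.

Lemma dom_open ax e : open_tx (dom ax e).
Proof.
move=> t x [a [E1 E2 H]]; have [d [d0 Hd]] := Dop H; exists d; split => // s y Hs Hy.
exists a; split => //; apply: Hd => -[i|] /=.
 rewrite (_ : _ - _ = vsub y x i); last by rewrite /vsub; ring.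
 exact: Rle_lt_trans (vnorm_term _ _) Hy.
rewrite (_ : _ - _ = s - t); pos.
Qed.

(** [g] is given in every chart by the function [f] of the class with weight [W]. *)
Definition Rep (W : idx n -> R -> R) (g : vec n -> vec n -> R -> vec n -> R) (f : fnR) :=
 SbI HB W f /\ forall a t x, HB (thof a t x) -> g (iax a) (iaxi a) t x = f a 0 (thof a t x).

Lemma is_derive_shift (h : R -> R) k t l : is_derive h (t - k) l -> is_derive (fun s => h (s - k)) t l.
Proof.
move=> H; have i : is_derive (fun s => s - k) t 1 by auto_derive => //; ring.
by have := is_derive_comp h (fun s => s - k) _ _ _ H i; rewrite /scal /= /mult /= Rmult_1_l.
Qed.

(** One description of the line through [(t, x)] in the time direction or in a coordinate direction,
    so that a single argument covers both kinds of derivative. *)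
Definition tx (o : J) (t : R) (x : vec n) (s : R) (g : R -> vec n -> R) : R :=
 match o with None => g s x | Some j => g t (upd x j s) end.
Definition txc (o : J) (t : R) (x : vec n) : R := match o with None => t | Some j => x j end.
Definition kof (o : J) (a : idx n) : R := match o with None => it a | Some j => ix a j end.

Lemma dtx_tx o (g : R -> vec n -> R) t x : dtx o g t x = Derive (fun s => tx o t x s g) (txc o t x).
Proof. by case: o. Qed.
Lemma ex_dtx_tx o (g : R -> vec n -> R) t x : ex_dtx o g t x <-> ex_derive (fun s => tx o t x s g) (txc o t x).
Proof. by case: o. Qed.

Lemma Rep_derive W g f f' o : Rep W g f ->
 (forall a r th, I01 r -> HB th -> pd (f a r) o th (f' a r th)) ->
 forall a t x, HB (thof a t x) ->
 is_derive (fun s => tx o t x s (g (iax a) (iaxi a))) (txc o t x) (f' a 0 (thof a t x)).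
Proof.
move=> [_ Hg] Hp a t x H.
have upE s : thof a (if o is None then s else t) (if o is Some j then upd x j s else x) = updI (thof a t x) o (s - kof o a).
 apply: funext; case: o {Hp} => [j|] [i|]; rewrite /thof /updI /upd //=.
 by rewrite (_ : (Some i == Some j) = (i == j)) //; case: eqP => // ->.
have E s : HB (updI (thof a t x) o (s - kof o a)) -> f a 0 (updI (thof a t x) o (s - kof o a)) = tx o t x s (g (iax a) (iaxi a)).
 by rewrite -upE => H'; rewrite -Hg //; case: (o).
have D := Hp a 0 (thof a t x) ltac:(lra) H.
have c0 : thof a t x o = txc o t x - kof o a by case: (o).
rewrite /pd c0 in D.
apply: is_derive_ext_loc (is_derive_shift D).
have L := locally_updI o Dop H; rewrite c0 in L.
have c : continuous (fun s => s - kof o a) (txc o t x) by cont.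
have L' : locally (txc o t x) (fun s => HB (updI (thof a t x) o (s - kof o a))) := c _ L.
apply: filter_imp L' => s; pos.
Qed.

Lemma Rep_dtx W g f f' o : Rep W g f ->
 (forall a r th, I01 r -> HB th -> pd (f a r) o th (f' a r th)) -> SbI HB W f' ->
 Rep W (fun ax e => dtx o (g ax e)) f'.
Proof.
move=> Hg Hp Sf'; split => // a t x H; rewrite dtx_tx.
exact: (is_derive_unique _ _ _ (Rep_derive Hg Hp H)).
Qed.

Lemma Rep_dtxs W g f : Rep W g f -> forall ds, exists f', Rep W (fun ax e => dtxs ds (g ax e)) f'.
Proof.
move=> Hg; elim=> [|o ds [f' IH]]; first by exists f.
have [f'' [Hp S]] := SbI_pd Dop (proj1 IH) o; exists f''.
exact: (Rep_dtx IH Hp S).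
Qed.

Lemma Rep_cont W g f : Rep W g f -> forall a t x, HB (thof a t x) -> cont_tx (g (iax a) (iaxi a)) t x.
Proof.
move=> [S Hg] a t x H e e0.
have [K [K0 HK]] := Sb_lip (S 1%N).
have [d [d0 Hd]] := Dop H.
have Wx : 0 <= K * Rabs (W a 0) * INR #|{: J}|.
 pos.
set B := K * Rabs (W a 0) * INR #|{: J}| in Wx.
exists (Rmin d (e / (B + 1))).
have q0 : 0 < e / (B + 1) by pos.
split; first exact: Rmin_pos.
move=> s y Hs Hy.
have m1 := Rmin_l d (e / (B + 1)); have m2 := Rmin_r d (e / (B + 1)).
have co c : Rabs (thof a s y c - thof a t x c) < Rmin d (e / (B + 1)).
 case: c => [i|] /=; last by rewrite (_ : _ - _ = s - t); pos.
 rewrite (_ : _ - _ = vsub y x i); last by rewrite /vsub; ring.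
 exact: Rle_lt_trans (vnorm_term _ _) Hy.
have H' : HB (thof a s y) by apply: Hd => c; apply: Rlt_le_trans (co c) _.
rewrite !Hg //.
have L := HK a 0 (thof a t x) (thof a s y) ltac:(lra) (fun z Hz => box_rect H H' Hz).
apply: Rle_lt_trans L _.
have l1b : l1 (fun c => thof a s y c - thof a t x c) <= INR #|{: J}| * (e / (B + 1)).
 by apply: fsum_le_const => c; apply: Rlt_le; apply: Rlt_le_trans (co c) _.
apply: (@Rle_lt_trans _ (B * (e / (B + 1)))).
 via (K * Rabs (W a 0) * (INR #|{: J}| * (e / (B + 1)))); last by rewrite /B; pos.
 via (K * Rabs (W a 0) * l1 (fun c => thof a s y c - thof a t x c)).
  by apply: Rmult_le_compat_r; [apply: l1_ge0|apply: Rmult_le_compat_l => //; apply: Rle_abs].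
 pos.
apply: (Rmult_lt_reg_r (B + 1)); first lra.
have -> : B * (e / (B + 1)) * (B + 1) = B * e by field; lra.
nra.
Qed.

Lemma Rep_smooth W g f ax e : Rep W g f -> smooth_on (dom ax e) (g ax e).
Proof.
move=> Hg ds t x [a [<- <- H]].
have [f' Hf'] := Rep_dtxs Hg ds; split; last exact: (Rep_cont Hf' H).
move=> o; have [f'' [Hp S]] := SbI_pd Dop (proj1 Hf') o.
apply/ex_dtx_tx; eexists; exact: (Rep_derive Hf' Hp H).
Qed.

Lemma Rep_Phi : Rep (fun a _ => TT (it a)) (fun ax e t x => Re (Phi ax e t x)) (fun a _ th => Re (phi b eps Ch Dh a th)) /\
 Rep (fun a _ => TT (it a)) (fun ax e t x => Im (Phi ax e t x)) (fun a _ th => Im (phi b eps Ch Dh a th)).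
Proof.
have [S1 S2] := phiS s0p bsm bdec am.
by split; split => // a t x H; rewrite Phi_chart.
Qed.

Lemma Phi_smooth ax e : smooth_onC (dom ax e) (Phi ax e).
Proof. by split; [exact: (@Rep_smooth _ _ _ ax e (proj1 Rep_Phi))|exact: (@Rep_smooth _ _ _ ax e (proj2 Rep_Phi))]. Qed.

Lemma dtxs_Some (g : R -> vec n -> R) ds t : dtxs (map Some ds) g t = dxs ds (g t).
Proof.
elim: ds t => //= j ds IH t.
by apply: funext => x; rewrite /dx IH.
Qed.

(** The innermost derivative is split off because only the gradient, not the phase itself, is
    bounded uniformly in time. *)
Lemma dmulti_split (A : 'I_n -> nat) : (exists j, A j <> 0%N) ->
 exists ds i, forall g : vec n -> R, dmulti A g = dxs ds (dx i g).
Proof.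
move=> [j Aj]; set l := flatten [seq nseq (A j) j | j <- enum 'I_n].
have jl : j \in l.
 apply/flattenP; exists (nseq (A j) j).
  by apply/mapP; exists j => //; apply: mem_enum.
 by case: (A j) Aj => //= m _; rewrite in_cons eqxx.
have [ds [i E]] : exists ds i, l = rcons ds i by move: (l) jl => l'; case/lastP: l' => // ds i _; exists ds, i.
exists ds, i => g.
have -> : dmulti A g = dxs l g.
 rewrite /dmulti /l; elim: (enum 'I_n) => //= k s ->.
 by elim: (A k) => //= m ->.
by rewrite E /dxs foldr_rcons.
Qed.

Lemma Phi_grad : exists dZ : J -> 'I_n -> fnC, (forall c i, SbC HB ones (dZ c i)) /\
 (forall c i a r th, I01 r -> HB th -> pdC (tT Ch Dh i a r) c th (dZ c i a r th)) /\
 (forall c i a th, HB th -> dZ c i a 1 th = RtoC (dxc c i)) /\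
 (forall c a t x, HB (thof a t x) -> dtxC c (Phi (iax a) (iaxi a)) t x = dphi b eps Ch Dh (dZ c) c a (thof a t x)) /\
 exists CV : ('I_n -> nat) -> R, forall A, (exists j, A j <> 0%N) -> forall a t x, HB (thof a t x) ->
  Cmod (dmultiC A (Phi (iax a) (iaxi a)) t x) <= CV A.
Proof.
have [dZ [dZS [dZP [dZ1 dP]]]] := phi_pd s0p bsm bdec bsym am.
have [R1 R2] := Rep_Phi.
have D c a t x : HB (thof a t x) -> dtxC c (Phi (iax a) (iaxi a)) t x = dphi b eps Ch Dh (dZ c) c a (thof a t x).
 move=> H; rewrite /dtxC !dtx_tx.
 have p1 a' r th : I01 r -> HB th -> pd (fun th => Re (phi b eps Ch Dh a' th)) c th (Re (dphi b eps Ch Dh (dZ c) c a' th)).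
  by move=> _ Hth; apply: (proj1 (dP c a' th Hth)).
 have p2 a' r th : I01 r -> HB th -> pd (fun th => Im (phi b eps Ch Dh a' th)) c th (Im (dphi b eps Ch Dh (dZ c) c a' th)).
  by move=> _ Hth; apply: (proj2 (dP c a' th Hth)).
 have e1 := is_derive_unique _ _ _ (Rep_derive R1 (f' := fun a _ th => Re (dphi b eps Ch Dh (dZ c) c a th)) p1 H).
 have e2 := is_derive_unique _ _ _ (Rep_derive R2 (f' := fun a _ th => Im (dphi b eps Ch Dh (dZ c) c a th)) p2 H).
 by rewrite e1 e2 -surjective_pairing.
exists dZ; do 4!split => //.
have RG j : Rep ones (fun ax e => dtx (Some j) (fun t x => Re (Phi ax e t x))) (fun a _ th => Re (dphi b eps Ch Dh (dZ (Some j)) (Some j) a th)) /\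
  Rep ones (fun ax e => dtx (Some j) (fun t x => Im (Phi ax e t x))) (fun a _ th => Im (dphi b eps Ch Dh (dZ (Some j)) (Some j) a th)).
 have [S1 S2] := dphiS j (dZS (Some j)).
 split; split => // a t x H.
  by have := f_equal Re (D (Some j) a t x H).
 by have := f_equal Im (D (Some j) a t x H).
have ex (A : 'I_n -> nat) : exists K, (exists j, A j <> 0%N) -> forall a t x, HB (thof a t x) ->
  Cmod (dmultiC A (Phi (iax a) (iaxi a)) t x) <= K.
 case: (classic (exists j, A j <> 0%N)) => [H|H]; last by exists 0 => /H.
 have [ds [i E]] := dmulti_split H.
 have [G1 G2] := RG i.
 have [f1 [S1 H1]] := Rep_dtxs G1 (map Some ds); have [f2 [S2 H2]] := Rep_dtxs G2 (map Some ds).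
 have [K1 [_ B1]] := Sb_bound (S1 0%N); have [K2 [_ B2]] := Sb_bound (S2 0%N).
 exists (K1 * 1 + K2 * 1) => _ a t x Hth; bound (Cmod_le_sum _); rewrite /dmultiC /= !E.
 apply: Rplus_le_compat.
  by have := B1 a 0 (thof a t x) ltac:(lra) Hth; rewrite -H1 // dtxs_Some.
 by have := B2 a 0 (thof a t x) ltac:(lra) Hth; rewrite -H2 // dtxs_Some.
by have [CV HCV] := choice _ ex; exists CV.
Qed.

End Charts.

(** * The real Hamiltonian flow *)

Lemma derive_compare (f g df dg : R -> R) a b' : a <= b' ->
 (forall s, a <= s <= b' -> is_derive f s (df s)) -> (forall s, a <= s <= b' -> is_derive g s (dg s)) ->
 (forall s, a <= s <= b' -> Rabs (df s) <= dg s) -> Rabs (f b' - f a) <= g b' - g a.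
Proof.
move=> ab Hf Hg H.
have mono (h dh : R -> R) : (forall s, a <= s <= b' -> is_derive h s (dh s)) -> (forall s, a <= s <= b' -> 0 <= dh s) -> h a <= h b'.
 move=> Hh dh0.
 have [|s Hs|c [Hc E]] := MVT_gen h a b' dh.
 - move=> s; rewrite Rmin_left // Rmax_right // => Hs; apply: Hh; lra.
 - rewrite Rmin_left // Rmax_right // in Hs.
  apply/continuity_pt_filterlim; apply: ex_derive_continuous; eexists; pos.
 - rewrite Rmin_left // Rmax_right // in Hc.
  have := dh0 c Hc; nra.
have m1 := mono (fun s => g s - f s) (fun s => dg s - df s) _ _.
have m2 := mono (fun s => g s + f s) (fun s => dg s + df s) _ _.
apply/Rabs_le_between; split.
- suff : g a + f a <= g b' + f b' by lra.
 apply: m2 => s Hs; first by apply: der_plus; auto.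
 have := H s Hs => /Rabs_le_between; lra.
- suff : g a - f a <= g b' - f b' by lra.
 apply: m1 => s Hs; first by apply: der_minus; auto.
 have := H s Hs => /Rabs_le_between; lra.
Qed.

(** Continuity method: take the largest symmetric interval on which [f <= rho]. There
    [f <= rho / 2], at the ends too by continuity, and then [f <= rho] slightly beyond them. *)
Lemma bootstrap (f : R -> R) rho : 0 < rho -> (forall s, continuous f s) ->
 (forall tau, 0 <= tau -> (forall s, Rabs s <= tau -> f s <= rho) -> forall s, Rabs s <= tau -> f s <= rho / 2) ->
 f 0 <= rho / 2 -> forall s, f s <= rho / 2.
Proof.
move=> r0 cf Hb f0.
have near s : f s <= rho / 2 -> exists d, 0 < d /\ forall s', Rabs (s' - s) < d -> f s' <= rho.
 move=> fs; have r2 : 0 < rho / 2 by lra.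
 move/filterlim_locally: (cf s) => /(_ (mkposreal _ r2)) [d Hd]; exists d; split; first exact: cond_pos.
 move=> s' Hs'; have := Hd s' Hs'; rewrite /ball /= /AbsRing_ball /abs /minus /plus /opp /= => /Rabs_lt_between; lra.
pose E tau := 0 <= tau /\ forall s, Rabs s <= tau -> f s <= rho.
have E0 : E 0.
 by split; [lra|move=> s Hs; have -> : s = 0 by [have := Rabs_pos s; split_Rabs; lra]; lra].
have good tau : E tau -> forall s, Rabs s <= tau -> f s <= rho / 2 by move=> [t0 Ht]; apply: Hb.
suff all tau : 0 <= tau -> E tau by move=> s; apply: (good (Rabs s)); pos.
move=> t0; apply: NNPP => nE.
have bE : bound E.
 exists tau => v [v0 Hv]; apply: Rnot_lt_le => lt; apply: nE; split => // s Hs; apply: Hv; lra.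
have [T [ub lub]] := completeness E bE (ex_intro _ 0 E0).
have T0 : 0 <= T by pos.
have below s : Rabs s < T -> f s <= rho / 2.
 move=> Hs; have [v [Ev lt]] : exists v, E v /\ Rabs s < v.
  apply: NNPP => H; have : T <= Rabs s; last lra.
  by apply: lub => v Ev; apply: Rnot_lt_le => lt; apply: H; exists v.
 apply: (good v Ev); lra.
have half s : Rabs s <= T -> f s <= rho / 2.
 case/Rle_lt_or_eq_dec => [|Es]; first exact: below.
 case: (Rle_lt_or_eq_dec _ _ T0) => [Tp|T00]; last first.
  by have -> : s = 0 by [split_Rabs; lra].
 apply: Rnot_lt_le => lt.
 have e0 : 0 < f s - rho / 2 by lra.
 move/filterlim_locally: (cf s) => /(_ (mkposreal _ e0)) [d Hd].
 pose k := Rmin (d / 2) (T / 2) / T.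
 have m0 : 0 < Rmin (d / 2) (T / 2) by apply: Rmin_pos; have := cond_pos d; lra.
 have k0 : 0 < k by apply: Rdiv_lt_0_compat.
 have kT : k * T = Rmin (d / 2) (T / 2) by rewrite /k; field; lra.
 have m1 := Rmin_l (d / 2) (T / 2); have m2 := Rmin_r (d / 2) (T / 2).
 have := Hd ((1 - k) * s); rewrite /ball /= /AbsRing_ball /abs /minus /plus /opp /=.
 have -> : (1 - k) * s + - s = - (k * s) by ring.
 rewrite Rabs_Ropp Rabs_mult (Rabs_pos_eq k) ?Es ?kT; last lra.
 move=> /(_ ltac:(have := cond_pos d; lra)) /Rabs_lt_between [h _].
 have : f ((1 - k) * s) <= rho / 2.
  apply: below; rewrite Rabs_mult Es; have : k <= / 2 by apply: (Rmult_le_reg_r T) => //; lra.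
  rewrite Rabs_pos_eq; nra.
 lra.
have [d1 [d10 H1]] := near T (half T ltac:(rewrite Rabs_pos_eq; lra)).
have [d2 [d20 H2]] := near (- T) (half (- T) ltac:(rewrite Rabs_Ropp Rabs_pos_eq; lra)).
have m0 : 0 < Rmin d1 d2 by pos.
have m1 := Rmin_l d1 d2; have m2 := Rmin_r d1 d2.
have : E (T + Rmin d1 d2 / 2).
 split; first lra.
 move=> s Hs; case: (Rle_or_lt (Rabs s) T) => [h|h]; first by have := half s h; lra.
 case: (Rle_or_lt 0 s) => sp.
  apply: H1; rewrite Rabs_pos_eq in Hs h => //; rewrite Rabs_pos_eq; lra.
 apply: H2; rewrite Rabs_left in Hs h => //; rewrite Rabs_left1; lra.
move/ub; lra.
Qed.

(** * A bounded primitive of an integrable weight on the line *)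

Section DecayPrimitive.
Variable s0 : R.
Hypothesis s0p : 0 < s0.

Definition dec (v : R) : R := Rpower (1 + Rabs v) (- (1 + s0)).
Definition Adec (u : R) : R := RInt dec 0 u.

Lemma dec_cont v : continuous dec v.
Proof.
rewrite /dec; apply: (continuous_comp (fun v => 1 + Rabs v) (fun x => Rpower x (- (1 + s0)))).
 by apply: cont_plus; [apply: continuous_const|apply: continuous_Rabs].
apply: Rpower_continuous; have := Rabs_pos v; lra.
Qed.

Lemma Adec_derive u : is_derive Adec u (dec u).
Proof.
apply: (is_derive_RInt dec Adec 0); last exact: dec_cont.
by apply: filter_forall => b; apply: RInt_correct; apply: ex_RInt_continuous => z _; apply: dec_cont.
Qed.

Lemma Adec_bound u : Rabs (Adec u) <= / s0.
Proof.
have is0 : 0 < / s0 by pos.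
have p x : 0 < x -> is_derive (fun x => Rpower x (- s0)) x (- s0 * Rpower x (- s0 - 1)).
 by move=> x0; apply/is_derive_Reals; apply: derivable_pt_lim_power.
have E0 : Adec 0 = 0 by rewrite /Adec RInt_point.
have dp v : 0 <= dec v by apply: Rlt_le; apply: Rpower_pos.
have le x : 1 <= x -> 0 <= / s0 * Rpower x (- s0) <= / s0.
 move=> x1; have := Rpower_neg_le1 x1 (s := s0) ltac:(lra); have := Rpower_pos x (- s0) => *; nra.
have e1 : - (1 + s0) = - s0 - 1 by ring.
case: (Rle_or_lt 0 u) => up.
- have := @derive_compare Adec (fun v => - (/ s0 * Rpower (1 + v) (- s0))) dec dec 0 u up.
 rewrite E0 Rminus_0_r => H; bound (H _ _ _).
 + by move=> s _; apply: Adec_derive.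
 + move=> s Hs; have i : is_derive (fun v => 1 + v) s 1 by auto_derive => //; ring.
  have := is_derive_comp _ (fun v => 1 + v) _ _ _ (p (1 + s) ltac:(lra)) i.
  move=> /(is_derive_scal _ _ (/ s0)) /(@is_derive_opp R_AbsRing R_NormedModule).
  rewrite /opp /scal /= /mult /=.
  by rewrite (_ : - (/ s0 * _) = dec s) // /dec Rabs_pos_eq ?e1; [field; lra|lra].
 + move=> s _; rewrite Rabs_pos_eq; pos.
 + move: (le (1 + u) ltac:(lra)) (le (1 + 0) ltac:(lra)); lra.
- have up' : u <= 0 by lra.
 have := @derive_compare Adec (fun v => / s0 * Rpower (1 - v) (- s0)) dec dec u 0 up'.
 rewrite E0 Rminus_0_l Rabs_Ropp => H; bound (H _ _ _).
 + by move=> s _; apply: Adec_derive.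
 + move=> s Hs; have i : is_derive (fun v => 1 - v) s (-1) by auto_derive => //; ring.
  have := is_derive_comp _ (fun v => 1 - v) _ _ _ (p (1 - s) ltac:(lra)) i.
  move=> /(is_derive_scal _ _ (/ s0)).
  rewrite /scal /= /mult /=.
  by rewrite (_ : / s0 * (-1 * _) = dec s) // /dec Rabs_left1 ?e1; [rewrite -/(1 - s); field; lra|lra].
 + move=> s _; rewrite Rabs_pos_eq; pos.
 + move: (le (1 - u) ltac:(lra)) (le (1 - 0) ltac:(lra)); lra.
Qed.

End DecayPrimitive.

Lemma is_derive_scalr (f : R -> R) (x l k : R) : is_derive f x l -> is_derive (fun s => f s * k) x (l * k).
Proof.
move=> H; have := @is_derive_mult R_AbsRing _ _ _ _ _ H (is_derive_const k x) Rmult_comm.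
by rewrite /plus /mult /zero /= Rmult_0_r Rplus_0_r.
Qed.

(** * Nontrapping and comparison of the real flow with straight lines *)

Section Flow.
Variables (n : nat) (b : 'I_n -> 'I_n -> vec n -> R) (sgm : R) (Ad : nat -> R).
Hypotheses (s0p : 0 < sgm) (bsm : forall j k, smooth_Rn (b j k)) (bdec : decays b sgm Ad) (bsym : forall j k x, b j k x = b k j x).

Definition gR (x xi : vec n) (j : 'I_n) : R := 2 * fsum (fun k => b j k x * xi k).
Definition fR (x xi : vec n) (i : 'I_n) : R :=
 - fsum (fun j => fsum (fun k => dxs [:: i] (b j k) x * (xi j * xi k))).

Definition flow (eps : R) (ax e : vec n) (X Xi : R -> vec n) : Prop :=
 (forall j, X 0 j = ax j) /\ (forall j, Xi 0 j = e j) /\ forall t j,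
 is_derive (fun s => X s j) t (2 * Xi t j + eps * gR (X t) (Xi t) j) /\
 is_derive (fun s => Xi s j) t (eps * fR (X t) (Xi t) j).

Lemma ham_flow_flow eps ax e X Xi : ham_flow eps b ax e X Xi -> flow eps ax e X Xi.
Proof.
move=> [h1 [h2 h3]]; split => //; split => // t j; have [d1 d2] := h3 t j.
have pRE x xi : pR eps b x xi = fsum (fun i => xi i * xi i) + eps * fsum (fun i => fsum (fun k => b i k x * xi i * xi k)).
 by rewrite /pR vnorm_sq.
split.
- move: d1; congr is_derive; apply: is_derive_unique.
 set xi := Xi t; set x := X t.
 pose dl i : R := if i == j then 1 else 0.
 have du i : is_derive (fun s => upd xi j s i) (xi j) (dl i).
  by rewrite /upd /dl; case: eqP => _; [exact: is_derive_id|exact: is_derive_const].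
 have ue i : upd xi j (xi j) i = xi i by rewrite /upd; case: eqP => // ->.
 have pm (f g : R -> R) f' g' y : is_derive f y f' -> is_derive g y g' -> is_derive (fun s => f s * g s) y (f' * g y + f y * g').
  by move=> k1 k2; have := @is_derive_mult R_AbsRing _ _ _ _ _ k1 k2 Rmult_comm.
 apply: (is_derive_ext (fun s => fsum (fun i => upd xi j s i * upd xi j s i) +
  eps * fsum (fun i => fsum (fun k => b i k x * (upd xi j s i * upd xi j s k))))).
  move=> s; rewrite pRE; congr (_ + eps * _); apply: fsum_ext => i; apply: fsum_ext => k; by lra.
 have -> : 2 * xi j + eps * gR x xi j = fsum (fun i => dl i * xi i + xi i * dl i) +
   eps * fsum (fun i => fsum (fun k => b i k x * (dl i * xi k + xi i * dl k))).
  congr (_ + eps * _).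
   rewrite -[RHS](_ : fsum (fun i => if i == j then 2 * xi i else 0) = _); first by rewrite (fsum_pick j (fun i => 2 * xi i)).
   apply: fsum_ext => i; rewrite /dl; case: eqP => _; ring.
  have -> : fsum (fun i => fsum (fun k => b i k x * (dl i * xi k + xi i * dl k))) =
    fsum (fun i => fsum (fun k => b i k x * (dl i * xi k))) + fsum (fun i => fsum (fun k => b i k x * (xi i * dl k))).
   rewrite -fsum_plus; apply: fsum_ext => i; rewrite -fsum_plus; apply: fsum_ext => k; ring.
  rewrite [X in _ = _ + X]fsum_exchange -fsum_plus /gR.
  rewrite -[LHS](fsum_pick j (fun i => 2 * fsum (fun k => b i k x * xi k))); apply: fsum_ext => i.
  rewrite -fsum_plus /dl; case: eqP => _.
   rewrite -fsum_scal; apply: fsum_ext => k; rewrite (bsym k i); ring.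
  rewrite -[LHS](@fsum_0 'I_n); apply: fsum_ext => k; ring.
 apply: der_plus.
  apply: (fsum_is_derive (F := fun s i => upd xi j s i * upd xi j s i)) => i.
  by have := pm _ _ _ _ _ (du i) (du i); rewrite ue.
 apply: is_derive_scal; apply: (fsum_is_derive (F := fun s i => fsum (fun k => b i k x * (upd xi j s i * upd xi j s k)))) => i.
 apply: (fsum_is_derive (F := fun s k => b i k x * (upd xi j s i * upd xi j s k))) => k.
 by apply: is_derive_scal; have := pm _ _ _ _ _ (du i) (du k); rewrite !ue.
- move: d2; congr is_derive.
 rewrite (_ : eps * fR (X t) (Xi t) j = - (eps * fsum (fun i => fsum (fun k => dxs [:: j] (b i k) (X t) * (Xi t i * Xi t k))))); last by rewrite /fR; ring.
 congr (- _); apply: is_derive_unique.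
 set xi := Xi t; set x := X t.
 apply: (is_derive_ext (fun s => fsum (fun i => xi i * xi i) +
  eps * fsum (fun i => fsum (fun k => b i k (upd x j s) * (xi i * xi k))))).
  move=> s; rewrite pRE; congr (_ + eps * _); apply: fsum_ext => i; apply: fsum_ext => k; by lra.
 rewrite -[X in is_derive _ _ X]Rplus_0_l.
 apply: der_plus; first exact: is_derive_const.
 apply: is_derive_scal; apply: (fsum_is_derive (F := fun s i => fsum (fun k => b i k (upd x j s) * (xi i * xi k)))) => i.
 apply: (fsum_is_derive (F := fun s k => b i k (upd x j s) * (xi i * xi k))) => k.
 exact: (is_derive_scalr _ (pd_dxs (bsm i k) [::] j x)).
Qed.

(** The momentum components stay below 3 in absolute value, whence the factors [6 = 2 * 3] and
    [9 = 3 * 3]. *)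
Definition Bg : R := 6 * (INR n * Rabs (Ad 0%N)).
Definition Bf : R := 9 * (INR n * (INR n * Rabs (Ad 1%N))).

Lemma Bg0 : 0 <= Bg.
Proof. rewrite /Bg; pos. Qed.
Lemma Bf0 : 0 <= Bf.
Proof.
rewrite /Bf; pos.
Qed.

Lemma b_bound ds j k x : Rabs (dxs ds (b j k) x) <= Rabs (Ad (size ds)) * om (sz sgm ds) x.
Proof.
bound (bdec _ _ _ _); apply: Rmult_le_compat_r; last exact: Rle_abs.
pos.
Qed.

Lemma gR_bound x xi j : (forall k, Rabs (xi k) <= 3) -> Rabs (gR x xi j) <= Bg * om (1 + sgm) x.
Proof.
move=> Hxi; rewrite /gR Rabs_mult Rabs_pos_eq; last lra.
have o0 : 0 < om (1 + sgm) x by pos.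
via (2 * (INR #|'I_n| * (Rabs (Ad 0%N) * om (1 + sgm) x * 3))); last by rewrite card_ord /Bg; pos.
apply: Rmult_le_compat_l; first lra.
bound (fsum_Rabs _); apply: fsum_le_const => k; rewrite Rabs_mult.
apply: Rmult_le_compat => //; [exact: Rabs_pos|exact: Rabs_pos|].
by have := b_bound [::] j k x; rewrite sz0.
Qed.

Lemma fR_bound x xi i : (forall k, Rabs (xi k) <= 3) -> Rabs (fR x xi i) <= Bf * om (2 + sgm) x.
Proof.
move=> Hxi; rewrite /fR Rabs_Ropp.
via (INR #|'I_n| * (INR #|'I_n| * (Rabs (Ad 1%N) * om (2 + sgm) x * (3 * 3)))); last by rewrite card_ord /Bf; pos.
bound (fsum_Rabs _); apply: fsum_le_const => j.
bound (fsum_Rabs _); apply: fsum_le_const => k; rewrite Rabs_mult.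
apply: Rmult_le_compat; [exact: Rabs_pos|exact: Rabs_pos| |].
 have := b_bound [:: i] j k x; pos.
rewrite Rabs_mult; pos.
Qed.

(** The factor 4 comes from a velocity of at least 1/4 along [e], the power of 3 from comparing
    [<x>] with the component along [e], and [2 / sgm] bounds the total increment of [Adec]. *)
Definition Kint : R := 4 * Rpower 3 (1 + sgm) * (2 * / sgm).

Lemma Kint0 : 0 <= Kint.
Proof.
have := Rinv_0_lt_compat _ s0p; have := Rpower_pos 3 (1 + sgm) => p q; rewrite /Kint.
pos.
Qed.

Variables (eps : R) (ax e : vec n) (X Xi : R -> vec n).
Hypotheses (ep : 0 < eps) (e12 : / 2 <= vnorm e <= 2) (F : flow eps ax e X Xi) (esm : eps * (INR n * Bg) <= / 20).

Lemma near_e s i : l1 (vsub (Xi s) e) <= / 20 -> Rabs (Xi s i) <= 3.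
Proof.
move=> H; have h1 : Rabs (Xi s i - e i) <= / 20 := Rle_trans _ _ _ (l1_term (vsub (Xi s) e) i) H.
have h2 := vnorm_term e i; move: h1 h2 e12 => /Rabs_le_between h1 h2 h3; have {h2} /Rabs_le_between h2 : Rabs (e i) <= 2 by lra.
apply/Rabs_le_between; lra.
Qed.

Lemma om_dec x : om (1 + sgm) x <= Rpower 3 (1 + sgm) * dec sgm (dot x e).
Proof.
have j1 := jbr_ge1 x; have v := vnorm_le_jbr x; have v0 := vnorm_ge0 x.
have cs := cauchy_schwarz x e.
have H : 1 + Rabs (dot x e) <= 3 * jbr x.
 have : vnorm x * vnorm e <= jbr x * 2 by pos.
 lra.
have := Rpower_neg_anti (s := 1 + sgm) (x := 1 + Rabs (dot x e)) ltac:(have := Rabs_pos (dot x e); lra) H ltac:(lra).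
rewrite -Rpower_mult_distr; [|lra|lra]; rewrite Rpower_Ropp /om /dec => K.
have p := Rpower_pos 3 (1 + sgm).
apply: (Rmult_le_reg_l (/ Rpower 3 (1 + sgm))); first exact: Rinv_0_lt_compat.
rewrite -Rmult_assoc Rinv_l; lra.
Qed.

(** Nontrapping: while the momentum is near [e], the component [u] of the position along [e]
    increases at speed at least 1/4. Time may then be traded for [u], and a weight decaying in [u]
    has an integral bounded independently of the time span. *)
Lemma flow_int (f df : R -> R) K s1 s2 : s1 <= s2 -> 0 <= K ->
 (forall s, s1 <= s <= s2 -> l1 (vsub (Xi s) e) <= / 20) ->
 (forall s, s1 <= s <= s2 -> is_derive f s (df s)) ->
 (forall s, s1 <= s <= s2 -> Rabs (df s) <= K * om (1 + sgm) (X s)) ->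
 Rabs (f s2 - f s1) <= K * Kint.
Proof.
move=> s12 K0 Hl Hf Hdf.
have p3 := Rpower_pos 3 (1 + sgm).
pose u s := dot (X s) e.
pose du s := fsum (fun j => (2 * Xi s j + eps * gR (X s) (Xi s) j) * e j).
have uP s : is_derive u s (du s).
 apply: (fsum_is_derive (F := fun s j => X s j * e j)) => j.
 exact: (is_derive_scalr _ (proj1 (proj2 (proj2 F) s j))).
have du4 s : s1 <= s <= s2 -> / 4 <= du s.
 move=> Hs; have H := Hl s Hs.
 have -> : du s = 2 * dot e e + (2 * dot (vsub (Xi s) e) e + eps * fsum (fun j => gR (X s) (Xi s) j * e j)).
  rewrite /du -[dot e e]/(fsum (fun j => e j * e j)) -[dot _ e]/(fsum (fun j => vsub (Xi s) e j * e j)).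
  rewrite -!fsum_scal -!fsum_plus; apply: fsum_ext => j; rewrite /vsub; ring.
 have D1 : Rabs (dot (vsub (Xi s) e) e) <= / 20 * vnorm e.
  bound (cauchy_schwarz _ _); apply: Rmult_le_compat_r; first lra.
  exact: Rle_trans (vnorm_le_l1 _) H.
 have D2 : Rabs (eps * fsum (fun j => gR (X s) (Xi s) j * e j)) <= / 10.
  rewrite Rabs_mult (Rabs_pos_eq eps); last lra.
  via (eps * (INR #|'I_n| * (Bg * 2))); last by rewrite card_ord; lra.
  apply: Rmult_le_compat_l; first lra.
  bound (fsum_Rabs _); apply: fsum_le_const => j; rewrite Rabs_mult.
  apply: Rmult_le_compat; [exact: Rabs_pos|exact: Rabs_pos| |].
   bound (gR_bound _ _ (fun k => near_e k H)).
   rewrite -[X in _ <= X]Rmult_1_r; apply: Rmult_le_compat_l; [exact: Bg0|apply: om_le1; lra].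
  have := vnorm_term e j; lra.
 have D3 := vnorm_sq e.
 move/Rabs_le_between: D1; move/Rabs_le_between: D2; nra.
have comp := @derive_compare f (fun s => K * (4 * Rpower 3 (1 + sgm)) * Adec sgm (u s)) df
  (fun s => K * (4 * Rpower 3 (1 + sgm)) * (du s * dec sgm (u s))) s1 s2 s12 Hf.
bound (comp _ _).
- move=> s _; apply: is_derive_scal.
 exact: (is_derive_comp (Adec sgm) u s _ _ (Adec_derive sgm (u s)) (uP s)).
- move=> s Hs; bound (Hdf s Hs).
 rewrite Rmult_assoc; apply: Rmult_le_compat_l => //; bound (om_dec _).
 have d0 : 0 < dec sgm (u s) by apply: Rpower_pos.
 have := du4 s Hs; rewrite -/(u s) => D.
 have : 1 * dec sgm (u s) <= 4 * du s * dec sgm (u s) by pos.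
 nra.
- rewrite -Rmult_minus_distr_l (_ : K * Kint = K * (4 * Rpower 3 (1 + sgm)) * (2 * / sgm)); last by rewrite /Kint; ring.
 apply: Rmult_le_compat_l; first pos.
 have /Rabs_le_between := Adec_bound s0p (u s1); have /Rabs_le_between := Adec_bound s0p (u s2); lra.
Qed.

Lemma Xi_cont i s : continuous (fun s => Xi s i) s.
Proof. apply: ex_derive_continuous; eexists; exact: (proj2 (proj2 (proj2 F) s i)). Qed.

Hypothesis esm2 : INR n * (eps * Bf * Kint) <= / 40.

Lemma Xi_step s i : (forall r, Rabs r <= Rabs s -> l1 (vsub (Xi r) e) <= / 20) ->
 Rabs (Xi s i - e i) <= eps * Bf * Kint.
Proof.
move=> H; rewrite -(proj1 (proj2 F) i).
have K0 : 0 <= eps * Bf by have := Rmult_le_pos _ _ (Rlt_le _ _ ep) Bf0.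
have dP r : is_derive (fun s => Xi s i) r (eps * fR (X r) (Xi r) i) := proj2 (proj2 (proj2 F) r i).
have db r : Rabs r <= Rabs s -> Rabs (eps * fR (X r) (Xi r) i) <= eps * Bf * om (1 + sgm) (X r).
 move=> Hr; rewrite Rabs_mult (Rabs_pos_eq eps); last lra.
 rewrite Rmult_assoc; apply: Rmult_le_compat_l; first lra.
 bound (fR_bound _ _ (fun k => near_e k (H r Hr))).
 apply: Rmult_le_compat_l; first exact: Bf0.
 apply: om_mono; lra.
case: (Rle_or_lt 0 s) => sp.
 have ab r : 0 <= r <= s -> Rabs r <= Rabs s by move=> Hr; rewrite !Rabs_pos_eq; lra.
 apply: (flow_int (f := fun s => Xi s i) (df := fun r => eps * fR (X r) (Xi r) i)) => // r Hr; pos.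
have ab r : s <= r <= 0 -> Rabs r <= Rabs s by move=> Hr; rewrite (Rabs_left s) // Rabs_left1; lra.
rewrite Rabs_minus_sym.
apply: (flow_int (f := fun s => Xi s i) (df := fun r => eps * fR (X r) (Xi r) i)) => //; pos.
Qed.

(** The two facts support each other: closeness to [e] up to time [tau] makes the force integrable,
    and integrability gives closeness with half the constant. *)
Lemma Xi_near s : l1 (vsub (Xi s) e) <= / 20.
Proof.
suff : l1 (vsub (Xi s) e) <= / 20 / 2 by lra.
apply: (bootstrap (f := fun s => l1 (vsub (Xi s) e))); first lra.
- move=> r; apply: (fsum_continuous (F := fun r c => Rabs (vsub (Xi r) e c))) => i.
 apply: (continuous_comp (fun r => vsub (Xi r) e i) Rabs); last exact: continuous_Rabs.
 by apply: cont_minus; [exact: Xi_cont|exact: continuous_const].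
- move=> tau t0 H r Hr; apply: Rle_trans (_ : INR #|'I_n| * (eps * Bf * Kint) <= _); last by rewrite card_ord; lra.
 apply: fsum_le_const => i; apply: Xi_step => r' Hr'; apply: H; lra.
- rewrite /l1 (_ : fsum _ = fsum (fun _ : 'I_n => 0)); first by rewrite fsum_0; lra.
 by apply: fsum_ext => i; rewrite /vsub (proj1 (proj2 F)) Rminus_diag Rabs_R0.
Qed.

Lemma Xi_close s i : Rabs (Xi s i - e i) <= eps * Bf * Kint.
Proof. by apply: Xi_step => r _; apply: Xi_near. Qed.

Lemma Xi_le3 s i : Rabs (Xi s i) <= 3. Proof. exact: near_e (Xi_near s). Qed.

Lemma X_line s s' i : Rabs (X s' i - X s i - 2 * (s' - s) * e i) <= eps * (2 * Bf * Kint + Bg) * Rabs (s' - s).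
Proof.
have key s1 s2 : s1 <= s2 -> Rabs (X s2 i - X s1 i - 2 * (s2 - s1) * e i) <= eps * (2 * Bf * Kint + Bg) * (s2 - s1).
 move=> s12.
 have := @derive_compare (fun s => X s i - 2 * s * e i) (fun s => eps * (2 * Bf * Kint + Bg) * s)
  (fun s => 2 * Xi s i + eps * gR (X s) (Xi s) i - 2 * e i) (fun s => eps * (2 * Bf * Kint + Bg)) s1 s2 s12.
 have -> : X s2 i - 2 * s2 * e i - (X s1 i - 2 * s1 * e i) = X s2 i - X s1 i - 2 * (s2 - s1) * e i by ring.
 have -> : eps * (2 * Bf * Kint + Bg) * s2 - eps * (2 * Bf * Kint + Bg) * s1 = eps * (2 * Bf * Kint + Bg) * (s2 - s1) by ring.
 apply => r _.
 - apply: der_minus; first exact: (proj1 (proj2 (proj2 F) r i)).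
  auto_derive => //; ring.
 - auto_derive => //; ring.
 - have h1 := Xi_close r i.
  have h2 : Rabs (eps * gR (X r) (Xi r) i) <= eps * Bg.
   rewrite Rabs_mult (Rabs_pos_eq eps); last lra.
   apply: Rmult_le_compat_l; first lra.
   bound (gR_bound _ _ (Xi_le3 r)).
   rewrite -[X in _ <= X]Rmult_1_r; apply: Rmult_le_compat_l; [exact: Bg0|apply: om_le1; lra].
  move/Rabs_le_between: h1; move/Rabs_le_between: h2 => *; apply/Rabs_le_between; lra.
case: (Rle_or_lt s s') => h; first by rewrite (Rabs_pos_eq (s' - s)); pos.
have := key s' s ltac:(lra); rewrite (Rabs_left (s' - s)); last lra.
rewrite -(Rabs_Ropp (_ - _ - _)) (_ : - _ = X s' i - X s i - 2 * (s' - s) * e i); lra.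
Qed.

Hypothesis esm3 : eps * (2 * Bf * Kint + Bg) * INR n <= / 2.

(** The displacement is at least half of that of the straight line, whose speed is at least one. The
    bound turns a factor [t - s] into weights of positions. *)
Lemma time_le s t : Rabs (t - s) <= 2 * vnorm (vsub (X t) (X s)).
Proof.
have V : vnorm (fun i => X t i - X s i - 2 * (t - s) * e i) <= / 2 * Rabs (t - s).
 bound (vnorm_le_l1 _).
 via (INR #|'I_n| * (eps * (2 * Bf * Kint + Bg) * Rabs (t - s))).
  by apply: fsum_le_const => i; apply: X_line.
 rewrite card_ord; have := Rabs_pos (t - s) => *; nra.
have := vnorm_vadd (vsub (X t) (X s)) (-1) (fun i => X t i - X s i - 2 * (t - s) * e i).
rewrite (_ : vadd _ _ _ = vadd (fun _ => 0) (2 * (t - s)) e); last first.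
 apply: funext => i; rewrite /vadd /vsub; ring.
rewrite (_ : Rabs (-1) = 1); last by split_Rabs; lra.
have -> : vnorm (vadd (fun _ => 0) (2 * (t - s)) e) = Rabs (2 * (t - s)) * vnorm e.
 rewrite /vnorm -sqrt_Rsqr_abs -sqrt_mult; [|apply: Rle_0_sqr|apply: dot_self_ge0].
 congr sqrt; rewrite -[dot _ _]/(fsum _) -[dot e e]/(fsum (fun i => e i * e i)) -fsum_scal; apply: fsum_ext => i.
 rewrite /vadd /Rsqr; ring.
rewrite Rabs_mult (Rabs_pos_eq 2); last lra.
have := Rabs_pos (t - s) => *; nra.
Qed.

(* [Psi s = X s + 2 (t - s) Xi s] interpolates between the free and the perturbed position at time [t]. *)
Lemma X_free t i : Rabs (X t i - ax i - 2 * t * e i) <= eps * (Bg + 4 * Bf) * Kint * 2 * jbr (X t).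
Proof.
pose P s := X s i + 2 * (t - s) * Xi s i.
pose dP s := eps * gR (X s) (Xi s) i + 2 * (t - s) * (eps * fR (X s) (Xi s) i).
have PP s : is_derive P s (dP s).
 have := proj2 (proj2 F) s i => -[h1 h2].
 have l : is_derive (fun s => 2 * (t - s)) s (-2) by auto_derive => //; ring.
 have h3 := @is_derive_mult R_AbsRing _ _ _ _ _ l h2 Rmult_comm.
 have := @is_derive_plus R_AbsRing R_NormedModule _ _ _ _ _ h1 h3.
 rewrite /plus /mult /= (_ : 2 * Xi s i + _ + _ = dP s) // /dP; ring.
have j1 := jbr_ge1 (X t).
(* The factor [t - s] is at most [2 (<X t> + <X s>)]. The weight [<X s>] is absorbed by the stronger
   decay of the force, and [<X t>] appears in the conclusion. *)
have dPb s : Rabs (dP s) <= eps * (Bg + 4 * Bf) * 2 * jbr (X t) * om (1 + sgm) (X s).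
 have o1 : 0 < om (1 + sgm) (X s) by pos.
 have o2 : 0 < om (2 + sgm) (X s) by pos.
 have js := jbr_ge1 (X s).
 have o12 : jbr (X s) * om (2 + sgm) (X s) = om (1 + sgm) (X s).
  rewrite /om (_ : - (1 + sgm) = 1 + - (2 + sgm)); last ring.
  rewrite Rpower_plus Rpower_1; lra.
 have o21 : om (2 + sgm) (X s) <= om (1 + sgm) (X s) by apply: om_mono; lra.
 have tl := time_le s t.
 have vl : vnorm (vsub (X t) (X s)) <= jbr (X t) + jbr (X s).
  have := vnorm_vadd (X t) (-1) (X s); rewrite (_ : vadd _ _ _ = vsub (X t) (X s)); last first.
   apply: funext => k; rewrite /vadd /vsub; ring.
  rewrite (_ : Rabs (-1) = 1); last by split_Rabs; lra.
  move: (vnorm_le_jbr (X t)) (vnorm_le_jbr (X s)); lra.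
 have g1 := gR_bound (X s) i (Xi_le3 s); have f1 := fR_bound (X s) i (Xi_le3 s).
 have B1 := Bg0; have B2 := Bf0.
 bound (Rabs_triang _ _).
 rewrite (Rabs_mult (2 * (t - s))) (Rabs_mult 2) !(Rabs_mult eps) (Rabs_pos_eq 2) ?(Rabs_pos_eq eps); try lra.
 have A1 : Rabs (gR (X s) (Xi s) i) <= Bg * jbr (X t) * om (1 + sgm) (X s).
  bound g1; rewrite Rmult_assoc; apply: Rmult_le_compat_l => //; nra.
 have A2 : Rabs (t - s) * Rabs (fR (X s) (Xi s) i) <= 4 * Bf * jbr (X t) * om (1 + sgm) (X s).
  via ((2 * (jbr (X t) + jbr (X s))) * (Bf * om (2 + sgm) (X s))).
   pos.
  rewrite (_ : _ * _ = 2 * Bf * (jbr (X t) * om (2 + sgm) (X s) + jbr (X s) * om (2 + sgm) (X s))); last ring.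
  rewrite o12.
  have : jbr (X t) * om (2 + sgm) (X s) + om (1 + sgm) (X s) <= 2 * (jbr (X t) * om (1 + sgm) (X s)) by nra.
  move=> h; have := Rmult_le_compat_l (2 * Bf) _ _ ltac:(lra) h; lra.
 have : eps * (Rabs (gR (X s) (Xi s) i) + 2 * (Rabs (t - s) * Rabs (fR (X s) (Xi s) i))) <=
   eps * (Bg * jbr (X t) * om (1 + sgm) (X s) + 2 * (4 * Bf * jbr (X t) * om (1 + sgm) (X s))).
  pos.
 have : 0 <= eps * (Bg * (jbr (X t) * om (1 + sgm) (X s))).
  pos.
 lra.
have E : X t i - ax i - 2 * t * e i = P t - P 0.
 rewrite /P -(proj1 F) -(proj1 (proj2 F)); ring.
have K0 : 0 <= eps * (Bg + 4 * Bf) * 2 * jbr (X t).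
 have B1 := Bg0; have B2 := Bf0; pos.
rewrite E (_ : eps * (Bg + 4 * Bf) * Kint * 2 * jbr (X t) = eps * (Bg + 4 * Bf) * 2 * jbr (X t) * Kint); last ring.
case: (Rle_or_lt 0 t) => tp.
 by apply: (flow_int (f := P) (df := dP)) => // r _; apply: Xi_near.
by rewrite Rabs_minus_sym; apply: (flow_int (f := P) (df := dP)) => //; [lra|move=> r _; apply: Xi_near].
Qed.

End Flow.

(** * Flow estimates under one smallness condition *)

Section FlowSummary.
Variables (n : nat) (b : 'I_n -> 'I_n -> vec n -> R) (sgm : R) (Ad : nat -> R).
Hypotheses (s0p : 0 < sgm) (bsm : forall j k, smooth_Rn (b j k)) (bdec : decays b sgm Ad) (bsym : forall j k x, b j k x = b k j x).

Record flow_bounds (Cf eps : R) (ax e : vec n) (X Xi : R -> vec n) : Prop := FlowBounds {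
 fbF : flow b eps ax e X Xi;
 fbE : forall s i, Rabs (Xi s i - e i) <= Cf * eps;
 fb3 : forall s i, Rabs (Xi s i) <= 3;
 fbL : forall s s' i, Rabs (X s' i - X s i - 2 * (s' - s) * e i) <= Cf * eps * Rabs (s' - s);
 fbX : forall t i, Rabs (X t i - ax i - 2 * t * e i) <= Cf * eps * jbr (X t) }.

Lemma flow_estimates : exists Cf eps2, 0 <= Cf /\ 0 < eps2 /\ forall eps, 0 < eps < eps2 ->
 forall ax e X Xi, / 2 <= vnorm e <= 2 -> ham_flow eps b ax e X Xi -> flow_bounds Cf eps ax e X Xi.
Proof.
set N := INR n; have N0 : 0 <= N := pos_INR n.
set g := Bg n Ad; have g0 : 0 <= g := Bg0 n Ad.
set f := Bf n Ad; have f0 : 0 <= f := Bf0 n Ad.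
set k := Kint sgm; have k0 : 0 <= k := Kint0 s0p.
have fk : 0 <= f * k by pos.
have gk : 0 <= g * k by pos.
pose M := 40 * (1 + N) * (1 + g + f * k).
have M1 : 1 <= M by rewrite /M; nra.
exists (g + 2 * (f * k) + 2 * (g * k) + 8 * (f * k)), (/ M).
split; first lra.
split; first pos.
move=> eps [ep eM] ax e X Xi e12 HF.
have F := ham_flow_flow bsm bsym HF.
have eM1 : eps * M <= 1.
 by apply: Rlt_le; apply: (Rmult_lt_reg_r (/ M)); [apply: Rinv_0_lt_compat; lra|rewrite Rmult_assoc Rinv_r; lra].
have P u : 0 <= u -> u <= (1 + N) * (1 + g + f * k) -> eps * u <= / 40.
 move=> u0 uM; apply: (Rmult_le_reg_l 40); first lra.
 apply: Rle_trans (_ : eps * M <= _); last lra.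
 rewrite /M; nra.
have Ng := Rmult_le_pos _ _ N0 g0; have Nf := Rmult_le_pos _ _ N0 fk.
have s1 : eps * (N * g) <= / 20 by have := P (N * g) ltac:(lra) ltac:(nra); lra.
have s2 : N * (eps * f * k) <= / 40.
 by rewrite (_ : _ * _ = eps * (N * (f * k))); [apply: P; nra|ring].
have s3 : eps * (2 * f * k + g) * N <= / 2.
 lra.
have efk := Rmult_le_pos _ _ (Rlt_le _ _ ep) fk; have egk := Rmult_le_pos _ _ (Rlt_le _ _ ep) gk.
have eg := Rmult_le_pos _ _ (Rlt_le _ _ ep) g0.
split => //.
- move=> s i; bound (Xi_close s0p bdec ep e12 F s1 s2 s i); rewrite -/f -/k; lra.
- by move=> s i; apply: (Xi_le3 s0p bdec ep e12 F s1 s2 s i).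
- move=> s s' i; bound (X_line s0p bdec ep e12 F s1 s2 s s' i); rewrite -/f -/k -/g.
 pos.
- move=> t i; bound (X_free s0p bdec ep e12 F s1 s2 s3 t i); rewrite -/f -/k -/g.
 by apply: Rmult_le_compat_r; [have := jbr_ge1 (X t); lra|lra].
Qed.

End FlowSummary.

(** * Geometry of the rays *)

Section Geometry.
Variable n : nat.
Implicit Types v x ax e : vec n.

(** With [c = |s| |e|] the hypothesis gives [<v + 2se>^2 >= <v>^2 - c <v> + 4 c^2]. Completing the
    square leaves at least [3/4 + 3 c^2], and [c >= |s|/2]. *)
Lemma jbr_line v e s : / 2 <= vnorm e -> - (/ 4 * Rabs s * jbr v * vnorm e) <= s * dot v e ->
 (1 + Rabs s) / 2 <= jbr (fun i => v i + 2 * s * e i).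
Proof.
move=> e2 H; set w := fun i => _.
have E : dot w w = dot v v + 4 * (s * dot v e) + 4 * s ^ 2 * dot e e.
 rewrite -[dot w w]/(fsum (fun i => w i * w i)) -[dot v v]/(fsum (fun i => v i * v i)).
 rewrite -[dot v e]/(fsum (fun i => v i * e i)) -[dot e e]/(fsum (fun i => e i * e i)) -(fsum_scal s) -(fsum_scal 4) -(fsum_scal (4 * s ^ 2)) -!fsum_plus.
 apply: fsum_ext => i; rewrite /w; ring.
have s0 := Rabs_pos s; have j1 := jbr_ge1 v; have js := jbr_sq v; have jw := jbr_sq w; have jw1 := jbr_ge1 w.
rewrite !vnorm_sq in js jw; have ee := vnorm_sq e.
rewrite -(pow2_abs s) in E.
apply: Rnot_lt_le => lt.
have lt2 : jbr w ^ 2 < ((1 + Rabs s) / 2) ^ 2 by nra.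
have a1 : 0 <= Rabs s * (vnorm e - / 2) by pos.
have a2 : (Rabs s / 2) ^ 2 <= (Rabs s * vnorm e) ^ 2 by pos.
set c := Rabs s * vnorm e in a1 a2 *.
have H' : - (/ 4 * (c * jbr v)) <= s * dot v e by rewrite /c; lra.
have E2 : 4 * Rabs s ^ 2 * dot e e = 4 * c ^ 2 by rewrite /c -ee; ring.
have := pow2_ge_0 (jbr v / 2 - c) => q1; have := pow2_ge_0 (Rabs s - 1) => q2.
nra.
Qed.

Lemma TT_kap t : TT t * / (1 + 4 * t ^ 2) <= 2.
Proof.
have P := pow2_ge_0 t; apply: (Rmult_le_reg_r (1 + 4 * t ^ 2)); first lra.
rewrite Rmult_assoc Rinv_l; last lra.
rewrite /TT -(pow2_abs t); nra.
Qed.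

Lemma jbr_perturb v w : jbr v - l1 (fun i => w i - v i) <= jbr w.
Proof.
have := jbr_sub w v; have : vnorm (vsub v w) <= l1 (fun i => w i - v i); last lra.
bound (vnorm_le_l1 _); right; apply: fsum_ext => i; exact: Rabs_minus_sym.
Qed.

(** The real part of the free complex ray is compared with the line of direction [e] through [ax],
    or through [x] followed backwards. The deviation is a small multiple of the weight since [yf] is
    at most [cst * TT], and [jbr_line] controls the line. *)
Lemma idx_exists ty ax e t x : / 2 <= vnorm e <= 2 ->
 (forall i, Rabs (yf ax e t x i) <= cst n * TT t) ->
 (if ty then - (/ 4 * Rabs t * jbr x * vnorm e) <= - (t * dot x e)
  else - (/ 4 * Rabs t * jbr ax * vnorm e) <= t * dot ax e) ->
 exists a : idx n, [/\ iax a = ax, iaxi a = e, it a = t, ix a = x & ity a = ty].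
Proof.
move=> e12 Hy Hc.
suff L r : I01 r -> cG * Lm ty t r <= jbr (Rezf ax e t x r) by exists (Idx (it := t) (ity := ty) e12 Hy L).
move=> Hr; have T1 := TT_ge1 t; have K2 := TT_kap t; have t0 := Rabs_pos t.
have P : 0 < / (1 + 4 * t ^ 2) <= 1.
 have := pow2_ge_0 t => p; split; first pos.
 rewrite -Rinv_1; pos.
set k := / (1 + 4 * t ^ 2) in K2 P.
have cn := cst_n n; have c0 := cst_pos n.
have small (m : R) (v : vec n) : 0 <= m -> (forall i, Rabs (v i) <= cst n * m) -> l1 v <= m / 100.
 move=> m0 Hv; bound (fsum_le_const Hv); rewrite card_ord -Rmult_assoc.
 nra.
destruct ty; rewrite /Lm /cG.
- have J := @jbr_line x e (- t * (1 - r)) (proj1 e12) _.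
 have m1 := mD_ge1 t Hr.
 have at1 : Rabs (- t * (1 - r)) = Rabs t * (1 - r) by rewrite Rabs_mult Rabs_Ropp (Rabs_pos_eq (1 - r)); lra.
 have J' : (1 + Rabs t * (1 - r)) / 2 <= jbr (fun i => x i + 2 * (- t * (1 - r)) * e i).
  rewrite -at1; apply: J; rewrite at1.
  nra.
 have D := jbr_perturb (fun i => x i + 2 * (- t * (1 - r)) * e i) (Rezf ax e t x r).
 have S : l1 (fun i => Rezf ax e t x r i - (x i + 2 * (- t * (1 - r)) * e i)) <= mD t r / 100.
  apply: small; first lra.
  move=> i; rewrite (_ : _ - _ = - ((1 - r) * (1 - k)) * yf ax e t x i); last by rewrite /Rezf /yf /kap /= -/k; ring.
  rewrite Rabs_mult Rabs_Ropp Rabs_pos_eq; last pos.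
  via ((1 - r) * 1 * (cst n * TT t)).
   pos.
  have : (1 - r) * TT t <= mD t r by rewrite /TT /mD; nra.
  nra.
 rewrite -/(mD t r) in J'; lra.
- have J := @jbr_line ax e (t * r) (proj1 e12) _.
 have m1 := mC_ge1 t Hr.
 have at1 : Rabs (t * r) = Rabs t * r by rewrite Rabs_mult (Rabs_pos_eq r); lra.
 have J' : (1 + Rabs t * r) / 2 <= jbr (fun i => ax i + 2 * (t * r) * e i).
  rewrite -at1; apply: J; rewrite at1.
  nra.
 have D := jbr_perturb (fun i => ax i + 2 * (t * r) * e i) (Rezf ax e t x r).
 have S : l1 (fun i => Rezf ax e t x r i - (ax i + 2 * (t * r) * e i)) <= (3 * mC t r) / 100.
  apply: small; first lra.
  move=> i; rewrite (_ : _ - _ = (r + (1 - r) * k) * yf ax e t x i); last by rewrite /Rezf /yf /kap /= -/k; ring.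
  rewrite Rabs_mult Rabs_pos_eq; last pos.
  via ((r + (1 - r) * k) * (cst n * TT t)).
   pos.
  have h1 : (1 - r) * (TT t * k) <= 2 by nra.
  have h2 : r * TT t + (1 - r) * (TT t * k) <= 3 * mC t r.
   have h3 : (1 - r) * (TT t * k) <= (1 - r) * 2 by pos.
   rewrite /mC /TT in h3 *; nra.
  nra.
 rewrite -/(mC t r) in J'; lra.
Qed.

Lemma jbrR_TT t : jbrR t <= TT t.
Proof.
rewrite /jbrR /TT -(pow2_abs t); have := Rabs_pos t => h.
rewrite -[X in _ <= X]sqrt_pow2; last lra.
apply: sqrt_le_1_alt; nra.
Qed.

Variables (b : 'I_n -> 'I_n -> vec n -> R) (Cf eps : R) (ax e : vec n) (X Xi : R -> vec n).
Hypotheses (e12 : / 2 <= vnorm e <= 2) (ep : 0 < eps) (Cf0 : 0 <= Cf) (FB : flow_bounds b Cf eps ax e X Xi) (esm : Cf * eps <= cst n / 2).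

(** In each coordinate the flow leaves the straight line by at most [cst/2] times the elapsed time,
    which the margin between 1/2 and 1/4 absorbs. *)
Lemma ray_lower (ty : bool) t x : (if ty then - (/ 4 * Rabs t * jbr (X t) * vnorm e) <= - (t * dot (X t) e)
  else - (/ 4 * Rabs t * jbr ax * vnorm e) <= t * dot ax e) ->
 forall r, I01 r -> / 4 * Lm ty t r <= jbr (X (t * r)).
Proof.
move=> Hc r Hr; have t0 := Rabs_pos t; have cn := cst_n n; have c0 := cst_pos n; have N0 := pos_INR n.
have small (m : R) (v : vec n) : 0 <= m -> (forall i, Rabs (v i) <= cst n / 2 * m) -> l1 v <= m / 100.
 move=> m0 Hv; bound (fsum_le_const Hv); rewrite card_ord -Rmult_assoc.
 nra.
destruct ty; rewrite /Lm.
- have at1 : Rabs (- t * (1 - r)) = Rabs t * (1 - r) by rewrite Rabs_mult Rabs_Ropp (Rabs_pos_eq (1 - r)); lra.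
 have J' : (1 + Rabs t * (1 - r)) / 2 <= jbr (fun i => X t i + 2 * (- t * (1 - r)) * e i).
  rewrite -at1; apply: (jbr_line (proj1 e12)); rewrite at1.
  nra.
 have D := jbr_perturb (fun i => X t i + 2 * (- t * (1 - r)) * e i) (X (t * r)).
 have S : l1 (fun i => X (t * r) i - (X t i + 2 * (- t * (1 - r)) * e i)) <= Rabs t * (1 - r) / 100.
  apply: small; first pos.
  move=> i; have := fbL FB t (t * r) i; have -> : t * r - t = - t * (1 - r) by ring.
  rewrite at1 (_ : _ - _ - _ = X (t * r) i - (X t i + 2 * (- t * (1 - r)) * e i)); last ring.
  move=> h; bound h; pos.
 rewrite /mD; nra.
- have at1 : Rabs (t * r) = Rabs t * r by rewrite Rabs_mult (Rabs_pos_eq r); lra.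
 have J' : (1 + Rabs t * r) / 2 <= jbr (fun i => ax i + 2 * (t * r) * e i).
  rewrite -at1; apply: (jbr_line (proj1 e12)); rewrite at1.
  nra.
 have D := jbr_perturb (fun i => ax i + 2 * (t * r) * e i) (X (t * r)).
 have S : l1 (fun i => X (t * r) i - (ax i + 2 * (t * r) * e i)) <= Rabs t * r / 100.
  apply: small; first pos.
  move=> i; have := fbL FB 0 (t * r) i; rewrite (proj1 (fbF FB)) Rminus_0_r.
  rewrite at1 (_ : _ - _ - _ = X (t * r) i - (ax i + 2 * (t * r) * e i)); last ring.
  move=> h; bound h; pos.
 rewrite /mC; nra.
Qed.

(** If the ray is not directed towards the origin for the given sign of [t], the lower bound starts
    from [ax]. In cases (b) and (c) with the other sign the condition on [x] lets it start from the
    end point. The gap between 1/4 and 1/8 permits replacing [x] by the real end point, except when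
    the latter is itself no farther from the origin than a multiple of its distance to [x]: this is
    the last alternative. *)
Lemma Omega_idx delta t x : 0 < delta <= cst n / 2 -> Omega delta (/ 4) (/ 8) ax e X t x ->
 vnorm (vsub x (X t)) <= delta * TT t /\ exists a : idx n,
 [/\ iax a = ax, iaxi a = e, it a = t & ix a = x] /\
 ((forall r, I01 r -> / 4 * Lm (ity a) t r <= jbr (X (t * r))) \/
  (ity a = true /\ jbr (X t) <= 9 * vnorm (vsub x (X t)))).
Proof.
move=> [d0 dc] O.
set rho := vnorm (vsub x (X t)).
have R0 : rho <= delta * jbrR t by case: O => [[_ ?]|[[_ [? _]]|[_ [? _]]]]; rewrite /rho; lra.
have R1 : rho <= delta * TT t by bound R0; apply: Rmult_le_compat_l; [lra|exact: jbrR_TT].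
split => //.
have Hy i : Rabs (yf ax e t x i) <= cst n * TT t.
 have h1 : Rabs (x i - X t i) <= rho := vnorm_term (vsub x (X t)) i.
 have := fbL FB 0 t i; rewrite (proj1 (fbF FB)) Rminus_0_r => h2.
 have h3 : Cf * eps * Rabs t <= cst n / 2 * TT t.
  by apply: Rmult_le_compat => //; [apply: Rmult_le_pos; lra|exact: Rabs_pos|rewrite /TT; lra].
 have h4 : delta * TT t <= cst n / 2 * TT t by pos.
 rewrite /yf (_ : _ - _ - _ = (x i - X t i) + (X t i - ax i - 2 * t * e i)); last ring.
 bound (Rabs_triang _ _); lra.
have j0 := jbr_ge1 ax; have v0 := vnorm_ge0 e; have t0 := Rabs_pos t; have jx := jbr_ge1 x; have jX := jbr_ge1 (X t).
have type1 : - (/ 4 * Rabs t * jbr ax * vnorm e) <= t * dot ax e -> exists a : idx n,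
  [/\ iax a = ax, iaxi a = e, it a = t & ix a = x] /\
  ((forall r, I01 r -> / 4 * Lm (ity a) t r <= jbr (X (t * r))) \/
  (ity a = true /\ jbr (X t) <= 9 * rho)).
 move=> Hc; have [a [E1 E2 E3 E4 E5]] := @idx_exists false ax e t x e12 Hy Hc.
 by exists a; split => //; left; rewrite E5; apply: (@ray_lower false t x).
have type2 : - (/ 8 * Rabs t * jbr x * vnorm e) <= - (t * dot x e) -> exists a : idx n,
  [/\ iax a = ax, iaxi a = e, it a = t & ix a = x] /\
  ((forall r, I01 r -> / 4 * Lm (ity a) t r <= jbr (X (t * r))) \/
  (ity a = true /\ jbr (X t) <= 9 * rho)).
 move=> Hc.
 have pp : 0 <= Rabs t * jbr x * vnorm e by pos.
 have [|a [E1 E2 E3 E4 E5]] := @idx_exists true ax e t x e12 Hy; first lra.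
 exists a; split => //; rewrite E5.
 case: (Rle_or_lt (- (/ 4 * Rabs t * jbr (X t) * vnorm e)) (- (t * dot (X t) e))) => [g|bad].
  by left; apply: (@ray_lower true t x).
 (* Failure of the condition at [X t], against its validity at [x], forces [<X t>/4 - <x>/8 < rho];
    with [<x> <= <X t> + rho] this gives the factor 9. *)
 right; split => //.
 have tp : 0 < Rabs t.
  case: (Rle_lt_or_eq_dec _ _ t0) => // E; exfalso; have tz : t = 0 by split_Rabs; lra.
  nra.
 have dd : dot x e - dot (X t) e = dot (vsub x (X t)) e.
  rewrite -[dot x e]/(fsum (fun i => x i * e i)) -[dot (X t) e]/(fsum (fun i => X t i * e i)) -fsum_minus.
  apply: fsum_ext => i; rewrite /vsub; ring.
 have cs := cauchy_schwarz (vsub x (X t)) e; rewrite -dd -/rho in cs.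
 have jd : jbr x <= jbr (X t) + rho := jbr_sub (X t) x.
 have B : t * (dot x e - dot (X t) e) < Rabs t * (/ 8 * jbr x * vnorm e - / 4 * jbr (X t) * vnorm e) by lra.
 have B2 : - (Rabs t * (rho * vnorm e)) <= t * (dot x e - dot (X t) e).
  have := Rabs_mult t (dot x e - dot (X t) e) => Em.
  have : Rabs (t * (dot x e - dot (X t) e)) <= Rabs t * (rho * vnorm e) by nra.
  move/Rabs_le_between; lra.
 nra.
case: O => [[H _]|[[H [_ Hx]]|[H [_ Hx]]]].
- apply: type1.
 have : Rabs (t * dot ax e) <= Rabs t * (/ 4 * jbr ax * vnorm e) by rewrite Rabs_mult; pos.
 move/Rabs_le_between; lra.
- have pp : 0 <= jbr ax * vnorm e by pos.
 have da : 0 < dot ax e by lra.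
 case: (Rle_or_lt 0 t) => tp.
  apply: type1; rewrite Rabs_pos_eq //.
  nra.
 apply: type2; rewrite Rabs_left //; nra.
- have pp : 0 <= jbr ax * vnorm e by pos.
 have da : dot ax e < 0 by lra.
 case: (Rle_or_lt t 0) => tp.
  apply: type1; rewrite Rabs_left1 //.
  nra.
 apply: type2; rewrite Rabs_pos_eq; nra.
Qed.

End Geometry.

(** * Comparison of the complex ray with the real one *)

Section WeightedIntegrals.
Variables (sgm : R) (s0p : 0 < sgm) (ty : bool) (t : R).

Definition KW : R := 1 + / sgm.
Definition IW (r : R) : R := RInt (fun s => W0 sgm ty t (clamp s)) 0 r.

Lemma KW1 : 1 <= KW.
Proof. rewrite /KW; have := Rinv_0_lt_compat _ s0p; lra. Qed.

Lemma IW_derive r : I01 r -> is_derive IW r (W0 sgm ty t r).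
Proof.
move=> Hr; rewrite -{2}(clamp_id Hr).
apply: (is_derive_RInt (fun r => W0 sgm ty t (clamp r)) _ 0); last exact: W0_cont.
by apply: filter_forall => b; apply: RInt_correct; apply: ex_RInt_continuous => z _; apply: W0_cont.
Qed.

Lemma IW_diff r1 r2 : 0 <= r1 -> r1 <= r2 -> r2 <= 1 -> 0 <= IW r2 - IW r1 <= KW.
Proof.
have mono a b' : 0 <= a -> a <= b' -> b' <= 1 -> IW a <= IW b'.
 move=> a0 ab b1; have := @derive_compare (fun _ => 0) IW (fun _ => 0) (W0 sgm ty t) a b' ab.
 rewrite Rminus_diag Rabs_R0 => H; suff : 0 <= IW b' - IW a by lra.
 apply: H => s Hs; [exact: is_derive_const|apply: IW_derive; lra|].
 pos.
move=> h1 h2 h3; have m1 := mono 0 r1 ltac:(lra) h1 ltac:(lra); have m2 := mono r1 r2 h1 h2 h3; have m3 := mono r2 1 ltac:(lra) h3 ltac:(lra).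
have E0 : IW 0 = 0 by rewrite /IW RInt_point.
have := W0_int s0p ty t; rewrite -/(IW 1) -/KW; lra.
Qed.

Lemma AC_bound u U k k' r1 r2 : AC u U -> 0 <= k -> 0 <= k' -> 0 <= r1 -> r1 <= r2 -> r2 <= 1 ->
 (forall s, r1 <= s <= r2 -> Rabs (U s) <= k + k' * W0 sgm ty t s) ->
 Rabs (u r2 - u r1) <= k * (r2 - r1) + k' * KW.
Proof.
move=> [_ [v Hv]] k0 k0' h1 h2 h3 HU.
have B := @derive_compare v (fun s => k * s + k' * IW s) U (fun s => k + k' * W0 sgm ty t s) r1 r2 h2.
rewrite -(proj1 (Hv r1 ltac:(lra))) -(proj1 (Hv r2 ltac:(lra))).
bound (B _ _ HU).
- move=> s Hs; apply: (proj2 (Hv s _)); lra.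
- move=> s Hs; apply: der_plus; first by auto_derive => //; ring.
 apply: is_derive_scal; apply: IW_derive; lra.
- have := IW_diff h1 h2 h3 => D.
 nra.
Qed.

Lemma ACC_bound u U k' r1 r2 : ACC u U -> 0 <= k' -> 0 <= r1 -> r1 <= r2 -> r2 <= 1 ->
 (forall s, r1 <= s <= r2 -> Cmod (U s) <= k' * W0 sgm ty t s) ->
 Cmod (u r2 - u r1) <= 2 * k' * KW.
Proof.
move=> [h1 h2] k0 a0 a1 a2 HU; bound (Cmod_le_sum _).
rewrite Re_minus Im_minus.
have b1 := @AC_bound _ _ 0 k' r1 r2 h1 (Rle_refl _) k0 a0 a1 a2.
have b2 := @AC_bound _ _ 0 k' r1 r2 h2 (Rle_refl _) k0 a0 a1 a2.
have c1 s : r1 <= s <= r2 -> Rabs (Re (U s)) <= 0 + k' * W0 sgm ty t s.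
 by move=> Hs; rewrite Rplus_0_l; apply: Rle_trans (Re_le_Cmod _) (HU s Hs).
have c2 s : r1 <= s <= r2 -> Rabs (Im (U s)) <= 0 + k' * W0 sgm ty t s.
 by move=> Hs; rewrite Rplus_0_l; apply: Rle_trans (Im_le_Cmod _) (HU s Hs).
move: (b1 c1) (b2 c2); lra.
Qed.

(** Supplies the a priori bound from which absorption starts. *)
Lemma ACC_sup u U : ACC u U -> exists B, forall r, I01 r -> Cmod (u r) <= B.
Proof.
move=> [h1 h2].
have sup v V : AC v V -> exists B, forall r, I01 r -> Rabs (v r) <= B.
 move=> Hv.
 have [B HB] := bounded_continuity (fun r => v (clamp r)) 0 1 (fun r _ => @AC_cont _ _ r Hv).
 by exists B => r Hr; apply: Rlt_le; have := HB r Hr; rewrite clamp_id.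
have [B1 H1] := sup _ _ h1; have [B2 H2] := sup _ _ h2.
exists (B1 + B2) => r Hr; bound (Cmod_le_sum _).
pos.
Qed.

End WeightedIntegrals.

Lemma kap_Cmod t : Cmod (kap t) <= 2 / TT t /\ Cmod (t * kap t) <= 1.
Proof.
have P : 0 < 1 + 4 * t ^ 2 by nra.
have E : Cmod (kap t) = / sqrt (1 + 4 * t ^ 2).
 rewrite /Cmod /kap -sqrt_inv; congr sqrt; rewrite /fst /snd; field; lra.
have t0 := Rabs_pos t; have T1 := TT_ge1 t.
have S0 : 0 < sqrt (1 + 4 * t ^ 2) by apply: sqrt_lt_R0.
have S1 : TT t / 2 <= sqrt (1 + 4 * t ^ 2).
 rewrite -(sqrt_pow2 (TT t / 2)); last lra.
 apply: sqrt_le_1_alt; rewrite -(pow2_abs t) /TT; nra.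
have S2 : Rabs t <= sqrt (1 + 4 * t ^ 2).
 rewrite -sqrt_Rsqr_abs /Rsqr; apply: sqrt_le_1_alt; lra.
split; rewrite ?Cmod_mult ?Cmod_R E.
 by rewrite (_ : 2 / TT t = / (TT t / 2)); [apply: Rinv_le_contravar; lra|field; lra].
apply/Rle_div_l; lra.
Qed.

(** * Comparison of the extended field with the real one *)

Section Lipschitz.
Variables (n : nat) (b : 'I_n -> 'I_n -> vec n -> R) (sgm : R) (Ad : nat -> R).
Hypotheses (s0p : 0 < sgm) (bsm : forall j k, smooth_Rn (b j k)) (bdec : decays b sgm Ad).

Definition Lp (ty : bool) (t r s : R) : R := Rpower (Lm ty t r) (- s).

Lemma om_Lp ty t r (x : vec n) s : 0 <= s -> I01 r -> / 8 * Lm ty t r <= jbr x -> om s x <= Rpower 8 s * Lp ty t r s.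
Proof.
move=> s0 Hr H; have L1 := Lm_ge1 ty t Hr; have p8 := Rpower_pos 8 s.
bound (Rpower_neg_anti (x := / 8 * Lm ty t r) _ H s0); first lra.
rewrite -Rpower_mult_distr; [|lra|lra].
rewrite (_ : Rpower (/ 8) (- s) = Rpower 8 s); first exact: Rle_refl.
by rewrite /Rpower ln_Rinv; [congr exp; ring|lra].
Qed.

Lemma Lp_pos ty t r s : 0 < Lp ty t r s. Proof. exact: Rpower_pos. Qed.

Lemma Lp_S ty t r s s' : I01 r -> s' = 1 + s -> Lp ty t r s = Lp ty t r s' * Lm ty t r.
Proof.
move=> Hr ->; have L1 := Lm_ge1 ty t Hr; rewrite /Lp (_ : - s = - (1 + s) + 1); last ring.
rewrite Rpower_plus Rpower_1; lra.
Qed.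

Lemma Cmod_csum_le (I : finType) (F : I -> C) k : (forall i, Cmod (F i) <= k) -> Cmod (csum F) <= 2 * (INR #|I| * k).
Proof.
move=> H; bound (Cmod_csum _); apply: Rmult_le_compat_l; first lra.
exact: fsum_le_const.
Qed.

Lemma EB_lip ds : exists C, 0 <= C /\ forall j k ty t r (p q x : vec n) m, I01 r -> vnorm q <= 1 ->
 / 8 * Lm ty t r <= jbr p -> / 8 * Lm ty t r <= jbr x -> 0 <= m ->
 (forall i, Cmod ((p i, q i) - x i) <= m) ->
 Cmod (EB b j k ds 0 p q - dxs ds (b j k) x) <= C * (Lp ty t r (1 + sz sgm ds) * m).
Proof.
have FP j k ds' i x : pd (dxs ds' (b j k)) i x (dxs (i :: ds') (b j k) x) by apply: pd_dxs.
have [K HK] := choice _ (fun jk : 'I_n * 'I_n => EE_lip_weighted s0p (FP jk.1 jk.2) (bdec jk.1 jk.2) ds).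
have FK : 0 <= fsum K by apply: fsum_ge0 => x; case: (HK x).
have sp : 0 <= sz sgm ds + 1 by have := sz_pos s0p ds; lra.
have N0 := pos_INR n; have p8 := Rpower_pos 8 (sz sgm ds + 1).
exists (fsum K * (2 * Rpower 8 (sz sgm ds + 1) * (2 * INR n))); split.
 pos.
move=> j k ty t r p q x m Hr q1 Lp' Lx m0 Hm.
have [K0 H] := HK (j, k); bound (H p q x q1) => /=.
have KF : K (j, k) <= fsum K by apply: fsum_term => y; case: (HK y).
have L0 := Lp_pos ty t r (1 + sz sgm ds).
have o1 := om_Lp sp Hr Lp'; have o2 := om_Lp sp Hr Lx.
rewrite (Rplus_comm (sz sgm ds)) in o1 o2 *.
have v1 : vnorm (vsub p x) <= INR n * m.
 bound (vnorm_le_l1 _); rewrite -[X in INR X * m](card_ord n); apply: fsum_le_const => i.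
 by apply: Rle_trans (Hm i); apply: Rle_trans (Re_le_Cmod _); right.
have v2 : vnorm q <= INR n * m.
 bound (vnorm_le_l1 _); rewrite -[X in INR X * m](card_ord n); apply: fsum_le_const => i.
 by apply: Rle_trans (Hm i); apply: Rle_trans (Im_le_Cmod _); rewrite Im_minus /=; right; rewrite Rminus_0_r.
rewrite Rmult_assoc; apply: Rmult_le_compat => //.
 pos.
rewrite (_ : _ * _ * (Lp ty t r (1 + sz sgm ds) * m) =
 (2 * (Rpower 8 (1 + sz sgm ds) * Lp ty t r (1 + sz sgm ds))) * (2 * (INR n * m))); last ring.
pos.
Qed.

Lemma b_Lp ds j k ty t r (x : vec n) : I01 r -> / 8 * Lm ty t r <= jbr x ->
 Cmod (RtoC (dxs ds (b j k) x)) <= Rabs (Ad (size ds)) * Rpower 8 (sz sgm ds) * Lp ty t r (sz sgm ds).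
Proof.
move=> Hr H; rewrite Cmod_R; bound (b_bound bdec ds j k x); rewrite Rmult_assoc.
apply: Rmult_le_compat_l; first exact: Rabs_pos.
by apply: om_Lp => //; apply: Rlt_le; apply: sz_pos.
Qed.

(** An error in position differentiates the coefficients and so comes with one more power of decay
    than an error in momentum; the force has one more power throughout than the velocity. *)
Lemma lip_gf : exists K, 0 <= K /\ forall ty t r (p q x xi : vec n) (zeta : 'I_n -> C) m1 m2, I01 r -> vnorm q <= 1 ->
 / 8 * Lm ty t r <= jbr p -> / 8 * Lm ty t r <= jbr x -> 0 <= m1 -> 0 <= m2 ->
 (forall i, Cmod ((p i, q i) - x i) <= m1) ->
 (forall i, Cmod (zeta i - xi i) <= m2) ->
 (forall i, Cmod (zeta i) <= 4) -> (forall i, Rabs (xi i) <= 4) -> forall i,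
 Cmod (gg b p q zeta i - gR b x xi i) <= K * (Lp ty t r (2 + sgm) * m1 + Lp ty t r (1 + sgm) * m2) /\
 Cmod (ff b p q zeta i - fR b x xi i) <= K * (Lp ty t r (3 + sgm) * m1 + Lp ty t r (2 + sgm) * m2).
Proof.
have [C1 [C10 H1]] := EB_lip [::].
have [C2' HC2] := choice _ (fun i : 'I_n => EB_lip [:: i]).
pose C2 := fsum C2'.
have C20 : 0 <= C2 by apply: fsum_ge0 => i; case: (HC2 i).
pose A0 := Rabs (Ad 0%N) * Rpower 8 (1 + sgm); pose A1 := Rabs (Ad 1%N) * Rpower 8 (2 + sgm).
have A00 : 0 <= A0 by apply: Rmult_le_pos; pos.
have A10 : 0 <= A1 by apply: Rmult_le_pos; pos.
have N0 := pos_INR n.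
pose K1 := 4 * INR n * (4 * C1 + A0); pose K2 := 4 * (INR n * INR n) * (16 * C2 + 8 * A1).
have K10 : 0 <= K1 by apply: Rmult_le_pos; lra.
have K20 : 0 <= K2 by apply: Rmult_le_pos; pos.
exists (K1 + K2); split; first lra.
move=> ty t r p q x xi zeta m1 m2 Hr q1 Lp' Lx m10 m20 Hm1 Hm2 z4 x4 i.
have l1 := Lp_pos ty t r (1 + sgm); have l2 := Lp_pos ty t r (2 + sgm); have l3 := Lp_pos ty t r (3 + sgm).
have xi4 k : Cmod (RtoC (xi k)) <= 4 by rewrite Cmod_R.
set Q1 := Lp ty t r (2 + sgm) * m1 + Lp ty t r (1 + sgm) * m2.
set Q2 := Lp ty t r (3 + sgm) * m1 + Lp ty t r (2 + sgm) * m2.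
have p21 : 0 <= Lp ty t r (2 + sgm) * m1 by pos.
have p12 : 0 <= Lp ty t r (1 + sgm) * m2 by pos.
have p31 : 0 <= Lp ty t r (3 + sgm) * m1 by pos.
have p22 : 0 <= Lp ty t r (2 + sgm) * m2 by pos.
have RtoC_fsum (I : finType) (F : I -> R) : RtoC (fsum F) = csum (fun i => RtoC (F i)) by rewrite /csum /= fsum_0.
split.
- have -> : (gg b p q zeta i - gR b x xi i)%C = (2 * csum (fun k =>
   ((EB b i k [::] 0 p q - b i k x) * zeta k + b i k x * (zeta k - xi k))))%C.
  rewrite /gg /gR RtoC_mult RtoC_fsum.
  have -> : forall u v, (2 * u - 2 * v)%C = (2 * (u + (Copp (RtoC 1)) * v))%C by move=> u v; ring.
  rewrite -csum_scal -csum_plus; congr Cmult; apply: csum_ext => k; rewrite RtoC_mult; ring.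
 rewrite Cmod_mult Cmod_R Rabs_pos_eq; last lra.
 via (2 * (2 * (INR #|'I_n| * ((4 * C1 + A0) * Q1)))).
  apply: Rmult_le_compat_l; first lra.
  apply: Cmod_csum_le => k; bound (Cmod_triangle _ _); rewrite !Cmod_mult.
  have a1 : Cmod (EB b i k [::] 0 p q - b i k x) <= C1 * (Lp ty t r (2 + sgm) * m1).
   have := H1 i k ty t r p q x m1 Hr q1 Lp' Lx m10 Hm1; rewrite sz0 (_ : 1 + (1 + sgm) = 2 + sgm); pos.
  have a2 : Cmod (RtoC (b i k x)) <= A0 * Lp ty t r (1 + sgm).
   by have := b_Lp [::] i k Hr Lx; rewrite sz0.
  have e1 := Cmod_mul_le a1 (z4 k).
  have e2 := Cmod_mul_le a2 (Hm2 k).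
  have f1 := Rmult_le_pos _ _ C10 p12; have f2 := Rmult_le_pos _ _ A00 p21.
  rewrite /Q1; lra.
 rewrite card_ord (_ : 2 * (2 * (INR n * ((4 * C1 + A0) * Q1))) = K1 * Q1); last by rewrite /K1; ring.
 by apply: Rmult_le_compat_r; [rewrite /Q1; lra|lra].
- have -> : (ff b p q zeta i - fR b x xi i)%C = Copp (csum (fun j => csum (fun k =>
   ((EB b j k [:: i] 0 p q - dxs [:: i] (b j k) x) * (zeta j * zeta k) + dxs [:: i] (b j k) x * (zeta j * (zeta k - xi k) + (zeta j - xi j) * xi k))%C))).
  rewrite /ff /fR RtoC_opp RtoC_fsum.
  have -> : forall u v, (- u - (- v))%C = Copp (u + (Copp (RtoC 1)) * v)%C by move=> u v; ring.
  rewrite -csum_scal -csum_plus; congr Copp; apply: csum_ext => j; rewrite RtoC_fsum -csum_scal -csum_plus; apply: csum_ext => k.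
  rewrite !RtoC_mult; ring.
 rewrite Cmod_opp.
 via (2 * (INR #|'I_n| * (2 * (INR #|'I_n| * ((16 * C2 + 8 * A1) * Q2))))).
  apply: Cmod_csum_le => j; apply: Cmod_csum_le => k; bound (Cmod_triangle _ _); rewrite !Cmod_mult.
  have a1 : Cmod (EB b j k [:: i] 0 p q - dxs [:: i] (b j k) x) <= C2 * (Lp ty t r (3 + sgm) * m1).
   have [c0 Hc] := HC2 i; have := Hc j k ty t r p q x m1 Hr q1 Lp' Lx m10 Hm1; rewrite sz1 (_ : 1 + (2 + sgm) = 3 + sgm); last ring.
   move=> h; bound h; apply: Rmult_le_compat_r => //; apply: fsum_term => y; by case: (HC2 y).
  have a2 : Cmod (RtoC (dxs [:: i] (b j k) x)) <= A1 * Lp ty t r (2 + sgm).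
   have := b_Lp [:: i] j k Hr Lx; pos.
  have zz : Cmod (zeta j) * Cmod (zeta k) <= 16.
   have := Cmod_mul_le (z4 j) (z4 k); lra.
  have dd : Cmod (zeta j * (zeta k - xi k) + (zeta j - xi j) * xi k) <= 8 * m2.
   bound (Cmod_triangle _ _); rewrite !Cmod_mult.
   have := Cmod_mul_le (z4 j) (Hm2 k).
   have := Cmod_mul_le (Hm2 j) (xi4 k); lra.
  have e1 := Rmult_le_compat _ _ _ _ (Cmod_ge_0 _) (Rmult_le_pos _ _ (Cmod_ge_0 _) (Cmod_ge_0 _)) a1 zz.
  have e2 := Cmod_mul_le a2 dd.
  have f1 := Rmult_le_pos _ _ C20 p22; have f2 := Rmult_le_pos _ _ A10 p31.
  rewrite /Q2; lra.
 rewrite card_ord (_ : 2 * _ = K2 * Q2); last by rewrite /K2; ring.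
 by apply: Rmult_le_compat_r; [rewrite /Q2; lra|lra].
Qed.

End Lipschitz.

#[global] Hint Resolve Lp_pos : nonneg.

(** * Complex rays against real and free rays *)

Section Rays.
Variables (n : nat) (b : 'I_n -> 'I_n -> vec n -> R) (sgm : R) (Ad : nat -> R).
Hypotheses (s0p : 0 < sgm) (bsm : forall j k, smooth_Rn (b j k)) (bdec : decays b sgm Ad).

(** What the comparison uses of a ray, detached from the charts and from the construction by
    amplitudes. *)
Record cpath (eps : R) (ty : bool) (t : R) (ax e x : vec n) (z zeta : 'I_n -> R -> C) : Prop := CPath {
 cpz : forall i, ACC (z i) (fun r => (t * vel b eps (fun i => Re (z i r)) (fun i => Im (z i r)) (fun k => zeta k r) i)%C);
 cpe : forall i, ACC (zeta i) (fun r => (t * (eps * ff b (fun i => Re (z i r)) (fun i => Im (z i r)) (fun k => zeta k r) i))%C);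
 cp1 : forall i, z i 1 = RtoC (x i);
 cp0 : forall i, zeta i 0 = (e i + Ci * (z i 0 - ax i))%C;
 cpq : forall r, I01 r -> vnorm (fun i => Im (z i r)) <= 1;
 cpp : forall r, I01 r -> / 8 * Lm ty t r <= jbr (fun i => Re (z i r));
 cp4 : forall i r, I01 r -> Cmod (zeta i r) <= 4 }.

Section Difference.
Variables (eps : R) (ty : bool) (t : R) (ax e x : vec n) (z zeta : 'I_n -> R -> C).
Hypothesis CP : cpath eps ty t ax e x z zeta.
(** The reference ray is left open: the real flow with its own field [g], [f], or the free line with
    zero field. *)
Variables (z0 e0 g f : 'I_n -> R -> R).
Hypotheses (z0P : forall i, AC (z0 i) (fun r => t * (2 * e0 i r + g i r))) (e0P : forall i, AC (e0 i) (fun r => t * f i r)) (z00 : forall i, z0 i 0 = ax i) (e00 : forall i, e0 i 0 = e i).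

Definition Gd i r : C := (eps * gg b (fun i => Re (z i r)) (fun i => Im (z i r)) (fun k => zeta k r) i - g i r)%C.
Definition Fd i r : C := (eps * ff b (fun i => Re (z i r)) (fun i => Im (z i r)) (fun k => zeta k r) i - f i r)%C.
Definition dz i r : C := (z i r - z0 i r)%C.
Definition de i r : C := (zeta i r - e0 i r)%C.
(** The amplitudes of the difference of the two rays in the free fundamental system. *)
Definition cc i r : C := (kap t * (dz i r + (2 * (t * (1 - r)))%R * de i r))%C.
Definition dd i r : C := ((0, 2) * cc i r - 2 * de i r)%C.

Lemma dzP i : ACC (dz i) (fun r => (t * (2 * de i r + Gd i r))%C).
Proof.
apply: ACC_ext (ACC_plus (cpz CP i) (ACC_scal (Copp (RtoC 1)) (ACC_RtoC (z0P i)))) => r _; rewrite ?/dz; first ring.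
rewrite /vel /Gd /de RtoC_mult RtoC_plus RtoC_mult; ring.
Qed.

Lemma deP i : ACC (de i) (fun r => (t * Fd i r)%C).
Proof.
apply: ACC_ext (ACC_plus (cpe CP i) (ACC_scal (Copp (RtoC 1)) (ACC_RtoC (e0P i)))) => r _; rewrite ?/de; first ring.
rewrite /Fd RtoC_mult; ring.
Qed.

Lemma ccP i : ACC (cc i) (fun r => (t * kap t * (Gd i r + (2 * (t * (1 - r)))%R * Fd i r))%C).
Proof.
have A : AC (fun r => 2 * (t * (1 - r))) (fun r => - (2 * t)).
 apply: AC_ext (AC_plus (AC_const (2 * t)) (AC_scal (- (2 * t)) AC_id)) => r _; ring.
apply: ACC_ext (ACC_scal (kap t) (ACC_plus (dzP i) (ACC_mult (ACC_RtoC A) (deP i)))) => r _ //.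
rewrite RtoC_opp RtoC_mult; ring.
Qed.

Lemma ddP i : ACC (dd i) (fun r => (t * kap t * ((0, 2) * Gd i r - 2 * ((1, 2 * t * r)%R * Fd i r)))%C).
Proof.
apply: ACC_ext (ACC_plus (ACC_scal (0, 2) (ccP i)) (ACC_scal (Copp (RtoC 2)) (deP i))) => r _; rewrite ?/dd; first ring.
have := kap_inv t; rewrite !pair_C !RtoC_mult !RtoC_minus.
move: (kap t) (Gd i r) (Fd i r) (RtoC t) (RtoC r) => k G F T s K.
set L := LHS; set M := RHS.
have -> : L = (M + 2 * (T * F) * (k * (1 + Ci * (2 * T)) - 1))%C.
 rewrite /L /M; ring.
rewrite K; ring.
Qed.

Lemma dz_cd i r : dz i r = ((1, 2 * t * r)%R * cc i r + (t * (1 - r))%R * dd i r)%C.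
Proof.
rewrite /dd /cc; have := kap_inv t; rewrite !pair_C !RtoC_mult !RtoC_minus.
move: (kap t) (dz i r) (de i r) (RtoC t) (RtoC r) => k Z E T s K.
set M := RHS.
have -> : M = (Z + (Z + 2 * (T * (1 - s) * E)) * (k * (1 + Ci * (2 * T)) - 1))%C.
 rewrite /M; ring.
rewrite K; ring.
Qed.

Lemma de_cd i r : de i r = (Ci * cc i r + (- / 2)%R * dd i r)%C.
Proof.
rewrite /dd pair_C RtoC_opp RtoC_inv; last lra.
field; pos.
Qed.

(** The mismatch at the end point enters multiplied by [kap t], of order [1 / TT]. This is the
    source of the ratio [rho / TT] in all later bounds. *)
Lemma cc1 i : cc i 1 = (kap t * (x i - z0 i 1)%R)%C.
Proof. rewrite /cc /dz (cp1 CP) Rminus_diag !Rmult_0_r RtoC_minus; ring. Qed.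

Lemma de0 i : de i 0 = (Ci * dz i 0)%C.
Proof. rewrite /de /dz (cp0 CP) z00 e00; ring. Qed.

Lemma cc0 i : cc i 0 = (z i 0 - ax i)%C.
Proof.
have <- : dz i 0 = (z i 0 - ax i)%C by rewrite /dz z00.
rewrite /cc de0; have := kap_inv t; rewrite !pair_C Rminus_0_r Rmult_1_r !RtoC_mult.
move: (kap t) (dz i 0) (RtoC t) => k Z T K.
rewrite -[RHS]Cmult_1_r -K; ring.
Qed.

Lemma dd0 i : dd i 0 = RtoC 0.
Proof.
have -> : dd i 0 = ((0, 2) * cc i 0 - 2 * de i 0)%C by [].
rewrite cc0 de0 /dz z00 pair_C; ring.
Qed.

End Difference.

Lemma AC_line (u : R -> R) du t : (forall s, is_derive u s (du s)) -> (forall s, continuous du s) ->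
 AC (fun r => u (t * r)) (fun r => t * du (t * r)).
Proof.
move=> Hu cd; split.
 move=> r; apply: cont_mult; first exact: continuous_const.
 apply: (continuous_comp (fun r => t * clamp r) du) => //.
 by apply: cont_mult; [apply: continuous_const|apply: clamp_continuous].
exists (fun r => u (t * r)) => r _; split => //.
have i : is_derive (fun r => t * r) r t by auto_derive => //; ring.
exact: (is_derive_comp u (fun r => t * r) r _ _ (Hu (t * r)) i).
Qed.

Lemma flow_AC eps ax e X Xi t : flow b eps ax e X Xi ->
 (forall i, AC (fun r => X (t * r) i) (fun r => t * (2 * Xi (t * r) i + eps * gR b (X (t * r)) (Xi (t * r)) i))) /\
 (forall i, AC (fun r => Xi (t * r) i) (fun r => t * (eps * fR b (X (t * r)) (Xi (t * r)) i))).
Proof.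
move=> [_ [_ F]].
have FP j k ds' i x : pd (dxs ds' (b j k)) i x (dxs (i :: ds') (b j k) x) by apply: pd_dxs.
have cb ds j k s : continuous (fun s => dxs ds (b j k) (X s)) s.
 apply: ex_derive_continuous; eexists.
 apply: (@F_curve _ (fun ds => dxs ds (b j k)) Ad sgm s0p (FP j k) (bdec j k) ds X) => i.
 exact: (proj1 (F s i)).
have cx i s : continuous (fun s => Xi s i) s by apply: ex_derive_continuous; eexists; exact: (proj2 (F s i)).
split => i.
- apply: (AC_line (u := fun s => X s i) (du := fun s => 2 * Xi s i + eps * gR b (X s) (Xi s) i)) => s; first exact: (proj1 (F s i)).
 apply: cont_plus.
  by cont.
 apply: cont_mult; first exact: continuous_const.
 apply: cont_mult; first exact: continuous_const.
 apply: (fsum_continuous (F := fun s k => b i k (X s) * Xi s k)) => k.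
 by apply: cont_mult; [exact: (cb [::])|exact: cx].
- apply: (AC_line (u := fun s => Xi s i) (du := fun s => eps * fR b (X s) (Xi s) i)) => s; first exact: (proj2 (F s i)).
 apply: cont_mult; first exact: continuous_const.
 apply: (@continuous_opp _ R_AbsRing R_NormedModule).
 apply: (fsum_continuous (F := fun s j => fsum (fun k => dxs [:: i] (b j k) (X s) * (Xi s j * Xi s k)))) => j.
 apply: (fsum_continuous (F := fun s k => dxs [:: i] (b j k) (X s) * (Xi s j * Xi s k))) => k.
 by cont.
Qed.

(** The admissible distance between the two rays in units of [rho]. If the origin can only be near
    the start, the distance grows from [1 / TT] to 1; if it can be near the end, the force acts
    where the rays are already [rho] apart, and only the bound 1 is left. [lamw] is the matching
    scale of the amplitude [d]. *)
Definition Mw (ty : bool) (t r : R) : R := if ty then 1 else Lm ty t r / TT t.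
Definition lamw (ty : bool) (t : R) : R := if ty then 1 else / TT t.

Lemma lamw_pos ty t : 0 < lamw ty t.
Proof. case: ty => /=; pos. Qed.

Lemma Mw_pos ty t r : I01 r -> 0 < Mw ty t r.
Proof.
move=> Hr; case: ty => /=; first lra.
by apply: Rdiv_lt_0_compat; [have := mC_ge1 t Hr; lra|have := TT_ge1 t; lra].
Qed.

(** The first two inequalities convert bounds on the amplitudes into bounds on the rays; the last
    two convert the resulting difference of fields back into the integrable weight, for [c] and for
    [d]. *)
Lemma weights ty t r k : I01 r -> 0 <= k ->
 [/\ 2 * mC t r * (k / TT t) + k * lamw ty t <= 3 * k * Mw ty t r,
  k / TT t + / 2 * (k * lamw ty t / mD t r) <= 2 * k * (Mw ty t r / Lm ty t r),
  Mw ty t r / Lm ty t r * (1 + 2 * mD t r / Lm ty t r) <= 3 &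
  mD t r * (Mw ty t r / Lm ty t r) * (2 + 4 * mC t r / Lm ty t r) <= 6 * lamw ty t * TT t].
Proof.
move=> Hr k0; have c1 := mC_ge1 t Hr; have d1 := mD_ge1 t Hr; have cT := mC_le t Hr; have dT := mD_le t Hr.
rewrite /Mw /lamw /Lm; move: c1 d1 cT dT; move: (mC t r) (mD t r) (TT t) => c d T c1 d1 cT dT.
have iT : 0 < / T by pos.
have id : 0 < / d <= 1 by split; [apply: Rinv_0_lt_compat; lra|rewrite -Rinv_1; apply: Rinv_le_contravar; lra].
have ic : 0 < / c <= 1 by split; [apply: Rinv_0_lt_compat; lra|rewrite -Rinv_1; apply: Rinv_le_contravar; lra].
have cT1 : c * / T <= 1 by apply/Rle_div_l; lra.
have dT1 : d * / T <= 1 by apply/Rle_div_l; lra.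
have iTd : / T <= / d by pos.
have T1 : / T * 1 <= / T * c by pos.
case: ty; split.
- nra.
- nra.
- by rewrite (_ : 1 / d * (1 + 2 * d / d) = 3 * / d); [lra|field; lra].
- have -> : d * (1 / d) * (2 + 4 * c / d) = 2 + 4 * (c * / d) by field; lra.
 nra.
- nra.
- have -> : c / T / c = / T by field; lra.
 have : k * / T * / d <= k * / T * 1 by pos.
 nra.
- have -> : c / T / c * (1 + 2 * d / c) = / T + 2 * ((d * / T) * / c) by field; lra.
 nra.
- have -> : d * (c / T / c) * (2 + 4 * c / c) = 6 * (d * / T) by field; lra.
 nra.
Qed.

Lemma pair_Cmod t r : I01 r -> Cmod (1, 2 * t * r) <= 2 * mC t r /\ Cmod (RtoC (t * (1 - r))) <= mD t r.
Proof.
move=> Hr; have t0 := Rabs_pos t; split.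
 bound (Cmod_le_sum _); rewrite /= Rabs_R1 !Rabs_mult (Rabs_pos_eq 2) ?(Rabs_pos_eq r) /mC; lra.
rewrite Cmod_R Rabs_mult (Rabs_pos_eq (1 - r)) /mD; lra.
Qed.

(** The amplitudes of the difference have boundary values [kap t * (x - X t)] at the end and zero at
    the start, and their equations contain only differences of the two fields, with the factor
    [eps]. This closes an absorption argument and makes the deviation of the starting point from its
    free value of order [eps]. *)
Lemma good_estimate : exists Cg, 0 <= Cg /\ forall eps ty t ax e x z zeta X Xi, 0 < eps -> Cg * eps <= 1 ->
 cpath eps ty t ax e x z zeta -> flow b eps ax e X Xi -> (forall s i, Rabs (Xi s i) <= 3) ->
 (forall r, I01 r -> / 4 * Lm ty t r <= jbr (X (t * r))) ->
 let rho := vnorm (vsub x (X t)) in forall i,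
 Cmod (z i 0 - ax i - kap t * (x i - X t i)%R) <= Cg * eps * (rho / TT t) /\
 forall r, I01 r -> Cmod (z i r - X (t * r) i) <= 12 * rho * Mw ty t r /\
  Cmod (zeta i r - Xi (t * r) i) <= 8 * rho * (Mw ty t r / Lm ty t r).
Proof.
have [K [K0 HK]] := lip_gf s0p bsm bdec.
have W1 := KW1 s0p; set W := KW sgm in W1.
have KW0 : 0 <= K * W by pos.
exists (120 * (K * W)); split; first lra.
move=> eps ty t ax e x z zeta X Xi ep esm CP FL x3 HX rho.
have rho0 : 0 <= rho := vnorm_ge0 _.
have [AX AXi] := flow_AC t FL.
pose z0 i r := X (t * r) i; pose e0 i r := Xi (t * r) i.
pose g i r := eps * gR b (X (t * r)) (Xi (t * r)) i; pose f i r := eps * fR b (X (t * r)) (Xi (t * r)) i.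
have z00 i : z0 i 0 = ax i by rewrite /z0 Rmult_0_r (proj1 FL).
have e00 i : e0 i 0 = e i by rewrite /e0 Rmult_0_r (proj1 (proj2 FL)).
pose c := cc t z zeta z0 e0; pose d := dd t z zeta z0 e0.
have cA i := ccP CP (z0 := z0) (e0 := e0) (g := g) (f := f) AX AXi i.
have dA i := ddP CP (z0 := z0) (e0 := e0) (g := g) (f := f) AX AXi i.
have T1 := TT_ge1 t; have iT : 0 < / TT t by pos.
have lm0 := lamw_pos ty t.
have kk := kap_Cmod t.
have eK : 0 <= eps * K by pos.
have eKW : 120 * (eps * K * W) <= 1 by lra.
have eKW0 : 0 <= eps * K * W by pos.
have back B : 0 <= B -> (forall i r, I01 r -> Cmod (c i r) <= B / TT t /\ mD t r * Cmod (d i r) <= B * lamw ty t) ->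
  forall i r, I01 r -> Cmod (dz z z0 i r) <= 3 * B * Mw ty t r /\ Cmod (de zeta e0 i r) <= 2 * B * (Mw ty t r / Lm ty t r).
 move=> B0 HB i r Hr; have [w1 w2 _ _] := weights ty t Hr B0; have [b1 b2] := HB i r Hr.
 have [p1 p2] := pair_Cmod t Hr; have md := mD_ge1 t Hr.
 have dB : Cmod (d i r) <= B * lamw ty t / mD t r by apply/Rle_div_r; lra.
 split.
  rewrite (dz_cd t z zeta z0 e0) -/(c i r) -/(d i r).
  bound (Cmod_triangle _ _); rewrite (Cmod_mult (1, _)) (Cmod_mult (RtoC (t * (1 - r)))); apply: Rle_trans w1.
  apply: Rplus_le_compat; first pos.
  apply: Rle_trans b2; pos.
 rewrite (de_cd t z zeta z0 e0) -/(c i r) -/(d i r).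
 bound (Cmod_triangle _ _); rewrite (Cmod_mult Ci) (Cmod_mult (RtoC (- / 2))); apply: Rle_trans w2.
 rewrite Cmod_Ci.
 rewrite Cmod_R Rabs_Ropp Rabs_pos_eq; last lra.
 pos.
have step B : 0 <= B -> (forall i r, I01 r -> Cmod (c i r) <= B / TT t /\ mD t r * Cmod (d i r) <= B * lamw ty t) ->
  forall i r, I01 r -> Cmod (c i 1 - c i r) <= 30 * (eps * K * W) * (B / TT t) /\
   mD t r * Cmod (d i r) <= 60 * (eps * K * W) * (B * lamw ty t).
 move=> B0 HB.
 have GF i r : I01 r -> Cmod (Gd eps z zeta g i r) <= 5 * (eps * K) * B * Mw ty t r * Lp ty t r (2 + sgm) /\
   Cmod (Fd eps z zeta f i r) <= 5 * (eps * K) * B * Mw ty t r * Lp ty t r (3 + sgm).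
  move=> Hr; have L1 := Lm_ge1 ty t Hr; have M0 := Mw_pos ty t Hr.
  have BM : 0 <= 3 * B * Mw ty t r by pos.
  have BM2 : 0 <= 2 * B * (Mw ty t r / Lm ty t r) by pos.
  have hx : / 8 * Lm ty t r <= jbr (X (t * r)) by have := HX r Hr; lra.
  have x4 k : Rabs (Xi (t * r) k) <= 4 by have := x3 (t * r) k; lra.
  have [h1 h2] := HK ty t r (fun i => Re (z i r)) (fun i => Im (z i r)) (X (t * r)) (Xi (t * r)) (fun i => zeta i r) _ _
   Hr (cpq CP Hr) (cpp CP Hr) hx BM BM2 (fun i => eq_ind _ (fun u => Cmod (u - _) <= _) (proj1 (back B B0 HB i r Hr)) _ (surjective_pairing _))
   (fun i => proj2 (back B B0 HB i r Hr)) (fun i => cp4 CP i Hr) x4 i.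
  have e1 : Lp ty t r (1 + sgm) = Lp ty t r (2 + sgm) * Lm ty t r by apply: Lp_S => //; lra.
  have e2 : Lp ty t r (2 + sgm) = Lp ty t r (3 + sgm) * Lm ty t r by apply: Lp_S => //; lra.
  have fac u v : Cmod (eps * u - (eps * v)%R) = eps * Cmod (u - v).
   rewrite RtoC_mult (_ : Cminus _ _ = (eps * (u - v))%C); last ring.
   rewrite Cmod_mult Cmod_R Rabs_pos_eq //; lra.
  split; rewrite /Gd /Fd /g /f fac.
   bound (Rmult_le_compat_l eps _ _ (Rlt_le _ _ ep) h1); rewrite e1.
   right; field; lra.
  bound (Rmult_le_compat_l eps _ _ (Rlt_le _ _ ep) h2); rewrite {1}e2.
  right; field; lra.
 have WE r : I01 r -> W0 sgm ty t r = TT t * (Lp ty t r (3 + sgm) * Lm ty t r * Lm ty t r) /\ Lp ty t r (2 + sgm) = Lp ty t r (3 + sgm) * Lm ty t r.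
  move=> Hr; have e2 : Lp ty t r (2 + sgm) = Lp ty t r (3 + sgm) * Lm ty t r by apply: Lp_S => //; lra.
  split => //; rewrite -e2 /W0 -/(Lp ty t r (1 + sgm)) -(@Lp_S _ _ _ (1 + sgm)) //; lra.
 have eKB : 0 <= eps * K * B by pos.
 move=> i r Hr; split.
 - have := @ACC_bound sgm s0p ty t (c i) _ (15 * (eps * K * B) / TT t) r 1 (cA i).
  have E : 2 * (15 * (eps * K * B) / TT t) * KW sgm = 30 * (eps * K * W) * (B / TT t) by rewrite -/W; lra.
  rewrite E; apply; [apply: Rmult_le_pos; lra|lra|lra|lra|].
  move=> s Hs; have Hs' : I01 s by lra.
  have [g1 f1] := GF i s Hs'; have [_ _ w3 _] := weights ty t Hs' B0; have [_ p2] := pair_Cmod t Hs'.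
  have L1 := Lm_ge1 ty t Hs'; have l3 := Lp_pos ty t s (3 + sgm); have [E1 E2] := WE s Hs'; have M0 := Mw_pos ty t Hs'.
  rewrite Cmod_mult; via (1 * (Cmod (Gd eps z zeta g i s) + 2 * mD t s * Cmod (Fd eps z zeta f i s))).
   apply: Rmult_le_compat; [exact: Cmod_ge_0|exact: Cmod_ge_0|exact: (proj2 kk)|].
   bound (Cmod_triangle _ _); apply: Rplus_le_compat_l; rewrite Cmod_mult.
   apply: Rmult_le_compat_r; first exact: Cmod_ge_0.
   rewrite RtoC_mult Cmod_mult Cmod_R (Rabs_pos_eq 2); lra.
  rewrite Rmult_1_l E1.
  have md := mD_ge1 t Hs'.
  via (5 * (eps * K) * B * (Lp ty t s (3 + sgm) * Lm ty t s * Lm ty t s) * (Mw ty t s / Lm ty t s * (1 + 2 * mD t s / Lm ty t s))).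
   have := Rmult_le_compat_l (2 * mD t s) _ _ ltac:(lra) f1; rewrite E2 in g1 => f2.
   bound (Rplus_le_compat _ _ _ _ g1 f2); right; field; lra.
  via (5 * (eps * K) * B * (Lp ty t s (3 + sgm) * Lm ty t s * Lm ty t s) * 3).
   pos.
  right; field; lra.
 - have md := mD_ge1 t Hr.
  have := @ACC_bound sgm s0p ty t (d i) _ (30 * (eps * K * B) * lamw ty t / mD t r) 0 r (dA i).
  rewrite /d (dd0 CP z00 e00) -/(d i r).
  have -> : (d i r - 0)%C = d i r by ring.
  have E : 2 * (30 * (eps * K * B) * lamw ty t / mD t r) * KW sgm = 60 * (eps * K * W) * (B * lamw ty t) / mD t r by rewrite -/W; lra.
  rewrite E => H.
  suff : Cmod (d i r) <= 60 * (eps * K * W) * (B * lamw ty t) / mD t r.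
   by move=> h; rewrite Rmult_comm; apply/Rle_div_r; [lra|].
  apply: H; [|lra|lra|lra|].
   pos.
  move=> s Hs; have Hs' : I01 s by lra.
  have [g1 f1] := GF i s Hs'; have [_ _ _ w4] := weights ty t Hs' B0; have [p1 _] := pair_Cmod t Hs'.
  have L1 := Lm_ge1 ty t Hs'; have l3 := Lp_pos ty t s (3 + sgm); have [E1 E2] := WE s Hs'; have M0 := Mw_pos ty t Hs'.
  have mds := mD_ge1 t Hs'; have mcs := mC_ge1 t Hs'.
  have mono : mD t r <= mD t s by rewrite /mD; pos.
  have imono : / mD t s <= / mD t r by pos.
  have C2 : Cmod (0, 2) <= 2 by bound (Cmod_le_sum _); rewrite /= Rabs_R0 Rabs_pos_eq; lra.
  rewrite Cmod_mult; via (1 * (2 * Cmod (Gd eps z zeta g i s) + 4 * mC t s * Cmod (Fd eps z zeta f i s))).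
   apply: Rmult_le_compat; [exact: Cmod_ge_0|exact: Cmod_ge_0|exact: (proj2 kk)|].
   bound (Cmod_triangle _ _); rewrite Cmod_opp !Cmod_mult Cmod_R (Rabs_pos_eq 2); last lra.
   have q1 := Rmult_le_compat_r _ _ _ (Cmod_ge_0 (Gd eps z zeta g i s)) C2.
   have q2 := Rmult_le_compat_r _ _ _ (Cmod_ge_0 (Fd eps z zeta f i s)) p1.
   lra.
  rewrite Rmult_1_l E1.
  set q := Lp ty t s (3 + sgm) * Lm ty t s * Lm ty t s.
  have q0 : 0 <= q by rewrite /q; pos.
  via (5 * (eps * K) * B * q * / mD t s * (mD t s * (Mw ty t s / Lm ty t s) * (2 + 4 * mC t s / Lm ty t s))).
   have := Rmult_le_compat_l (4 * mC t s) _ _ ltac:(lra) f1; rewrite E2 in g1 => f2.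
   bound (Rplus_le_compat _ _ _ _ (Rmult_le_compat_l 2 _ _ ltac:(lra) g1) f2); rewrite /q; right; field; lra.
  have ims : 0 < / mD t s by pos.
  have A0 : 0 <= 5 * (eps * K) * B * q by pos.
  via (5 * (eps * K) * B * q * / mD t s * (6 * lamw ty t * TT t)).
   pos.
  have -> : 30 * (eps * K * B) * lamw ty t / mD t r * (TT t * q) = 5 * (eps * K) * B * q * / mD t r * (6 * lamw ty t * TT t) by lra.
  pos.
have c1 i : Cmod (c i 1) <= 2 * rho / TT t.
 rewrite /c (cc1 CP) /z0 Rmult_1_r Cmod_mult Cmod_R.
 via (2 / TT t * rho); last pos.
 apply: Rmult_le_compat; [exact: Cmod_ge_0|exact: Rabs_pos|exact: (proj1 kk)|exact: (vnorm_term (vsub x (X t)) i)].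
have [Bc HBc] := choice _ (fun i => ACC_sup (cA i)).
have [Bd HBd] := choice _ (fun i => ACC_sup (dA i)).
(* Both kinds of amplitudes and all times form one index set, so that absorption treats them
   jointly; [clamp] lets the time range over all reals. *)
have fin : forall y : bool * 'I_n * R, (if y.1.1 then mD t (clamp y.2) * Cmod (d y.1.2 (clamp y.2)) else Cmod (c y.1.2 (clamp y.2)))
  <= 2 * (2 * rho) * (if y.1.1 then lamw ty t else / TT t).
 apply: contraction_bound; first lra.
 - move=> [[[] i] r] /=; lra.
 - exists (TT t / lamw ty t * fsum (fun i => Rabs (Bd i)) + TT t * fsum (fun i => Rabs (Bc i))) => -[[[] i] r] /=.
  + have P2 : 0 <= TT t * fsum (fun i => Rabs (Bc i)) by pos.
   via (TT t * fsum (fun i => Rabs (Bd i))).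
    apply: Rmult_le_compat; [have := mD_ge1 t (clampP r); lra|exact: Cmod_ge_0|by apply: mD_le; apply: clampP|].
    bound (HBd i _ (clampP r)); bound (Rle_abs _).
    apply: (fsum_term (F := fun i => Rabs (Bd i))) => j; pos.
   rewrite Rmult_plus_distr_r (_ : TT t / lamw ty t * fsum (fun i => Rabs (Bd i)) * lamw ty t = TT t * fsum (fun i => Rabs (Bd i))); last by field; lra.
   rewrite -[X in X <= _]Rplus_0_r; apply: Rplus_le_compat_l.
   pos.
  + have P1 : 0 <= TT t / lamw ty t * fsum (fun i => Rabs (Bd i)).
    pos.
   via (fsum (fun i => Rabs (Bc i))).
    bound (HBc i _ (clampP r)); bound (Rle_abs _).
    apply: (fsum_term (F := fun i => Rabs (Bc i))) => j; pos.
   rewrite Rmult_plus_distr_r (_ : TT t * fsum (fun i => Rabs (Bc i)) * / TT t = fsum (fun i => Rabs (Bc i))); last by field; lra.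
   rewrite -[X in X <= _]Rplus_0_l; apply: Rplus_le_compat_r.
   pos.
 - move=> B B0 HB.
  have HB' i r : I01 r -> Cmod (c i r) <= B / TT t /\ mD t r * Cmod (d i r) <= B * lamw ty t.
   move=> Hr; have := HB (false, i, r); have := HB (true, i, r); rewrite /= (clamp_id Hr); lra.
  move=> [[[] i] r] /=; have [s1 s2] := step B B0 HB' i _ (clampP r).
  + bound s2; rewrite (_ : _ * (B * lamw ty t) = 60 * (eps * K * W) * B * lamw ty t); last ring.
   apply: Rmult_le_compat_r; first lra.
   nra.
  + have -> : c i (clamp r) = (c i 1 - (c i 1 - c i (clamp r)))%C by ring.
   bound (Cmod_triangle _ _); rewrite Cmod_opp; have := c1 i => h.
   have : 30 * (eps * K * W) * (B / TT t) <= B / 2 * / TT t.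
    rewrite (_ : _ * (B / TT t) = 30 * (eps * K * W) * B * / TT t); last lra.
    apply: Rmult_le_compat_r; first lra.
    nra.
   pos.
have HB' i r : I01 r -> Cmod (c i r) <= 4 * rho / TT t /\ mD t r * Cmod (d i r) <= 4 * rho * lamw ty t.
 move=> Hr; have := fin (false, i, r); have := fin (true, i, r); rewrite /= (clamp_id Hr) /Rdiv; lra.
have rho4 : 0 <= 4 * rho by lra.
move=> i; split.
 have := proj1 (step (4 * rho) rho4 HB' i 0 ltac:(lra)).
 rewrite /c (cc1 CP) (cc0 CP z00 e00) /z0 Rmult_1_r.
 rewrite -(Cmod_opp (Cminus _ _)) (_ : Copp _ = (z i 0 - ax i - kap t * (x i - X t i)%R)%C); last ring.
 pos.
move=> r Hr; have [h1 h2] := back (4 * rho) rho4 HB' i r Hr; rewrite /dz /de /z0 /e0 in h1 h2.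
pos.
Qed.

(** Comparison with the free line. The error does not contain [rho], which is enough when the real
    ray ends within [9 * rho] of the origin, for then [rho] is bounded below. *)
Lemma absolute_estimate : exists Ca, 0 <= Ca /\ forall eps t ax e x z zeta, 0 < eps ->
 cpath eps true t ax e x z zeta -> forall i,
 Cmod (z i 0 - ax i - kap t * (x i - ax i - 2 * t * e i)%R) <= Ca * eps / TT t.
Proof.
have [K [K0 HK]] := lip_gf s0p bsm bdec.
have W1 := KW1 s0p; set W := KW sgm in W1.
have KW0 : 0 <= K * W by pos.
exists (30 * (K * W)); split; first lra.
move=> eps t ax e x z zeta ep CP i.
have T1 := TT_ge1 t; have iT : 0 < / TT t by pos.
pose z0 (i : 'I_n) r := ax i + 2 * t * e i * r; pose e0 (i : 'I_n) (r : R) := e i.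
pose g (i : 'I_n) (r : R) := 0 : R.
have AX i' : AC (z0 i') (fun r => t * (2 * e0 i' r + g i' r)).
 apply: AC_ext (AC_plus (AC_const (ax i')) (AC_scal (2 * t * e i') AC_id)) => r _; rewrite /z0 /e0 /g; ring.
have AXi i' : AC (e0 i') (fun r => t * g i' r).
 apply: AC_ext (AC_const (e i')) => r _; rewrite /e0 /g; ring.
have z00 i' : z0 i' 0 = ax i' by rewrite /z0; ring.
have e00 i' : e0 i' 0 = e i' by [].
have cA := ccP CP (z0 := z0) (e0 := e0) (g := g) (f := g) AX AXi i.
have kk := kap_Cmod t.
have zz m : 0 <= m <= 4 -> Cmod (RtoC m) <= 4 by move=> h; rewrite Cmod_R Rabs_pos_eq; lra.
have := @ACC_bound sgm s0p true t (cc t z zeta z0 e0 i) _ (15 * (eps * K) / TT t) 0 1 cA.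
rewrite (cc1 CP) (cc0 CP z00 e00) => H.
rewrite -(Cmod_opp (Cminus _ _)) (_ : Copp _ = (kap t * (x i - z0 i 1)%R - (z i 0 - ax i))%C); last first.
 by rewrite /z0 (_ : x i - (ax i + 2 * t * e i * 1) = x i - ax i - 2 * t * e i); [ring|ring].
bound (H _ _ _ _ _); [|lra|lra|lra| |rewrite -/W; lra].
 pos.
move=> r Hr; have md := mD_ge1 t Hr.
(* The comparison point is the real part of the ray with momentum zero. There the real field
   vanishes, so the Lipschitz bound becomes a plain bound on the extended field. *)
have [|||h1 h2] := HK true t r (fun i => Re (z i r)) (fun i => Im (z i r)) (fun i => Re (z i r)) (fun _ => 0) (fun i => zeta i r) 1 4
  Hr (cpq CP Hr) (cpp CP Hr) (cpp CP Hr) ltac:(lra) ltac:(lra) _ _ (fun i => cp4 CP i Hr) _ i.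
- move=> k; apply: Rle_trans (cpq CP Hr); apply: Rle_trans (vnorm_term _ k).
 bound (Cmod_le_sum _); rewrite Re_minus Im_minus /= Rminus_diag Rabs_R0 Rminus_0_r; lra.
- by move=> k; rewrite (_ : Cminus _ _ = zeta k r); [exact: (cp4 CP)|rewrite /Cminus; ring].
- move=> k; rewrite Rabs_R0; lra.
have gz : gR b (fun i => Re (z i r)) (fun _ => 0) i = 0.
 rewrite /gR (_ : fsum _ = 0) ?Rmult_0_r // -[RHS](@fsum_0 'I_n); apply: fsum_ext => k; lra.
have fz : fR b (fun i => Re (z i r)) (fun _ => 0) i = 0.
 rewrite /fR (_ : fsum _ = 0) ?Ropp_0 // -[RHS](@fsum_0 'I_n); apply: fsum_ext => j.
 rewrite -[RHS](@fsum_0 'I_n); apply: fsum_ext => k; lra.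
have c0 u : (u - 0)%C = u by ring.
rewrite gz fz !c0 in h1 h2.
have l1 := Lp_pos true t r (1 + sgm); have l2 := Lp_pos true t r (2 + sgm).
have m21 : Lp true t r (2 + sgm) <= Lp true t r (1 + sgm) by apply: Rle_Rpower; pos.
have m32 : Lp true t r (3 + sgm) <= Lp true t r (2 + sgm) by apply: Rle_Rpower; pos.
have e1 : Lp true t r (1 + sgm) = Lp true t r (2 + sgm) * mD t r by apply: Lp_S => //; lra.
have [_ p2] := pair_Cmod t Hr.
have eK : 0 <= eps * K by pos.
have G1 : Cmod (Gd eps z zeta g i r) <= 5 * (eps * K) * Lp true t r (1 + sgm).
 rewrite /Gd c0 Cmod_mult Cmod_R Rabs_pos_eq; last lra.
 nra.
have F1 : Cmod (Fd eps z zeta g i r) <= 5 * (eps * K) * Lp true t r (2 + sgm).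
 rewrite /Fd c0 Cmod_mult Cmod_R Rabs_pos_eq; last lra.
 nra.
rewrite Cmod_mult; via (1 * (Cmod (Gd eps z zeta g i r) + 2 * mD t r * Cmod (Fd eps z zeta g i r))).
 apply: Rmult_le_compat; [exact: Cmod_ge_0|exact: Cmod_ge_0|exact: (proj2 kk)|].
 bound (Cmod_triangle _ _); apply: Rplus_le_compat_l; rewrite Cmod_mult.
 apply: Rmult_le_compat_r; first exact: Cmod_ge_0.
 rewrite RtoC_mult Cmod_mult Cmod_R (Rabs_pos_eq 2); lra.
have F2 := Rmult_le_compat_l (2 * mD t r) _ _ ltac:(lra) F1.
rewrite (_ : 15 * (eps * K) / TT t * W0 sgm true t r = 15 * (eps * K) * Lp true t r (1 + sgm)); last by rewrite /W0 -/(Lp true t r (1 + sgm)); field; lra.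
nra.
Qed.

(** When the origin may be near the end, the distance to the real ray is only of order [rho], too
    large near [r = 1]. The imaginary part is estimated directly: the field at the real part of the
    ray is real, [Im z] vanishes at the end because [x] is real, and [Im zeta] at the start is the
    real part of the initial displacement. *)
Lemma imaginary_estimate : exists Ci0, 0 <= Ci0 /\ forall eps t ax e x z zeta k, 0 < eps -> Ci0 * eps <= 1 -> 0 <= k ->
 cpath eps true t ax e x z zeta -> (forall i, Cmod (z i 0 - ax i) <= k / TT t) ->
 forall i r, I01 r -> Rabs (Im (z i r)) <= 16 * k * (mD t r / TT t) /\ Rabs (Im (zeta i r)) <= 2 * k / TT t.
Proof.
have [K [K0 HK]] := lip_gf s0p bsm bdec.
have W1 := KW1 s0p; set W := KW sgm in W1.
have KW0 : 0 <= K * W by pos.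
exists (18 * (K * W)); split; first lra.
move=> eps t ax e x z zeta k ep esm k0 CP Hw.
have T1 := TT_ge1 t; have iT : 0 < / TT t by pos.
have eK : 0 <= eps * K by pos.
have eKW : 18 * (eps * K * W) <= 1 by lra.
have AZ i := proj2 (cpz CP i); have AE i := proj2 (cpe CP i).
have q1 i : Im (z i 1) = 0 by rewrite (cp1 CP).
have b0 i : Rabs (Im (zeta i 0)) <= k / TT t.
 rewrite (cp0 CP); apply: Rle_trans (Hw i); apply: Rle_trans (Re_le_Cmod _); right; congr Rabs.
 rewrite /Re /Im /Cplus /Cmult /Ci /RtoC /Cminus /=; ring.
have step B : 0 <= B -> (forall i r, I01 r -> Rabs (Im (z i r)) <= 8 * B * (mD t r / TT t) /\ Rabs (Im (zeta i r)) <= B / TT t) ->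
  forall i r, I01 r -> Rabs (Im (z i r)) <= (5 / 2) * B * (mD t r / TT t) /\ Rabs (Im (zeta i r)) <= k / TT t + B / 2 / TT t.
 move=> B0 HB.
 have GF i r : I01 r ->
   Rabs (Im (gg b (fun i => Re (z i r)) (fun i => Im (z i r)) (fun k => zeta k r) i)) <= 9 * (K * B / TT t) * Lp true t r (1 + sgm) /\
   Rabs (Im (ff b (fun i => Re (z i r)) (fun i => Im (z i r)) (fun k => zeta k r) i)) <= 9 * (K * B / TT t) * Lp true t r (2 + sgm).
  move=> Hr; have md := mD_ge1 t Hr.
  have BT : 0 <= B / TT t by pos.
  have BM : 0 <= 8 * B * (mD t r / TT t) by pos.
  have [|||h1 h2] := HK true t r (fun i => Re (z i r)) (fun i => Im (z i r)) (fun i => Re (z i r)) (fun i => Re (zeta i r)) (fun i => zeta i r) _ _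
   Hr (cpq CP Hr) (cpp CP Hr) (cpp CP Hr) BM BT _ _ (fun i => cp4 CP i Hr) _ i.
  - move=> j; apply: Rle_trans (proj1 (HB j r Hr)); bound (Cmod_le_sum _).
   rewrite Re_minus Im_minus /= Rminus_diag Rabs_R0 Rminus_0_r; lra.
  - move=> j; apply: Rle_trans (proj2 (HB j r Hr)); bound (Cmod_le_sum _).
   rewrite Re_minus Im_minus /= Rminus_diag Rabs_R0 Rminus_0_r; lra.
  - by move=> j; apply: Rle_trans (Re_le_Cmod _) (cp4 CP j Hr).
  have e1 : Lp true t r (1 + sgm) = Lp true t r (2 + sgm) * mD t r by apply: Lp_S => //; lra.
  have e2 : Lp true t r (2 + sgm) = Lp true t r (3 + sgm) * mD t r by apply: Lp_S => //; lra.
  split.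
   bound (Im_le_Cminus _ _); bound h1; nra.
  bound (Im_le_Cminus _ _); bound h2; nra.
 have KB : 0 <= 9 * (eps * K * B / TT t).
  pos.
 have half : 9 * (eps * K * B / TT t) * KW sgm <= B / 2 / TT t.
  rewrite -/W (_ : _ * W = (9 * (eps * K * W)) * B * / TT t); last lra.
  have -> : B / 2 / TT t = / 2 * B * / TT t by lra.
  pos.
 have tT : Rabs t <= TT t by rewrite /TT; lra.
 move=> i r Hr; split.
 - have md := mD_ge1 t Hr.
  have := @AC_bound sgm s0p true t _ _ (Rabs t * (2 * (B / TT t))) (9 * (eps * K * B / TT t)) r 1 (AZ i).
  rewrite q1 Rminus_0_l Rabs_Ropp => H.
  have k1 : 0 <= Rabs t * (2 * (B / TT t)).
   pos.
  bound (H k1 KB _ _ _ _); [lra|lra|lra| |].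
   move=> s Hs; have Hs' : I01 s by lra.
   have [g1 _] := GF i s Hs'; have b1 := proj2 (HB i s Hs').
   rewrite Im_RtoC_mult /vel.
   rewrite (_ : Im (Cplus _ _) = 2 * Im (zeta i s) + eps * Im (gg b (fun i => Re (z i s)) (fun i => Im (z i s)) (fun k => zeta k s) i)); last first.
    by rewrite -Im_RtoC_mult -Im_RtoC_mult.
   rewrite Rabs_mult; via (Rabs t * (2 * (B / TT t)) + Rabs t * (eps * (9 * (K * B / TT t) * Lp true t s (1 + sgm)))).
    rewrite -Rmult_plus_distr_l; apply: Rmult_le_compat_l; first exact: Rabs_pos.
    bound (Rabs_triang _ _); rewrite !Rabs_mult (Rabs_pos_eq 2) ?(Rabs_pos_eq eps); try lra.
    pos.
   apply: Rplus_le_compat_l; rewrite /W0 -/(Lp true t s (1 + sgm)).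
   rewrite [X in _ <= X](_ : _ = TT t * (eps * (9 * (K * B / TT t) * Lp true t s (1 + sgm)))); last lra.
   pos.
  via (2 * B * (Rabs t * (1 - r) / TT t) + B / 2 / TT t).
   pos.
  rewrite /mD; have := Rmult_le_pos _ _ B0 (Rlt_le _ _ iT) => h.
  nra.
 - have := @AC_bound sgm s0p true t _ _ 0 (9 * (eps * K * B / TT t)) 0 r (AE i) ltac:(lra) KB ltac:(lra) ltac:(lra) ltac:(lra) => H.
  have D : Rabs (Im (zeta i r) - Im (zeta i 0)) <= B / 2 / TT t.
   bound (H _); last lra.
   move=> s Hs; have Hs' : I01 s by lra.
   have [_ f1] := GF i s Hs'.
   rewrite !Im_RtoC_mult Rabs_mult Rabs_mult (Rabs_pos_eq eps) ?Rplus_0_l; last lra.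
   have m21 : Lp true t s (2 + sgm) <= Lp true t s (1 + sgm) by apply: Rle_Rpower; [exact: mD_ge1|lra].
   have h : 0 <= K * B / TT t by pos.
   rewrite /W0 -/(Lp true t s (1 + sgm)).
   rewrite [X in _ <= X](_ : _ = TT t * (eps * (9 * (K * B / TT t) * Lp true t s (1 + sgm)))); last lra.
   apply: Rmult_le_compat => //; [exact: Rabs_pos|pos|].
   nra.
  have -> : Im (zeta i r) = Im (zeta i 0) + (Im (zeta i r) - Im (zeta i 0)) by ring.
  bound (Rabs_triang _ _); pos.
have fin : forall y : bool * 'I_n * R, (if y.1.1 then Rabs (Im (z y.1.2 (clamp y.2))) else Rabs (Im (zeta y.1.2 (clamp y.2))))
  <= 2 * k * (if y.1.1 then 8 * (mD t (clamp y.2) / TT t) else / TT t).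
 apply: contraction_bound => //.
 - move=> [[[] i] r] /=; last lra.
  have := mD_ge1 t (clampP r) => h; pos.
 - exists (4 * TT t) => -[[[] i] r] /=.
   have md := mD_ge1 t (clampP r).
   apply: (@Rle_trans _ 1); first exact: Rle_trans (vnorm_term (fun i => Im (z i (clamp r))) i) (cpq CP (clampP r)).
   by rewrite (_ : 4 * TT t * _ = 32 * mD t (clamp r)); [lra|field; lra].
  bound (Im_le_Cmod _); bound (cp4 CP i (clampP r)).
  rewrite Rmult_assoc Rinv_r; lra.
 - move=> B B0 HB.
  have HB' i r : I01 r -> Rabs (Im (z i r)) <= 8 * B * (mD t r / TT t) /\ Rabs (Im (zeta i r)) <= B / TT t.
   move=> Hr; have := HB (false, i, r); have := HB (true, i, r); rewrite /= (clamp_id Hr) => *; lra.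
  move=> [[[] i] r] /=; have [s1 s2] := step B B0 HB' i _ (clampP r); last pos.
  bound s1; have := mD_ge1 t (clampP r) => h; have := Rmult_le_pos (mD t (clamp r)) _ ltac:(lra) (Rlt_le _ _ iT); rewrite -/(Rdiv _ _).
  nra.
move=> i r Hr; have := fin (true, i, r); have := fin (false, i, r); rewrite /= (clamp_id Hr) => h1 h2.
pos.
Qed.

Lemma ray_estimate Cf : 0 <= Cf -> exists Ce, 0 <= Ce /\ forall eps ty t ax e x z zeta X Xi, 0 < eps -> Ce * eps <= 1 ->
 cpath eps ty t ax e x z zeta -> flow_bounds b Cf eps ax e X Xi ->
 let rho := vnorm (vsub x (X t)) in
 ((forall r, I01 r -> / 4 * Lm ty t r <= jbr (X (t * r))) \/ (ty = true /\ jbr (X t) <= 9 * rho)) -> forall i,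
 Cmod (z i 0 - ax i - kap t * (x i - X t i)%R) <= Ce * eps * (rho / TT t) /\
 forall r, I01 r -> Rabs (Im (z i r)) <= Ce * (rho / TT t) * Lm ty t r /\ Rabs (Im (zeta i r)) <= Ce * (rho / TT t).
Proof.
move=> Cf0.
have [Cg [Cg0 HG]] := good_estimate; have [Ca [Ca0 HA]] := absolute_estimate; have [Cq [Cq0 HQ]] := imaginary_estimate.
exists (Cg + 9 * (Ca + 2 * Cf) + Cq + 48); split; first lra.
set Ce := _ + 48; move=> eps ty t ax e x z zeta X Xi ep esm CP FB rho HC.
have T1 := TT_ge1 t; have iT : 0 < / TT t by pos.
have rho0 : 0 <= rho := vnorm_ge0 _.
have rT : 0 <= rho / TT t by pos.
have G1 : forall i, Cmod (z i 0 - ax i - kap t * (x i - X t i)%R) <= (Cg + 9 * (Ca + 2 * Cf)) * eps * (rho / TT t).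
 case: HC => [good|[E bad]] i.
  have [h _] := HG eps ty t ax e x z zeta X Xi ep ltac:(rewrite /Ce in esm; nra) CP (fbF FB) (fb3 FB) good i.
  bound h; apply: Rmult_le_compat_r => //; pos.
 (* Here [1 <= <X t> <= 9 * rho], so errors of size [eps / TT] and [eps * <X t> / TT] are both of
    order [eps * rho / TT]. *)
 subst ty; have h := HA eps t ax e x z zeta ep CP i.
 rewrite (_ : Cminus _ _ = (z i 0 - ax i - kap t * (x i - ax i - 2 * t * e i)%R + kap t * (X t i - ax i - 2 * t * e i)%R)%C); last by rewrite !RtoC_minus; ring.
 bound (Cmod_triangle _ _); rewrite (Cmod_mult (kap t)) Cmod_R.
 have j1 := jbr_ge1 (X t).
 have h2 : Cmod (kap t) * Rabs (X t i - ax i - 2 * t * e i) <= 2 / TT t * (Cf * eps * (9 * rho)).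
  apply: Rmult_le_compat; [exact: Cmod_ge_0|exact: Rabs_pos|exact: (proj1 (kap_Cmod t))|].
  bound (fbX FB t i); pos.
 have h3 : Ca * eps / TT t <= Ca * eps * (9 * rho) / TT t.
  apply: Rmult_le_compat_r; first lra.
  rewrite -{1}[Ca * eps]Rmult_1_r; pos.
 have h4 : 0 <= Cg * eps * (rho / TT t) by pos.
 lra.
move=> i; split.
 bound (G1 i); apply: Rmult_le_compat_r => //; apply: Rmult_le_compat_r; [lra|rewrite /Ce; lra].
move=> r Hr; have C2 : 0 <= (Ce - 48) * (rho / TT t) by apply: Rmult_le_pos; rewrite /Ce; lra.
destruct ty.
 have w i' : Cmod (z i' 0 - ax i') <= 3 * rho / TT t.
  rewrite (_ : Cminus _ _ = (z i' 0 - ax i' - kap t * (x i' - X t i')%R + kap t * (x i' - X t i')%R)%C); last ring.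
  bound (Cmod_triangle _ _); rewrite (Cmod_mult (kap t)) Cmod_R.
  have h2 : Cmod (kap t) * Rabs (x i' - X t i') <= 2 / TT t * rho.
   apply: Rmult_le_compat; [exact: Cmod_ge_0|exact: Rabs_pos|exact: (proj1 (kap_Cmod t))|exact: (vnorm_term (vsub x (X t)) i')].
  have h3 : (Cg + 9 * (Ca + 2 * Cf)) * eps * (rho / TT t) <= 1 * (rho / TT t).
   apply: Rmult_le_compat_r => //; rewrite /Ce in esm; nra.
  have := G1 i'; lra.
 have [q b'] := HQ eps t ax e x z zeta (3 * rho) ep ltac:(rewrite /Ce in esm; nra) ltac:(lra) CP w i r Hr.
 have md := mD_ge1 t Hr; have P := Rmult_le_pos _ _ rT (Rle_trans _ _ _ Rle_0_1 md).
 have C1 : 0 <= (Ce - 48) * (rho / TT t * mD t r) by nra.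
 split; [bound q; rewrite /Lm|bound b']; pos.
case: HC => [good|[//]].
have [_ h] := HG eps false t ax e x z zeta X Xi ep ltac:(rewrite /Ce in esm; nra) CP (fbF FB) (fb3 FB) good i.
have [h1 h2] := h r Hr; have mc := mC_ge1 t Hr; have P := Rmult_le_pos _ _ rT (Rle_trans _ _ _ Rle_0_1 mc).
have C1 : 0 <= (Ce - 48) * (rho / TT t * mC t r) by nra.
split; bound (Im_le_Cminus _ _); [bound h1|bound h2].
 rewrite -/rho /Mw /Lm /Rdiv; lra.
rewrite /Mw /Lm (_ : mC t r / TT t / mC t r = / TT t); last by field; lra.
rewrite -/rho; pos.
Qed.

End Rays.

(** * Estimates of the phase *)

Section Remainders.
Variables (n : nat) (b : 'I_n -> 'I_n -> vec n -> R) (sgm : R) (Ad : nat -> R).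
Hypotheses (s0p : 0 < sgm) (bsm : forall j k, smooth_Rn (b j k)) (bdec : decays b sgm Ad) (bsym : forall j k x, b j k x = b k j x).

Let FP j k ds i x : pd (dxs ds (b j k)) i x (dxs (i :: ds) (b j k) x) := pd_dxs (bsm j k) ds i x.

Lemma Lp_pow ty t r N s : I01 r -> Lm ty t r ^ N * Lp ty t r (s + INR N) = Lp ty t r s.
Proof.
move=> Hr; have L1 := Lm_ge1 ty t Hr; rewrite /Lp -Rpower_pow; last lra.
rewrite -Rpower_plus; congr Rpower; ring.
Qed.

Lemma l1_small (q : vec n) m L : (forall i, Rabs (q i) <= m * L) -> l1 q <= INR n * m * L.
Proof. move=> H; bound (fsum_le_const H); rewrite card_ord; pos. Qed.

(** Each factor [q], at most [m * Lm], is matched by one of the additional powers of decay, so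
    flatness becomes a pure power of [m] and the weight of the force is untouched. *)
Lemma cr_bound N : exists K, 0 <= K /\ forall ty t r (p q : vec n) (zeta : 'I_n -> C) m, I01 r -> vnorm q <= 1 ->
 / 8 * Lm ty t r <= jbr p -> (forall i, Cmod (zeta i) <= 4) -> 0 <= m -> (forall i, Rabs (q i) <= m * Lm ty t r) ->
 forall i, Cmod (cr b p q zeta i) <= K * m ^ N * Lp ty t r (2 + sgm).
Proof.
have [C HC] := choice _ (fun x : 'I_n * 'I_n * 'I_n => Hm_taylor s0p (FP x.1.1 x.1.2) (bdec x.1.1 x.1.2) N [:: x.2]).
have C0 : 0 <= fsum C by apply: fsum_ge0 => x; case: (HC x).
have N0 := pos_INR n; have p8 := Rpower_pos 8 (2 + sgm + INR N).
have nN : 0 <= INR n ^ N by pos.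
have NN := Rmult_le_pos _ _ N0 N0.
exists (4 * (INR n * INR n) * (fsum C * (INR n ^ N * Rpower 8 (2 + sgm + INR N)) * 16)); split.
 pos.
move=> ty t r p q zeta m Hr q1 Lb z4 m0 Hq i; have L1 := Lm_ge1 ty t Hr.
have mN : 0 <= m ^ N by pos.
have l2 := Lp_pos ty t r (2 + sgm).
via (2 * (INR #|'I_n| * (2 * (INR #|'I_n| * ((fsum C * (INR n ^ N * Rpower 8 (2 + sgm + INR N)) * 16) * (m ^ N * Lp ty t r (2 + sgm))))))); last by rewrite card_ord; lra.
apply: Cmod_csum_le => j; apply: Cmod_csum_le => k; rewrite !Cmod_mult.
have zz : Cmod (zeta j) * Cmod (zeta k) <= 16.
 have := Cmod_mul_le (z4 j) (z4 k); lra.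
have [c0 H] := HC (j, k, i); have [_ h] := H p q q1.
have cF : C (j, k, i) <= fsum C by apply: fsum_term => x; case: (HC x).
have lq : l1 q ^ N <= (INR n * m * Lm ty t r) ^ N by apply: pow_incr; split; [exact: l1_ge0|exact: l1_small].
have o : om (2 + sgm + INR N) p <= Rpower 8 (2 + sgm + INR N) * Lp ty t r (2 + sgm + INR N).
 apply: om_Lp => //; pos.
have o0 : 0 <= om (2 + sgm + INR N) p by pos.
have E : Cmod (EB b j k [:: i] 1 p q - Ci * EB b j k [:: i] 0 p q) <=
  fsum C * (INR n ^ N * Rpower 8 (2 + sgm + INR N)) * (m ^ N * Lp ty t r (2 + sgm)).
 bound h; rewrite [sz _ _]sz1 /=.
 rewrite -(Lp_pow ty t N (2 + sgm) Hr) (_ : fsum C * _ * _ = fsum C *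
   ((INR n * m * Lm ty t r) ^ N * (Rpower 8 (2 + sgm + INR N) * Lp ty t r (2 + sgm + INR N)))); last by rewrite !Rpow_mult_distr; ring.
 pos.
have := Rmult_le_compat _ _ _ _ (Cmod_ge_0 _) (Rmult_le_pos _ _ (Cmod_ge_0 _) (Cmod_ge_0 _)) E zz; lra.
Qed.

Lemma EB_Lp ds l : exists K, 0 <= K /\ forall j k ty t r (p q : vec n), I01 r -> vnorm q <= 1 ->
 / 8 * Lm ty t r <= jbr p -> Cmod (EB b j k ds l p q) <= K * Lp ty t r (sz sgm ds).
Proof.
have [C HC] := choice _ (fun x : 'I_n * 'I_n => EE_bound s0p (bdec x.1 x.2) ds l).
have C0 : 0 <= fsum C by apply: fsum_ge0 => x; case: (HC x).
have p8 := Rpower_pos 8 (sz sgm ds).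
exists (fsum C * Rpower 8 (sz sgm ds)); split; first pos.
move=> j k ty t r p q Hr q1 Lb; have [c0 H] := HC (j, k).
have cF : C (j, k) <= fsum C by apply: fsum_term => x; case: (HC x).
bound (H p q q1); rewrite Rmult_assoc; apply: Rmult_le_compat => //.
 pos.
by apply: om_Lp => //; apply: Rlt_le; apply: sz_pos.
Qed.

(** What remains of the derivative of [Im (t pt) - d/dr (Re zeta . Im z)]. *)
Definition Rrem (p q : vec n) (zeta : 'I_n -> C) : R :=
 Im (csum (fun j => csum (fun k => (EB b j k [::] 0 p q * (zeta j * zeta k))%C)))
 - fsum (fun j => Re (zeta j) * Im (gg b p q zeta j)) - fsum (fun i => Re (ff b p q zeta i) * q i).

(** Symmetry of the coefficients lets the velocity terms be paired, after which the first-order part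
    is visible as [q] times the gradient minus [Im E]. *)
Lemma Rrem_sum p q zeta : Rrem p q zeta = fsum (fun j => fsum (fun k =>
 fsum (fun i => q i * Re (EB b j k [:: i] 0 p q * (zeta j * zeta k)))
 - Im (EB b j k [::] 0 p q) * (Re (zeta j) * Re (zeta k) + Im (zeta j) * Im (zeta k)))).
Proof.
pose E j k := EB b j k [::] 0 p q.
pose F i j k := Re (EB b j k [:: i] 0 p q * (zeta j * zeta k)).
have A1 : Im (csum (fun j => csum (fun k => (E j k * (zeta j * zeta k))%C))) =
  fsum (fun j => fsum (fun k => Im (E j k * (zeta j * zeta k)))) by [].
have A2 : fsum (fun j => Re (zeta j) * Im (gg b p q zeta j)) =
  fsum (fun j => fsum (fun k => Re (zeta j) * Im (E j k * zeta k) + Re (zeta k) * Im (E j k * zeta j))).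
 have -> : fsum (fun j => fsum (fun k => Re (zeta j) * Im (E j k * zeta k) + Re (zeta k) * Im (E j k * zeta j))) =
   fsum (fun j => fsum (fun k => Re (zeta j) * Im (E j k * zeta k))) + fsum (fun j => fsum (fun k => Re (zeta k) * Im (E j k * zeta j))).
  by rewrite -fsum_plus; apply: fsum_ext => j; rewrite -fsum_plus.
 rewrite [X in _ = _ + X]fsum_exchange -fsum_plus; apply: fsum_ext => j.
 rewrite /gg Im_RtoC_mult (_ : Im (csum _) = fsum (fun k => Im (E j k * zeta k))) // -fsum_plus -(fsum_scal 2) -(fsum_scal (Re (zeta j))); apply: fsum_ext => k.
 rewrite /E (EB_sym bsym k j); ring.
have A3 : fsum (fun i => Re (ff b p q zeta i) * q i) = - fsum (fun j => fsum (fun k => fsum (fun i => q i * F i j k))).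
 have -> : fsum (fun j => fsum (fun k => fsum (fun i => q i * F i j k))) = fsum (fun i => fsum (fun j => fsum (fun k => q i * F i j k))).
  by rewrite [RHS]fsum_exchange; apply: fsum_ext => j; rewrite fsum_exchange.
 rewrite -fsum_opp; apply: fsum_ext => i; rewrite /ff.
 rewrite (_ : Re (Copp _) = - fsum (fun j => fsum (fun k => F i j k))) //.
 rewrite Rmult_comm Ropp_mult_distr_r_reverse; congr (- _).
 by rewrite -(fsum_scal (q i)); apply: fsum_ext => j; rewrite -(fsum_scal (q i)).
rewrite /Rrem -/E [Im _]A1 A2 A3.
rewrite -!fsum_minus /Rminus Ropp_involutive -fsum_plus; apply: fsum_ext => j.
rewrite -fsum_opp -!fsum_plus; apply: fsum_ext => k; rewrite -/E -[fsum _]/(fsum (fun i => q i * F i j k)).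
rewrite -[EB b j k [::] 0 p q]/(E j k); move: (fsum _) (E j k) (zeta j) (zeta k) => S [e1 e2] [u1 u2] [v1 v2].
rewrite /Re /Im /Cmult /=; ring.
Qed.

(** The first-order part cancels to second order by [EE_im2]. Every other term contains two small
    factors among [q], [Im zeta] and the imaginary part of an extended coefficient or derivative. *)
Lemma Rrem_bound : exists K, 0 <= K /\ forall ty t r (p q : vec n) (zeta : 'I_n -> C) m, I01 r -> vnorm q <= 1 ->
 / 8 * Lm ty t r <= jbr p -> (forall i, Cmod (zeta i) <= 4) -> 0 <= m -> (forall i, Rabs (q i) <= m * Lm ty t r) ->
 (forall i, Rabs (Im (zeta i)) <= m) -> Rabs (Rrem p q zeta) <= K * m ^ 2 * Lp ty t r (1 + sgm).
Proof.
have [K0 [K00 H0]] := EB_Lp [::] 0.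
have [K1 HK1] := choice _ (fun i : 'I_n => EB_Lp [:: i] 0).
have [K2 HK2] := choice _ (fun x : 'I_n * 'I_n => EE_im2 s0p (FP x.1 x.2) (bdec x.1 x.2) [::]).
have [K3 HK3] := choice _ (fun x : 'I_n * 'I_n * 'I_n => EE_im1 s0p (FP x.1.1 x.1.2) (bdec x.1.1 x.1.2) [:: x.2]).
have P1 : 0 <= fsum K1 by apply: fsum_ge0 => x; case: (HK1 x).
have P2 : 0 <= fsum K2 by apply: fsum_ge0 => x; case: (HK2 x).
have P3 : 0 <= fsum K3 by apply: fsum_ge0 => x; case: (HK3 x).
have N0 := pos_INR n; have p8 := Rpower_pos 8 (3 + sgm); have NN := Rmult_le_pos _ _ N0 N0.
pose A := 16 * (fsum K2 * (INR n * INR n * Rpower 8 (3 + sgm))) + K0 + INR n * (fsum K1 + 32 * (fsum K3 * (INR n * Rpower 8 (3 + sgm)))).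
have A0 : 0 <= A.
 have h1 : 0 <= fsum K2 * (INR n * INR n * Rpower 8 (3 + sgm)) by pos.
 have h2 : 0 <= fsum K3 * (INR n * Rpower 8 (3 + sgm)) by pos.
 have := Rmult_le_pos (INR n) (fsum K1 + 32 * (fsum K3 * (INR n * Rpower 8 (3 + sgm)))) N0 ltac:(lra); rewrite /A; lra.
exists (INR n * (INR n * A)); split; first pos.
move=> ty t r p q zeta m Hr q1 Lb z4 m0 Hq Hb; have L1 := Lm_ge1 ty t Hr.
have l1p := Lp_pos ty t r (1 + sgm); have l3p := Lp_pos ty t r (3 + sgm).
have m2 : 0 <= m ^ 2 by pos.
set w := m ^ 2 * Lp ty t r (1 + sgm); have w0 : 0 <= w by apply: Rmult_le_pos; lra.
rewrite Rrem_sum; via (INR #|'I_n| * (INR #|'I_n| * (A * w))); last by rewrite card_ord /w; lra.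
bound (fsum_Rabs _); apply: fsum_le_const => j; bound (fsum_Rabs _); apply: fsum_le_const => k.
set E := EB b j k [::] 0 p q; pose Ei i := EB b j k [:: i] 0 p q.
have a4 i : Rabs (Re (zeta i)) <= 4 by apply: Rle_trans (Re_le_Cmod _) (z4 i).
have b4 i : Rabs (Im (zeta i)) <= 4 by apply: Rle_trans (Im_le_Cmod _) (z4 i).
have mul u v U V : Rabs u <= U -> Rabs v <= V -> Rabs (u * v) <= U * V.
 rewrite Rabs_mult; pos.
have e3 : Lm ty t r ^ 2 * Lp ty t r (3 + sgm) = Lp ty t r (1 + sgm).
 rewrite -(Lp_pow ty t 2 (1 + sgm) Hr); congr (_ * Lp _ _ _ _); rewrite /=; ring.
have o3 : om (3 + sgm) p <= Rpower 8 (3 + sgm) * Lp ty t r (3 + sgm) by apply: om_Lp => //; lra.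
have o0 : 0 <= om (3 + sgm) p by pos.
have lq := l1_small Hq; have lq0 := l1_ge0 q.
have bb : Rabs (Im (zeta j) * Im (zeta k)) <= m * m by pos.
have T1 : Rabs (Im E - fsum (fun i => Re (Ei i) * q i)) <= fsum K2 * (INR n * INR n * Rpower 8 (3 + sgm)) * w.
 have [c0 H] := HK2 (j, k); bound (H p q q1); rewrite [sz _ _]sz0 (_ : 1 + sgm + 2 = 3 + sgm); last ring.
 rewrite (_ : _ * w = fsum K2 * ((INR n * m * Lm ty t r) ^ 2 * (Rpower 8 (3 + sgm) * Lp ty t r (3 + sgm)))); last by rewrite /w -e3; ring.
 have cF : K2 (j, k) <= fsum K2 by apply: fsum_term => x; case: (HK2 x).
 pos.
have T2 : Rabs (Im E * (Im (zeta j) * Im (zeta k))) <= K0 * w.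
 rewrite (_ : K0 * w = (K0 * Lp ty t r (1 + sgm)) * (m * m)); last by rewrite /w; ring.
 by apply: (mul) => //; bound (Im_le_Cmod _); have := H0 j k ty t r p q Hr q1 Lb; rewrite sz0.
have T3 i : Rabs (q i * Re (Ei i) * (Im (zeta j) * Im (zeta k))) <= fsum K1 * w.
 have [c0 H] := HK1 i; have cF : K1 i <= fsum K1 by apply: fsum_term => x; case: (HK1 x).
 rewrite (_ : fsum K1 * w = (1 * (fsum K1 * Lp ty t r (1 + sgm))) * (m * m)); last by rewrite /w; ring.
 apply: (mul) => //; apply: (mul); first exact: Rle_trans (vnorm_term q i) q1.
 bound (Re_le_Cmod _); bound (H j k ty t r p q Hr q1 Lb); rewrite sz1.
 by apply: Rmult_le_compat => //; [apply: Rlt_le; apply: Lp_pos|apply: Rle_Rpower; lra].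
have T4 i : Rabs (q i * Im (Ei i) * (Re (zeta j) * Im (zeta k) + Im (zeta j) * Re (zeta k))) <= 32 * (fsum K3 * (INR n * Rpower 8 (3 + sgm))) * w.
 have [c0 H] := HK3 (j, k, i); have cF : K3 (j, k, i) <= fsum K3 by apply: fsum_term => x; case: (HK3 x).
 rewrite (_ : 32 * _ * w = ((m * Lm ty t r) * (fsum K3 * (INR n * m * Lm ty t r * (Rpower 8 (3 + sgm) * Lp ty t r (3 + sgm))))) * 32); last by rewrite /w -e3; ring.
 apply: (mul); last first.
  bound (Rabs_triang _ _); move: (mul _ _ _ _ (a4 j) (b4 k)) (mul _ _ _ _ (b4 j) (a4 k)); lra.
 apply: (mul) => //; bound (H p q q1); rewrite [sz _ _]sz1 (_ : 2 + sgm + 1 = 3 + sgm); last ring.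
 pos.
have -> : fsum (fun i => q i * Re (Ei i * (zeta j * zeta k))) - Im E * (Re (zeta j) * Re (zeta k) + Im (zeta j) * Im (zeta k)) =
  - (Im E - fsum (fun i => Re (Ei i) * q i)) * (Re (zeta j) * Re (zeta k)) - Im E * (Im (zeta j) * Im (zeta k))
  - fsum (fun i => q i * Re (Ei i) * (Im (zeta j) * Im (zeta k)) + q i * Im (Ei i) * (Re (zeta j) * Im (zeta k) + Im (zeta j) * Re (zeta k))).
 have -> : fsum (fun i => q i * Re (Ei i * (zeta j * zeta k))) =
   (Re (zeta j) * Re (zeta k)) * fsum (fun i => Re (Ei i) * q i)
   - fsum (fun i => q i * Re (Ei i) * (Im (zeta j) * Im (zeta k)) + q i * Im (Ei i) * (Re (zeta j) * Im (zeta k) + Im (zeta j) * Re (zeta k))).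
  rewrite -(fsum_scal (Re (zeta j) * Re (zeta k))) -fsum_minus; apply: fsum_ext => i.
  rewrite /Re /Im /Cmult /=; ring.
 ring.
have S1 : Rabs (- (Im E - fsum (fun i => Re (Ei i) * q i)) * (Re (zeta j) * Re (zeta k))) <= fsum K2 * (INR n * INR n * Rpower 8 (3 + sgm)) * w * 16.
 apply: (mul); first by rewrite Rabs_Ropp.
 have := mul _ _ _ _ (a4 j) (a4 k); lra.
have S2 : Rabs (fsum (fun i => q i * Re (Ei i) * (Im (zeta j) * Im (zeta k)) + q i * Im (Ei i) * (Re (zeta j) * Im (zeta k) + Im (zeta j) * Re (zeta k))))
  <= INR n * ((fsum K1 + 32 * (fsum K3 * (INR n * Rpower 8 (3 + sgm)))) * w).
 bound (fsum_Rabs _); rewrite -[X in INR X * _](card_ord n); apply: fsum_le_const => i.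
 bound (Rabs_triang _ _); move: (T3 i) (T4 i); lra.
move: S1 T2 S2; rewrite /A; move: (- _ * _) (Im E * (Im _ * Im _)) (fsum (fun i => q i * Re (Ei i) * _ + _)) => u v x.
move=> /Rabs_le_between h1 /Rabs_le_between h2 /Rabs_le_between h3; apply/Rabs_le_between; lra.
Qed.

End Remainders.

(** * Energy, gradient and imaginary part of the phase at the centre of a chart *)

Section PhaseEstimates.
Variables (n : nat) (b : 'I_n -> 'I_n -> vec n -> R) (sgm : R) (Ad : nat -> R).
Hypotheses (s0p : 0 < sgm) (bsm : forall j k, smooth_Rn (b j k)) (bdec : decays b sgm Ad) (bsym : forall j k x, b j k x = b k j x).
Notation J := (option 'I_n).
Notation HB := (@hb n).
Notation fnC := (idx n -> R -> (J -> R) -> C).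
Let Dop : openI HB := @hb_open n.

Lemma primiC_le (f : fnC) V a th k : SbC HB V f -> HB th -> 0 <= k ->
 (forall r, I01 r -> Cmod (f a r th) <= k * W0 sgm (ity a) (it a) r) ->
 Cmod (primiC f a 1 th) <= 2 * k * KW sgm.
Proof.
move=> Sf Hth k0 Hf.
have A : ACC (fun r => primiC f a r th) (fun r => f a r th).
 apply: (primiC_ACC (u0 := RtoC 0) Sf Hth) => r _; ring.
have := @ACC_bound sgm s0p (ity a) (it a) _ _ k 0 1 A k0 ltac:(lra) ltac:(lra) ltac:(lra) Hf.
rewrite (_ : primiC f a 0 th = RtoC 0); last by rewrite /primiC /primi !RInt_point.
rewrite (_ : (primiC f a 1 th - 0)%C = primiC f a 1 th) //; ring.
Qed.

Variables (eps C0 : R) (Ch Dh : 'I_n -> fnC).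
Hypotheses (ep : 0 < eps) (am : amplitudes b eps C0 Ch Dh).

Section Centre.
Variables (a : idx n) (th : J -> R).
(** At the centre of a chart time and position are those recorded in the index, so the bounds built
    into [idx] and the comparison of rays apply. *)
Hypotheses (Hth : HB th) (Ht0 : tt a th = it a) (Hx0 : xx a th = ix a).

Let z i r := tZ Ch Dh i a r th.
Let zeta i r := tE Ch Dh i a r th.

Lemma tPE r : tP Ch Dh a r th = (fun i => Re (z i r)).
Proof. by apply: funext => i; rewrite tP_parts. Qed.
Lemma tQE r : tQ Ch Dh a r th = (fun i => Im (z i r)).
Proof. by []. Qed.

Lemma tT0E i : tT Ch Dh i a 0 th = (z i 0 - iax a i)%C.
Proof. rewrite /z tZ_tT /zbase (_ : (1 - 0) * iax a i + 0 * ix a i = iax a i); ring. Qed.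

Lemma ChDh_small (f : fnC) r : Rabs (Re (f a r th)) <= eps * C0 /\ Rabs (Im (f a r th)) <= eps * C0 -> Cmod (f a r th) <= 2 * (eps * C0).
Proof. move=> [h1 h2]; bound (Cmod_le_sum _); lra. Qed.

Lemma amp_le (m : R) (f : fnC) r : 1 <= m -> Cmod (f a r th) <= 2 * (eps * C0) -> Cmod ((cst n / m)%R * f a r th) <= eps * C0.
Proof.
move=> m1 h; have c0 := cst_pos n; have cl := cst_le n.
rewrite Cmod_mult Cmod_R Rabs_pos_eq; last pos.
have : cst n / m <= / 2 by apply/Rle_div_l; lra.
have : 0 < cst n / m by pos.
have := Cmod_ge_0 (f a r th) => *; nra.
Qed.

(** Used with [k = cst] for a crude bound on the momentum, and with a small [k] for the gradient
    estimate. *)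
Lemma tE_close i r k : I01 r -> 0 <= k -> Rabs (yf (iax a) (iaxi a) (it a) (ix a) i) <= k * TT (it a) ->
 Cmod (zeta i r - iaxi a i) <= 2 * k + 2 * (eps * C0).
Proof.
move=> Hr k0 Hy; have T1 := TT_ge1 (it a).
have E : (zeta i r - iaxi a i)%C = ((0, yf (iax a) (iaxi a) (it a) (ix a) i) * kap (it a) + (Ci * Cf Ch i a r th + (- / 2)%R * Df Dh i a r th))%C.
 have -> : zeta i r = zetaC (iax a) (iaxi a) (tt a th) (xx a th) (fun i => Cf Ch i a r th) (fun i => Df Dh i a r th) i by [].
 rewrite Ht0 Hx0 /zetaC; ring.
rewrite E.
have c1 := amp_le (mC_ge1 (it a) Hr) (ChDh_small (amCb am i a r Hth)).
have d1 := amp_le (mD_ge1 (it a) Hr) (ChDh_small (amDb am i a r Hth)).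
rewrite -/(Cf Ch i a r th) in c1; rewrite -/(Df Dh i a r th) in d1.
bound (Cmod_triangle _ _); apply: Rplus_le_compat.
 rewrite Cmod_mult; via ((k * TT (it a)) * (2 / TT (it a))); last by right; field; lra.
 apply: Rmult_le_compat; [exact: Cmod_ge_0|exact: Cmod_ge_0| |exact: (proj1 (kap_Cmod _))].
 by bound (Cmod_le_sum _); rewrite /= Rabs_R0 Rplus_0_l.
bound (Cmod_triangle _ _); rewrite (Cmod_mult Ci) (Cmod_mult (RtoC _)).
rewrite Cmod_Ci.
rewrite Cmod_R Rabs_Ropp Rabs_pos_eq; last lra.
have := Cmod_ge_0 (Df Dh i a r th); lra.
Qed.

Lemma tE_le4 i r : I01 r -> Cmod (zeta i r) <= 4.
Proof.
move=> Hr; have c0 := cst_pos n; have cl := cst_le n.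
have h := tE_close Hr (Rlt_le _ _ c0) (iy a i); have := amsm am => sm.
have -> : zeta i r = (zeta i r - iaxi a i + iaxi a i)%C by ring.
bound (Cmod_triangle _ _); rewrite Cmod_R; have := e_abs a i; lra.
Qed.

Lemma chart_cpath : cpath b eps (ity a) (it a) (iax a) (iaxi a) (ix a) z zeta.
Proof.
split.
- by move=> i; have := tZ_ACC am i a Hth; rewrite Ht0; apply: ACC_ext => r Hr //; rewrite /tV tPE tQE.
- by move=> i; have := tE_ACC am i a Hth; rewrite Ht0; apply: ACC_ext => r Hr //; rewrite /tF tPE tQE.
- by move=> i; rewrite /z (tZ1 am) // Hx0.
- by move=> i; rewrite /zeta (tE0 am) // tT0E.
- move=> r Hr; have := tQ_small am a Hr Hth; pos.
- move=> r Hr; have := tP_big am a Hr Hth; rewrite tPE /cG; lra.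
- by apply: tE_le4.
Qed.

Lemma T_Lp2 r : I01 r -> TT (it a) * Lp (ity a) (it a) r (2 + sgm) <= W0 sgm (ity a) (it a) r.
Proof.
move=> Hr; rewrite /W0; apply: Rmult_le_compat_l; first pos.
by apply: Rle_Rpower; [apply: Lm_ge1|lra].
Qed.

Lemma Gam_int N K Kd m (dZ : 'I_n -> fnC) : 0 <= K -> 0 <= Kd -> 0 <= m -> (forall i, SbC HB ones (dZ i)) ->
 (forall i r, I01 r -> Cmod (dZ i a r th) <= Kd) ->
 (forall i r, I01 r -> Cmod (tR b Ch Dh i a r th) <= K * m ^ N * Lp (ity a) (it a) r (2 + sgm)) ->
 Cmod (tt a th * primiC (Gam b eps Ch Dh dZ) a 1 th) <= eps * (4 * (INR n * (Kd * K)) * KW sgm) * m ^ N.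
Proof.
move=> K0 Kd0 m0 dZS dZb Rb; have GS := GamS s0p bsm bdec am dZS.
have mN : 0 <= m ^ N by pos.
have N0 := pos_INR n; have KK := Rmult_le_pos _ _ Kd0 K0.
rewrite -(primiC_scal (@tt n) _ _ GS Hth).
have S1 := SbC_mult Dop (@ttCS n) GS.
bound (primiC_le (k := eps * (2 * (INR n * (Kd * K))) * m ^ N) S1 Hth _ _).
- pos.
- move=> r Hr; rewrite Cmod_mult Cmod_R Ht0 /Gam Cmod_mult Cmod_R (Rabs_pos_eq eps); last lra.
 have l2 := Lp_pos (ity a) (it a) r (2 + sgm).
 have S : Cmod (csum (fun i => (Im (dZ i a r th) * tR b Ch Dh i a r th)%C)) <= 2 * (INR #|'I_n| * (Kd * (K * m ^ N * Lp (ity a) (it a) r (2 + sgm)))).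
  apply: Cmod_csum_le => i; rewrite Cmod_mult Cmod_R; apply: Rmult_le_compat; [exact: Rabs_pos|exact: Cmod_ge_0| |exact: Rb].
  bound (Im_le_Cmod _); pos.
 rewrite card_ord in S.
 have tT : Rabs (it a) <= TT (it a) by rewrite /TT; lra.
 via (TT (it a) * (eps * (2 * (INR n * (Kd * (K * m ^ N * Lp (ity a) (it a) r (2 + sgm))))))).
  pos.
 rewrite (_ : TT (it a) * _ = eps * (2 * (INR n * (Kd * K))) * m ^ N * (TT (it a) * Lp (ity a) (it a) r (2 + sgm))); last ring.
 apply: Rmult_le_compat_l; last exact: T_Lp2.
 pos.
- lra.
Qed.

Lemma dphi_Some dZ j : dphi b eps Ch Dh dZ (Some j) a th =
 (zeta j 1 - tt a th * primiC (Gam b eps Ch Dh dZ) a 1 th)%C.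
Proof.
rewrite /dphi /dtc.
have -> : csum (fun i => (dxc (Some j) i * tE Ch Dh i a 1 th)%C) = zeta j 1.
 rewrite -[RHS](csum_pick j (fun i => zeta i 1)); apply: csum_ext => i; rewrite /dxc.
 rewrite (_ : (Some j == Some i) = (i == j)); last by rewrite eq_sym.
 by case: (i == j); rewrite ?Cmult_1_l ?Cmult_0_l.
ring.
Qed.

Lemma dphi_None dZ : dphi b eps Ch Dh dZ None a th =
 (- primiC (tH b eps Ch Dh) a 1 th - tt a th * primiC (Gam b eps Ch Dh dZ) a 1 th)%C.
Proof.
rewrite /dphi /dtc.
have -> : csum (fun i => (dxc None i * tE Ch Dh i a 1 th)%C) = RtoC 0.
 by rewrite -[RHS](@csum_0 'I_n); apply: csum_ext => i; rewrite /dxc /= Cmult_0_l.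
ring.
Qed.

(** The energy is constant along the ray up to the flat defect, hence its final value is as close to
    its mean. *)
Lemma tH_osc N K Kv m : 0 <= K -> 0 <= Kv -> 0 <= m -> (forall i r, I01 r -> Cmod (tV b eps Ch Dh i a r th) <= Kv) ->
 (forall i r, I01 r -> Cmod (tR b Ch Dh i a r th) <= K * m ^ N * Lp (ity a) (it a) r (2 + sgm)) ->
 Cmod (tH b eps Ch Dh a 1 th - primiC (tH b eps Ch Dh) a 1 th) <= eps * (8 * (INR n * (Kv * K)) * KW sgm) * m ^ N.
Proof.
move=> K0 Kv0 m0 Vb Rb; have N0 := pos_INR n; have KK := Rmult_le_pos _ _ Kv0 K0.
have mN : 0 <= m ^ N by pos.
have KW1' := KW1 s0p.
have B0 : 0 <= eps * (2 * (INR n * (Kv * K))) * m ^ N.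
 pos.
set k := 2 * (eps * (2 * (INR n * (Kv * K))) * m ^ N) * KW sgm.
have osc r : I01 r -> Cmod (tH b eps Ch Dh a 1 th - tH b eps Ch Dh a r th) <= k.
 move=> Hr; apply: (@ACC_bound sgm s0p (ity a) (it a) _ _ _ r 1 (tH_ACC s0p bsm bdec bsym am a Hth) B0); try lra.
 move=> s Hs; have Hs' : I01 s by lra.
 rewrite Cmod_mult Cmod_R (Rabs_pos_eq eps); last lra.
 have S : Cmod (csum (fun i => (Im (tt a th * tV b eps Ch Dh i a s th) * tR b Ch Dh i a s th)%C)) <=
   2 * (INR #|'I_n| * ((TT (it a) * Kv) * (K * m ^ N * Lp (ity a) (it a) s (2 + sgm)))).
  apply: Cmod_csum_le => i; rewrite Cmod_mult Cmod_R; apply: Rmult_le_compat; [exact: Rabs_pos|exact: Cmod_ge_0| |exact: Rb].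
  rewrite Im_RtoC_mult Rabs_mult Ht0; apply: Rmult_le_compat; [exact: Rabs_pos|exact: Rabs_pos|rewrite /TT; lra|].
  bound (Im_le_Cmod _); pos.
 rewrite card_ord in S.
 bound (Rmult_le_compat_l eps _ _ (Rlt_le _ _ ep) S).
 rewrite (_ : eps * _ = eps * (2 * (INR n * (Kv * K))) * m ^ N * (TT (it a) * Lp (ity a) (it a) s (2 + sgm))); last ring.
 by apply: Rmult_le_compat_l => //; apply: T_Lp2.
have Sh := tHS s0p bsm bdec am.
have [A1 A2] : ACC (fun r => primiC (tH b eps Ch Dh) a r th) (fun r => tH b eps Ch Dh a r th).
 apply: (primiC_ACC (u0 := RtoC 0) Sh Hth) => r _; ring.
have k0 : 0 <= k by rewrite /k; pos.
have part (pt : C -> R) : (forall u v, pt (u - v)%C = pt u - pt v) -> (forall u, Rabs (pt u) <= Cmod u) ->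
  AC (fun r => pt (primiC (tH b eps Ch Dh) a r th)) (fun r => pt (tH b eps Ch Dh a r th)) ->
  pt (primiC (tH b eps Ch Dh) a 0 th) = 0 ->
  Rabs (pt (tH b eps Ch Dh a 1 th) - pt (primiC (tH b eps Ch Dh) a 1 th)) <= k.
 move=> pm pc A p0.
 have A' := AC_plus (AC_scal (pt (tH b eps Ch Dh a 1 th)) AC_id) (AC_scal (-1) A).
 have := @AC_bound sgm s0p (ity a) (it a) _ _ k 0 0 1 A' k0 ltac:(lra) ltac:(lra) ltac:(lra) ltac:(lra).
 rewrite p0 (_ : pt _ * 1 + -1 * pt (primiC _ _ _ _) - _ = pt (tH b eps Ch Dh a 1 th) - pt (primiC (tH b eps Ch Dh) a 1 th)); last ring.
 have -> : k * (1 - 0) + 0 * KW sgm = k by ring.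
 apply => s Hs; rewrite Rmult_0_l Rplus_0_r (_ : _ + _ = pt (tH b eps Ch Dh a 1 th - tH b eps Ch Dh a s th)%C); last by rewrite pm; ring.
 bound (pc _); pos.
have z0 : primiC (tH b eps Ch Dh) a 0 th = RtoC 0 by rewrite /primiC /primi !RInt_point.
bound (Cmod_le_sum _); rewrite Re_minus Im_minus.
have p1 := part Re Re_minus Re_le_Cmod A1 (f_equal Re z0); have p2 := part Im Im_minus Im_le_Cmod A2 (f_equal Im z0).
by rewrite (_ : eps * _ * m ^ N = k + k); [lra|rewrite /k; ring].
Qed.

(** The sum [S] of [Re zeta * Im z] vanishes at the end, where [z] is real, and at the start it is
    computed from the Lagrangian. Adding it to the imaginary part of the action leaves the integral
    of [Rrem], and turns [Re w^2 - Im w^2] in the initial phase into [|w|^2]. *)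
Lemma Im_phi K m : 0 <= K -> 0 <= m ->
 (forall r, I01 r -> Rabs (Rrem b (fun i => Re (z i r)) (fun i => Im (z i r)) (fun i => zeta i r)) <= K * m ^ 2 * Lp (ity a) (it a) r (1 + sgm)) ->
 Rabs (Im (phi b eps Ch Dh a th) + / 2 * vnorm (iaxi a) ^ 2 - / 2 * fsum (fun i => Cmod (z i 0 - iax a i) ^ 2))
  <= eps * (K * KW sgm) * m ^ 2.
Proof.
move=> K0 m0 HR; have CP := chart_cpath.
have m2 : 0 <= m ^ 2 by pos.
pose w i := (z i 0 - iax a i)%C.
have Sh := tHS s0p bsm bdec am.
have [_ A2] : ACC (fun r => primiC (tH b eps Ch Dh) a r th) (fun r => tH b eps Ch Dh a r th).
 apply: (primiC_ACC (u0 := RtoC 0) Sh Hth) => r _; ring.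
have AY := AC_scal (it a) A2.
pose S r := fsum (fun i => Re (zeta i r) * Im (z i r)).
have AS := AC_fsum (fun i => AC_mult (proj1 (cpe CP i)) (proj2 (cpz CP i))).
have A := AC_plus AY (AC_scal (-1) AS).
have kB : 0 <= eps * (K * m ^ 2) by pos.
have := @AC_bound sgm s0p (ity a) (it a) _ _ 0 (eps * (K * m ^ 2)) 0 1 A (Rle_refl _) kB ltac:(lra) ltac:(lra) ltac:(lra).
have S1 : fsum (fun i => Re (zeta i 1) * Im (z i 1)) = 0.
 by rewrite -[RHS](@fsum_0 'I_n); apply: fsum_ext => i; rewrite (cp1 CP) Rmult_0_r.
have z0 : Im (primiC (tH b eps Ch Dh) a 0 th) = 0 by rewrite /primiC /primi !RInt_point.
rewrite S1 z0 => H.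
have {}H : Rabs (it a * Im (primiC (tH b eps Ch Dh) a 1 th) + S 0) <= eps * (K * KW sgm) * m ^ 2.
 have := H _; rewrite (_ : it a * Im _ + -1 * 0 - (it a * 0 + -1 * _) = it a * Im (primiC (tH b eps Ch Dh) a 1 th) + S 0); last by rewrite -/(S 0); ring.
 have -> : 0 * (1 - 0) + eps * (K * m ^ 2) * KW sgm = eps * (K * KW sgm) * m ^ 2 by ring.
 apply => r Hr {H}.
 have -> : it a * Im (tH b eps Ch Dh a r th) + -1 * fsum (fun i => Re (it a * (eps * ff b (fun i0 => Re (z i0 r)) (fun i0 => Im (z i0 r)) (zeta^~ r) i)) * Im (z i r) +
    Re (zeta i r) * Im (it a * vel b eps (fun i0 => Re (z i0 r)) (fun i0 => Im (z i0 r)) (zeta^~ r) i)) =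
   it a * (eps * Rrem b (fun i => Re (z i r)) (fun i => Im (z i r)) (fun i => zeta i r)).
  set p := fun i0 => Re (z i0 r); set q := fun i0 => Im (z i0 r); set ze := zeta^~ r.
  have -> : Im (tH b eps Ch Dh a r th) = fsum (fun i => 2 * (Re (ze i) * Im (ze i))) +
    eps * Im (csum (fun j => csum (fun k => (EB b j k [::] 0 p q * (ze j * ze k))%C))).
   rewrite /tH /Ht tPE tQE -/p -/q.
   rewrite (_ : Im (Cplus _ _) = Im (csum (fun j => (ze j * ze j)%C)) + Im (eps * csum (fun j => csum (fun k => (EB b j k [::] 0 p q * (ze j * ze k))%C)))) //.
   rewrite Im_RtoC_mult; congr (_ + _); rewrite /csum /Im /=; apply: fsum_ext => i.
   lra.
  have -> : fsum (fun i => Re (it a * (eps * ff b p q ze i)) * Im (z i r) + Re (zeta i r) * Im (it a * vel b eps p q ze i)) =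
    it a * (fsum (fun i => 2 * (Re (ze i) * Im (ze i))) + eps * (fsum (fun j => Re (ze j) * Im (gg b p q ze j)) + fsum (fun i => Re (ff b p q ze i) * q i))).
   rewrite -fsum_plus -(fsum_scal eps) -fsum_plus -(fsum_scal (it a)); apply: fsum_ext => i.
   rewrite !Re_RtoC_mult Im_RtoC_mult /vel.
   rewrite (_ : Im (Cplus _ _) = 2 * Im (ze i) + eps * Im (gg b p q ze i)); last by rewrite -Im_RtoC_mult -Im_RtoC_mult.
   rewrite -/(q i) -/(ze i); ring.
  rewrite /Rrem; ring.
 rewrite !Rabs_mult (Rabs_pos_eq eps); last lra.
 rewrite Rplus_0_l /W0 -/(Lp (ity a) (it a) r (1 + sgm)).
 rewrite (_ : eps * (K * m ^ 2) * _ = TT (it a) * (eps * (K * m ^ 2 * Lp (ity a) (it a) r (1 + sgm)))); last ring.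
 apply: Rmult_le_compat; [exact: Rabs_pos|pos|rewrite /TT; lra|].
 pos.
have S0 : S 0 = fsum (fun i => iaxi a i * Im (w i)) - fsum (fun i => Im (w i) ^ 2).
 rewrite -fsum_minus; apply: fsum_ext => i; rewrite (cp0 CP) -/(w i).
 rewrite (_ : Im (z i 0) = Im (w i)); last by rewrite /w Im_minus -[Im (RtoC _)]/(0 : R) Rminus_0_r.
 rewrite /Re /Im /Cplus /Cmult /Ci /RtoC /=; ring.
have E : Im (phi b eps Ch Dh a th) = fsum (fun i => iaxi a i * Im (w i)) + / 2 * fsum (fun i => Re (w i) ^ 2 - Im (w i) ^ 2)
  - / 2 * vnorm (iaxi a) ^ 2 + it a * Im (primiC (tH b eps Ch Dh) a 1 th).
 rewrite /phi (phiE s0p bsm bdec am) // Ht0.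
 have Ip u v : Im (u + v) = Im u + Im v by [].
 have hI v : Im (Ci * (/ 2)%R * v) = / 2 * Re v by rewrite /Im /Re /Cmult /Ci /RtoC /=; ring.
 rewrite 2!Ip Im_minus !hI Im_RtoC_mult.
 have -> : Im (csum (fun i => (iaxi a i * tT Ch Dh i a 0 th)%C)) = fsum (fun i => iaxi a i * Im (w i)).
  by apply: fsum_ext => i; rewrite -/(Im _) tT0E Im_RtoC_mult.
 have -> : Re (csum (fun i => (tT Ch Dh i a 0 th * tT Ch Dh i a 0 th)%C)) = fsum (fun i => Re (w i) ^ 2 - Im (w i) ^ 2).
  rewrite {1}/csum {1}/Re /fst; apply: fsum_ext => i; rewrite -/(Re _) tT0E -/(w i).
  rewrite /Re /Im /Cmult /=; ring.
 rewrite /=; ring.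
have W2 : fsum (fun i => Cmod (w i) ^ 2) = fsum (fun i => Re (w i) ^ 2 - Im (w i) ^ 2) + 2 * fsum (fun i => Im (w i) ^ 2).
 rewrite -(fsum_scal 2) -fsum_plus; apply: fsum_ext => i; rewrite /Cmod pow2_sqrt; last first.
  pos.
 rewrite /Re /Im; ring.
rewrite -/w W2 E; move: H; rewrite S0; congr (Rabs _ <= _); field.
Qed.

End Centre.
End PhaseEstimates.

(** * The eikonal equation and the initial value *)

Section Eikonal.
Variables (n : nat) (b : 'I_n -> 'I_n -> vec n -> R) (sgm : R) (Ad : nat -> R).
Hypotheses (s0p : 0 < sgm) (bsm : forall j k, smooth_Rn (b j k)) (bdec : decays b sgm Ad) (bsym : forall j k x, b j k x = b k j x).
Notation J := (option 'I_n).
Notation HB := (@hb n).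
Notation fnC := (idx n -> R -> (J -> R) -> C).

Lemma EB_real j k (x : vec n) : EB b j k [::] 0 x (fun _ => 0) = RtoC (b j k x).
Proof. exact: (EE_real (fun ds => dxs ds (b j k)) [::] x). Qed.

Lemma pC_Ht eps x zeta : pC eps b x zeta = Ht b eps x (fun _ => 0) zeta.
Proof.
rewrite /pC /Ht !Csum_csum; congr (_ + _ * _)%C; apply: csum_ext => j; rewrite Csum_csum; apply: csum_ext => k.
by rewrite EB_real -Cmult_assoc.
Qed.

Lemma Ht_lip eps x (zeta v : 'I_n -> C) V V0 : 0 < eps -> 0 <= V <= V0 -> (forall i, Cmod (zeta i) <= 4) -> (forall i, Cmod (v i) <= V) ->
 Cmod (Ht b eps x (fun _ => 0) (fun i => (zeta i - v i)%C) - Ht b eps x (fun _ => 0) zeta) <=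
 (8 + V0) * (2 * INR n + eps * (4 * (INR n * (INR n * Rabs (Ad 0%N))))) * V.
Proof.
move=> ep [V1 V2] z4 vV.
have N0 := pos_INR n.
have pr j k : Cmod ((zeta j - v j) * (zeta k - v k) - zeta j * zeta k) <= (8 + V0) * V.
 rewrite (_ : Cminus _ _ = ((- zeta j) * v k + (- v j) * zeta k + v j * v k)%C); last ring.
 bound (Cmod_triangle _ _); bound (Rplus_le_compat_r _ _ _ (Cmod_triangle _ _)).
 rewrite !Cmod_mult !Cmod_opp.
 have h1 := Cmod_mul_le (z4 j) (vV k).
 have h2 := Cmod_mul_le (vV j) (z4 k).
 have h3 := Cmod_mul_le (Rle_trans _ _ _ (vV j) V2) (vV k).
 lra.
have -> : (Ht b eps x (fun _ => 0) (fun i => (zeta i - v i)) - Ht b eps x (fun _ => 0) zeta)%C =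
 (csum (fun j => ((zeta j - v j) * (zeta j - v j) - zeta j * zeta j)) + eps * csum (fun j => csum (fun k => (b j k x * ((zeta j - v j) * (zeta k - v k) - zeta j * zeta k)))))%C.
 have sub (I : finType) (F G : I -> C) : csum (fun i => (F i - G i)%C) = (csum F - csum G)%C.
  have -> : (csum F - csum G)%C = (csum F + (Copp (RtoC 1)) * csum G)%C by ring.
  rewrite -csum_scal -csum_plus; apply: csum_ext => i; ring.
 have -> : csum (fun j => csum (fun k => (b j k x * ((zeta j - v j) * (zeta k - v k) - zeta j * zeta k))%C)) =
   (csum (fun j => csum (fun k => ((EB b j k [::] 0 x (fun _ => 0))%R * ((zeta j - v j) * (zeta k - v k))))) - csum (fun j => csum (fun k => ((EB b j k [::] 0 x (fun _ => 0))%R * (zeta j * zeta k)))))%C.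
  rewrite -sub; apply: csum_ext => j; rewrite -sub; apply: csum_ext => k; rewrite EB_real; ring.
 rewrite /Ht sub; ring.
bound (Cmod_triangle _ _); rewrite Cmod_mult Cmod_R (Rabs_pos_eq eps); last lra.
have A1 := Cmod_csum_le (fun j => pr j j).
have A2 : Cmod (csum (fun j => csum (fun k => (b j k x * ((zeta j - v j) * (zeta k - v k) - zeta j * zeta k))%C))) <=
  2 * (INR #|'I_n| * (2 * (INR #|'I_n| * (Rabs (Ad 0%N) * ((8 + V0) * V))))).
 apply: Cmod_csum_le => j; apply: Cmod_csum_le => k; rewrite Cmod_mult Cmod_R; apply: Rmult_le_compat => //; [exact: Rabs_pos|exact: Cmod_ge_0|].
 bound (b_bound bdec [::] j k x); rewrite -[X in _ <= X]Rmult_1_r; apply: Rmult_le_compat_l; first exact: Rabs_pos.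
 by apply: om_le1; apply: Rlt_le; apply: sz_pos.
rewrite !card_ord in A1 A2.
nra.
Qed.

Variables (eps C0 : R) (Ch Dh : 'I_n -> fnC).
Hypotheses (ep : 0 < eps) (am : amplitudes b eps C0 Ch Dh).
Variable dZ : J -> 'I_n -> fnC.
Hypotheses (dZS : forall c i, SbC HB ones (dZ c i)) (dZP : forall c i a r th, I01 r -> HB th -> pdC (tT Ch Dh i a r) c th (dZ c i a r th)).

Lemma tR_cr N : exists K, 0 <= K /\ forall a th m, HB th -> tt a th = it a -> xx a th = ix a -> 0 <= m ->
 (forall i r, I01 r -> Rabs (Im (tZ Ch Dh i a r th)) <= m * Lm (ity a) (it a) r) ->
 forall i r, I01 r -> Cmod (tR b Ch Dh i a r th) <= K * m ^ N * Lp (ity a) (it a) r (2 + sgm).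
Proof.
have [K [K0 HK]] := cr_bound s0p bsm bdec N; exists K; split => // a th m Hth Ht0 Hx0 m0 Hq i r Hr.
have CP := chart_cpath am Hth Ht0 Hx0.
rewrite /tR; apply: HK => //; first exact: (tQ_small am a Hr Hth).
- have := tP_big am a Hr Hth; rewrite /cG; lra.
- by move=> k; apply: (cp4 CP).
- move=> k; rewrite tQ_parts; pos.
Qed.

(** Three flat errors add up: the final energy against its mean, the replacement of the final
    momentum by the gradient inside [pC], and the defect in the time derivative. At the end the ray
    is real, so there the extended Hamiltonian is [pC] itself. *)
Lemma eikonal N : exists K, 0 <= K /\ forall a th m, HB th -> tt a th = it a -> xx a th = ix a -> 0 <= m ->
 (forall i r, I01 r -> Rabs (Im (tZ Ch Dh i a r th)) <= m * Lm (ity a) (it a) r) ->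
 Cmod (dphi b eps Ch Dh (dZ None) None a th + pC eps b (ix a) (fun j => dphi b eps Ch Dh (dZ (Some j)) (Some j) a th)) <= K * m ^ N.
Proof.
have [Kd [Kd0 Hd]] := tT_pd_bound n; have {}Hd := Hd _ _ _ _ _ am.
have [K1 [K10 H1]] := tR_cr N; have [K2 [K20 H2]] := tR_cr 0.
have [Kv HKv] := choice _ (fun i => SbC_bound (tVS s0p bsm bdec am i)).
have Kv0 : 0 <= fsum Kv by apply: fsum_ge0 => i; case: (HKv i).
have N0 := pos_INR n; have W1 := KW1 s0p.
pose A K := eps * (4 * (INR n * (Kd * K)) * KW sgm).
have A0 K : 0 <= K -> 0 <= A K.
 move=> h; rewrite /A; apply: Rmult_le_pos; first lra.
 pos.
pose B := eps * (8 * (INR n * (fsum Kv * K1)) * KW sgm).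
have B0 : 0 <= B.
 rewrite /B; apply: Rmult_le_pos; first lra.
 pos.
pose M := 2 * INR n + eps * (4 * (INR n * (INR n * Rabs (Ad 0%N)))).
have M0 : 0 <= M.
 have := Rmult_le_pos _ _ (Rlt_le _ _ ep) (Rmult_le_pos _ _ N0 (Rmult_le_pos _ _ N0 (Rabs_pos (Ad 0%N)))); rewrite /M; lra.
have a1 := A0 K1 K10; have a2 := A0 K2 K20.
exists (B + (8 + (A K1 + A K2)) * M * A K1 + A K1); split.
 pos.
move=> a th m Hth Ht0 Hx0 m0 Hq; have mN : 0 <= m ^ N by pos.
have CP := chart_cpath am Hth Ht0 Hx0.
have dZb c i r : I01 r -> Cmod (dZ c i a r th) <= Kd by move=> Hr; apply: (Hd i c a r th _ Hr Hth); pos.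
have R1 := H1 a th m Hth Ht0 Hx0 m0 Hq; have R2 := H2 a th m Hth Ht0 Hx0 m0 Hq.
pose v c := (tt a th * primiC (Gam b eps Ch Dh (dZ c)) a 1 th)%C.
have v1 c : Cmod (v c) <= A K1 * m ^ N := Gam_int s0p bsm bdec ep am Hth Ht0 K10 Kd0 m0 (dZS c) (dZb c) R1.
have v2 c : Cmod (v c) <= A K2.
 by have := Gam_int s0p bsm bdec ep am Hth Ht0 K20 Kd0 m0 (dZS c) (dZb c) R2; rewrite /= Rmult_1_r.
have Vb i r : I01 r -> Cmod (tV b eps Ch Dh i a r th) <= fsum Kv.
 move=> Hr; bound (proj2 (HKv i) a r th Hr Hth); rewrite Rmult_1_r.
 by apply: fsum_term => j; case: (HKv j).
have osc := tH_osc s0p bsm bdec bsym ep am Hth Ht0 K10 Kv0 m0 Vb R1.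
pose zeta i := tE Ch Dh i a 1 th.
have H1E : tH b eps Ch Dh a 1 th = Ht b eps (ix a) (fun _ => 0) zeta.
 rewrite /tH; congr Ht; apply: funext => i; rewrite ?tP_parts ?tQ_parts (tZ1 am) // Hx0 //.
have GE : (fun j => dphi b eps Ch Dh (dZ (Some j)) (Some j) a th) = (fun j => (zeta j - v (Some j))%C).
 by apply: funext => j; rewrite dphi_Some.
rewrite GE dphi_None pC_Ht -/(v None).
(* The Lipschitz bound for the quadratic symbol needs the increment to be both bounded,
   independently of [m], and flat. The minimum of the bounds for exponents 0 and [N] provides
   both. *)
pose V := Rmin (A K1 * m ^ N) (A K2).
have VV : 0 <= V <= A K1 + A K2.
 split; first by apply: Rmin_glb => //; pos.
 bound (Rmin_r _ _); lra.
have vV j : Cmod (v (Some j)) <= V by apply: Rmin_glb.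
have L := Ht_lip (ix a) ep VV (fun i => cp4 CP i (r := 1) ltac:(lra)) vV.
rewrite -/zeta -/M in L.
have L' : Cmod (Ht b eps (ix a) (fun _ => 0) (fun i => (zeta i - v (Some i))%C) - Ht b eps (ix a) (fun _ => 0) zeta) <=
  (8 + (A K1 + A K2)) * M * (A K1 * m ^ N).
 bound L; apply: Rmult_le_compat_l; last exact: Rmin_l.
 pos.
rewrite (_ : Cplus _ _ = (tH b eps Ch Dh a 1 th - primiC (tH b eps Ch Dh) a 1 th + (Ht b eps (ix a) (fun _ => 0) (fun i => (zeta i - v (Some i))) - Ht b eps (ix a) (fun _ => 0) zeta) + (- v None))%C); last first.
 rewrite H1E; ring.
bound (Cmod_triangle _ _); rewrite Cmod_opp.
bound (Rplus_le_compat_r _ _ _ (Cmod_triangle _ _)).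
have := v1 None; rewrite -/B in osc; lra.
Qed.

(** In rescaled time the velocity carries the factor [t], so at [t = 0] the ray is constantly [x],
    the action vanishes, and the phase is exactly the Gaussian one. *)
Lemma initial_phase a th : HB th -> tt a th = it a -> xx a th = ix a -> it a = 0 ->
 phi b eps Ch Dh a th = (dot (vsub (ix a) (iax a)) (iaxi a) + Cdiv Ci (RtoC 2) * (vnorm (vsub (ix a) (iax a)) ^ 2)%R + Cinv (2 * Ci) * (vnorm (iaxi a) ^ 2)%R)%C.
Proof.
move=> Hth Ht0 Hx0 t0; have CP := chart_cpath am Hth Ht0 Hx0.
have w i : tT Ch Dh i a 0 th = RtoC (vsub (ix a) (iax a) i).
 rewrite tT0E /vsub RtoC_minus; congr (Cminus _ _); rewrite -(cp1 CP i).
 have D : Cmod (tZ Ch Dh i a 1 th - tZ Ch Dh i a 0 th) <= 2 * 0 * KW sgm.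
  apply: (@ACC_bound sgm s0p (ity a) (it a) _ _ 0 0 1 (cpz CP i)); try lra.
  move=> s _; rewrite t0 Cmult_0_l Cmod_0 Rmult_0_l; lra.
 have D0 : Cmod (tZ Ch Dh i a 1 th - tZ Ch Dh i a 0 th) = 0.
  apply: Rle_antisym; pos.
 have := Cmod_eq_0 _ D0 => E.
 have -> : tZ Ch Dh i a 0 th = (tZ Ch Dh i a 1 th - (tZ Ch Dh i a 1 th - tZ Ch Dh i a 0 th))%C by ring.
 rewrite E; ring.
have Rsum (F : 'I_n -> R) : csum (fun i => RtoC (F i)) = RtoC (fsum F) by rewrite /csum /= fsum_0.
rewrite /phi (phiE s0p bsm bdec am) // Ht0 t0 Cmult_0_l Cplus_0_r.
have -> : csum (fun i => (iaxi a i * tT Ch Dh i a 0 th)%C) = RtoC (dot (vsub (ix a) (iax a)) (iaxi a)).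
 rewrite -[dot _ _]/(fsum (fun i => vsub (ix a) (iax a) i * iaxi a i)) -Rsum; apply: csum_ext => i; rewrite w -RtoC_mult.
 congr RtoC; ring.
have -> : csum (fun i => (tT Ch Dh i a 0 th * tT Ch Dh i a 0 th)%C) = RtoC (vnorm (vsub (ix a) (iax a)) ^ 2).
 by rewrite vnorm_sq -[dot _ _]/(fsum (fun i => vsub (ix a) (iax a) i * vsub (ix a) (iax a) i)) -Rsum; apply: csum_ext => i; rewrite w -RtoC_mult.
rewrite RtoC_inv; last lra.
have Ci2 : Cmult Ci Ci = Copp (RtoC 1) by rewrite /Cmult /Ci /Copp /RtoC /=; congr pair; ring.
have Cn : Ci <> RtoC 0 by move=> /(f_equal Im) /=; lra.
have C2 : RtoC 2 <> RtoC 0 by move=> /(f_equal Re) /=; lra.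
have E : Cinv (2 * Ci)%C = Copp (Ci * Cinv (RtoC 2))%C.
 have -> : Copp (Ci * Cinv (RtoC 2))%C = ((- (Ci * Ci)) * Cinv (2 * Ci))%C by field.
 by rewrite Ci2; field.
rewrite E /Cdiv; ring.
Qed.

End Eikonal.

(** * From estimates of single rays to the final constants *)

Lemma vnormC_le n (v : 'I_n -> C) k : (forall j, Cmod (v j) <= k) -> vnormC v <= INR n * k.
Proof.
move=> H; rewrite (_ : vnormC v = vnorm (fun j => Cmod (v j))); last first.
 congr sqrt; apply: fsum_ext => j; lra.
bound (vnorm_le_l1 _); rewrite -[X in INR X * _](card_ord n); apply: fsum_le_const => j.
rewrite Rabs_pos_eq //; pos.
Qed.

Lemma kap_Cmod2 t : Cmod (kap t) ^ 2 = / (1 + 4 * t ^ 2).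
Proof.
have P : 0 < 1 + 4 * t ^ 2 by nra.
rewrite /Cmod pow2_sqrt; first by rewrite /kap /fst /snd; field; lra.
pos.
Qed.

Lemma Cmod_sq_close (w v : C) k q : 0 <= q -> k <= 1 -> Cmod (w - v) <= k * q -> Cmod v <= 2 * q ->
 Rabs (Cmod w ^ 2 - Cmod v ^ 2) <= 5 * k * q ^ 2.
Proof.
move=> q0 k1 H1 H2; have h0 := Cmod_ge_0 (w - v)%C; have hw := Cmod_ge_0 w; have hv := Cmod_ge_0 v.
have h1 : Cmod w <= Cmod (w - v) + Cmod v by have := Cmod_triangle (w - v)%C v; rewrite (_ : (w - v + v)%C = w) //; ring.
have h2 : Cmod v <= Cmod (w - v) + Cmod w.
 have := Cmod_triangle (- (w - v))%C w; rewrite Cmod_opp (_ : (- (w - v) + w)%C = v) //; ring.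
have kq : k * q <= 1 * q by pos.
rewrite (_ : _ - _ = (Cmod w - Cmod v) * (Cmod w + Cmod v)); last ring.
rewrite Rabs_mult (Rabs_pos_eq (_ + _)); last lra.
have -> : 5 * k * q ^ 2 = k * q * (5 * q) by ring.
apply: Rmult_le_compat; [exact: Rabs_pos|lra| |lra].
apply: Rabs_le; lra.
Qed.

Theorem mainTheorem13 (n : nat) (b : 'I_n -> 'I_n -> vec n -> R)
  (sigma0 : R) (A : nat -> R)
  (Hsigma0 : 0 < sigma0)
  (Hsym : forall j k x, b j k x = b k j x)
  (Hsmooth : forall j k, smooth_Rn (b j k))
  (Hdecay : forall (l : nat) (x : vec n),
      decay_sum b l x <= A l * Rpower (jbr x) (- 1 - INR l - sigma0)) :
  forall eta : R, 0 < eta ->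
  exists eps0 delta c0 c1 : R,
    0 < eps0 /\ 0 < delta /\ 0 < c0 /\ 0 < c1 /\
    forall eps : R, 0 < eps < eps0 ->
    exists (CI CII : nat -> R) (CV : ('I_n -> nat) -> R),
    forall (ax axi : vec n), / 2 <= vnorm axi <= 2 ->
    forall X Xi : R -> vec n, ham_flow eps b ax axi X Xi ->
    exists (phi : R -> vec n -> C) (U : R -> vec n -> Prop),
      open_tx U /\
      (forall t x, Omega delta c0 c1 ax axi X t x -> U t x) /\
      smooth_onC U phi /\
      (* (i) *)
      (forall x, Omega delta c0 c1 ax axi X 0 x ->
         forall N : nat,
           Cmod (phi 0 x -
                 (RtoC (dot (vsub x ax) axi)
                  + Ci / 2 * RtoC (vnorm (vsub x ax) ^ 2)
                  + / (2 * Ci) * RtoC (vnorm axi ^ 2)))%C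
           <= CI N * vnorm (vsub x ax) ^ N) /\
      (forall t x, Omega delta c0 c1 ax axi X t x ->
         (* (ii) *)
         (forall N : nat,
            Cmod (dtxC None phi t x + pC eps b x (gradC phi t x))%C
            <= CII N * (vnorm (vsub x (X t)) / jbrR t) ^ N) /\
         (* (iii) *)
         vnormC (fun j => (gradC phi t x j - RtoC (axi j))%C) <= eta /\
         (* (iv) *)
         Rabs (Im (phi t x)
               - / 2 * (vnorm (vsub x (X t)) ^ 2 / (1 + 4 * t ^ 2))
               + / 2 * vnorm axi ^ 2)
         <= eta * (vnorm (vsub x (X t)) ^ 2 / jbrR t ^ 2) /\
         (* (v) *)
         (forall Aidx : 'I_n -> nat, (exists j, Aidx j <> 0%N) ->
            Cmod (dmultiC Aidx phi t x) <= CV Aidx)).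
Proof.
move=> eta eta0.
have bdec : forall j k ds x, Rabs (dxs ds (b j k) x) <= A (size ds) * om (sz sigma0 ds) x by exact: dxs_decay.
have [eps1 [CA [e1p [CA0 HA]]]] := amplitudes_exist Hsigma0 Hsmooth bdec.
have [Cf [eps2 [Cf0 [e2p HF]]]] := flow_estimates Hsigma0 Hsmooth bdec Hsym.
have [Ce [Ce0 HE]] := ray_estimate Hsigma0 Hsmooth bdec Cf0.
have [Kd [Kd0 HKd]] := tT_pd_bound n.
have [Kc [Kc0 HKc]] := cr_bound Hsigma0 Hsmooth bdec 0.
have [KR [KR0 HKR]] := Rrem_bound Hsigma0 Hsmooth bdec Hsym.
have N0 := pos_INR n; have c0 := cst_pos n; have W1 := KW1 Hsigma0.
(* [C3] collects the contributions to the gradient besides [delta]: deviation of the flow,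
   amplitudes, defect. [C4] does the same for the imaginary part. Neither involves [eps], so [eps0]
   may be chosen from them. *)
pose C3 := 2 * Cf + 2 * CA + 4 * (INR n * (Kd * Kc)) * KW sigma0.
pose C4 := 3 * (INR n * Ce) + KR * KW sigma0 * Ce ^ 2.
have C30 : 0 <= C3.
 have := Rmult_le_pos (4 * (INR n * (Kd * Kc))) (KW sigma0) ltac:(have := Rmult_le_pos _ _ N0 (Rmult_le_pos _ _ Kd0 Kc0); lra) ltac:(lra).
 rewrite /C3; lra.
have C40 : 0 <= C4.
 have := Rmult_le_pos _ _ N0 Ce0; have := Rmult_le_pos _ _ (Rmult_le_pos KR (KW sigma0) KR0 ltac:(lra)) (pow2_ge_0 Ce); rewrite /C4; lra.
pose M := 1 + Ce + Cf + INR n * C3 + C4.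
have nC3 := Rmult_le_pos _ _ N0 C30.
have M1 : 1 <= M by rewrite /M; lra.
(* The three entries serve the comparison of rays, the size of the charts, and the halves of [eta]
   in (iii) and (iv); [eps * M <= kp] yields all of them at once. *)
pose kp := Rmin (Rmin 1 (cst n / 2)) (eta / 2).
have kp0 : 0 < kp by apply: Rmin_pos; pos.
have kp1 : kp <= 1 by apply: Rle_trans (Rmin_l _ _) (Rmin_l _ _).
have kp2 : kp <= cst n / 2 by apply: Rle_trans (Rmin_l _ _) (Rmin_r _ _).
have kp3 : kp <= eta / 2 := Rmin_r _ _.
(* The first entry places [Omega] inside the charts, the second makes [2 * delta] per coordinate
   contribute at most [eta / 2] to the gradient. *)
pose delta := Rmin (cst n / 2) (eta / (4 * (INR n + 1))).
have dl0 : 0 < delta by apply: Rmin_pos; pos.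
have dl1 : delta <= cst n / 2 := Rmin_l _ _.
have dl2 : INR n * (2 * delta) <= eta / 2.
 have h : delta <= eta / (4 * (INR n + 1)) := Rmin_r _ _.
 have h2 : delta * (4 * (INR n + 1)) <= eta by apply/Rle_div_r; lra.
 lra.
exists (Rmin (Rmin eps1 eps2) (kp / M)), delta, (/ 4), (/ 8).
split; first pos.
do 3 (split; first lra).
move=> eps [ep elt].
have ee1 : eps < eps1 by move: (Rmin_l (Rmin eps1 eps2) (kp / M)) (Rmin_l eps1 eps2); lra.
have ee2 : eps < eps2 by move: (Rmin_l (Rmin eps1 eps2) (kp / M)) (Rmin_r eps1 eps2); lra.
have eM : eps * M <= kp.
 have h : eps <= kp / M by [have := Rmin_r (Rmin eps1 eps2) (kp / M); lra]; apply/Rle_div_r; lra.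
have p1 := Rmult_le_pos _ _ (Rlt_le _ _ ep) Ce0; have p2 := Rmult_le_pos _ _ (Rlt_le _ _ ep) Cf0.
have p3 := Rmult_le_pos _ _ (Rlt_le _ _ ep) nC3; have p4 := Rmult_le_pos _ _ (Rlt_le _ _ ep) C40.
have s1 : Ce * eps <= 1 by rewrite /M in eM; lra.
have s2 : Cf * eps <= cst n / 2 by rewrite /M in eM; lra.
have s3 : eps * (INR n * C3) <= eta / 2 by rewrite /M in eM; lra.
have s4 : eps * C4 <= eta / 2 by rewrite /M in eM; lra.
have [Ch [Dh am]] := HA eps (conj ep ee1).
have [dZ [dZS [dZP [_ [dPhi [CV HCV]]]]]] := Phi_grad Hsigma0 Hsmooth bdec Hsym am.
have [KN HKN] := choice _ (fun N => eikonal Hsigma0 Hsmooth bdec Hsym ep am dZS dZP N).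
(* The remainder [g] is zero: the phase is exactly Gaussian at time 0. In (ii) the factor [Ce ^ N]
   comes from [m = Ce * (rho / TT t)]. *)
exists (fun _ => 0), (fun N => KN N * Ce ^ N), CV => ax e e12 X Xi HamF.
have FB := HF eps (conj ep ee2) ax e X Xi e12 HamF.
exists (Phi b eps Ch Dh ax e), (dom ax e).
have Om t x : Omega delta (/ 4) (/ 8) ax e X t x -> vnorm (vsub x (X t)) <= delta * TT t /\ exists a : idx n,
  [/\ iax a = ax, iaxi a = e, it a = t & ix a = x] /\ hb (thof a t x) /\
  ((forall r, I01 r -> / 4 * Lm (ity a) t r <= jbr (X (t * r))) \/
  (ity a = true /\ jbr (X t) <= 9 * vnorm (vsub x (X t)))).
 move=> O; have [h1 [a [[E1 E2 E3 E4] h2]]] := Omega_idx e12 ep Cf0 FB s2 (conj dl0 dl1) O.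
 split => //; exists a; split => //; split => // -[i|] /=; rewrite ?E3 ?E4 Rminus_diag Rabs_R0; lra.
split; first exact: dom_open.
split.
 by move=> t x /Om [_ [a [[E1 E2 _ _] [Hth _]]]]; exists a.
split; first exact: (Phi_smooth Hsigma0 Hsmooth bdec am).
split.
 move=> x /Om [_ [a [[E1 E2 E3 E4] [Hth _]]]] N.
 rewrite -E1 -E2 (Phi_chart Hsigma0 Hsmooth bdec am Hth) (initial_phase Hsigma0 Hsmooth bdec am Hth) ?tt_thof ?xx_thof //.
 rewrite E4 /Cminus Cplus_opp_r Cmod_0 Rmult_0_l; lra.
move=> t x /Om [rhoT [a [[E1 E2 E3 E4] [Hth HC]]]].
set rho := vnorm (vsub x (X t)) in rhoT HC *.
have rho0 : 0 <= rho := vnorm_ge0 _.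
set th := thof a t x in Hth.
have Ht0 : tt a th = it a by rewrite tt_thof E3.
have Hx0 : xx a th = ix a by rewrite xx_thof E4.
have CP := chart_cpath am Hth Ht0 Hx0.
rewrite E3 E4 E1 E2 in CP.
have T1 := TT_ge1 t; have iT : 0 < / TT t by pos.
have j0 : 0 < jbrR t by apply: sqrt_lt_R0; nra.
have RE := HE eps (ity a) t ax e x _ _ X Xi ep s1 CP FB HC.
rewrite -/rho in RE.
have rT : 0 <= rho / TT t by pos.
have rj : rho / TT t <= rho / jbrR t.
 apply: Rmult_le_compat_l => //; apply: Rinv_le_contravar => //; exact: jbrR_TT.
set m := Ce * (rho / TT t); have m0 : 0 <= m by apply: Rmult_le_pos.
have Hq i r : I01 r -> Rabs (Im (tZ Ch Dh i a r th)) <= m * Lm (ity a) (it a) r.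
 move=> Hr; rewrite E3; exact: (proj1 (proj2 (RE i) r Hr)).
have Hb i r : I01 r -> Rabs (Im (tE Ch Dh i a r th)) <= m by move=> Hr; exact: (proj2 (proj2 (RE i) r Hr)).
have DE c : dtxC c (Phi b eps Ch Dh ax e) t x = dphi b eps Ch Dh (dZ c) c a th by rewrite -E1 -E2; pos.
split; last split; last split.
- move=> N; have [K0 HK] := HKN N.
 have := HK a th m Hth Ht0 Hx0 m0 Hq.
 rewrite E4 (_ : (fun j => dphi b eps Ch Dh (dZ (Some j)) (Some j) a th) = gradC (Phi b eps Ch Dh ax e) t x); last first.
  by apply: funext => j; rewrite /gradC DE.
 rewrite -DE => h; bound h; rewrite /m Rpow_mult_distr -Rmult_assoc.
 pos.
- bound (vnormC_le (k := 2 * delta + eps * C3) _); last lra.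
 move=> j; rewrite /gradC DE dphi_Some.
 have Hy : Rabs (yf (iax a) (iaxi a) (it a) (ix a) j) <= (delta + Cf * eps) * TT (it a).
  rewrite E1 E2 E3 E4 /yf (_ : _ - _ - _ = (x j - X t j) + (X t j - ax j - 2 * t * e j)); last ring.
  have h1 : Rabs (x j - X t j) <= rho := vnorm_term (vsub x (X t)) j.
  have := fbL FB 0 t j; rewrite (proj1 (fbF FB)) Rminus_0_r => h2.
  have h3 : Cf * eps * Rabs t <= Cf * eps * TT t by apply: Rmult_le_compat_l; [lra|rewrite /TT; lra].
  bound (Rabs_triang _ _); lra.
 have B1 := tE_close am Hth Ht0 Hx0 (i := j) (r := 1) ltac:(lra) (_ : 0 <= delta + Cf * eps) Hy.
 have {}B1 := B1 ltac:(lra); rewrite E2 in B1.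
 (* In (iii) the smallness comes from [eps] alone, so the defect is taken with exponent 0 and
    [m = 1]; the constant [Kc] is free of [eps]. *)
 have R1 i r : I01 r -> Cmod (tR b Ch Dh i a r th) <= Kc * 1 ^ 0 * Lp (ity a) (it a) r (2 + sigma0).
  move=> Hr; rewrite /tR; apply: HKc => //; [exact: (tQ_small am a Hr Hth)| | |lra|].
  + have := tP_big am a Hr Hth; rewrite /cG; lra.
  + by move=> k; apply: (cp4 CP).
  + move=> k; bound (vnorm_term _ k); bound (tQ_small am a Hr Hth).
   have := Lm_ge1 (ity a) (it a) Hr; lra.
 have dZb i r : I01 r -> Cmod (dZ (Some j) i a r th) <= Kd by move=> Hr; apply: (HKd _ _ _ _ _ am i (Some j) a r th _ Hr Hth); pos.
 have B2 := Gam_int Hsigma0 Hsmooth bdec ep am Hth Ht0 Kc0 Kd0 Rle_0_1 (dZS (Some j)) dZb R1.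
 rewrite [1 ^ 0]/= Rmult_1_r in B2.
 rewrite (_ : (_ - _ - _)%C = (tE Ch Dh j a 1 th - e j - tt a th * primiC (Gam b eps Ch Dh (dZ (Some j))) a 1 th)%C); last ring.
 bound (Cmod_triangle _ _); rewrite Cmod_opp; rewrite /C3; lra.
- have RR r : I01 r -> Rabs (Rrem b (fun i => Re (tZ Ch Dh i a r th)) (fun i => Im (tZ Ch Dh i a r th)) (fun i => tE Ch Dh i a r th)) <= KR * m ^ 2 * Lp (ity a) (it a) r (1 + sigma0).
  move=> Hr; apply: HKR => //; [exact: (cpq CP)|rewrite E3; exact: (cpp CP)|by move=> k; apply: (cp4 CP)|pos|pos].
 have I1 := Im_phi Hsigma0 Hsmooth bdec ep am Hth Ht0 Hx0 KR0 m0 RR.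
 set F := fsum _ in I1; set q := rho / TT t.
 (* Up to order [eps] the initial displacement is [kap t * (x - X t)], and
    [|kap t|^2 = 1 / (1 + 4 t^2)] produces the quadratic form of (iv). *)
 have S1 : Rabs (F - rho ^ 2 / (1 + 4 * t ^ 2)) <= INR n * (5 * (Ce * eps) * q ^ 2).
  rewrite (_ : rho ^ 2 / (1 + 4 * t ^ 2) = fsum (fun i => Cmod (kap t * RtoC (x i - X t i)) ^ 2)); last first.
   rewrite /rho vnorm_sq /dot /Rdiv Rmult_comm -kap_Cmod2 -fsum_scal; apply: fsum_ext => i.
   rewrite Cmod_mult Cmod_R Rpow_mult_distr pow2_abs /vsub /=; ring.
  rewrite /F -fsum_minus; bound (fsum_Rabs _).
  rewrite -[X in INR X * _](card_ord n); apply: fsum_le_const => i.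
  apply: Cmod_sq_close => //; first by rewrite E1; exact: (proj1 (RE i)).
  rewrite Cmod_mult Cmod_R (_ : 2 * q = 2 / TT t * rho); last by rewrite /q /Rdiv; ring.
  apply: Rmult_le_compat; [exact: Cmod_ge_0|exact: Rabs_pos|exact: (proj1 (kap_Cmod t))|].
  exact: (vnorm_term (vsub x (X t)) i).
 rewrite -E1 -E2 (Phi_chart Hsigma0 Hsmooth bdec am Hth) -/th E2.
 rewrite E2 in I1.
 have h1 : eps * C4 * q ^ 2 <= eta / 2 * (rho / jbrR t) ^ 2.
  pos.
 have h2 := Rmult_le_pos _ _ (Rlt_le _ _ eta0) (pow2_ge_0 (rho / jbrR t)).
 have -> : rho ^ 2 / jbrR t ^ 2 = (rho / jbrR t) ^ 2 by field; lra.
 have h3 : INR n * (5 * (Ce * eps) * q ^ 2) <= 2 * (eps * (3 * (INR n * Ce)) * q ^ 2).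
  have : 0 <= INR n * ((Ce * eps) * q ^ 2) by pos.
  lra.
 have h4 : eps * (KR * KW sigma0) * m ^ 2 = eps * (KR * KW sigma0 * Ce ^ 2) * q ^ 2 by rewrite /m -/q; ring.
 have h5 : eps * C4 * q ^ 2 = eps * (3 * (INR n * Ce)) * q ^ 2 + eps * (KR * KW sigma0 * Ce ^ 2) * q ^ 2 by rewrite /C4; ring.
 rewrite h4 in I1.
 move/Rabs_le_between: S1 => S1; move/Rabs_le_between: I1 => I1.
 apply: Rabs_le; lra.
- rewrite -E1 -E2; pos.
Qed.
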